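(* Let the standing hypotheses stated in the context hold, together with Assumptions A and B of the context. Then for every $x\in\mathbf R^m$ and every $s\in\mathbf N$ there exists a constant $C(x,s)$ such that, for all integers $d\ge 1$, the approximate solutions $\boldsymbol\psi^x_d$ and $\nabla_x\boldsymbol\psi^x_d$ satisfy $$\|\hat\pi(\boldsymbol\psi^x_d)-\boldsymbol\psi^x\|_0\ \vee\ \|\hat\pi(\nabla_x\boldsymbol\psi^x_d)-\nabla_x\boldsymbol\psi^x\|_0\ \le\ C(x,s)\,d^{-s},$$ where $a\vee b=\max(a,b)$.
   Context: Setting. Consider the fast/slow system $dX^\varepsilon_t=\frac1\varepsilon \boldsymbol f(X^\varepsilon_t,Y^\varepsilon_t)\,dt+\boldsymbol\alpha(X^\varepsilon_t,Y^\varepsilon_t)\,dW_{xt}$, $dY^\varepsilon_t=-\frac1{\varepsilon^2}\nabla V(Y^\varepsilon_t)\,dt+\frac{\sqrt2}{\varepsilon}\,dW_{yt}$, with $\boldsymbol f:\mathbf R^m\times\mathbf R^n\to\mathbf R^m$, $\boldsymbol\alpha:\mathbf R^m\times\mathbf R^n\to\mathbf R^{m\times p}$, $V:\mathbf R^n\to\mathbf R$. $|\cdot|$ is the Euclidean norm for vectors and the Frobenius norm for matrices. $\mathbf N$ contains $0$. Standing hypotheses. (i) $V\in C^\infty(\mathbf R^n)$, $\lim_{|y|\to\infty}V(y)=\infty$, $e^{-V}\in L^1(\mathbf R^n)$, normalized so that $\int e^{-V}dy=1$. (ii) $\lim_{|y|\to\infty}\nabla V(y)\cdot y=\infty$ and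 $\lim_{|y|\to\infty}W(y)=\infty$, where $W:=\frac14|\nabla V|^2-\frac12\Delta V$. (iii) $\boldsymbol f\in(C^\infty(\mathbf R^m\times\mathbf R^n))^m$; $\int_{\mathbf R^n}\boldsymbol f(x,y)e^{-V(y)}dy=0$ for all $x$; and there is a polynomial $q$ with $|\boldsymbol f(x,y)|\le q(y)$ for all $x,y$. (iv) $|\boldsymbol f(x,y)-\boldsymbol f(x',y)|+|\boldsymbol\alpha(x,y)-\boldsymbol\alpha(x',y)|\le C(y)|x-x'|$ for some function $C(y)$. (v) $|\boldsymbol f(x,y)|\le K(1+|x|)(1+|y|^{m_1})$, $|\nabla_x\boldsymbol f(x,y)|+|\nabla_x^2\boldsymbol f(x,y)|\le K(1+|y|^{m_2})$, $|\boldsymbol\alpha(x,y)|\le K(1+|x|^{1/2})(1+|y|^{m_3})$ for some positive integers $m_1,m_2,m_3$ and $K>0$. Assumption A. $W$ is bounded from above by a polynomial of degree $4k$ for some $k\in\mathbf N$, and for every multi-index $\alpha$ there exist $c_\alpha>0$, $\mu_\alpha\in\mathbf R$ with $|\partial_y^\alpha V(y)|\le c_\alpha e^{\mu_\alpha|y|}$. Assumption B. Let $E(\mathbf R^n)$ be the set of $g\in L^2(\mathbf R^n)\cap C^\infty(\mathbf R^n)$ with $\int g(y)^2e^{\nu|y|}dy<\infty$ for all $\nu\in\mathbf R$. For all $\alpha\in\mathbf N^n$ and $x\in\mathbf R^m$, $e^{-V/2}\partial_y^\alpha\boldsymbol f(x,\cdot)\in(E(\mathbf R^n))^m$ and $e^{-V/2}\partial_y^\alpha\nabla_x\boldsymbol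 f(x,\cdot)\in(E(\mathbf R^n))^{m\times m}$. Poisson equation. Write $\boldsymbol f^x=\boldsymbol f(x,\cdot)$. For each $x$, $\boldsymbol\phi^x=\boldsymbol\phi(x,\cdot)$ is the unique smooth-in-$y$ solution, locally bounded and growing at most polynomially in $y$, of $-(\Delta_y-\nabla_yV\cdot\nabla_y)\phi_i(x,y)=f_i(x,y)$, $i=1,\dots,m$, with $\int\boldsymbol\phi(x,y)e^{-V(y)}dy=0$. Set $\boldsymbol\psi^x=e^{-V/2}\boldsymbol\phi^x$ and $\nabla_x\boldsymbol\psi^x=e^{-V/2}\nabla_x\boldsymbol\phi^x$. On $H^1(\mathbf R^n,\mathcal H)=\{u\in H^1(\mathbf R^n):\int|W|u^2dy<\infty\}$ set $a(u,v)=\int\nabla u\cdot\nabla v+W\,u\,v\,dy$; then $a(\psi^x_i,v)=\int f^x_i\,v\,e^{-V/2}dy$ for all $v\in H^1(\mathbf R^n,\mathcal H)$. Galerkin approximation. Fix $\mu\in\mathbf R^n$ and a symmetric positive definite $\Sigma=QDQ^T$ ($D$ diagonal, $Q$ orthogonal), $S=QD^{1/2}$. Let $H_r(s)=\frac{(-1)^r}{\sqrt{r!}}e^{s^2/2}\frac{d^r}{ds^r}e^{-s^2/2}$, $H_\alpha(y;\mu,\Sigma)=\prod_{k=1}^nH_{\alpha_k}\big((S^{-1}(y-\mu))_k\big)$ and $h_\alpha(y;\mu,\Sigma)=\sqrt{G_{(\mu,\Sigma)}(y)}\,H_\alpha(y;\mu,\Sigma)$, where $G_{(\mu,\Sigma)}$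 is the Gaussian density with mean $\mu$ and covariance $\Sigma$. Let $\hat S_d=\mathrm{span}\{h_\alpha(\cdot;\mu,\Sigma)\}_{|\alpha|\le d}$. $\boldsymbol\psi_d^x$, with components in $\hat S_d$, is a solution of $a(\psi^x_{di},v_d)=\int f_i^x\,v_d\,e^{-V/2}dy$ for all $v_d\in\hat S_d$, $i=1,\dots,m$; and $\nabla_x\boldsymbol\psi^x_d$ denotes the matrix-valued function with entries in $\hat S_d$ obtained by solving the same finite-dimensional problem with $f_i^x$ replaced by the entries of $\nabla_x\boldsymbol f^x$. Solutions are possibly unique only up to elements of the kernel of $a$. Norm and projection. $\|\cdot\|_0$ is the $L^2(\mathbf R^n)$ norm (of vector/matrix valued functions), and $\hat\pi(v)=v-\left(\int v\,e^{-V/2}dy\right)e^{-V/2}$ for $v\in L^2(\mathbf R^n)$, applied componentwise. *)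

(* Defs.v *)
From HB Require Import structures.
From mathcomp Require Import all_boot all_order all_algebra.
From mathcomp Require Import all_classical all_reals all_analysis.
From mathcomp Require mpoly.
(* The notations of mpoly clash with those of the analysis library. *)
Import -(notations) mpoly.

Set Implicit Arguments.
Unset Strict Implicit.
Unset Printing Implicit Defensive.

Import Order.TTheory GRing.Theory Num.Theory.
Import numFieldNormedType.Exports.

Local Open Scope classical_set_scope.
Local Open Scope ring_scope.

Definition rV_display : measure_display.
Proof. exact: default_measure_display. Qed.

Section measurable_rV.
Context {R : realType}.
Variable n : nat.

Let coord (i : 'I_n) (y : 'rV[R]_n) : measurableTypeR R := y 0 i.

Let rV_set0 : g_sigma_preimage coord set0.
Proof. exact: sigma_algebra0. Qed.

Let rV_setC A : g_sigma_preimage coord A -> g_sigma_preimage coord (~` A).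
Proof. exact: sigma_algebraC. Qed.

Let rV_bigcup (F : _^nat) : (forall i, g_sigma_preimage coord (F i)) ->
  g_sigma_preimage coord (\bigcup_i (F i)).
Proof. exact: sigma_algebra_bigcup. Qed.

HB.instance Definition _ :=
  @isMeasurable.Build rV_display
    'rV[R]_n (g_sigma_preimage coord) rV_set0 rV_setC rV_bigcup.

Lemma measurable_coord (i : 'I_n) :
  measurable_fun [set: 'rV[R]_n] (fun y : 'rV[R]_n => y 0 i : measurableTypeR R).
Proof.
move=> _ Y mY; rewrite setTI; apply: sub_sigma_algebra => /=.
rewrite -bigcup_seq/=; exists i => /=; first by rewrite mem_index_enum.
by exists Y => //; rewrite setTI.
Qed.

Lemma measurable_fun_rV d (T : measurableType d) (f : T -> 'rV[R]_n) :
  (forall i, measurable_fun [set: T] (fun t => f t 0 i : measurableTypeR R)) ->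
  measurable_fun [set: T] f.
Proof.
move=> mf _ A mA; rewrite setTI.
suff: g_sigma_preimage (fun i => coord i \o f) `<=` measurable.
  by apply; rewrite g_sigma_preimage_comp; exists A => //; rewrite setTI.
apply: smallest_sub; first exact: sigma_algebra_measurable.
rewrite -bigcup_seq; apply: bigcup_sub => i _ _ [B mB <-].
exact: (mf i).
Qed.

End measurable_rV.

Section lebesgue_rV.
Context {R : realType}.

Definition rV_cons n (z : measurableTypeR R * 'rV[R]_n) : 'rV[R]_n.+1 :=
  row_mx (z.1 : R)%:M z.2 : 'rV[R]_(1 + n).

Lemma measurable_rV_cons n : measurable_fun setT (@rV_cons n).
Proof.
apply: measurable_fun_rV => i.
case: (@split_ordP 1 n i) => j ->.
  apply: (@eq_measurable_fun _ _ _ _ _ (fun z => z.1)); last exact: measurable_fst.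
  move=> -[t y] _ /=; have /= -> := @row_mxEl _ 1 1 n (t : R)%:M y 0 j.
  by rewrite ord1 mxE eqxx mulr1n.
have := measurableT_comp (@measurable_coord R n j)
  (@measurable_snd _ _ (measurableTypeR R) 'rV[R]_n).
apply: eq_measurable_fun => -[t y] _ /=.
by have /= -> := @row_mxEr _ 1 1 n (t : R)%:M y 0 j.
Qed.

(* The image under rV_cons of the product of the Lebesgue measure on the line
   with mu; the head constant is the measure structure of pushforward. *)
Definition lebesgue_cons n (mu : {measure set 'rV[R]_n -> \bar R}) :
    {measure set 'rV[R]_n.+1 -> \bar R} :=
  measure_function_pushforward__canonical__measure_function_Measure
    (lebesgue_measure \x^ mu)%E (@measurable_rV_cons n).

Fixpoint lebesgue_rV n : {measure set 'rV[R]_n -> \bar R} :=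
  match n return {measure set 'rV[R]_n -> \bar R} with
  | 0%N => dirac (0 : 'rV[R]_0)
  | n'.+1 => lebesgue_cons (lebesgue_rV n')
  end.

End lebesgue_rV.

Section calculus.
Context {R : realType}.

(* Euclidean norm of a vector, Frobenius norm of a matrix; the canonical norm
   `|A| of a matrix is the sup norm. *)
Definition enorm a b (A : 'M[R]_(a, b)) : R :=
  Num.sqrt (\sum_i \sum_j A i j ^+ 2).

Definition dot n (u v : 'rV[R]_n) : R := \sum_i u 0 i * v 0 i.

Definition partial n (i : 'I_n) (g : 'rV[R]_n -> R) (y : 'rV[R]_n) : R :=
  'D_(delta_mx 0 i) g y.

Definition partials n (s : seq 'I_n) (g : 'rV[R]_n -> R) : 'rV[R]_n -> R :=
  foldr (@partial n) g s.

Definition multi_partial n (a : 'I_n -> nat) (g : 'rV[R]_n -> R) :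
    'rV[R]_n -> R :=
  partials (flatten [seq nseq (a i) i | i <- enum 'I_n]) g.

Definition grad n (g : 'rV[R]_n -> R) (y : 'rV[R]_n) : 'rV[R]_n :=
  \row_i partial i g y.

Definition laplacian n (g : 'rV[R]_n -> R) (y : 'rV[R]_n) : R :=
  \sum_i partial i (partial i g) y.

(* C^oo: iterated partial derivatives of every order, in every order of
   differentiation, exist and are continuous. *)
Definition smooth n (g : 'rV[R]_n -> R) : Prop :=
  forall s : seq 'I_n, continuous (partials s g) /\
    forall i y, derivable (partials s g) y (delta_mx 0 i).

(* g(y) --> +oo as |y| --> +oo *)
Definition coercive n (g : 'rV[R]_n -> R) : Prop :=
  forall M, exists r, forall y, r < enorm y -> M < g y.

Definition poly_eval n (q : mpoly.mpoly n R) (y : 'rV[R]_n) : R :=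
  mpoly.meval (fun i => y 0 i) q.

(* msize is the degree plus one *)
Definition has_degree n (q : mpoly.mpoly n R) (d : nat) : Prop :=
  mpoly.msize q = d.+1.

Definition integralR n (g : 'rV[R]_n -> R) : R :=
  \int[lebesgue_rV n]_y g y.

Definition integrableR n (g : 'rV[R]_n -> R) : Prop :=
  (lebesgue_rV n).-integrable setT (EFin \o g).

(* Extended-real valued, hence not subject to the convention that makes a
   real-valued divergent integral 0. *)
Definition norm0 n a b (F : 'rV[R]_n -> 'M[R]_(a, b)) : \bar R :=
  'N[lebesgue_rV n]_2%:E [EFin \o (fun y => enorm (F y))]%E.

Definition in_E n (g : 'rV[R]_n -> R) : Prop :=
  [/\ smooth g, integrableR (fun y => g y ^+ 2) &
      forall nu : R, integrableR (fun y => g y ^+ 2 * expR (nu * enorm y))].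

End calculus.

Section hypotheses.
Context {R : realType} {m n : nat}.
Variables (V : 'rV[R]_n -> R) (f : 'rV[R]_m -> 'rV[R]_n -> 'rV[R]_m).

Definition Wpot (y : 'rV[R]_n) : R :=
  4^-1 * enorm (grad V y) ^+ 2 - 2^-1 * laplacian V y.

Definition grad_x (F : 'rV[R]_m -> 'rV[R]_n -> 'rV[R]_m)
    (x : 'rV[R]_m) (y : 'rV[R]_n) : 'M[R]_m :=
  \matrix_(i, j) partial j (fun x' => F x' y 0 i) x.

Definition hess_x_norm (F : 'rV[R]_m -> 'rV[R]_n -> 'rV[R]_m)
    (x : 'rV[R]_m) (y : 'rV[R]_n) : R :=
  Num.sqrt (\sum_i \sum_j \sum_k
    partial j (partial k (fun x' => F x' y 0 i)) x ^+ 2).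

Record standing_hypotheses p (alpha : 'rV[R]_m -> 'rV[R]_n -> 'M[R]_(m, p)) :
    Prop := {
  V_smooth : smooth V;
  V_coercive : coercive V;
  expV_integrable : integrableR (fun y => expR (- V y));
  expV_normalized : integralR (fun y => expR (- V y)) = 1;
  gradV_coercive : coercive (fun y => dot (grad V y) y);
  W_coercive : coercive Wpot;
  f_smooth : forall i,
    smooth (fun z : 'rV[R]_(m + n) => f (lsubmx z) (rsubmx z) 0 i);
  f_centered : forall x i, integralR (fun y => f x y 0 i * expR (- V y)) = 0;
  f_poly_bound : exists q : mpoly.mpoly n R,
    forall x y, enorm (f x y) <= poly_eval q y;
  f_alpha_lipschitz : exists C : 'rV[R]_n -> R, forall x x' y,
    enorm (f x y - f x' y) + enorm (alpha x y - alpha x' y)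
      <= C y * enorm (x - x');
  growth : exists m1 m2 m3 : nat, exists K : R,
    [/\ (0 < m1)%N, (0 < m2)%N, (0 < m3)%N, 0 < K & forall x y,
      [/\ enorm (f x y) <= K * (1 + enorm x) * (1 + enorm y ^+ m1),
          enorm (grad_x f x y) + hess_x_norm f x y
            <= K * (1 + enorm y ^+ m2) &
          enorm (alpha x y)
            <= K * (1 + Num.sqrt (enorm x)) * (1 + enorm y ^+ m3)]] }.

Definition assumption_A : Prop :=
  (exists k : nat, exists2 q : mpoly.mpoly n R,
     has_degree q (4 * k) & forall y, Wpot y <= poly_eval q y) /\
  (forall a : 'I_n -> nat, exists2 c : R, 0 < c & exists nu : R,
     forall y, `|multi_partial a V y| <= c * expR (nu * enorm y)).

Definition assumption_B : Prop :=
  forall (a : 'I_n -> nat) (x : 'rV[R]_m),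
    (forall i, in_E (fun y =>
       expR (- V y / 2) * multi_partial a (fun y' => f x y' 0 i) y)) /\
    (forall i j, in_E (fun y =>
       expR (- V y / 2) * multi_partial a (fun y' => grad_x f x y' i j) y)).

Record poisson_solution (phi : 'rV[R]_m -> 'rV[R]_n -> 'rV[R]_m) : Prop := {
  phi_smooth : forall x i, smooth (fun y => phi x y 0 i);
  phi_locally_bounded : forall x (r : R), exists M : R,
    forall y, enorm y <= r -> enorm (phi x y) <= M;
  phi_poly_growth : forall x, exists q : mpoly.mpoly n R,
    forall y, enorm (phi x y) <= poly_eval q y;
  phi_eq : forall x i y,
    - (laplacian (fun y' => phi x y' 0 i) y
       - dot (grad V y) (grad (fun y' => phi x y' 0 i) y)) = f x y 0 i;
  phi_centered : forall x i,
    integralR (fun y => phi x y 0 i * expR (- V y)) = 0 }.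

Definition psi (phi : 'rV[R]_m -> 'rV[R]_n -> 'rV[R]_m)
    (x : 'rV[R]_m) (y : 'rV[R]_n) : 'rV[R]_m :=
  expR (- V y / 2) *: phi x y.

Definition grad_x_psi (phi : 'rV[R]_m -> 'rV[R]_n -> 'rV[R]_m)
    (x : 'rV[R]_m) (y : 'rV[R]_n) : 'M[R]_m :=
  expR (- V y / 2) *: grad_x phi x y.

End hypotheses.

Section galerkin.
Context {R : realType} {n : nat}.

Definition hermite (r : nat) (s : R) : R :=
  (-1) ^+ r / Num.sqrt (r`!)%:R * expR (s ^+ 2 / 2)
    * derive1n r (fun t : R => expR (- (t ^+ 2) / 2)) s.

Definition gaussian_density (mu : 'rV[R]_n) (Sigma : 'M[R]_n)
    (y : 'rV[R]_n) : R :=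
  expR (- ((y - mu) *m invmx Sigma *m (y - mu)^T) 0 0 / 2)
    / Num.sqrt ((2 * pi) ^+ n * \det Sigma).

Definition pos_def (Sigma : 'M[R]_n) : Prop :=
  forall v : 'rV[R]_n, v != 0 -> 0 < (v *m Sigma *m v^T) 0 0.

(* Sigma = Q D Q^T, the diagonal of D being stored in the row vector D *)
Record spd_factorization (Sigma Q : 'M[R]_n) (D : 'rV[R]_n) : Prop := {
  Sigma_sym : Sigma^T = Sigma;
  Sigma_pos_def : pos_def Sigma;
  Q_orthogonal : Q *m Q^T = 1%:M;
  Sigma_eq : Sigma = Q *m diag_mx D *m Q^T }.

Definition scaling (Q : 'M[R]_n) (D : 'rV[R]_n) : 'M[R]_n :=
  Q *m diag_mx (map_mx Num.sqrt D).

Variables (V : 'rV[R]_n -> R) (mu : 'rV[R]_n) (Sigma Q : 'M[R]_n)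
  (D : 'rV[R]_n).

(* Points of R^n are row vectors here, hence the transpose. *)
Definition hermite_poly (a : 'I_n -> nat) (y : 'rV[R]_n) : R :=
  \prod_k hermite (a k) ((invmx (scaling Q D) *m (y - mu)^T) k 0).

Definition hermite_fun (a : 'I_n -> nat) (y : 'rV[R]_n) : R :=
  Num.sqrt (gaussian_density mu Sigma y) * hermite_poly a y.

(* v lies in the span of the h_a with |a| <= d; each index of such an a is
   at most d. *)
Definition in_span (d : nat) (v : 'rV[R]_n -> R) : Prop :=
  exists c : {ffun 'I_n -> 'I_d.+1} -> R,
    v = fun y => \sum_(a : {ffun 'I_n -> 'I_d.+1} | (\sum_i a i <= d)%N)
                   c a * hermite_fun (fun i => a i) y.

(* The gradients are classical ones: a is only evaluated on the span of the
   Hermite functions, which are smooth. *)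
Definition aform (u v : 'rV[R]_n -> R) : R :=
  integralR (fun y => dot (grad u y) (grad v y) + Wpot V y * u y * v y).

Definition galerkin_solution (d : nat) (g u : 'rV[R]_n -> R) : Prop :=
  in_span d u /\ forall v, in_span d v ->
    aform u v = integralR (fun y => g y * v y * expR (- V y / 2)).

Definition pihat (v : 'rV[R]_n -> R) (y : 'rV[R]_n) : R :=
  v y - integralR (fun y' => v y' * expR (- V y' / 2)) * expR (- V y / 2).

Definition pihat_mx a b (F : 'rV[R]_n -> 'M[R]_(a, b)) (y : 'rV[R]_n) :
    'M[R]_(a, b) :=
  \matrix_(i, j) pihat (fun y' => F y' i j) y.

End galerkin.

(* Main.v *)
(* Put H = - Delta + W and phi0 = e^{-V/2}, so that H phi0 = 0 and
   H psi = phi0 f.  Writing W in terms of V turns a(u, u) into the sum of the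
   integrals of (d_i u + u d_i V / 2)^2.  A Poincare inequality on a large cube
   together with the coercivity of W outside it yields the spectral gap
   int (pihat u)^2 <= C a(u, u).
   The maximum principle with the supersolution 1 / sum_i cosh(nu y_i) and
   interior gradient estimates show that psi and all its derivatives decay
   faster than any exponential.  The same estimates, applied to difference
   quotients in x, make grad_x psi exist, be rapidly decaying and solve
   H (d_j psi) = phi0 d_j f.
   After the affine change of variables that standardizes the Gaussian, iterating
   the lowering operators d/dz_i + z_i/2 bounds the L^2 distance of a rapidly
   decaying function to its Hermite expansion by any negative power of the
   cutoff; polynomial bounds for the Hermite functions upgrade this to the sup
   norm.  Finally a(u_d - psi, u_d - psi) <= a(R, R) <= sup |R| int |H R|, with R
   the remainder of the expansion of psi, and the second factor grows only
   polynomially in d. *)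
From HB Require Import structures.
Require Import Defs.
From mathcomp Require Import all_boot all_order all_algebra.
From mathcomp Require Import all_classical all_reals all_analysis.
From mathcomp Require Import measurable_realfun ring lra.

Set Implicit Arguments.
Unset Strict Implicit.
Unset Printing Implicit Defensive.

Import Order.TTheory GRing.Theory Num.Theory.
Import numFieldNormedType.Exports.

Local Open Scope classical_set_scope.
Local Open Scope ring_scope.

(** * Lebesgue measure on row vectors *)

(** Exact and approximate solutions all live in one class, [fast]: smooth functions each of whose
    derivatives decays beyond every exponential. It is a module over [pclass], the functions with
    exponentially bounded derivatives, and Assumption A puts [V] and [Wpot V] there; so integrals
    are dominated and integration by parts has no boundary terms. Three obstacles shape the rest.
    The Poisson problem is posed for each [x] separately: the derivative of [psi] in [x] exists
    because the difference quotients are centred solutions with converging sources, and the spectral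
    gap makes such solutions depend continuously on the source. Assumption B gives weighted L^2
    bounds, which a Sobolev inequality makes pointwise. And [aform] controls nothing along [phi0],
    while Galerkin solutions may differ by a kernel element; hence the gap is stated for
    [pihat V u]. On the line, the rate of the Hermite expansion comes from solving [raise u = f]
    with decay. Since the remainder decays at any rate, the polynomial loss of the last step is
    absorbed by asking for that much more. *)

Section sup_norm.
Context {R : realType}.

Lemma rV_normP n (y : 'rV[R]_n) (r : R) : 0 <= r ->
  (forall i, `|y 0 i| <= r) <-> `|y| <= r.
Proof.
move=> r0; split => [h|h i].
  rewrite /Num.norm/= mx_normrE; apply/bigmax_leP; split => //= -[j i] _ /=.
  by rewrite (ord1 j).
apply: le_trans h; rewrite [leRHS]/Num.norm/= mx_normrE.
by apply: (le_trans _ (@le_bigmax _ _ _ _ _ (0%R,i))).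
Qed.

Lemma coord_le_norm n (y : 'rV[R]_n) i : `|y 0 i| <= `|y|.
Proof. by move: i; apply/rV_normP. Qed.

Lemma rV_norm_le n (y : 'rV[R]_n) (r : R) : 0 <= r ->
  (forall i, `|y 0 i| <= r) -> `|y| <= r.
Proof. by move=> r0 /rV_normP; apply. Qed.

(** Inductions on the dimension follow the construction of [lebesgue_rV] and peel off the first
    coordinate; slices are written [fun y => g (cns t y)]. *)
Definition cns n (t : R) (y : 'rV[R]_n) : 'rV[R]_n.+1 := rV_cons (t, y).

Lemma cns0 n t (y : 'rV[R]_n) : cns t y 0 ord0 = t.
Proof.
rewrite /cns /rV_cons.
have -> : ord0 = lshift n (0 : 'I_1) by apply: val_inj.
by rewrite (@row_mxEl _ 1 1 n) mxE eqxx mulr1n.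
Qed.

Lemma cnsS n t (y : 'rV[R]_n) j : cns t y 0 (lift ord0 j) = y 0 j.
Proof.
rewrite /cns /rV_cons.
have -> : lift ord0 j = rshift 1 j by apply: val_inj.
by rewrite (@row_mxEr _ 1 1 n).
Qed.

Definition hd n (z : 'rV[R]_n.+1) : R := z 0 ord0.
Definition tl n (z : 'rV[R]_n.+1) : 'rV[R]_n := \row_j z 0 (lift ord0 j).

Lemma cnsK n (z : 'rV[R]_n.+1) : cns (hd z) (tl z) = z.
Proof.
apply/rowP => i; case: (unliftP ord0 i) => [j ->|->].
  by rewrite cnsS mxE.
by rewrite cns0.
Qed.

Lemma cnsD n t s (y z : 'rV[R]_n) : cns t y + cns s z = cns (t + s) (y + z).
Proof.
apply/rowP => i; case: (unliftP ord0 i) => [j ->|->]; rewrite [LHS]mxE !(cnsS, cns0) ?mxE//.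
Qed.

Lemma cnsZ n c t (y : 'rV[R]_n) : c *: cns t y = cns (c * t) (c *: y).
Proof.
apply/rowP => i; case: (unliftP ord0 i) => [j ->|->]; rewrite !(cnsS, cns0, mxE)//.
Qed.

Lemma cnsN n t (y : 'rV[R]_n) : - cns t y = cns (- t) (- y).
Proof. by rewrite -scaleN1r cnsZ mulN1r scaleN1r. Qed.

Lemma cns_delta0 n : cns 1 0 = delta_mx 0 ord0 :> 'rV[R]_n.+1.
Proof.
apply/rowP => i; case: (unliftP ord0 i) => [j ->|->]; rewrite !(cnsS, cns0, mxE)//.
Qed.

Lemma cns_deltaS n (i : 'I_n) :
  cns 0 (delta_mx 0 i) = delta_mx 0 (lift ord0 i) :> 'rV[R]_n.+1.
Proof.
apply/rowP => j; case: (unliftP ord0 j) => [k ->|->]; rewrite ?cnsS ?cns0 !mxE/= ?(inj_eq (@lift_inj _ _))//.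
Qed.

Lemma norm_cnsP n t (y : 'rV[R]_n) (r : R) : 0 <= r ->
  (`|cns t y| <= r) = (`|t| <= r) && (`|y| <= r).
Proof.
move=> r0; apply/idP/andP => [h|[h1 h2]].
  split; first by have := coord_le_norm (cns t y) ord0; rewrite cns0 => /le_trans; apply.
  apply/rV_normP => // i; have := coord_le_norm (cns t y) (lift ord0 i).
  by rewrite cnsS => /le_trans; apply.
apply/rV_normP => // i; case: (unliftP ord0 i) => [j ->|->]; rewrite ?cnsS ?cns0//.
by apply: le_trans h2; exact: coord_le_norm.
Qed.

Lemma norm_cns n t (y : 'rV[R]_n) : `|cns t y| = Num.max `|t| `|y|.
Proof.
apply/eqP; rewrite eq_le; apply/andP; split.
  by rewrite norm_cnsP !le_max ?lexx ?orbT ?normr_ge0.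
by rewrite ge_max -norm_cnsP.
Qed.

End sup_norm.

Section continuous_measurable.
Context {R : realType}.

(** The sigma-algebra is generated by the coordinates, so an open set is exhausted by countably many
    boxes: those with rational centre and half-side [1 / (k + 1)] that it contains. *)
Lemma open_rV_measurable n (U : set 'rV[R]_n) : open U -> measurable U.
Proof.
move=> oU.
pose box (q : 'rV[rat]_n) (k : nat) : set 'rV[R]_n :=
  [set y | forall i, ratr (q 0 i) - k.+1%:R^-1 < y 0 i < ratr (q 0 i) + k.+1%:R^-1].
have mbox q k : measurable (box q k).
  have -> : box q k = \bigcap_(i in [set: 'I_n])
     ((fun y : 'rV[R]_n => y 0 i) @^-1`
        `]ratr (q 0 i) - k.+1%:R^-1, ratr (q 0 i) + k.+1%:R^-1[).
    apply/seteqP; split => y.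
      by move=> h i _ /=; rewrite in_itv/=; exact: h.
    by move=> h i; have := h i I; rewrite /= in_itv.
  apply: fin_bigcap_measurable; first exact: finite_finset.
  move=> i _; rewrite -[X in measurable X]setTI.
  exact: (@measurable_coord R n i measurableT _ (measurable_itv _)).
pose I := {qk : 'rV[rat]_n * nat | `[< box qk.1 qk.2 `<=` U >]}.
have -> : U = \bigcup_(j in [set: I]) box (val j).1 (val j).2.
  apply/seteqP; split => y; last first.
    by move=> [[j /= /asboolP hj]] _ /hj.
  move=> Uy; have /nbhs_ballP[e /= e0 he] : nbhs y U by apply: open_nbhs_nbhs.
  have [k hk] : exists k : nat, k.+1%:R^-1 * 2 < e :> R.
    have := @cvg_harmonic R => /cvgrPdist_lt/(_ (e / 2)) [|k _ hk].
      by rewrite divr_gt0.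
    exists k; have := hk k (leqnn k); rewrite /harmonic/= sub0r normrN ger0_norm//.
    by rewrite ltr_pdivlMr.
  have hq (i : 'I_n) : exists q : rat, ratr q \in `]y 0 i - k.+1%:R^-1, y 0 i + k.+1%:R^-1[.
    by apply: rat_in_itvoo; rewrite ltrD2l gtrN.
  pose q : 'rV[rat]_n := \row_i sval (cid (hq i)).
  have hq2 i : ratr (q 0 i) - k.+1%:R^-1 < y 0 i < ratr (q 0 i) + k.+1%:R^-1.
    by rewrite mxE; case: cid => /= r; rewrite in_itv/= => /andP[h1 h2]; rewrite ltrBlDr h2 -ltrBlDr h1.
  have hb : box q k `<=` U.
    move=> z hz; apply: he; rewrite mx_norm_ball /ball_/=.
    apply: (@le_lt_trans _ _ (k.+1%:R^-1 * 2)) => //.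
    apply: rV_norm_le; first by rewrite mulr_ge0.
    move=> j; rewrite !mxE ler_norml; have := hz j; have := hq2 j.
    move: (ratr _ : R) (k.+1%:R^-1 : R) (z 0 j) (y 0 j) => p d s t.
    move=> /andP[? ?] /andP[? ?]; apply/andP; split; lra.
  have hb' : `[< box (q, k).1 (q, k).2 `<=` U >] by apply/asboolP.
  by exists (exist _ (q, k) hb').
apply: countable_bigcupT_measurable; first exact: countableP.
by move=> j; exact: mbox.
Qed.

Lemma continuous_rV_measurable n (g : 'rV[R]_n -> R) : continuous g ->
  measurable_fun setT g.
Proof.
move=> cg; apply: (measurability _ (measurable_realfun.RGenOpens.measurableE R)).
move=> _ [_ [a [b ->] <-]]; rewrite setTI; apply: open_rV_measurable.
by move/continuousP : cg => /(_ _ (interval_open _ _ )); apply.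
Qed.

End continuous_measurable.

Section lebesgue_rV_theory.
Context {R : realType}.
Notation mu1 := (@lebesgue_measure R).

Definition cube n (y0 : 'rV[R]_n) (r : R) : set 'rV[R]_n :=
  [set y | `|y - y0| <= r].

Lemma cube_measurable n (y0 : 'rV[R]_n) r : measurable (cube y0 r).
Proof.
have -> : cube y0 r = (fun y : 'rV[R]_n => `|y - y0|) @^-1` `]-oo, r].
  by apply/seteqP; split => y /=; rewrite in_itv.
rewrite -[X in measurable X]setTI.
apply: (@continuous_rV_measurable R n (fun y => `|y - y0|)) => //.
move=> y; apply: continuous_comp; last exact: norm_continuous.
by apply: continuousB => //; exact: cst_continuous.
Qed.

Lemma rV_cons_cube n (y0 : 'rV[R]_n.+1) r : 0 <= r ->
  (@rV_cons R n) @^-1` cube y0 r =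
  `[hd y0 - r, hd y0 + r]%classic `*` cube (tl y0) r.
Proof.
move=> r0; rewrite /cube -{1}(cnsK y0); apply/seteqP; split => -[t y] /=;
  rewrite -[rV_cons _]/(cns t y) cnsN cnsD norm_cnsP// in_itv/= ler_norml.
  by move=> /andP[/andP[h1 h2] h3]; split => //; apply/andP; split; lra.
by move=> -[/andP[h1 h2] h3]; rewrite h3 andbT; apply/andP; split; lra.
Qed.

Lemma lebesgue_rV_cube n (y0 : 'rV[R]_n) r : 0 <= r ->
  lebesgue_rV n (cube y0 r) = ((2 * r) ^+ n)%:E.
Proof.
move=> r0; elim: n y0 => [|n IH] y0 /=.
  by rewrite expr0 /dirac/= indicE mem_set// /cube/= [0 - y0]thinmx0 normr0.
rewrite /pushforward rV_cons_cube// product_measure2E//=; last first.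
  exact: cube_measurable.
rewrite IH lebesgue_measure_itv/= lte_fin exprS EFinM.
case: ltP => h; first by rewrite -EFinB; congr (_%:E * _)%E; lra.
have -> : r = 0 by lra.
by rewrite mulr0 mul0e.
Qed.

Lemma lebesgue_rV_sigma_finite n : sigma_finite setT (@lebesgue_rV R n).
Proof.
exists (fun k => cube 0 k%:R).
  apply/seteqP; split => // y _.
  have [k hk] : exists k : nat, `|y| <= k%:R.
    exists (Num.truncn `|y|).+1; exact/ltW/truncnS_gt.
  by exists k => //; rewrite /cube/= subr0.
move=> k; split; first exact: cube_measurable.
by rewrite -/(lebesgue_rV n) lebesgue_rV_cube// ltry.
Qed.

(* The fixpoint lebesgue_rV carries no sigma-finiteness instance; this copy does. *)
Definition leb n : set 'rV[R]_n -> \bar R := lebesgue_rV n.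

HB.instance Definition _ n := isMeasure.Build _ _ _ (@leb n)
  (measure0 (lebesgue_rV n)) (measure_ge0 (lebesgue_rV n))
  (@measure_semi_sigma_additive _ _ _ (lebesgue_rV n)).
HB.instance Definition _ n := Measure_isSigmaFinite.Build _ _ _ (@leb n)
  (@lebesgue_rV_sigma_finite n).

Lemma measurable_comp_rV_cons n (h : 'rV[R]_n.+1 -> \bar R) :
  measurable_fun [set: 'rV[R]_n.+1] h -> measurable_fun setT (h \o @rV_cons R n).
Proof. by move=> mh; apply: measurableT_comp => //; exact: measurable_rV_cons. Qed.

Lemma integral_cns n (h : 'rV[R]_n.+1 -> \bar R) :
  measurable_fun [set: 'rV[R]_n.+1] h -> (forall y, 0 <= h y)%E ->
  (\int[lebesgue_rV n.+1]_y h y = \int[mu1]_t \int[lebesgue_rV n]_y h (cns t y))%E.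
Proof.
move=> mh h0 /=.
rewrite ge0_integral_pushforward//=; last exact: measurable_rV_cons.
rewrite preimage_setT.
transitivity (\int[mu1 \x^ @leb n]_x (h \o @rV_cons R n) x)%E; first by [].
(* [lebesgue_rV] is built on [\x^], Tonelli is used on [\x]; the two product measures agree on
   rectangles, hence everywhere. *)
transitivity (\int[mu1 \x @leb n]_x (h \o @rV_cons R n) x)%E.
  apply: (@eq_measure_integral _ _ R setT (mu1 \x @leb n)%E (mu1 \x^ @leb n)%E) => //= A mA _.
  by apply/esym; apply: product_measure_unique => // B C mB mC/=; rewrite product_measure2E.
apply: (@fubini_tonelli1 _ _ _ _ R mu1 (@leb n) (h \o @rV_cons R n)) => [|z]; [exact: measurable_comp_rV_cons|exact: h0].
Qed.

Lemma integral_cns_swap n (h : 'rV[R]_n.+1 -> \bar R) :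
  measurable_fun [set: 'rV[R]_n.+1] h -> (forall y, 0 <= h y)%E ->
  (\int[mu1]_t \int[lebesgue_rV n]_y h (cns t y) = \int[lebesgue_rV n]_y \int[mu1]_t h (cns t y))%E.
Proof.
move=> mh h0.
apply: (@fubini_tonelli _ _ _ _ R mu1 (@leb n) (h \o @rV_cons R n)) => [|z]; [exact: measurable_comp_rV_cons|exact: h0].
Qed.

Lemma measurable_integral_cns n (h : 'rV[R]_n.+1 -> \bar R) :
  measurable_fun [set: 'rV[R]_n.+1] h -> (forall y, 0 <= h y)%E ->
  measurable_fun setT (fun t : measurableTypeR R => \int[lebesgue_rV n]_y h (cns t y))%E.
Proof.
move=> mh h0.
apply: (@measurable_fun_fubini_tonelli_F _ _ _ _ R (@leb n) (h \o @rV_cons R n)) => [|z]; [exact: measurable_comp_rV_cons|exact: h0].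
Qed.

Lemma measurable_integral_cnsr n (h : 'rV[R]_n.+1 -> \bar R) :
  measurable_fun [set: 'rV[R]_n.+1] h -> (forall y, 0 <= h y)%E ->
  measurable_fun setT (fun y : 'rV[R]_n => \int[mu1]_t h (cns t y))%E.
Proof.
move=> mh h0.
apply: (@measurable_fun_fubini_tonelli_G _ _ _ _ R mu1 (h \o @rV_cons R n)) => [|z]; [exact: measurable_comp_rV_cons|exact: h0].
Qed.

(* An integrable majorant that is a product over the coordinates. *)
Definition maj n (y : 'rV[R]_n) : R := \prod_i (1 + y 0 i ^+ 2)^-1.

Lemma maj_cns n t (y : 'rV[R]_n) : maj (cns t y) = (1 + t ^+ 2)^-1 * maj y.
Proof.
rewrite /maj big_ord_recl cns0; congr (_ * _).
by apply: eq_bigr => i _; rewrite cnsS.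
Qed.

Lemma maj_gt0 n (y : 'rV[R]_n) : 0 < maj y.
Proof. by apply: prodr_gt0 => i _; rewrite invr_gt0 ltr_wpDr// sqr_ge0. Qed.

Lemma continuous_compose (S T U : topologicalType) (f : S -> T) (g : T -> U) :
  continuous f -> continuous g -> continuous (fun x => g (f x)).
Proof. by move=> cf cg x; apply: continuous_comp; [exact: cf|exact: cg]. Qed.

Lemma continuous_prod (T : topologicalType) (I : Type) (r : seq I) (F : I -> T -> R) :
  (forall i, continuous (F i)) -> continuous (fun x => \prod_(i <- r) F i x).
Proof.
move=> cF x; elim: r => [|i r IH].
  by under eq_fun do rewrite big_nil; exact: cst_continuous.
by under eq_fun do rewrite big_cons; apply: continuousM => //; exact: cF.
Qed.

Lemma coord_cont n i : continuous (fun y : 'rV[R]_n => y 0 i).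
Proof. exact: coord_continuous. Qed.

Lemma continuous_maj n : continuous (@maj n).
Proof.
apply: continuous_prod => i.
exact: (continuous_compose (@coord_cont _ i) (@continuous_oneDsqrV R)).
Qed.

Lemma integral_inv1sqr : (\int[mu1]_t ((1 + t ^+ 2)^-1)%:E < +oo)%E.
Proof.
rewrite (ge0_symfun_integralT (f := fun t => (1 + t ^+ 2)^-1)).
- have := @integral0y_oneDsqr R; rewrite /oneDsqr set_itvcy => ->.
  by rewrite -EFinM ltry.
- by move=> t; rewrite invr_ge0 addr_ge0// sqr_ge0.
- by move=> t; apply: continuous_oneDsqrV.
- by move=> t /=; rewrite sqrrN.
Qed.

Lemma measurable_maj n : measurable_fun [set: 'rV[R]_n] (fun y => (maj y)%:E).
Proof.
by apply/measurable_EFinP; apply: continuous_rV_measurable; exact: continuous_maj.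
Qed.

Lemma integral_maj n : (\int[lebesgue_rV n]_y (maj y)%:E < +oo)%E.
Proof.
elim: n => [|n IH].
  rewrite /= integral_dirac//; last exact: measurable_maj.
  by rewrite /dirac indicE mem_set// mul1e ltry.
rewrite integral_cns; last 2 first.
- exact: measurable_maj.
- by move=> y; rewrite lee_fin ltW// maj_gt0.
have m2 : measurable_fun setT (fun t : measurableTypeR R => ((1 + t ^+ 2)^-1)%:E).
  apply/measurable_EFinP; apply: continuous_measurable_fun.
  exact: continuous_oneDsqrV.
under eq_integral.
  move=> t _; under eq_integral do rewrite maj_cns EFinM.
  rewrite ge0_integralZl//; last 3 first.
  - exact: measurable_maj.
  - by move=> y _; rewrite lee_fin ltW// maj_gt0.
  - by rewrite lee_fin invr_ge0 addr_ge0// sqr_ge0.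
  over.
rewrite ge0_integralZr//; last 2 first.
- by move=> t _; rewrite lee_fin invr_ge0 addr_ge0// sqr_ge0.
- by apply: integral_ge0 => y _; rewrite lee_fin ltW// maj_gt0.
rewrite lte_mul_pinfty//.
- by apply: integral_ge0 => y _; rewrite lee_fin invr_ge0 addr_ge0// sqr_ge0.
- rewrite ge0_fin_numE; first exact: integral_inv1sqr.
  by apply: integral_ge0 => y _; rewrite lee_fin invr_ge0 addr_ge0// sqr_ge0.
Qed.

(** Domination by a product majorant passes to every slice, integrability only to almost every one;
    Fubini and integration by parts can thus be carried out slice by slice. *)
Definition dom n (g : 'rV[R]_n -> R) : Prop :=
  continuous g /\ exists C, forall y, `|g y| <= C * maj y.

Lemma dom_integrable n (g : 'rV[R]_n -> R) : dom g -> integrableR g.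
Proof.
move=> [cg [C hC]].
have mg : measurable_fun setT g by exact: continuous_rV_measurable.
apply/integrableP; split; first exact/measurable_EFinP.
have C0 : 0 <= C by have := le_trans (normr_ge0 _) (hC 0); rewrite pmulr_lge0// maj_gt0.
apply: (@le_lt_trans _ _ (\int[lebesgue_rV n]_y (C%:E * (maj y)%:E))%E).
  apply: ge0_le_integral => //.
  - by apply/measurable_EFinP; exact: measurableT_comp.
  - apply/measurable_EFinP; apply: measurable_funM => //.
    by apply: continuous_rV_measurable; exact: continuous_maj.
  - by move=> y _; rewrite /= -EFinM lee_fin.
rewrite ge0_integralZl//.
- by rewrite lte_mul_pinfty// integral_maj.
- exact: measurable_maj.
- by move=> y _; rewrite lee_fin ltW// maj_gt0.
Qed.

End lebesgue_rV_theory.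

(** * Partial derivatives and smooth functions *)

Section calculus_lemmas.
Context {R : realType}.

(** The two difference quotients are the same function of [h], because [phi] carries the line in
    direction [v] to the line in direction [w]. *)
Lemma derive_affine (T U : normedModType R) (g : U -> R) (phi : T -> U)
    (a v : T) (w : U) : (forall h : R, phi (h *: v + a) = h *: w + phi a) ->
  (derivable (g \o phi) a v <-> derivable g (phi a) w) /\
  'D_v (g \o phi) a = 'D_w g (phi a).
Proof.
move=> H; rewrite /derivable /derive.
have -> : (fun h : R => h^-1 *: ((g \o phi) (h *: v + a) - (g \o phi) a)) =
   (fun h : R => h^-1 *: (g (h *: w + phi a) - g (phi a))).
  by apply/funext => h /=; rewrite H.
by [].
Qed.

Lemma is_derive_line (U : normedModType R) (g : U -> R) (y v : U) (t : R) :
  derivable g (y + t *: v) v ->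
  is_derive t (1 : R) (fun s : R => g (y + s *: v)) ('D_v g (y + t *: v)).
Proof.
move=> dg.
have H (h : R) : y + (h *: (1 : R) + t) *: v = h *: v + (y + t *: v).
  by rewrite scalerDl -[h *: 1]/(h * 1) mulr1 addrCA.
have [d1 d2] := @derive_affine R U g (fun s => y + s *: v) t 1 v H.
by split; [apply/d1; exact: dg|exact: d2].
Qed.

Lemma is_derive_of_line (U : normedModType R) (g : U -> R) (y v : U) (d : R) :
  is_derive (0 : R) (1 : R) (fun s : R => g (y + s *: v)) d -> is_derive y v g d.
Proof.
have H (h : R) : y + (h *: (1 : R) + 0) *: v = h *: v + (y + 0 *: v).
  by rewrite addr0 scale0r addr0 -[h *: 1]/(h * 1) mulr1 addrC.
have [d1 d2] := derive_affine g (phi := fun s : R => y + s *: v) H.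
rewrite scale0r addr0 in d1 d2.
by case=> e1 e2; split; [exact/d1|exact: etrans (esym d2) e2].
Qed.

(** Naming the intermediate point by a ratio [th] frees the statement from the order of [a] and
    [b]. *)
Lemma mvt (f df : R -> R) a b : (forall x, is_derive x (1 : R) f (df x)) ->
  exists2 th, 0 <= th <= 1 & f b - f a = df (a + th * (b - a)) * (b - a).
Proof.
move=> H; have cf A : {within A, continuous f}.
  apply: continuous_subspaceT => x; apply: differentiable_continuous.
  exact/derivable1_diffP/(@ex_derive _ _ _ _ _ _ _ (H x)).
case: (ltgtP a b) => [ab|ba|->].
- have [c] := MVT ab (fun x _ => H x) (cf _).
  rewrite in_itv/= => /andP[h1 h2] h3; exists ((c - a) / (b - a)).
    by rewrite divr_ge0 ?ler_pdivrMr ?mul1r ?lerD2r ?ltW ?subr_gt0.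
  have -> : a + (c - a) / (b - a) * (b - a) = c.
    by rewrite divfK ?subr_eq0 ?gt_eqF//; lra.
  by [].
- have [c] := MVT ba (fun x _ => H x) (cf _).
  rewrite in_itv/= => /andP[h1 h2] h3; exists ((a - c) / (a - b)).
    by rewrite divr_ge0 ?ler_pdivrMr ?mul1r ?lerD2l ?lerN2 ?ltW ?subr_gt0.
  have -> : a + (a - c) / (a - b) * (b - a) = c.
    rewrite -(opprB a b) mulrN divfK ?subr_eq0 ?gt_eqF//; lra.
  by rewrite -opprB h3 -mulrN opprB.
- by exists 0; rewrite ?lexx ?ler01// !subrr mulr0.
Qed.

Lemma mvt_le (f df : R -> R) a b M : (forall x, is_derive x (1 : R) f (df x)) ->
  (forall th, 0 <= th <= 1 -> `|df (a + th * (b - a))| <= M) ->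
  `|f b - f a| <= M * `|b - a|.
Proof.
move=> H hM; have [th h1 ->] := @mvt f df a b H.
by rewrite normrM ler_wpM2r// hM.
Qed.

Notation e_ i := (delta_mx 0 i).

Definition deriv_along n (g : 'rV[R]_n -> R) i :=
  forall y, derivable g y (e_ i).

Lemma partial_line n (g : 'rV[R]_n -> R) i y t : deriv_along g i ->
  is_derive t (1 : R) (fun s : R => g (y + s *: e_ i)) (partial i g (y + t *: e_ i)).
Proof. by move=> dg; apply: is_derive_line; exact: dg. Qed.

Lemma cns_lineS n t (y : 'rV[R]_n) i (h : R) :
  cns t (h *: e_ i + y) = h *: e_ (lift ord0 i) + cns t y.
Proof. by rewrite -cns_deltaS cnsZ cnsD mulr0 add0r. Qed.

Lemma cns_line0 n t (y : 'rV[R]_n) (h : R) :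
  cns (h *: 1 + t) y = h *: e_ ord0 + cns t y.
Proof. by rewrite -cns_delta0 cnsZ cnsD scaler0 add0r. Qed.

Lemma partial_cnsS n (g : 'rV[R]_n.+1 -> R) t i y :
  partial i (fun y => g (cns t y)) y = partial (lift ord0 i) g (cns t y).
Proof. exact: (derive_affine g (fun h => cns_lineS t y i h)).2. Qed.

Lemma deriv_cnsS n (g : 'rV[R]_n.+1 -> R) t i :
  deriv_along g (lift ord0 i) -> deriv_along (fun y => g (cns t y)) i.
Proof.
by move=> dg y; apply/(derive_affine g (fun h => cns_lineS t y i h)).1; exact: dg.
Qed.

Lemma is_derive_cns0 n (g : 'rV[R]_n.+1 -> R) t y :
  deriv_along g ord0 ->
  is_derive t (1 : R) (fun t => g (cns t y)) (partial ord0 g (cns t y)).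
Proof.
move=> dg; have [d1 d2] := @derive_affine R _ g (fun s : R => cns s y) t (1 : R) (e_ ord0) (cns_line0 t y).
by split; [apply/d1; exact: dg|].
Qed.

Lemma continuous_cns n (t : R) : continuous (fun y : 'rV[R]_n => cns t y).
Proof.
move=> y A [B hB hA]; exists (fun i j => B 0 (lift ord0 j)) => [i j|z hz].
  by have := hB 0 (lift ord0 j); rewrite cnsS (ord1 i).
apply: hA => i j; rewrite (ord1 i); case: (unliftP ord0 j) => [k ->|->].
  by rewrite cnsS; exact: hz.
by rewrite cns0; have := nbhs_singleton (hB 0 ord0); rewrite cns0.
Qed.

Lemma continuous_cnsl n (y : 'rV[R]_n) : continuous (fun t : R => cns t y).
Proof.
move=> t; apply/cvgrPdist_lt => e e0; near=> s.
rewrite cnsN cnsD subrr norm_cns normr0 gt_max e0 andbT.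
by near: s; apply: cvgr_dist_lt => //; exact: cvg_id.
Unshelve. all: by end_near. Qed.

(* Induction on k makes stability under algebraic operations a matter of the
   Leibniz rule at order one. *)
Fixpoint CB n (P : ('rV[R]_n -> R) -> Prop) k (g : 'rV[R]_n -> R) : Prop :=
  [/\ continuous g, P g &
   if k is k'.+1 then forall i, deriv_along g i /\ CB P k' (partial i g) else True].

Section CB_theory.
Variable n : nat.
Implicit Types (P Q S : ('rV[R]_n -> R) -> Prop) (f g : 'rV[R]_n -> R).

(** The classes of the proof, [pclass] and [fast] among them, are instances: smoothness plus a
    growth condition on every derivative. *)
Definition tame P g := smooth g /\ forall s, P (partials s g).

Lemma partials_rcons s i g : partials (rcons s i) g = partials s (partial i g).
Proof. by rewrite /partials foldr_rcons. Qed.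

Lemma partials_cat s t g : partials (s ++ t) g = partials s (partials t g).
Proof. by rewrite /partials foldr_cat. Qed.

Lemma tame_partial P i g : tame P g -> tame P (partial i g).
Proof.
move=> [sg pg]; split => s; rewrite -partials_rcons; last exact: pg.
exact: sg.
Qed.

Lemma tame_partials P s g : tame P g -> tame P (partials s g).
Proof.
move=> [sg pg]; split => t; rewrite -partials_cat; last exact: pg.
exact: sg.
Qed.

Lemma CB_lower P k g : CB P k.+1 g -> CB P k g.
Proof.
elim: k g => [|k IH] g [cg pg h]; split => // i.
by have [d1 d2] := h i; split => //; exact: IH.
Qed.

Lemma tameP P g : tame P g <-> forall k, CB P k g.
Proof.
split => [tg k|h].
  elim: k g tg => [|k IH] g [sg pg]; (split; [exact: (sg [::]).1|exact: (pg [::])|]) => //.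
  move=> i; split; first exact: ((sg [::]).2 i).
  by apply: IH; apply: tame_partial.
have key s k : CB P (size s + k) g -> CB P k (partials s g).
  elim/last_ind: s g {h} => [//|s i IH] g.
  rewrite size_rcons partials_rcons => -[_ _ /(_ i)[_]]; exact: IH.
split => s; last by have [] := key s 0%N (h _).
split; first by have [] := key s 0%N (h _).
by have [_ _ h2] := key s 1%N (h _) => i; exact: (h2 i).1.
Qed.

Lemma tameW P Q g : (forall f, P f -> Q f) -> tame P g -> tame Q g.
Proof. by move=> PQ [sg pg]; split => // s; exact: PQ. Qed.

Lemma partialD i f g : deriv_along f i -> deriv_along g i ->
  partial i (fun y => f y + g y) = (fun y => partial i f y + partial i g y).
Proof. by move=> df dg; apply/funext => y; apply: deriveD; [exact: df|exact: dg]. Qed.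

Lemma partialM i f g : deriv_along f i -> deriv_along g i ->
  partial i (fun y => f y * g y) = (fun y => partial i f y * g y + f y * partial i g y).
Proof.
move=> df dg; apply/funext => y.
rewrite /partial [LHS](deriveM (df y) (dg y)) addrC; congr (_ + _).
exact: mulrC.
Qed.

Lemma partial_cst i c : partial i (fun _ : 'rV[R]_n => c) = fun=> 0.
Proof. by apply/funext => y; rewrite /partial derive_cst. Qed.

Lemma deriv_cst i c : deriv_along (fun _ : 'rV[R]_n => c) i.
Proof. by move=> y; exact: derivable_cst. Qed.

Lemma derivD i f g : deriv_along f i -> deriv_along g i ->
  deriv_along (fun y => f y + g y) i.
Proof. by move=> df dg y; apply: derivableD; [exact: df|exact: dg]. Qed.

Lemma derivM i f g : deriv_along f i -> deriv_along g i ->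
  deriv_along (fun y => f y * g y) i.
Proof. by move=> df dg y; apply: derivableM; [exact: df|exact: dg]. Qed.

Lemma contD f g : continuous f -> continuous g -> continuous (fun y => f y + g y).
Proof. by move=> cf cg y; apply: continuousD; [exact: cf|exact: cg]. Qed.

Lemma contM f g : continuous f -> continuous g -> continuous (fun y => f y * g y).
Proof. by move=> cf cg y; apply: continuousM; [exact: cf|exact: cg]. Qed.

Lemma continuous_sum_fun (I : Type) (r : seq I) (F : I -> 'rV[R]_n -> R) :
  (forall i, continuous (F i)) -> continuous (fun y => \sum_(i <- r) F i y).
Proof.
move=> h; elim: r => [|i r IH].
  by under eq_fun do rewrite big_nil; exact: cst_continuous.
by under eq_fun do rewrite big_cons; exact: contD.
Qed.

Lemma CB_D P k f g : (forall f g, P f -> P g -> P (fun y => f y + g y)) ->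
  CB P k f -> CB P k g -> CB P k (fun y => f y + g y).
Proof.
move=> PD; elim: k f g => [|k IH] f g [cf pf hf] [cg pg hg];
  (split; [exact: contD|exact: PD|]) => // i.
have [df hf'] := hf i; have [dg hg'] := hg i.
by split; [exact: derivD|rewrite partialD//; exact: IH].
Qed.

Lemma CB_M P Q S k f g : (forall f g, S f -> S g -> S (fun y => f y + g y)) ->
  (forall f g, P f -> Q g -> S (fun y => f y * g y)) ->
  CB P k f -> CB Q k g -> CB S k (fun y => f y * g y).
Proof.
move=> SD PQS; elim: k f g => [|k IH] f g hf hg.
  by case: hf hg => cf pf _ [cg pg _]; split; [exact: contM|exact: PQS|].
have [lf lg] := (CB_lower hf, CB_lower hg).
case: hf hg => cf pf hf [cg pg hg]; split; [exact: contM|exact: PQS|] => i.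
have [df hf'] := hf i; have [dg hg'] := hg i.
split; first exact: derivM.
by rewrite partialM//; apply: CB_D => //; exact: IH.
Qed.

Lemma CB_cst P k c : (forall c, P (fun=> c)) -> CB P k (fun=> c).
Proof.
move=> Pc; elim: k c => [|k IH] c; (split; [exact: cst_continuous|exact: Pc|]) => // i.
by rewrite partial_cst; split; [exact: deriv_cst|exact: IH].
Qed.

Lemma tame_D P f g : (forall f g, P f -> P g -> P (fun y => f y + g y)) ->
  tame P f -> tame P g -> tame P (fun y => f y + g y).
Proof. by move=> PD /tameP hf /tameP hg; apply/tameP => k; exact: CB_D. Qed.

Lemma tame_M P Q S f g : (forall f g, S f -> S g -> S (fun y => f y + g y)) ->
  (forall f g, P f -> Q g -> S (fun y => f y * g y)) ->
  tame P f -> tame Q g -> tame S (fun y => f y * g y).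
Proof.
by move=> SD PQS /tameP hf /tameP hg; apply/tameP => k; exact: (CB_M SD PQS).
Qed.

Lemma tame_cst P c : (forall c, P (fun=> c)) -> tame P (fun=> c).
Proof. by move=> Pc; apply/tameP => k; exact: CB_cst. Qed.

Lemma smooth_tame g : smooth g <-> tame (fun=> True) g.
Proof. by split => [//|[]]. Qed.

Lemma smoothD f g : smooth f -> smooth g -> smooth (fun y => f y + g y).
Proof. by rewrite !smooth_tame; exact: tame_D. Qed.

Lemma smoothM f g : smooth f -> smooth g -> smooth (fun y => f y * g y).
Proof. by rewrite !smooth_tame; exact: tame_M. Qed.

Lemma smooth_cst c : smooth (fun _ : 'rV[R]_n => c).
Proof. by rewrite smooth_tame; exact: tame_cst. Qed.

Lemma smooth_partial i g : smooth g -> smooth (partial i g).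
Proof. by rewrite !smooth_tame; exact: tame_partial. Qed.

Lemma smooth_partials s g : smooth g -> smooth (partials s g).
Proof. by rewrite !smooth_tame; exact: tame_partials. Qed.

Lemma smooth_deriv g i : smooth g -> deriv_along g i.
Proof. by move=> sg; exact: (sg [::]).2. Qed.

Lemma smooth_cont g : smooth g -> continuous g.
Proof. by move=> sg; exact: (sg [::]).1. Qed.

Lemma partial_expR i g : smooth g -> deriv_along (fun y => expR (g y)) i /\
  partial i (fun y => expR (g y)) = (fun y => partial i g y * expR (g y)).
Proof.
move=> sg.
suff H y : is_derive y (e_ i) (fun y => expR (g y)) (partial i g y * expR (g y)).
  by split => [y|]; [have [] := H y|apply/funext => y; have [] := H y].
have dg : derivable g y (e_ i) by apply: smooth_deriv.
have e0 : y = y + 0 *: e_ i by rewrite scale0r addr0.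
have L : is_derive (0 : R) (1 : R) (fun s : R => g (y + s *: e_ i)) (partial i g y).
  by rewrite [in partial i g y]e0; apply: partial_line; apply: smooth_deriv.
have L2 : is_derive (0 : R) (1 : R) (fun s : R => expR (g (y + s *: e_ i)))
    (partial i g y * expR (g y)).
  rewrite mulrC; rewrite [in expR (g y)]e0.
  apply: (@is_derive1_comp _ expR (fun s : R => g (y + s *: e_ i)) 0).
exact: is_derive_of_line L2.
Qed.

(* e^g reproduces itself up to the factor d_i g, so P propagates from e^g to
   all its partial derivatives. *)
Lemma tame_expR P Q g : (forall f g, Q f -> Q g -> Q (fun y => f y + g y)) ->
  (forall f g, P f -> Q g -> Q (fun y => f y * g y)) ->
  Q (fun y => expR (g y)) -> smooth g -> (forall i, tame P (partial i g)) ->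
  tame Q (fun y => expR (g y)).
Proof.
move=> QD PQ Qg sg hg.
have E i := partial_expR i sg.
apply/tameP; elim => [|k IH].
  by split => // y; apply: continuous_comp; [exact: smooth_cont|exact: continuous_expR].
split => //.
  by move=> y; apply: continuous_comp; [exact: smooth_cont|exact: continuous_expR].
move=> i; split; first exact: (E i).1.
rewrite (E i).2; apply: (CB_M QD PQ) => //.
by move/tameP : (hg i); apply.
Qed.

Lemma smooth_expR g : smooth g -> smooth (fun y => expR (g y)).
Proof.
move=> sg; apply/smooth_tame; apply: (@tame_expR (fun=> True) (fun=> True)) => // i.
by apply/smooth_tame; exact: smooth_partial.
Qed.

End CB_theory.
End calculus_lemmas.
Notation e_ i := (delta_mx 0 i).

(** * Symmetry of mixed partial derivatives *)

Section mixed_partials.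
Context {R : realType} {n : nat}.
Implicit Types (g : 'rV[R]_n -> R).

Lemma norm_line (i : 'I_n) (s : R) : `|s *: (e_ i : 'rV[R]_n)| <= `|s|.
Proof.
apply: rV_norm_le => // j; rewrite !mxE eqxx/= normrM ler_piMr//.
by case: eqVneq => _; rewrite ?normr1 ?normr0.
Qed.

(** Two uses of the mean value theorem: along [e_ i] for the increment in direction [e_ j], then
    along [e_ j] for [partial i g]. *)
Lemma second_difference g i j y h : smooth g -> 0 < h ->
  exists z, `|z - y| <= 2 * h /\
    g (y + h *: e_ i + h *: e_ j) - g (y + h *: e_ i) - g (y + h *: e_ j) + g y
      = h ^+ 2 * partial j (partial i g) z.
Proof.
move=> sg h0.
have der_i w s : is_derive s (1 : R) (fun s => g (y + s *: e_ i + w)) (partial i g (y + s *: e_ i + w)).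
  have -> : (fun s => g (y + s *: e_ i + w)) = (fun s => g ((y + w) + s *: e_ i)).
    by apply/funext => r; rewrite addrAC.
  by rewrite addrAC; apply: partial_line; exact: smooth_deriv.
have [c /andP[c1 c2]] := mvt 0 h (fun s => is_deriveB (der_i (h *: e_ j) s) (der_i 0 s)).
rewrite /= !fctE !addr0 !scale0r !addr0 subr0 add0r => Fc.
have [d /andP[d1 d2] Gd] := mvt 0 h (fun s => partial_line (y + (c * h) *: e_ i) s (@smooth_deriv _ _ _ j (smooth_partial i sg))).
exists (y + (c * h) *: e_ i + (d * h) *: e_ j); split.
  rewrite -(addrA y) [y + (_ + _)]addrC addrK; apply: le_trans (ler_normD _ _) _.
  have := norm_line i (c * h); have := norm_line j (d * h).
  rewrite !ger0_norm ?mulr_ge0 ?(ltW h0)//; move: (`|_|) (`|_|) => p q.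
  by move: c1 c2 d1 d2 h0; clear; nra.
move: Gd; rewrite scale0r addr0 subr0 add0r => Gd.
rewrite Gd in Fc; rewrite expr2 mulrC mulrA -Fc; ring.
Qed.

(** The second difference is symmetric in [i] and [j], and by [second_difference] each mixed partial
    takes its value, up to [d ^+ 2], at a point near [y]; continuity concludes. *)
Lemma partialC g i j : smooth g -> partial i (partial j g) = partial j (partial i g).
Proof.
move=> sg; apply/funext => y; apply/eqP; rewrite -subr_eq0 -normr_eq0.
rewrite -[_ == 0]negbK; apply/negP => h.
have e0 : 0 < `|partial i (partial j g) y - partial j (partial i g) y| by rewrite lt_def h normr_ge0.
set e : R := `|_| in e0 h.
have He : e = `|partial i (partial j g) y - partial j (partial i g) y| by [].
clearbody e.
have near_y (f : 'rV[R]_n -> R) : continuous f -> exists2 d, 0 < d & forall z, `|z - y| <= 2 * d -> `|f z - f y| < e / 2 :> R.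
  move=> /(_ y) cf; have /cvgrPdist_lt/(_ (e / 2)) := cf.
  rewrite divr_gt0// => /(_ isT) /nbhs_ballP [d /= d0 hd]; exists (d / 4); first by rewrite divr_gt0.
  move=> z hz; rewrite distrC; apply: hd; rewrite mx_norm_ball /ball_/= distrC.
  by apply: le_lt_trans hz _; lra.
have [d1 d10 h1] := near_y _ (smooth_cont (smooth_partial i (smooth_partial j sg))).
have [d2 d20 h2] := near_y _ (smooth_cont (smooth_partial j (smooth_partial i sg))).
have [d [d0 dd1 dd2]] : exists d, [/\ 0 < d, d <= d1 & d <= d2].
  by exists (Num.min d1 d2); rewrite lt_min d10 d20 !ge_min !lexx orbT.
have [z [zy Ez]] := second_difference i j y sg d0.
have [w [wy Ew]] := second_difference j i y sg d0.
have E : partial j (partial i g) z = partial i (partial j g) w.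
  apply: (@mulfI _ (d ^+ 2)); first by rewrite expf_neq0// gt_eqF.
  apply: etrans (etrans (esym Ez) _) Ew; have := addrAC y (d *: e_ i) (d *: e_ j).
  by move=> ->; move: (g _) (g _) (g _) (g _); clear=> p q r s; ring.
have H1 : `|partial i (partial j g) w - partial i (partial j g) y| < e / 2.
  apply: h1.
  apply: le_trans wy _.
  by rewrite ler_wpM2l.
have H2 : `|partial j (partial i g) z - partial j (partial i g) y| < e / 2.
  apply: h2.
  apply: le_trans zy _.
  by rewrite ler_wpM2l.
have : e < e.
  move: H1 H2 He E.
  move: (partial i _ w) (partial j _ z) (partial i _ y) (partial j _ y).
  clear=> p q a b H1 H2 He E; move: H1 H2.
  rewrite E => H1 H2; rewrite {1}He -(subrK p a) -addrA.
  by apply: le_lt_trans (ler_normD _ _) _; rewrite (distrC a); lra.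
by rewrite ltxx.
Qed.

Lemma partials_perm g s t : smooth g -> perm_eq s t -> partials s g = partials t g.
Proof.
move=> sg; elim: s t => [|i s IH] t.
  by rewrite perm_sym => /perm_nilP ->.
move=> st; have it : i \in t by rewrite -(perm_mem st) mem_head.
case/splitPr: it st => t1 t2 st.
have st' : perm_eq s (t1 ++ t2).
  by rewrite -(perm_cons i); apply: perm_trans st _; apply/permPl; exact: (perm_catCA t1 [:: i] t2).
rewrite [LHS]/= -/(partials s g) (IH _ st').
elim: t1 {st st'} => [//|k t1 IH1] /=.
rewrite -/(partials (t1 ++ t2) g) -/(partials (t1 ++ i :: t2) g).
by rewrite partialC; [rewrite IH1|exact: smooth_partials].
Qed.

(** Assumptions A and B speak of multi-indices, [smooth] and [tame] of words; this is the bridge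
    between them. *)
Lemma partials_multi_partial g s : smooth g ->
  partials s g = multi_partial (fun i => count_mem i s) g.
Proof.
move=> sg; apply: partials_perm => //; apply/allP => k _ /=; apply/eqP.
rewrite count_flatten -map_comp sumnE big_map big_enum/=.
rewrite (bigD1 k)//= big1 ?addn0.
  by rewrite count_nseq/= eqxx mul1n.
by move=> j jk; rewrite count_nseq/= (negbTE jk).
Qed.

End mixed_partials.

(** * Directional derivatives of functions with continuous partials *)

Section directional.
Context {R : realType}.

Lemma smooth_cnsS n (g : 'rV[R]_n.+1 -> R) t : smooth g ->
  smooth (fun y => g (cns t y)) /\
  forall s, partials s (fun y => g (cns t y)) = (fun y => partials (map (lift ord0) s) g (cns t y)).
Proof.
move=> sg.
have E s : partials s (fun y => g (cns t y)) = (fun y => partials (map (lift ord0) s) g (cns t y)).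
  elim: s => [//|i s IH] /=; rewrite IH; apply/funext => y.
  by rewrite (partial_cnsS (partials (map (lift ord0) s) g)).
split => // s; rewrite E; split.
  exact: (continuous_compose (@continuous_cns _ _ t) (smooth_cont (smooth_partials _ sg))).
by move=> i; apply: (@deriv_cnsS _ _ (partials (map (lift ord0) s) g)); apply: smooth_deriv; apply: smooth_partials.
Qed.

(** The increment is split into a move of the first coordinate, treated by the mean value theorem
    and continuity of [partial ord0 g], and a move of the others, treated by induction on the
    dimension. *)
Lemma is_derive_directional n (g : 'rV[R]_n -> R) (y v : 'rV[R]_n) :
  (forall i, deriv_along g i) -> (forall i, continuous (partial i g)) ->
  is_derive y v g (\sum_i v 0 i * partial i g y).
Proof.
suff H : (forall i, deriv_along g i) -> (forall i, continuous (partial i g)) ->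
   h^-1 *: (g (h *: v + y) - g y) @[h --> (0 : R)^'] --> \sum_i v 0 i * partial i g y.
  move=> /H{}H /H{}H; split; last exact/cvg_lim.
  by apply/cvg_ex; exists (\sum_i v 0 i * partial i g y).
elim: n g y v => [|n IH] g y v dg cg.
  rewrite big_ord0 (thinmx0 v); under eq_fun do rewrite scaler0 add0r subrr scaler0.
  exact: cvg_cst.
rewrite -(cnsK y) -(cnsK v); move: (hd y) (tl y) (hd v) (tl v) => t {}y a {}v.
have E : (fun h : R => h^-1 *: (g (h *: cns a v + cns t y) - g (cns t y))) =
   (fun h => h^-1 *: (g (cns (t + h * a) (h *: v + y)) - g (cns t (h *: v + y))) +
             h^-1 *: (g (cns t (h *: v + y)) - g (cns t y))).
  apply/funext => h; rewrite -scalerDr addrA subrK cnsZ cnsD.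
  by rewrite [h * a + t]addrC.
rewrite E big_ord_recl cns0.
apply: cvgD; last first.
  have -> : \sum_(i < n) cns a v 0 (lift ord0 i) * partial (lift ord0 i) g (cns t y) =
      \sum_(i < n) v 0 i * partial i (fun y => g (cns t y)) y.
    by apply: eq_bigr => i _; rewrite cnsS partial_cnsS.
  apply: (IH (fun y => g (cns t y)) y v) => i; first exact: deriv_cnsS.
  have -> : partial i (fun y => g (cns t y)) = (fun y => partial (lift ord0 i) g (cns t y)).
    by apply/funext => z; rewrite partial_cnsS.
  exact: (continuous_compose (@continuous_cns _ _ t) (cg _)).
apply/cvgrPdist_lt => e e0.
have /cvgrPdist_lt/(_ (e / (`|a| + 1))) := cg ord0 (cns t y).
rewrite divr_gt0//= ?ltr_wpDl// => /(_ isT) /nbhs_ballP[d /= d0 hd].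
have D0 : 0 < d / (`|a| + `|v| + 1) by rewrite divr_gt0// ltr_wpDl// addr_ge0.
near=> h.
have h0 : h != 0 by near: h; exact: nbhs_dnbhs_neq.
have hh : `|h| < d / (`|a| + `|v| + 1).
  by near: h; apply: dnbhs0_lt.
have [th /andP[th0 th1] ->] := mvt t (t + h * a) (fun s => is_derive_cns0 s (h *: v + y) (dg ord0)).
rewrite [t + _ - t]addrAC subrr add0r.
set c := t + th * (h * a).
have -> : h^-1 *: (partial ord0 g (cns c (h *: v + y)) * (h * a)) = a * partial ord0 g (cns c (h *: v + y)).
  by rewrite -[_ *: _]/(_ * _) (mulrC (partial _ _ _)) -(mulrA h) mulKf.
rewrite -mulrBr normrM.
have : `|partial ord0 g (cns t y) - partial ord0 g (cns c (h *: v + y))| < e / (`|a| + 1).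
  apply: hd; rewrite mx_norm_ball /ball_/= cnsN cnsD norm_cns.
  have -> : y - (h *: v + y) = - (h *: v) by rewrite opprD addrCA subrr addr0.
  move: hh; rewrite ltr_pdivlMr ?ltr_wpDl ?addr_ge0// => hh.
  have A : 0 <= `|h| * `|a| by rewrite mulr_ge0.
  have B : 0 <= `|h| * `|v| by rewrite mulr_ge0.
  have C : 0 < `|h| by rewrite normr_gt0.
  rewrite gt_max normrN mx_normZ; apply/andP; split; last first.
    by apply: le_lt_trans hh; rewrite !mulrDr mulr1; lra.
  apply: (@le_lt_trans _ _ (`|h| * `|a|)); last first.
    by apply: le_lt_trans hh; rewrite !mulrDr mulr1; lra.
  rewrite /c opprD addNKr normrN normrM normrM ler_piMl// ger0_norm//.
rewrite ltr_pdivlMr ?ltr_wpDl// => H; apply: le_lt_trans H.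
by rewrite mulrC ler_wpM2l// lerDl.
Unshelve. all: by end_near. Qed.

End directional.

(** * Rapidly decaying functions and their integrals *)

Section integral_toolbox.
Context {R : realType}.
Notation mu1 := (@lebesgue_measure R).

(** The norm in the exponent is the sup norm, which behaves well under slicing; [norm_le_enorm] and
    [enorm_le] compare it with the Euclidean norm of the hypotheses. *)
Definition expb n (g : 'rV[R]_n -> R) : Prop :=
  exists C nu, forall y, `|g y| <= C * expR (nu * `|y|).
Definition edec n (g : 'rV[R]_n -> R) : Prop :=
  forall nu, exists C, forall y, `|g y| <= C * expR (- (nu * `|y|)).
Definition pclass n := tame (@expb n).
Definition fast n := tame (@edec n).

Section nfix.
Variable n : nat.
Implicit Types f g : 'rV[R]_n -> R.

Lemma dom_D f g : dom f -> dom g -> dom (fun y => f y + g y).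
Proof.
move=> [cf [C hC]] [cg [D hD]]; split; first exact: contD.
exists (C + D) => y; apply: le_trans (ler_normD _ _) _.
by rewrite mulrDl lerD.
Qed.

Lemma dom_Z c f : dom f -> dom (fun y => c * f y).
Proof.
move=> [cf [C hC]]; split; first by apply: contM => //; exact: cst_continuous.
by exists (`|c| * C) => y; rewrite normrM -mulrA ler_wpM2l.
Qed.

Lemma dom_abs f : dom f -> dom (fun y => `|f y|).
Proof.
move=> [cf [C hC]]; split; last by exists C => y; rewrite normr_id.
exact: (continuous_compose cf (@norm_continuous _ _)).
Qed.

Lemma dom_sum (I : Type) (r : seq I) (F : I -> 'rV[R]_n -> R) :
  (forall i, dom (F i)) -> dom (fun y => \sum_(i <- r) F i y).
Proof.
move=> h; elim: r => [|i r IH].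
  under eq_fun do rewrite big_nil.
  by split; [exact: cst_continuous|exists 0 => y; rewrite normr0 mul0r].
by under eq_fun do rewrite big_cons; exact: dom_D.
Qed.

Lemma integralR_D f g : dom f -> dom g ->
  integralR (fun y => f y + g y) = integralR f + integralR g.
Proof. by move=> df dg; apply: RintegralD => //; exact: dom_integrable. Qed.

Lemma integralR_B f g : dom f -> dom g ->
  integralR (fun y => f y - g y) = integralR f - integralR g.
Proof. by move=> df dg; apply: RintegralB => //; exact: dom_integrable. Qed.

Lemma integralR_Z c f : dom f -> integralR (fun y => c * f y) = c * integralR f.
Proof. by move=> df; apply: RintegralZl => //; exact: dom_integrable. Qed.

Lemma integralR_sum (I : Type) (r : seq I) (F : I -> 'rV[R]_n -> R) :
  (forall i, dom (F i)) ->
  integralR (fun y => \sum_(i <- r) F i y) = \sum_(i <- r) integralR (F i).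
Proof.
move=> h; elim: r => [|i r IH].
  under eq_fun do rewrite big_nil; rewrite big_nil /integralR.
  by rewrite Rintegral_cst// mul0r.
under eq_fun do rewrite big_cons; rewrite big_cons -IH integralR_D//.
exact: dom_sum.
Qed.

Lemma integralR_le f g : dom f -> dom g -> (forall y, f y <= g y) ->
  integralR f <= integralR g.
Proof. by move=> df dg fg; apply: le_Rintegral => //; exact: dom_integrable. Qed.

Lemma integralR_ge0 f : (forall y, 0 <= f y) -> 0 <= integralR f.
Proof. by move=> f0; apply: Rintegral_ge0. Qed.

Lemma integralR_abs f : dom f -> `|integralR f| <= integralR (fun y => `|f y|).
Proof. by move=> df; apply: le_normr_Rintegral => //; exact: dom_integrable. Qed.

Lemma integralRE f : dom f ->
  (integralR f)%:E = (\int[lebesgue_rV n]_y (f y)%:E)%E.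
Proof.
by move=> df; rewrite /integralR /Rintegral fineK//; apply: integrable_fin_num => //; exact: dom_integrable.
Qed.

Lemma dom_maj : dom (@maj R n).
Proof.
split; first exact: continuous_maj.
by exists 1 => y; rewrite mul1r gtr0_norm// maj_gt0.
Qed.

(** In each coordinate [1 + t^2 <= (1 + |t|)^2 <= exp (2 |t|)], hence the exponent [2 n] for the
    product. *)
Lemma majV_le (y : 'rV[R]_n) : 1 <= expR (2 * n%:R * `|y|) * maj y.
Proof.
rewrite -ler_pdivrMr ?maj_gt0// mul1r /maj -prodfV.
apply: (@le_trans _ _ (\prod_(i < n) expR (2 * `|y|))).
  apply: ler_prod => i _; rewrite invrK addr_ge0 ?sqr_ge0//=.
  apply: (@le_trans _ _ ((1 + `|y|) ^+ 2)).
    have := coord_le_norm y i; rewrite -real_normK ?num_real//.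
    by have := normr_ge0 (y 0 i); nra.
  rewrite mulrC expRM_natr; last first.
  rewrite ler_pXn2r ?nnegrE ?expR_ge0 ?addr_ge0//.
  exact: expR_ge1Dx.
by rewrite prodr_const card_ord -expRM_natr mulrAC mulrC.
Qed.

Lemma edec_dom g : continuous g -> edec g -> dom g.
Proof.
move=> cg /(_ (2 * n%:R)) [C hC]; split => //; exists C => y.
have C0 : 0 <= C by have := le_trans (normr_ge0 _) (hC 0); rewrite pmulr_lge0// expR_gt0.
apply: le_trans (hC y) _; rewrite ler_wpM2l// expRN -[leLHS]mulr1 ler_pdivrMl ?expR_gt0//.
exact: majV_le.
Qed.

Lemma fast_dom g : fast g -> dom g.
Proof. by move=> [sg eg]; apply: edec_dom; [exact: smooth_cont|exact: (eg [::])]. Qed.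

Lemma expb_D f g : expb f -> expb g -> expb (fun y => f y + g y).
Proof.
move=> [C [nu hf]] [D [nu' hg]]; exists (`|C| + `|D|), (`|nu| + `|nu'|) => y.
apply: le_trans (ler_normD _ _) _; rewrite mulrDl lerD//.
  apply: le_trans (hf y) _; apply: (@le_trans _ _ (`|C| * expR (nu * `|y|))).
    by rewrite ler_wpM2r ?expR_ge0// ler_norm.
  rewrite ler_wpM2l// ler_expR ler_wpM2r//.
  by have := ler_norm nu; have := normr_ge0 nu'; lra.
apply: le_trans (hg y) _; apply: (@le_trans _ _ (`|D| * expR (nu' * `|y|))).
  by rewrite ler_wpM2r ?expR_ge0// ler_norm.
rewrite ler_wpM2l// ler_expR ler_wpM2r//.
by have := ler_norm nu'; have := normr_ge0 nu; lra.
Qed.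

Lemma expb_M f g : expb f -> expb g -> expb (fun y => f y * g y).
Proof.
move=> [C [nu hf]] [D [nu' hg]]; exists (C * D), (nu + nu') => y.
rewrite normrM mulrDl expRD mulrACA.
by apply: ler_pM.
Qed.

Lemma expb_cst c : expb (fun _ : 'rV[R]_n => c).
Proof. by exists `|c|, 0 => y; rewrite mul0r expR0 mulr1. Qed.

Lemma edec_D f g : edec f -> edec g -> edec (fun y => f y + g y).
Proof.
move=> hf hg nu; have [C hC] := hf nu; have [D hD] := hg nu.
by exists (C + D) => y; apply: le_trans (ler_normD _ _) _; rewrite mulrDl lerD.
Qed.

Lemma edec_M f g : expb f -> edec g -> edec (fun y => f y * g y).
Proof.
move=> [C [nu hf]] hg la; have [D hD] := hg (nu + la); exists (C * D) => y.
have -> : - (la * `|y|) = nu * `|y| + - ((nu + la) * `|y|) by ring.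
by rewrite normrM expRD mulrACA ler_pM.
Qed.

Lemma edec_expb g : edec g -> expb g.
Proof. by move=> /(_ 0) [C hC]; exists C, 0 => y; move: (hC y); rewrite !mul0r oppr0. Qed.

Lemma fast_pclass g : fast g -> pclass g.
Proof. exact: (tameW edec_expb). Qed.

Lemma pclass_D f g : pclass f -> pclass g -> pclass (fun y => f y + g y).
Proof. exact: (tame_D expb_D). Qed.

Lemma pclass_M f g : pclass f -> pclass g -> pclass (fun y => f y * g y).
Proof. exact: (tame_M expb_D expb_M). Qed.

Lemma pclass_cst c : pclass (fun _ : 'rV[R]_n => c).
Proof. by apply: tame_cst; exact: expb_cst. Qed.

Lemma pclass_N f : pclass f -> pclass (fun y => - f y).
Proof.
move=> hf; under eq_fun do rewrite -mulN1r.
by apply: pclass_M => //; exact: pclass_cst.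
Qed.

Lemma pclass_sum (I : Type) (r : seq I) (F : I -> 'rV[R]_n -> R) :
  (forall i, pclass (F i)) -> pclass (fun y => \sum_(i <- r) F i y).
Proof.
move=> h; elim: r => [|i r IH].
  by under eq_fun do rewrite big_nil; exact: pclass_cst.
by under eq_fun do rewrite big_cons; exact: pclass_D.
Qed.

Lemma fast_D f g : fast f -> fast g -> fast (fun y => f y + g y).
Proof. exact: (tame_D edec_D). Qed.

Lemma fast_M f g : pclass f -> fast g -> fast (fun y => f y * g y).
Proof. exact: (tame_M edec_D edec_M). Qed.

Lemma fast_MM f g : fast f -> fast g -> fast (fun y => f y * g y).
Proof. by move=> /fast_pclass; exact: fast_M. Qed.

Lemma fast_Mr f g : fast f -> pclass g -> fast (fun y => f y * g y).
Proof. by move=> hf hg; under eq_fun do rewrite mulrC; exact: fast_M. Qed.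

Lemma fast_Z c f : fast f -> fast (fun y => c * f y).
Proof. by apply: fast_M; exact: pclass_cst. Qed.

Lemma fast_N f : fast f -> fast (fun y => - f y).
Proof. by move=> hf; under eq_fun do rewrite -mulN1r; exact: fast_Z. Qed.

Lemma fast_B f g : fast f -> fast g -> fast (fun y => f y - g y).
Proof. by move=> hf hg; apply: fast_D => //; exact: fast_N. Qed.

Lemma fast0 : fast (fun _ : 'rV[R]_n => 0).
Proof.
apply/tameP; elim => [|k IH]; (split; [exact: cst_continuous|by move=> nu; exists 0 => y; rewrite mul0r normr0|]) => // i.
by rewrite partial_cst; split; [exact: deriv_cst|].
Qed.

Lemma fast_sum (I : Type) (r : seq I) (F : I -> 'rV[R]_n -> R) :
  (forall i, fast (F i)) -> fast (fun y => \sum_(i <- r) F i y).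
Proof.
move=> h; elim: r => [|i r IH].
  by under eq_fun do rewrite big_nil; exact: fast0.
by under eq_fun do rewrite big_cons; exact: fast_D.
Qed.

Lemma fast_partial i f : fast f -> fast (partial i f).
Proof. exact: tame_partial. Qed.

Lemma pclass_partial i f : pclass f -> pclass (partial i f).
Proof. exact: tame_partial. Qed.

Lemma fast_smooth f : fast f -> smooth f. Proof. by case. Qed.
Lemma pclass_smooth f : pclass f -> smooth f. Proof. by case. Qed.

End nfix.

Lemma dom_slice n (g : 'rV[R]_n.+1 -> R) t : dom g -> dom (fun y => g (cns t y)).
Proof.
move=> [cg [C hC]]; split; first exact: (continuous_compose (@continuous_cns _ _ t) cg).
exists (C * (1 + t ^+ 2)^-1) => y.
by rewrite -mulrA -maj_cns.
Qed.

Definition dom1 (g : R -> R) : Prop :=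
  continuous g /\ exists C, forall t, `|g t| <= C * (1 + t ^+ 2)^-1.

Lemma dom1_integrable g : dom1 g -> mu1.-integrable setT (EFin \o g).
Proof.
move=> [cg [C hC]].
have mg : measurable_fun setT g by exact: continuous_measurable_fun.
apply/integrableP; split; first exact/measurable_EFinP.
have C0 : 0 <= C.
  by have := le_trans (normr_ge0 _) (hC 0); rewrite expr0n/= addr0 invr1 mulr1.
have m2 : measurable_fun setT (fun t : measurableTypeR R => ((1 + t ^+ 2)^-1)%:E).
  apply/measurable_EFinP; apply: continuous_measurable_fun.
  exact: continuous_oneDsqrV.
apply: (@le_lt_trans _ _ (\int[mu1]_y (C%:E * ((1 + y ^+ 2)^-1)%:E))%E).
  apply: ge0_le_integral => //.
  - by apply/measurable_EFinP; exact: measurableT_comp.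
  - by apply: emeasurable_funM.
  - by move=> y _; rewrite /= -EFinM lee_fin.
rewrite ge0_integralZl//.
- by rewrite lte_mul_pinfty// integral_inv1sqr.
- by move=> y _; rewrite lee_fin invr_ge0 addr_ge0// sqr_ge0.
Qed.

Lemma dom_slice0 n (g : 'rV[R]_n.+1 -> R) y : dom g -> dom1 (fun t => g (cns t y)).
Proof.
move=> [cg [C hC]]; split; first exact: (continuous_compose (@continuous_cnsl _ _ y) cg).
by exists (C * maj y) => t; rewrite -mulrA [maj y * _]mulrC -maj_cns.
Qed.

Lemma integrable_cns n (g : 'rV[R]_n.+1 -> R) : dom g ->
  (mu1 \x @leb R n)%E.-integrable setT (EFin \o g \o @rV_cons R n).
Proof.
move=> dg; have mg : measurable_fun [set: 'rV[R]_n.+1] (EFin \o g).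
  by apply/measurable_EFinP; apply: continuous_rV_measurable; case: dg.
apply/integrable12ltyP; first exact: (measurable_comp_rV_cons mg).
have /integrableP[_] := dom_integrable dg.
rewrite (@integral_cns _ _ (fun y => `|(EFin \o g) y|)%E)//.
exact: measurableT_comp.
Qed.

Lemma integral_cns_dom n (g : 'rV[R]_n.+1 -> R) : dom g ->
  (\int[lebesgue_rV n.+1]_y (g y)%:E = \int[mu1]_t \int[lebesgue_rV n]_y (g (cns t y))%:E)%E /\
  (\int[lebesgue_rV n.+1]_y (g y)%:E = \int[lebesgue_rV n]_y \int[mu1]_t (g (cns t y))%:E)%E.
Proof.
move=> dg; have ig := integrable_cns dg.
have mg : measurable_fun [set: 'rV[R]_n.+1] (EFin \o g).
  by apply/measurable_EFinP; apply: continuous_rV_measurable; case: dg.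
have X2 h : (\int[mu1 \x^ @leb R n]_x h x = \int[mu1 \x @leb R n]_x h x)%E.
  apply: (@eq_measure_integral _ _ R setT (mu1 \x @leb R n)%E (mu1 \x^ @leb R n)%E) => //= A mA _.
  by apply/esym; apply: product_measure_unique => // B C mB mC/=; rewrite product_measure2E.
have E : (\int[lebesgue_rV n.+1]_y (g y)%:E = \int[mu1 \x @leb R n]_z (EFin \o g \o @rV_cons R n) z)%E.
  rewrite -X2.
  have E2 := @integral_pushforward _ _ _ _ R _ (@measurable_rV_cons R n) (mu1 \x^ @leb R n)%E setT (EFin \o g) mg _ measurableT.
  rewrite -[LHS]/(\int[pushforward (mu1 \x^ @leb R n)%E (@rV_cons R n)]_y (EFin \o g) y)%E E2 ?preimage_setT//.
  by case/integrableP : ig => m1 m2; apply/integrableP; split => //; rewrite X2.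
split; rewrite E.
  by rewrite -(integral12_prod_meas1 ig).
by rewrite -(integral21_prod_meas1 ig).
Qed.

End integral_toolbox.

(** * Integrals of derivatives over the line and over the space *)

Section integration_by_parts.
Context {R : realType}.
Notation mu1 := (@lebesgue_measure R).

Lemma is_derive_cont (F f : R -> R) :
  (forall x, is_derive x (1 : R) F (f x)) -> continuous F.
Proof.
move=> dF x; apply: differentiable_continuous; apply/derivable1_diffP.
exact: (@ex_derive _ _ _ _ _ _ _ (dF x)).
Qed.

Lemma ftc_seg (F f : R -> R) (a b : R) : a <= b ->
  (forall x, is_derive x (1 : R) F (f x)) -> continuous f ->
  (\int[mu1]_(x in `[a, b]) (f x)%:E = (F b - F a)%:E)%E.
Proof.
rewrite le_eqVlt => /predU1P[->|ab] dF cf.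
  by rewrite set_itv1 integral_set1 subrr.
have cF := is_derive_cont dF.
rewrite (@continuous_FTC2 _ f F)//.
- exact: continuous_subspaceT.
- split.
  + by move=> x _; exact: (@ex_derive _ _ _ _ _ _ _ (dF x)).
  + by apply: cvg_at_right_filter; exact: cF.
  + by apply: cvg_at_left_filter; exact: cF.
- by move=> x _; rewrite derive1E; exact: (@derive_val _ _ _ _ _ _ _ (dF x)).
Qed.

(** The fundamental theorem on [[- k, k]] leaves boundary values that tend to 0, and dominated
    convergence passes to the whole line. *)
Lemma integral1_derive0 (F f : R -> R) :
  (forall x, is_derive x (1 : R) F (f x)) -> dom1 f ->
  (exists C, forall t, `|F t| <= C * (1 + t ^+ 2)^-1) ->
  (\int[mu1]_t (f t)%:E = 0)%E.
Proof.
move=> dF [cf [D hD]] [C hC].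
have C0 : 0 <= C.
  by have := le_trans (normr_ge0 _) (hC 0); rewrite expr0n/= addr0 invr1 mulr1.
pose f_ (k : nat) := (EFin \o f) \_ `[- k%:R, k%:R].
have mf : measurable_fun [set: measurableTypeR R] (EFin \o f).
  by apply/measurable_EFinP; exact: continuous_measurable_fun.
have if1 : mu1.-integrable setT (EFin \o f) by apply: dom1_integrable; split => //; exists D.
have [|||||_ _ h] := @dominated_convergence _ _ _ mu1 setT measurableT f_ (EFin \o f) (abse \o EFin \o f).
- by move=> k; apply/measurable_restrict => //; exact: measurable_funS mf.
- exact: mf.
- apply: aeW => x _; apply: cvg_near_cst; exists (Num.truncn `|x|).+1 => // k /= hk.
  rewrite /f_ patchE mem_set//= in_itv/= -ler_norml.
  by apply: le_trans (ltW (truncnS_gt _)) _; rewrite ler_nat.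
- exact: integrable_abse.
- apply: aeW => x k _ ; rewrite /f_ patchE; case: ifP => //= _.
  by rewrite normr0 lee_fin.
have {h} : (F k%:R - F (- k%:R))%:E @[k --> \oo] --> (\int[mu1]_t (f t)%:E)%E.
  have -> : (fun k : nat => (F k%:R - F (- k%:R))%:E) = (fun k => \int[mu1]_x f_ k x)%E.
    apply/funext => k; rewrite /f_ -integral_mkcond (ftc_seg _ dF)//.
    by rewrite (@le_trans _ _ 0)// oppr_le0.
  exact: h.
have h0 : (F k%:R - F (- k%:R))%:E @[k --> \oo] --> 0%:E.
  apply: cvg_EFin; first exact: nearW.
  have c1 : 2 * C * harmonic k @[k --> \oo] --> 0.
    by rewrite -(mulr0 (2 * C)); apply: cvgM; [exact: cvg_cst|exact: cvg_harmonic].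
  apply: norm_cvg0; apply: (squeeze_cvgr _ (cvg_cst 0) c1).
  apply: nearW => k; rewrite normr_ge0/=; apply: le_trans (ler_normB _ _) _.
  (* For a natural number [k <= k^2], so [1 / (1 + k^2)] is at most the harmonic term. *)
  have H t : t ^+ 2 = k%:R ^+ 2 -> `|F t| <= C * harmonic k.
    move=> tk; apply: le_trans (hC t) _; rewrite ler_wpM2l// /harmonic lef_pV2 ?posrE ?ltr_wpDr ?sqr_ge0//.
    by rewrite tk -natr1 addrC lerD2l -natrX ler_nat; case: (k) => // j; rewrite expnS leq_pmulr.
  rewrite -[leRHS]/(2 * C * harmonic k) -mulrA mulr_natl mulr2n.
  by apply: lerD; apply: H; rewrite ?sqrrN.
by move=> h; exact: (cvg_unique _ h h0).
Qed.

(** The order of the iterated integral is chosen so that the differentiated variable is integrated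
    innermost; the other coordinates are reached by induction on the dimension. *)
Lemma integral_partial0 n (F : 'rV[R]_n -> R) i :
  deriv_along F i -> dom F -> dom (partial i F) -> integralR (partial i F) = 0.
Proof.
suff H : deriv_along F i -> dom F -> dom (partial i F) ->
    (\int[lebesgue_rV n]_y (partial i F y)%:E = 0)%E.
  by move=> dF h1 h2; rewrite /integralR /Rintegral H.
elim: n F i => [|n IH] F i; first by case: i.
move=> dF hF hd; have [E1 E2] := integral_cns_dom hd.
case: (unliftP ord0 i) => [j|] ij; subst i.
  rewrite E1; apply: integral0_eq => t _.
  have E : (fun y => partial (lift ord0 j) F (cns t y)) = partial j (fun y => F (cns t y)).
    by apply/funext => y; rewrite partial_cnsS.
  rewrite -[LHS]/(\int[lebesgue_rV n]_y ((fun y => partial (lift ord0 j) F (cns t y)) y)%:E)%E E.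
  apply: IH; [exact: deriv_cnsS|exact: dom_slice|rewrite -E; exact: dom_slice hd].
rewrite E2; apply: integral0_eq => y _.
apply: (integral1_derive0 (fun t => is_derive_cns0 t y dF)); first exact: (dom_slice0 y hd).
by have [] := dom_slice0 y hF.
Qed.

End integration_by_parts.

(** * Maximum principle and interior estimates *)

Section maximum_principle.
Context {R : realType}.

Lemma contN n (f : 'rV[R]_n -> R) : continuous f -> continuous (fun y => - f y).
Proof.
by move=> cf; under eq_fun do rewrite -mulN1r; apply: contM => //; exact: cst_continuous.
Qed.

Lemma contB n (f g : 'rV[R]_n -> R) : continuous f -> continuous g ->
  continuous (fun y => f y - g y).
Proof. by move=> cf cg; apply: contD => //; exact: contN. Qed.

(** Adding the values at [t] and [- t] cancels the linear term, so only the symmetric second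
    difference has to be compared with the parabola. *)
Lemma second_derivative_le (F F1 : R -> R) (s a b d : R) :
  (forall t, is_derive t (1 : R) F (F1 t)) -> is_derive (0 : R) (1 : R) F1 s ->
  0 < d -> (forall t, `|t| < d -> F t <= F 0 + a * t + b * t ^+ 2) -> s <= 2 * b.
Proof.
move=> dF dF1 d0 hF; rewrite leNgt; apply/negP => bs.
(* A quarter of the gap: with [c := 2 * b + e] below, the derivative forces the symmetrized
   difference up and the parabola forces it down. *)
pose e := (s - 2 * b) / 4.
have e0 : 0 < e by rewrite /e; lra.
have [d' d'0 hd'] : exists2 d', 0 < d' & forall t, 0 < `|t| < d' -> `|(F1 t - F1 0) / t - s| < e.
  have [+ <-] := dF1; rewrite /derivable => /cvgrPdist_lt/(_ e e0).
  move=> /nbhs_ballP[d' /= d'0 hd']; exists d' => // t /andP[t0 td].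
  have td' : ball (0 : R) d' t by rewrite /ball/= sub0r normrN.
  have t00 : t != 0 by rewrite -normr_gt0.
  have := hd' t td' t00.
  by rewrite -[t *: 1]/(t * 1) mulr1 addr0 -[t^-1 *: _]/(t^-1 * _) distrC mulrC.
pose D := Num.min d d'.
have D0 : 0 < D by rewrite lt_min d0.
have Dd : D <= d by rewrite ge_min lexx.
have Dd' : D <= d' by rewrite ge_min lexx orbT.
have key t : 0 <= t < D -> (2 * s - 2 * e) * t <= F1 t - F1 (- t).
  move=> /andP[]; rewrite le_eqVlt => /predU1P[<- _|t0 tD]; first by rewrite oppr0 mulr0 subrr.
  have h1 := hd' t; have h2 := hd' (- t).
  move: h1 h2; rewrite normrN gtr0_norm// t0 (lt_le_trans tD Dd') => /(_ isT) h1 /(_ isT) h2.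
  move: h1 h2; rewrite !ltr_norml => /andP[h1 _] /andP[h2 _].
  move: h1; rewrite ltrBrDl ltr_pdivlMr// => h1.
  move: h2; rewrite invrN mulrN -mulNr ltrBrDl ltr_pdivlMr// => h2.
  by move: h1 h2; move: (F1 t) (F1 0) (F1 (- t)) => p q r; lra.
pose t0 := D / 2.
have t00 : 0 < t0 by rewrite /t0; lra.
have t0D : t0 < D by rewrite /t0; lra.
pose c := 2 * b + e.
have dG t : is_derive t (1 : R) (fun t => F t + F (- t) - c * t ^+ 2) (F1 t - F1 (- t) - c * (2 * t)).
  have h1 := dF t; have h2 : is_derive t (1 : R) (fun t => F (- t)) (F1 (- t) * (-1)).
    exact: (@is_derive1_comp R F (fun t => - t) t).
  have h3 : is_derive t (1 : R) (fun t : R => c * t ^+ 2) (c * (2 * t)).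
    have h4 := @is_deriveX R _ (fun t : R => t) 2 t 1 1 (is_derive_id _ _).
    have := @is_deriveZ _ _ _ _ c _ _ _ h4; move=> h5; apply: (is_derive_eq h5).
    by rewrite expr1 -[X in c *: X]/((2 * t) * 1) mulr1.
  have h6 := is_deriveB (is_deriveD h1 h2) h3; apply: (is_derive_eq h6).
  by rewrite mulrN1.
have [th /andP[th0 th1]] := mvt 0 t0 dG.
rewrite oppr0 expr0n/= !addr0 mulr0 subr0 add0r => E.
have tht0 : 0 <= th * t0 < D.
  apply/andP; split; first by rewrite mulr_ge0// ltW//.
  by apply: le_lt_trans t0D; rewrite ler_piMl// ltW.
have pos : 0 <= (F1 (th * t0) - F1 (- (th * t0)) - c * (2 * (th * t0))) * t0.
  apply: mulr_ge0; last exact: ltW.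
  rewrite subr_ge0; apply: le_trans (key _ tht0).
  by case/andP: tht0 => h _; rewrite /c /e; move: h; move: (th * t0) => p h; nra.
rewrite -E in pos.
have := hF t0; have := hF (- t0); rewrite normrN gtr0_norm// (lt_le_trans t0D Dd).
move=> /(_ isT) h1 /(_ isT) h2; move: h1 h2 pos.
rewrite sqrrN /c; move: (F t0) (F (- t0)) (F 0) => p q r h1 h2 h3.
have : 0 < e * t0 ^+ 2 by rewrite mulr_gt0// exprn_gt0.
by nra.
Qed.

Lemma line_at0 n (y : 'rV[R]_n) i : y + 0 *: e_ i = y.
Proof. by rewrite scale0r addr0. Qed.

(** Second-order condition at a maximum of [u - W] along an axis, up to a parabola; [W] stands for
    the restriction of a comparison function to that axis and [s] for its second derivative. *)
Lemma partial2_le n (u : 'rV[R]_n -> R) y i (W W1 : R -> R) (s d a b : R) : smooth u ->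
  (forall t, is_derive t (1 : R) W (W1 t)) -> is_derive (0 : R) (1 : R) W1 s -> 0 < d ->
  (forall t, `|t| < d -> u (y + t *: e_ i) - W t <= u y - W 0 + a * t + b * t ^+ 2) ->
  partial i (partial i u) y <= s + 2 * b.
Proof.
move=> su dW dW1 d0 h.
have dF t := is_deriveB (partial_line y t (smooth_deriv (i := i) su)) (dW t).
have dF1 := is_deriveB (partial_line y 0 (smooth_deriv (i := i) (smooth_partial i su))) dW1.
rewrite addrC -lerBlDr -[X in partial i _ X](line_at0 y i).
apply: (second_derivative_le dF dF1 d0) => t td /=.
by rewrite !fctE line_at0; exact: h.
Qed.

Lemma closed_cube n (y : 'rV[R]_n) r : closed (cube y r).
Proof.
rewrite (_ : cube y r = (fun z => `|z - y|) @^-1` `]-oo, r]).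
  apply: preimage_closed; last exact: interval_closed.
  move=> z _; apply: continuous_comp; last exact: norm_continuous.
  by apply: continuousB => //; exact: cst_continuous.
by apply/seteqP; split => z /=; rewrite in_itv.
Qed.

Lemma closed_bounded_compact n (y : 'rV[R]_n) r (A : set 'rV[R]_n) :
  closed A -> A `<=` cube y r -> compact A.
Proof.
move=> cA sA; apply: bounded_closed_compact => //.
exists (`|r| + `|y|); split; first exact: num_real.
move=> M hM z /sA; rewrite /cube/= => h.
rewrite -(subrK y z); apply: le_trans (ler_normD _ _) _; apply: ltW; apply: le_lt_trans hM.
by rewrite lerD2r; apply: le_trans h (ler_norm _).
Qed.

Lemma compact_cube n (y : 'rV[R]_n) r : compact (cube y r).
Proof. exact: (@closed_bounded_compact _ y r _ (@closed_cube _ y r)). Qed.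

Lemma cont_max n (f : 'rV[R]_n -> R) (A : set 'rV[R]_n) y : compact A -> A y ->
  continuous f -> exists2 z, A z & forall w, A w -> f w <= f z.
Proof.
move=> cA Ay cf.
have [|z] := @EVT_max_rV R n f A (ex_intro _ y Ay) cA; first exact: continuous_subspaceT.
by rewrite inE => Az h; exists z => // w Aw; apply: h; rewrite inE.
Qed.

Lemma cont_bounded n (f : 'rV[R]_n -> R) (y : 'rV[R]_n) r : continuous f ->
  exists2 M, 0 <= M & forall z, `|z - y| <= r -> `|f z| <= M.
Proof.
move=> cf; have [r0|r0] := leP 0 r; last first.
  by exists 0 => // z h; have := lt_le_trans (le_lt_trans h r0) (normr_ge0 (z - y)); rewrite ltxx.
have [||z _ h] := @cont_max n (fun y => `|f y|) (cube y r) y (@compact_cube _ y r).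
- by rewrite /cube/= subrr normr0.
- exact: (continuous_compose cf (@norm_continuous _ _)).
by exists `|f z| => // w hw; exact: h.
Qed.

(** Twice the hyperbolic cosine and sine. *)
Definition ch (t : R) : R := expR t + expR (- t).
Definition sh (t : R) : R := expR t - expR (- t).

Lemma ch_gt0 t : 0 < ch t. Proof. by rewrite addr_gt0// expR_gt0. Qed.

Lemma sh2_le t : sh t ^+ 2 <= ch t ^+ 2.
Proof.
rewrite /sh /ch; have := expR_gt0 t; have := expR_gt0 (- t).
by move: (expR _) (expR _) => p q; nra.
Qed.

Lemma ch_ge t : expR `|t| <= ch t.
Proof.
rewrite /ch; case: ger0P => _; first by rewrite lerDl expR_ge0.
by rewrite lerDr expR_ge0.
Qed.

Lemma ch_le t : ch t <= 2 * expR `|t|.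
Proof.
rewrite /ch; have : expR t <= expR `|t| by rewrite ler_expR ler_norm.
have : expR (- t) <= expR `|t| by rewrite ler_expR -normrN ler_norm.
by move: (expR _) (expR _) (expR _) => p q r; lra.
Qed.

Lemma is_derive_affine (nu a t : R) : is_derive t (1 : R) (fun t => nu * (a + t)) nu.
Proof.
have h := @is_deriveZ _ _ _ (fun t : R => a + t) nu t 1 1 _.
apply: (is_derive_eq (h _)); last by rewrite -[_ *: _]/(_ * _) mulr1.
have h2 := is_deriveD (is_derive_cst a t (1 : R)) (is_derive_id t (1 : R)).
by apply: (is_derive_eq h2); rewrite add0r.
Qed.

Lemma is_derive_ch (nu a t : R) :
  is_derive t (1 : R) (fun t => ch (nu * (a + t))) (nu * sh (nu * (a + t))).
Proof.
have h1 := @is_derive1_comp R expR _ t _ _ (is_derive_expR _) (is_derive_affine nu a t).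
have h2 := @is_derive1_comp R expR _ t _ _ (is_derive_expR _) (is_deriveN (is_derive_affine nu a t)).
by apply: (is_derive_eq (is_deriveD h1 h2)); rewrite /sh; ring.
Qed.

Lemma is_derive_sh (nu a t : R) :
  is_derive t (1 : R) (fun t => sh (nu * (a + t))) (nu * ch (nu * (a + t))).
Proof.
have h1 := @is_derive1_comp R expR _ t _ _ (is_derive_expR _) (is_derive_affine nu a t).
have h2 := @is_derive1_comp R expR _ t _ _ (is_derive_expR _) (is_deriveN (is_derive_affine nu a t)).
by apply: (is_derive_eq (is_deriveB h1 h2)); rewrite /ch; ring.
Qed.

(** Comparable with [exp (- (nu |y|))] by [cinv_le] and [cinv_ge], but smooth, with derivatives that
    are explicit along each axis. *)
Definition cinv n (nu : R) (y : 'rV[R]_n) : R := (\sum_i ch (nu * y 0 i))^-1.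

Lemma sum_ch_gt0 n nu (y : 'rV[R]_n) : (0 < n)%N -> 0 < \sum_i ch (nu * y 0 i).
Proof.
case: n y => // n y _; rewrite big_ord_recl ltr_pwDl ?ch_gt0//.
by apply: sumr_ge0 => i _; exact/ltW/ch_gt0.
Qed.

Lemma cinv_gt0 n nu (y : 'rV[R]_n) : (0 < n)%N -> 0 < cinv nu y.
Proof. by move=> n0; rewrite invr_gt0; exact: sum_ch_gt0. Qed.

Lemma cinv_le n nu (y : 'rV[R]_n) : (0 < n)%N -> 0 <= nu -> cinv nu y <= expR (- (nu * `|y|)).
Proof.
move=> n0 nu0; rewrite /cinv expRN lef_pV2 ?posrE ?expR_gt0 ?sum_ch_gt0//.
have [i ->] : exists i, `|y| = `|y 0 i|.
  case: n y n0 => // n y _; have [y0|/mx_norm_neq0[[i j]] /= E] := eqVneq (mx_norm y) 0.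
    exists ord0; apply/eqP; rewrite eq_le coord_le_norm andbT.
    by rewrite [leLHS]y0 normr_ge0.
  by exists j; rewrite -[LHS]/(mx_norm y) E (ord1 i).
rewrite (bigD1 i)//=; apply: (@le_trans _ _ (ch (nu * y 0 i))).
  by have := ch_ge (nu * y 0 i); rewrite normrM (ger0_norm nu0).
by rewrite lerDl sumr_ge0// => j _; exact/ltW/ch_gt0.
Qed.

Lemma cinv_ge n nu (y : 'rV[R]_n) : (0 < n)%N -> 0 <= nu ->
  expR (- (nu * `|y|)) <= 2 * n%:R * cinv nu y.
Proof.
move=> n0 nu0; rewrite /cinv expRN ler_pdivlMr ?sum_ch_gt0// ler_pdivrMl ?expR_gt0//.
apply: (@le_trans _ _ (\sum_(i < n) 2 * expR (nu * `|y|))).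
  apply: ler_sum => i _; apply: le_trans (ch_le _) _.
  rewrite ler_pM2l// ler_expR normrM (ger0_norm nu0) ler_wpM2l//.
  exact: coord_le_norm.
by rewrite sumr_const card_ord -[leLHS]mulr_natr le_eqVlt; apply/orP; left; apply/eqP; ring.
Qed.

Lemma sum_sqr_le n (a : 'I_n -> R) : (forall i, 0 <= a i) ->
  \sum_i a i ^+ 2 <= (\sum_i a i) ^+ 2.
Proof.
move=> a0; rewrite expr2 mulr_suml; apply: ler_sum => i _.
rewrite expr2 ler_wpM2l// (bigD1 i)//= lerDl sumr_ge0//.
Qed.

Lemma continuous_cinv n nu : (0 < n)%N -> continuous (@cinv n nu).
Proof.
move=> n0 y; apply: continuousV; first by rewrite gt_eqF// sum_ch_gt0.
move: y; apply: continuous_sum_fun => i.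
have c1 : continuous (fun y : 'rV[R]_n => nu * y 0 i).
  by apply: contM; [exact: cst_continuous|exact: coord_cont].
apply: contD; first exact: (continuous_compose c1 (@continuous_expR R)).
have c2 := contN c1.
exact: (continuous_compose c2 (@continuous_expR R)).
Qed.

Lemma cinv_line n nu (z : 'rV[R]_n) i t :
  cinv nu (z + t *: e_ i) = (\sum_(k | k != i) ch (nu * z 0 k) + ch (nu * (z 0 i + t)))^-1.
Proof.
rewrite /cinv (bigD1 i)//= addrC !mxE !eqxx mulr1; congr (_ + _)^-1.
by apply: eq_bigr => k ki; rewrite !mxE (negbTE ki) andbF mulr0 addr0.
Qed.

(* 1 / sum_i 2 cosh (nu y_i) is a supersolution: its Laplacian is at most
   nu^2 times itself. *)
Lemma comparison_le n (v W G : 'rV[R]_n -> R) (nu r M M' : R) : (0 < n)%N -> smooth v ->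
  (forall y, laplacian v y = W y * v y - G y) ->
  0 <= M -> 0 <= M' ->
  (forall y, `|G y| <= M * cinv nu y) ->
  (forall y, r < `|y| -> nu ^+ 2 + 1 <= W y) ->
  (forall y, `|y| <= r -> `|v y| <= M' * cinv nu y) ->
  (forall e, 0 < e -> exists rho, forall y, rho < `|y| -> `|v y| < e) ->
  forall y, v y <= (M + M' + 1) * cinv nu y.
Proof.
move=> n0 sv eq M0 M'0 hG hW hM hinf y1.
(* [M'] settles the region [|y| <= r], [M] absorbs the source [G] outside it, and the extra 1 makes
   both comparisons strict. *)
set A := M + M' + 1; rewrite leNgt; apply/negP; rewrite -subr_gt0 => e0.
have [rho hrho] := hinf _ e0.
pose rho' := Num.max rho `|y1|.
have cf : continuous (fun y => v y - A * cinv nu y).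
  apply: contB; first exact: smooth_cont.
  by apply: contM; [exact: cst_continuous|exact: continuous_cinv].
have A0 : 0 < A by rewrite /A; lra.
(* Beyond [rho] the function [v] is below the positive value reached at [y1], so the maximum over
   this cube is a global one. *)
have [|z _ hz] := @cont_max n _ (cube 0 rho') y1 (@compact_cube n 0 rho') _ cf.
  by rewrite /cube/= subr0 le_max lexx orbT.
have zmax w : v w - A * cinv nu w <= v z - A * cinv nu z.
  have [wr|wr] := leP `|w| rho'; first by apply: hz; rewrite /cube/= subr0.
  have h1 : v z - A * cinv nu z >= v y1 - A * cinv nu y1.
    by apply: hz; rewrite /cube/= subr0 le_max lexx orbT.
  apply: le_trans h1; have /hrho : rho < `|w| by apply: le_lt_trans wr; rewrite le_max lexx.
  have := mulr_gt0 A0 (cinv_gt0 nu w n0); have := ler_norm (v w).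
  by move: (v w) (`|_|) (_ * cinv nu w) (v y1 - _) => p q r' t; lra.
have zpos : 0 < v z - A * cinv nu z by apply: lt_le_trans e0 (zmax _).
have qp := cinv_gt0 nu z n0.
have zr : r < `|z|.
  rewrite ltNge; apply/negP => /hM; move: zpos; have := ler_norm (v z).
  by rewrite /A; move: (v z) (`|_|) (cinv nu z) qp => p q c; nra.
set q := cinv nu z in qp zpos.
have L i : partial i (partial i v) z <=
    A * (2 * q ^+ 3 * nu ^+ 2 * sh (nu * z 0 i) ^+ 2 - q ^+ 2 * nu ^+ 2 * ch (nu * z 0 i)).
  pose K := \sum_(k | k != i) ch (nu * z 0 k).
  pose c t := K + ch (nu * (z 0 i + t)).
  have K0 : 0 <= K by apply: sumr_ge0 => k _; exact/ltW/ch_gt0.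
  have c0 t : c t != 0 by rewrite gt_eqF// ltr_wpDl// ch_gt0.
  have dc t : is_derive t (1 : R) c (nu * sh (nu * (z 0 i + t))).
    apply: (is_derive_eq (is_deriveD (is_derive_cst K t (1 : R)) (is_derive_ch nu (z 0 i) t))).
    by rewrite add0r.
  have dq t : is_derive t (1 : R) (fun t => (c t)^-1) (- ((c t)^-1 ^+ 2) * (nu * sh (nu * (z 0 i + t)))).
    by apply: (is_derive_eq (is_deriveV (c0 t) (dc t))); rewrite exprVn.
  have dW t : is_derive t (1 : R) (fun t => A * (c t)^-1) (A * (- ((c t)^-1 ^+ 2) * (nu * sh (nu * (z 0 i + t))))).
    exact: (is_deriveZ A (dq t)).
  have dS t : is_derive t (1 : R) (fun t => nu * sh (nu * (z 0 i + t))) (nu * (nu * ch (nu * (z 0 i + t)))).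
    exact: (is_deriveZ nu (is_derive_sh nu (z 0 i) t)).
  have dW1 t := is_deriveZ A (is_deriveM (is_deriveN (is_deriveX 2 (dq t))) (dS t)).
  have q0 : (c 0)^-1 = q by have := cinv_line nu z i 0; rewrite line_at0.
  have := @partial2_le n v z i _ _ _ 1 0 0 sv dW (dW1 0) ltr01.
  rewrite q0 addr0 => h; apply: (@le_trans _ _ _ _ _ (h _)).
    move=> t _; rewrite !mul0r !addr0.
    by have := zmax (z + t *: e_ i); rewrite cinv_line.
  rewrite mulr0 addr0 -![_ *: _]/(_ * _).
  rewrite le_eqVlt; apply/orP; left; apply/eqP.
  by rewrite expr1 -[X in X * (nu * (nu * _))]/(- ((c 0)^-1 ^+ 2)) q0; ring.
have LL : laplacian v z <= A * (nu ^+ 2 * q).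
  apply: le_trans (ler_sum _ (fun i _ => L i)) _.
  rewrite -mulr_sumr ler_wpM2l ?(ltW A0)// sumrB -!mulr_sumr.
  set S := \sum_i ch _; set T := \sum_i sh _ ^+ 2.
  (* With [q * S = 1] this bounds the positive part of the sum by [2 nu^2 q], while the negative
     part is exactly [nu^2 q]. *)
  have TS : T <= S ^+ 2.
    apply: le_trans (sum_sqr_le (fun i => ltW (ch_gt0 _))).
    by apply: ler_sum => i _; exact: sh2_le.
  have Sq : q * S = 1 by rewrite /q /cinv mulVf// gt_eqF// sum_ch_gt0.
  have E1 : q ^+ 2 * nu ^+ 2 * S = nu ^+ 2 * q.
    by rewrite -[RHS]mulr1 -Sq; ring.
  have E2 : 2 * q ^+ 3 * nu ^+ 2 * T <= 2 * nu ^+ 2 * q.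
    have -> : 2 * nu ^+ 2 * q = 2 * q ^+ 3 * nu ^+ 2 * S ^+ 2.
      by rewrite -[LHS]mulr1 -[X in _ * X]mulr1 -{1}Sq -{1}Sq; ring.
    apply: ler_wpM2l => //; apply: mulr_ge0; last exact: sqr_ge0.
    by apply: mulr_ge0 => //; apply: exprn_ge0; exact: ltW.
  rewrite E1; clear -E2; lra.
rewrite eq in LL; have := hG z; have := hW z zr; rewrite -/q.
move: LL zpos; have := ler_norm (G z); have : 0 <= nu ^+ 2 by exact: sqr_ge0.
move: (W z) (v z) (G z) (`|_|) (nu ^+ 2) => w p g g' N N0 h1 h2 h3 h4 h5.
have p0 : 0 < p by apply: lt_trans (_ : A * q < p); rewrite ?mulr_gt0//; lra.
(* The surplus 1 in [nu^2 + 1 <= W] leaves [p <= M q] at the maximum, against [p > A q]. *)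
have : (N + 1) * p <= w * p by rewrite ler_wpM2r// ltW.
have : N * (A * q) <= N * p by rewrite ler_wpM2l//; lra.
have : M * q + q <= A * q by rewrite /A; nra.
by lra.
Qed.

Lemma partialN n (u : 'rV[R]_n -> R) i : deriv_along u i ->
  partial i (fun y => - u y) = (fun y => - partial i u y).
Proof. by move=> du; apply/funext => y; rewrite /partial [LHS]deriveN. Qed.

Lemma smoothN n (u : 'rV[R]_n -> R) : smooth u -> smooth (fun y => - u y).
Proof.
move=> su; under eq_fun do rewrite -mulN1r.
by apply: smoothM => //; exact: smooth_cst.
Qed.

Lemma laplacianN n (u : 'rV[R]_n -> R) y : smooth u -> laplacian (fun y => - u y) y = - laplacian u y.
Proof.
move=> su; rewrite /laplacian -sumrN; apply: eq_bigr => i _.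
rewrite partialN; last exact: smooth_deriv.
by rewrite partialN//; apply: smooth_deriv; exact: smooth_partial.
Qed.

Lemma comparison n (u W G : 'rV[R]_n -> R) (nu r M M' : R) : (0 < n)%N -> smooth u ->
  (forall y, laplacian u y = W y * u y - G y) ->
  0 <= M -> 0 <= M' ->
  (forall y, `|G y| <= M * cinv nu y) ->
  (forall y, r < `|y| -> nu ^+ 2 + 1 <= W y) ->
  (forall y, `|y| <= r -> `|u y| <= M' * cinv nu y) ->
  (forall e, 0 < e -> exists rho, forall y, rho < `|y| -> `|u y| < e) ->
  forall y, `|u y| <= (M + M' + 1) * cinv nu y.
Proof.
move=> n0 su eq M0 M'0 hG hW hM hinf y; rewrite ler_norml lerNl; apply/andP; split.
  apply: (@comparison_le n (fun y => - u y) W (fun y => - G y) nu r) => //; first exact: smoothN.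
  - by move=> z; rewrite laplacianN// eq opprB opprK mulrN addrC.
  - by move=> z; rewrite normrN.
  - by move=> z; rewrite normrN; exact: hM.
  - by move=> e /hinf[rho h]; exists rho => z; rewrite normrN; exact: h.
exact: (@comparison_le n u W G nu r).
Qed.

End maximum_principle.

Lemma quad_ineq (R : realType) (b u1 u2 u3 u4 a t c : R) :
  2^-1 * (u1 - u2) - (b + a * t + c * t ^+ 2) <= 2^-1 * (u3 - u4) - b ->
  u1 - u2 <= u3 - u4 + 2 * a * t + 2 * c * t ^+ 2.
Proof. lra. Qed.

Lemma gap_ineq (R : realType) (p q M : R) : - p < M -> q < M -> p - q <= - (2 * M) -> False.
Proof. lra. Qed.

(** * Interior gradient estimate and local sup bound *)

Section gradient_estimate.
Context {R : realType}.

Lemma cont_rV (T : topologicalType) n (f : T -> 'rV[R]_n) :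
  (forall j, continuous (fun y => f y 0 j)) -> continuous f.
Proof.
move=> h x; apply/cvgrPdist_le => e e0.
have H : \forall y \near x, forall j, `|f x 0 j - f y 0 j| <= e.
  by apply: filter_forall => j; have /cvgrPdist_le/(_ e e0) := h j x.
apply: filterS H => y hy; apply: rV_norm_le; first exact: ltW.
by move=> j; rewrite !mxE; exact: hy.
Qed.

Lemma cube_line n (y0 z : 'rV[R]_n) i d t :
  (forall k, `|z 0 k - y0 0 k| < d) -> `|t| <= d - `|z 0 i - y0 0 i| -> 0 <= d ->
  cube y0 d (z + t *: e_ i).
Proof.
move=> hz ht d0; rewrite /cube/=; apply: rV_norm_le => // k; rewrite !mxE eqxx/=.
case: eqVneq => [->|_]; last by rewrite mulr0 addr0 ltW.
rewrite mulr1 addrAC; apply: le_trans (ler_normD _ _) _; move: ht.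
by move: (`|_|) (`|_|) => p q; lra.
Qed.

Lemma cubeE n (y0 z : 'rV[R]_n) d : 0 <= d -> cube y0 d z <-> forall k, `|z 0 k - y0 0 k| <= d.
Proof.
move=> d0; rewrite /cube/=; split => h.
  by move=> k; have := coord_le_norm (z - y0) k; rewrite !mxE => /le_trans; apply.
by apply: rV_norm_le => // k; rewrite !mxE; exact: h.
Qed.

Section halfcube.
Variables (n : nat) (u : 'rV[R]_n -> R) (y0 : 'rV[R]_n) (i : 'I_n) (d A N : R).
Hypotheses (su : smooth u) (d0 : 0 < d).
Hypothesis hA : forall y, cube y0 d y -> `|u y| <= A.
Hypothesis hN : forall y, cube y0 d y -> `|laplacian u y| < N.

Let tau (y : 'rV[R]_n) := y 0 i - y0 0 i.
Let rho (y : 'rV[R]_n) := y - (2 * tau y) *: e_ i.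
(** The coefficients make the Laplacian of [bar] equal to [- N], keep it nonnegative for
    [0 <= tau y <= d], and make it at least [A] on the outer faces of the half cube. [rho] is the
    reflection in the face [tau y = 0]. *)
Let bar (y : 'rV[R]_n) := A / d ^+ 2 * (\sum_(k | k != i) (y 0 k - y0 0 k) ^+ 2
    + tau y * (n%:R * d - (n%:R - 1) * tau y)) + N / 2 * (tau y * (d - tau y)).
Let Phi (y : 'rV[R]_n) := 2^-1 * (u y - u (rho y)) - bar y.

Let A0 : 0 <= A.
Proof. by apply: le_trans (normr_ge0 _) (hA (y := y0) _); rewrite /cube/= subrr normr0 ltW. Qed.

Let N0 : 0 < N.
Proof. by apply: le_lt_trans (normr_ge0 _) (hN (y := y0) _); rewrite /cube/= subrr normr0 ltW. Qed.

Let n1 : 1 <= n%:R :> R.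
Proof. by rewrite ler1n; apply: leq_trans (ltn_ord i). Qed.

Let rho_cube y : cube y0 d y -> cube y0 d (rho y).
Proof.
move=> /(cubeE y0 y (ltW d0)) h; apply/(cubeE _ _ (ltW d0)) => k; rewrite !mxE eqxx/=.
case: eqVneq => [->|_]; last by rewrite mulr0 subr0.
by rewrite mulr1 /tau (_ : _ - _ - _ = - (y 0 i - y0 0 i)) ?normrN//; ring.
Qed.

Let cont_coordB k : continuous (fun y : 'rV[R]_n => y 0 k - y0 0 k).
Proof. by apply: contB; [exact: coord_cont|exact: cst_continuous]. Qed.

Let cont_Phi : continuous Phi.
Proof.
have cc (c : R) : continuous (fun _ : 'rV[R]_n => c) by exact: cst_continuous.
have ct : continuous tau by exact: cont_coordB.
have cu := smooth_cont su.
have cr : continuous rho.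
  apply: cont_rV => j.
  rewrite (_ : (fun y : 'rV[R]_n => rho y 0 j) = (fun y : 'rV[R]_n => y 0 j - 2 * tau y * (e_ i : 'rV[R]_n) 0 j)); last first.
    by apply/funext => y; rewrite !mxE.
  apply: contB; first exact: coord_cont.
  by apply: contM => //; exact: contM.
apply: contB.
  apply: contM => //; apply: contB => //.
  exact: (continuous_compose cr cu).
apply: contD; last by apply: contM => //; apply: contM => //; exact: contB.
apply: contM => //; apply: contD; last first.
  by apply: contM => //; apply: contB => //; exact: contM.
under eq_fun do rewrite big_mkcond.
apply: continuous_sum_fun => k; case: (k != i); last exact: cc.
under eq_fun do rewrite expr2.
by apply: contM; exact: cont_coordB.
Qed.

Let bar_line_ne z k t : k != i ->
  bar (z + t *: e_ k) = bar z + 2 * (A / d ^+ 2) * (z 0 k - y0 0 k) * t + A / d ^+ 2 * t ^+ 2.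
Proof.
move=> ki; have Et : tau (z + t *: e_ k) = tau z.
  by rewrite /tau !mxE eq_sym (negbTE ki) andbF mulr0 addr0.
rewrite /bar Et (bigD1 k)//= [in RHS](bigD1 k)//= !mxE !eqxx mulr1.
have -> : \sum_(j | (j != i) && (j != k)) ((z + t *: e_ k) 0 j - y0 0 j) ^+ 2 =
    \sum_(j | (j != i) && (j != k)) (z 0 j - y0 0 j) ^+ 2.
  by apply: eq_bigr => j /andP[_ jk]; rewrite !mxE (negbTE jk) andbF mulr0 addr0.
by move: (\sum_(_ | _) _) (z 0 k) (tau z) => p q r; ring.
Qed.

Let bar_line_i z : exists a, forall t,
  bar (z + t *: e_ i) = bar z + a * t + (- (A / d ^+ 2 * (n%:R - 1)) - N / 2) * t ^+ 2.
Proof.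
exists (A / d ^+ 2 * (n%:R * d - 2 * (n%:R - 1) * tau z) + N / 2 * (d - 2 * tau z)) => t.
have Et : tau (z + t *: e_ i) = tau z + t by rewrite /tau !mxE !eqxx mulr1 addrAC.
rewrite /bar Et.
have -> : \sum_(j | j != i) ((z + t *: e_ i) 0 j - y0 0 j) ^+ 2 =
    \sum_(j | j != i) (z 0 j - y0 0 j) ^+ 2.
  by apply: eq_bigr => j jk; rewrite !mxE (negbTE jk) andbF mulr0 addr0.
by move: (\sum_(_ | _) _) (tau z) => p q; ring.
Qed.

(** A positive maximum of [Phi] cannot lie on the boundary: [bar] dominates on the outer faces and
    the antisymmetrized [u] vanishes where [tau] does. It cannot be interior either, since there the
    strict bound [hN] makes the Laplacian of [Phi] positive. *)
Lemma halfcube_barrier y : cube y0 d y -> 0 <= tau y -> Phi y <= 0.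
Proof.
pose H : set 'rV[R]_n := cube y0 d `&` [set y | 0 <= tau y].
have cH : compact H.
  apply: (@closed_bounded_compact R _ y0 d); last by move=> z [].
  apply: closedI; first exact: closed_cube.
  rewrite (_ : [set y | _] = tau @^-1` `[0, +oo[); last by apply/seteqP; split => z /=; rewrite in_itv/= andbT.
  by apply: preimage_closed; [move=> z _; exact: cont_coordB|exact: interval_closed].
move=> hy ty; have [|z [zc zt] hz] := @cont_max R n Phi H y cH _ cont_Phi; first by split.
apply: le_trans (hz y _) _; first by split.
rewrite leNgt; apply/negP => P0.
have zc' := (cubeE y0 z (ltW d0)).1 zc.
have Uz : 2^-1 * (u z - u (rho z)) <= A.
  have := hA zc; have := hA (rho_cube zc); rewrite !ler_norml => /andP[h1 h2] /andP[h3 h4].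
  by move: h1 h2 h3 h4; move: (u z) (u (rho z)) => p q; lra.
have sum0 : 0 <= \sum_(k | k != i) (z 0 k - y0 0 k) ^+ 2 by apply: sumr_ge0 => k _; exact: sqr_ge0.
have td : tau z <= d by have := zc' i; rewrite ler_norml => /andP[].
have d20 : 0 < d ^+ 2 by rewrite exprn_gt0.
have Ad : 0 <= A / d ^+ 2 by rewrite divr_ge0// ltW.
have tt : 0 <= tau z * (n%:R * d - (n%:R - 1) * tau z).
  by rewrite mulr_ge0//; move: zt td n1 d0; rewrite /=; move: (tau z) (n%:R : R) => p q; nra.
have t2 : 0 <= N / 2 * (tau z * (d - tau z)).
  apply: mulr_ge0; first by apply: divr_ge0 => //; exact: ltW.
  by apply: mulr_ge0 => //; rewrite subr_ge0.
have zin k : `|z 0 k - y0 0 k| < d.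
  rewrite lt_neqAle zc' andbT; apply/eqP => zk.
  have zk2 : (z 0 k - y0 0 k) ^+ 2 = d ^+ 2 by rewrite -real_normK ?num_real// zk.
  move: P0; apply/negP; rewrite -leNgt /Phi subr_le0; apply: le_trans Uz _.
  have bA : A <= A / d ^+ 2 * (\sum_(k | k != i) (z 0 k - y0 0 k) ^+ 2 + tau z * (n%:R * d - (n%:R - 1) * tau z)).
    rewrite -[leLHS](@divfK _ (d ^+ 2)) ?gt_eqF//.
    rewrite ler_wpM2l//.
    have [ki|ki] := eqVneq k i.
      have tzd : tau z = d.
        by move: zk; rewrite ki ger0_norm.
      rewrite tzd; rewrite -[leLHS]add0r lerD//.
      by rewrite le_eqVlt; apply/orP; left; apply/eqP; ring.
    rewrite (bigD1 k)//= zk2 -addrA lerDl addr_ge0//.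
    by apply: sumr_ge0 => j _; exact: sqr_ge0.
  by apply: le_trans bA _; rewrite lerDl.
have tz0 : 0 < tau z.
  rewrite lt_neqAle zt andbT eq_sym; apply/eqP => tz.
  move: P0; rewrite /Phi /rho tz mulr0 scale0r subr0 subrr mulr0 sub0r oppr_gt0.
  by apply/negP; rewrite -leNgt /bar addr_ge0// mulr_ge0// addr_ge0.
(* [z] is interior, so [Phi] has a local maximum there along every axis. *)
have [e [e0 he]] : exists e : R, 0 < e /\ forall k t, `|t| < e -> Phi (z + t *: e_ k) <= Phi z.
  pose e := Num.min (tau z) (\big[Num.min/d]_k (d - `|z 0 k - y0 0 k|)).
  have e0 : 0 < e.
    rewrite lt_min tz0/=; elim/big_ind: _ => // [a b a0 b0|k _]; first by rewrite lt_min a0.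
    by rewrite subr_gt0.
  exists e; split => // k t te; apply: hz; split.
    apply: cube_line => //; last exact: ltW.
    apply: ltW; apply: lt_le_trans te _; rewrite /e ge_min; apply/orP; right.
    exact: (bigmin_le _ k).
  rewrite /= /tau !mxE eqxx/=; case: eqVneq => [_|_]; last by rewrite mulr0 addr0.
  rewrite mulr1; have : `|t| < tau z by apply: lt_le_trans te _; rewrite ge_min lexx.
  by rewrite ltr_norml /tau => /andP[h1 h2]; move: h1; move: (z 0 i) (y0 0 i) => p q; lra.
have zr := rho_cube zc.
have D k : partial k (partial k u) z - partial k (partial k u) (rho z) <=
    2 * (2 * (if k == i then - (A / d ^+ 2 * (n%:R - 1)) - N / 2 else A / d ^+ 2)).
  have dl t := partial_line z t (smooth_deriv (i := k) su).
  have dl2 := partial_line z 0 (smooth_deriv (i := k) (smooth_partial k su)).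
  rewrite line_at0 in dl2.
  case: eqVneq => [ki|ki].
    subst k; have [a ha] := bar_line_i z.
    have rl t : rho (z + t *: e_ i) = rho z + (- t) *: e_ i.
      rewrite /rho /tau !mxE !eqxx mulr1 scaleNr.
      have -> : 2 * (z 0 i + t - y0 0 i) = 2 * (z 0 i - y0 0 i) + t + t by ring.
      rewrite !scalerDl; move: ((2 * _) *: _) (t *: _) => p q.
      by rewrite !opprD !addrA [z + q - p]addrAC addrK.
    have dr t : is_derive t (1 : R) (fun t => u (rho z + (- t) *: e_ i)) (partial i u (rho z + (- t) *: e_ i) * -1).
      exact: (@is_derive1_comp R (fun t => u (rho z + t *: e_ i)) (fun t => - t) t _ _ (partial_line _ _ (smooth_deriv (i := i) su))).
    have dr2 : is_derive (0 : R) (1 : R) (fun t => partial i u (rho z + (- t) *: e_ i) * -1) (partial i (partial i u) (rho z)).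
      have h := @is_derive1_comp R (fun t => partial i u (rho z + t *: e_ i)) (fun t => - t) 0 _ _ (partial_line _ _ (smooth_deriv (i := i) (smooth_partial i su))) (is_deriveNid _ _).
      have h2 := is_deriveM h (is_derive_cst (-1 : R) (0 : R) (1 : R)).
      by apply: (is_derive_eq h2); rewrite oppr0 line_at0 scaler0 add0r /= -![_ *: _]/(_ * _); ring.
    rewrite mulrA.
    have HS := @second_derivative_le R _ _ _ (2 * a) (2 * (- (A / d ^+ 2 * (n%:R - 1)) - N / 2)) e
      (fun t => is_deriveB (dl t) (dr t)) (is_deriveB dl2 dr2) e0.
    rewrite -mulrA; apply: HS => t te /=; have := he i t te.
    rewrite !fctE line_at0 oppr0 line_at0 /Phi rl.
    by rewrite ha; exact: quad_ineq.
  have rl t : rho (z + t *: e_ k) = rho z + t *: e_ k.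
    by rewrite /rho /tau !mxE eq_sym (negbTE ki) andbF mulr0 addr0 addrAC.
  have dr t := partial_line (rho z) t (smooth_deriv (i := k) su).
  have dr2 := partial_line (rho z) 0 (smooth_deriv (i := k) (smooth_partial k su)).
  rewrite line_at0 in dr2.
  have HS := @second_derivative_le R _ _ _ (2 * (2 * (A / d ^+ 2) * (z 0 k - y0 0 k))) (2 * (A / d ^+ 2)) e
      (fun t => is_deriveB (dl t) (dr t)) (is_deriveB dl2 dr2) e0.
  apply: HS => t te /=; have := he k t te.
  rewrite !fctE !line_at0 /Phi rl bar_line_ne//.
  exact: quad_ineq.
(* The terms in [A] cancel between the [n - 1] tangential directions and the normal one; what
   remains contradicts the strict bounds at [z] and [rho z]. *)
have : laplacian u z - laplacian u (rho z) <= - (2 * N).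
  rewrite /laplacian -sumrB; apply: le_trans (ler_sum _ (fun k _ => D k)) _.
  rewrite -!mulr_sumr (bigD1 i)//= eqxx.
  rewrite (eq_bigr (fun _ => A / d ^+ 2)); last by move=> k /negbTE ->.
  rewrite sumr_const.
  have -> : #|[pred k | k != i]| = n.-1 by rewrite cardC1 card_ord.
  have -> : A / d ^+ 2 *+ n.-1 = A / d ^+ 2 * (n%:R - 1).
    rewrite -[LHS]mulr_natr; congr (_ * _).
    by rewrite -[n in RHS](prednK (leq_ltn_trans (leq0n i) (ltn_ord i))) -natr1 addrK.
  rewrite le_eqVlt; apply/orP; left; apply/eqP; field; rewrite gt_eqF//.
have [h1 _] := ltr_normlP _ _ (hN zc); have [_ h2] := ltr_normlP _ _ (hN zr).
exact: (gap_ineq h1 h2).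
Qed.

Lemma halfcube_diff t : 0 <= t <= d ->
  u (y0 + t *: e_ i) - u (y0 + (- t) *: e_ i) <= 2 * t * (n%:R / d * A + d / 2 * N).
Proof.
move=> /andP[t0 td].
have Et : tau (y0 + t *: e_ i) = t by rewrite /tau !mxE !eqxx mulr1 addrAC subrr add0r.
have hc : cube y0 d (y0 + t *: e_ i).
  apply: cube_line => [k|//|]; last exact: ltW.
    by rewrite subrr normr0.
  by rewrite subrr normr0 subr0 ger0_norm.
have := halfcube_barrier hc; rewrite Et => /(_ t0); rewrite /Phi /rho Et.
have -> : y0 + t *: e_ i - (2 * t) *: e_ i = y0 + (- t) *: e_ i.
  by rewrite -addrA -scalerBl; congr (_ + _ *: _); ring.
rewrite /bar Et big1 ?add0r; last first.
  by move=> k ki; rewrite !mxE (negbTE ki) andbF mulr0 addr0 subrr expr0n.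
rewrite subr_le0 mulrC ler_pdivrMr// => h; apply: le_trans h _.
have X : A / d ^+ 2 * (t * (n%:R * d - (n%:R - 1) * t)) <= t * (n%:R / d * A).
  have -> : t * (n%:R / d * A) = A / d ^+ 2 * (t * (n%:R * d)).
    by field; rewrite gt_eqF.
  apply: ler_wpM2l; first by apply: divr_ge0 => //; apply: exprn_ge0; exact: ltW.
  by apply: ler_wpM2l => //; rewrite gerBl mulr_ge0// subr_ge0.
have Y : N / 2 * (t * (d - t)) <= t * (d / 2 * N).
  have -> : t * (d / 2 * N) = N / 2 * (t * d) by ring.
  apply: ler_wpM2l; first by apply: divr_ge0 => //; exact: ltW.
  by apply: ler_wpM2l => //; rewrite gerBl.
have := lerD X Y; rewrite -mulrDr => h.
by rewrite [leRHS](_ : _ = t * (n%:R / d * A + d / 2 * N) * 2) ?ler_wpM2r//; ring.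
Qed.

End halfcube.

(* Comparison on half of the cube, for the antisymmetrization of u in y_i, with a
   quadratic barrier (Gilbarg-Trudinger, section 3.4). *)
Lemma gradient_le n (u : 'rV[R]_n -> R) y0 i (d A N : R) : smooth u -> 0 < d ->
  (forall y, cube y0 d y -> `|u y| <= A) ->
  (forall y, cube y0 d y -> `|laplacian u y| <= N) ->
  partial i u y0 <= n%:R / d * A + d / 2 * N.
Proof.
move=> su d0 hA hN; rewrite leNgt; apply/negP; set B := _ + _ => h.
(* The barrier asks for a strict bound on the Laplacian, so [N] is enlarged by [e]; with this choice
   [B'] is the midpoint between [B] and the derivative. *)
pose e := (partial i u y0 - B) / d.
have e0 : 0 < e by rewrite divr_gt0// subr_gt0.
pose B' := n%:R / d * A + d / 2 * (N + e).
have B'E : B' = (partial i u y0 + B) / 2.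
  by rewrite /B' /e /B; field; rewrite gt_eqF.
have B'lt : B' < partial i u y0.
  by rewrite B'E addrC; have [_] := midf_lt h.
have cdu : continuous (partial i u) by exact: smooth_cont (smooth_partial i su).
have := cdu y0; move=> /cvgrPdist_lt/(_ (partial i u y0 - B')); rewrite subr_gt0 => /(_ B'lt).
move=> /nbhs_ballP[r /= r0 hr].
pose t := Num.min (r / 2) d.
have t0 : 0 < t by rewrite lt_min d0 divr_gt0.
have td : t <= d by rewrite ge_min lexx orbT.
have tr : t < r by apply: (@le_lt_trans _ _ (r / 2)); [rewrite ge_min lexx|lra].
have hN' y : cube y0 d y -> `|laplacian u y| < N + e.
  by move=> /hN H; apply: le_lt_trans H _; rewrite ltrDl.
have := @halfcube_diff n u y0 i d A (N + e) su d0 hA hN' t.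
rewrite (ltW t0) td => /(_ isT).
have [th /andP[th0 th1] ->] := mvt (- t) t (fun s => partial_line y0 s (smooth_deriv (i := i) su)).
set z := y0 + _ *: e_ i.
rewrite -/B' opprK (_ : t + t = 2 * t); last by ring.
rewrite [leRHS]mulrC ler_pM2r ?mulr_gt0//.
apply/negP; rewrite -ltNge.
have : ball y0 r z.
  rewrite mx_norm_ball /ball_/= /z opprD addNKr normrN.
  apply: le_lt_trans (norm_line _ _) _; apply: le_lt_trans tr.
  rewrite opprK ler_norml; apply/andP; split.
    by move: th0 t0; clear; nra.
  by move: th1 t0; clear; nra.
move=> /hr; move: (partial i u z) => p; move: (partial i u y0) => q.
rewrite ltr_norml => /andP[_]; clear; lra.
Qed.

Lemma gradient_bound n (u : 'rV[R]_n -> R) y0 i (d A N : R) : smooth u -> 0 < d ->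
  (forall y, cube y0 d y -> `|u y| <= A) ->
  (forall y, cube y0 d y -> `|laplacian u y| <= N) ->
  `|partial i u y0| <= n%:R / d * A + d / 2 * N.
Proof.
move=> su d0 hA hN; rewrite ler_norml lerNl; apply/andP; split; last exact: gradient_le.
have := @gradient_le n (fun y => - u y) y0 i d A N (smoothN su) d0.
rewrite partialN; last exact: smooth_deriv.
apply => y hy; first by rewrite normrN hA.
by rewrite laplacianN// normrN hN.
Qed.

Lemma integralR_cube_ge n (f : 'rV[R]_n -> R) (y : 'rV[R]_n) (r c : R) : dom f -> (forall z, 0 <= f z) ->
  0 <= r -> 0 <= c -> (forall z, cube y r z -> c <= f z) ->
  c * (2 * r) ^+ n <= integralR f.
Proof.
move=> df f0 r0 c0 h; rewrite -lee_fin integralRE// EFinM -(lebesgue_rV_cube y r0).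
have mf : measurable_fun setT f by apply: continuous_rV_measurable; case: df.
rewrite -(@integral_cst _ _ _ (lebesgue_rV n) (cube y r) (@cube_measurable R n y r)).
apply: (@le_trans _ _ (\int[lebesgue_rV n]_(z in cube y r) (f z)%:E)%E).
  apply: ge0_le_integral => //; first exact: cube_measurable.
  - apply/measurable_EFinP; exact: measurable_funS mf.
apply: ge0_subset_integral => //; first exact: cube_measurable.
- exact/measurable_EFinP.
- by move=> z _; rewrite lee_fin.
Qed.

(* The weight (1 - |y - y0|)^n.+1 makes a supremum of |u| attained; near the
   point where it is attained the gradient bound keeps |u| above half its
   value on a cube whose volume pays for the weight. *)
Lemma local_sup_bound n (K : R) : 0 <= K -> exists2 C, 0 <= C &
  forall (u : 'rV[R]_n -> R) y0 F, fast u -> 0 <= F ->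
    (forall y, cube y0 1 y -> `|laplacian u y| <= K * `|u y| + F) ->
    u y0 ^+ 2 <= C * (integralR (fun y => u y ^+ 2) + F ^+ 2).
Proof.
move=> K0.
(* On the cube of radius half of [w y1] the weight at least halves, which costs [T]. [L] is the
   resulting gradient constant, and [P] is so large that over the radius [r / P] the value of [|u|]
   drops by at most half. *)
pose T : R := 2 ^+ n.+1.
have T0 : 0 <= T by exact: exprn_ge0.
pose L := 2 * n%:R * T + (K * T + 1).
have n0 := ler0n R n.
have L0 : 0 <= L by rewrite /L; nra.
pose P := 2 * n%:R * L + 2.
have P0 : 2 <= P by rewrite /P; nra.
have Pn0 : 0 <= P ^+ n by apply: exprn_ge0; lra.
pose C := 4 * P ^+ n + 1.
have C0 : 0 <= C by rewrite /C; lra.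
exists C => // u y0 F fu F0 hL.
have su := fast_smooth fu; have cu := smooth_cont su.
have I0 : 0 <= integralR (fun y => u y ^+ 2) by apply: integralR_ge0 => y; exact: sqr_ge0.
have S0 : 0 <= integralR (fun y => u y ^+ 2) + F ^+ 2 by apply: addr_ge0 => //; exact: sqr_ge0.
pose w (y : 'rV[R]_n) := 1 - `|y - y0|.
have cw : continuous w.
  apply: contB; first exact: cst_continuous.
  move=> y; apply: continuous_comp; last exact: norm_continuous.
  by apply: (@continuousB _ _ _ (fun y => y)) => //; exact: cst_continuous.
have cphi : continuous (fun y => w y ^+ n.+1 * `|u y|).
  apply: contM; last exact: (continuous_compose cu (@norm_continuous _ _)).
  exact: (continuous_compose cw (@exprn_continuous _ _)).
have [|y1 c1 hm] := @cont_max R n _ (cube y0 1) y0 (@compact_cube R n y0 1) _ cphi.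
  by rewrite /cube/= subrr normr0.
have w0 : w y0 = 1 by rewrite /w subrr normr0 subr0.
have h00 : `|u y0| <= w y1 ^+ n.+1 * `|u y1|.
  by have := hm y0; rewrite w0 expr1n mul1r; apply; rewrite /cube/= subrr normr0.
have w10 : 0 <= w y1 by rewrite /w subr_ge0; exact: c1.
have w11 : w y1 <= 1 by rewrite /w gerBl.
set m := `|u y1| in h00.
have m0 : 0 <= m by exact: normr_ge0.
(* Of the weight [w^(2n+2)] only [w^n] is kept: it matches the volume of the cube of radius [rho],
   which is proportional to [w y1 ^+ n]. *)
have u2 : u y0 ^+ 2 <= w y1 ^+ n * m ^+ 2.
  rewrite -real_normK ?num_real//; apply: (@le_trans _ _ ((w y1 ^+ n.+1 * m) ^+ 2)).
    by rewrite ler_pXn2r// nnegrE//; apply: mulr_ge0 => //; exact: exprn_ge0.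
  rewrite exprMn; apply: ler_wpM2r; first exact: sqr_ge0.
  rewrite -exprM (_ : n.+1 * 2 = n + n.+2)%N; last by rewrite mulnC mul2n -addnn addSnnS.
  by rewrite exprD ler_piMr ?exprn_ge0// exprn_ile1.
(* If [|u|] is at most [F] at [y1], the term [F ^+ 2] suffices; otherwise [F] is absorbed into the
   coefficient [K * T + 1] of [m]. *)
have [mF|Fm] := lerP m F.
  apply: le_trans u2 _; apply: (@le_trans _ _ (1 * F ^+ 2)).
    apply: ler_pM; [exact: exprn_ge0|exact: sqr_ge0|exact: exprn_ile1|].
    by rewrite ler_pXn2r// nnegrE.
  apply: ler_pM; [by []|exact: sqr_ge0|by rewrite /C; lra|].
  by rewrite lerDr.
have mp : 0 < m by exact: le_lt_trans Fm.
have [w1z|wp] := eqVneq (w y1) 0.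
  move: h00; rewrite w1z expr0n/= mul0r normr_le0 => /eqP ->.
  by rewrite expr0n/= mulr_ge0.
have {wp} : 0 < w y1 by rewrite lt_neqAle eq_sym wp.
pose r := w y1 / 2.
move=> wp; have r0 : 0 < r by rewrite divr_gt0.
have w2r : w y1 = 2 * r by rewrite /r; field.
have r1 : 2 * r <= 1 by rewrite -w2r.
have wr y : cube y1 r y -> r <= w y.
  rewrite /cube/= => h; have := ler_distD y1 y y0; move: h w2r; rewrite /w.
  by move: (`|y - y1|) (`|y1 - y0|) (`|y - y0|) => a b c; clear; lra.
have wc y : 0 <= w y -> cube y0 1 y by rewrite /w /cube/= subr_ge0.
have uT y : cube y1 r y -> `|u y| <= T * m.
  move=> hy; have ry := wr _ hy.
  have h1 := hm y (wc y (le_trans (ltW r0) ry)).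
  have h2 : r ^+ n.+1 * `|u y| <= w y ^+ n.+1 * `|u y|.
    by apply: ler_wpM2r => //; rewrite ler_pXn2r// nnegrE ltW// (lt_le_trans r0).
  have h3 := le_trans h2 h1.
  have E : w y1 ^+ n.+1 * `|u y1| = r ^+ n.+1 * (T * m) by rewrite w2r exprMn /T /m; ring.
  rewrite E in h3; rewrite -(ler_pM2l (_ : 0 < r ^+ n.+1))//.
  exact: exprn_gt0.
have Dm y i : cube y1 (r / 2) y -> `|partial i u y| <= L * m / r.
  move=> hy; have sub z : cube y (r / 2) z -> cube y1 r z.
    move: hy; rewrite /cube/= => h1 h2; have := ler_distD y z y1; move: h1 h2.
    by move: (`|y - y1|) (`|z - y|) (`|z - y1|) => a b c; clear; lra.
  have r20 : 0 < r / 2 by rewrite divr_gt0.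
  have := @gradient_bound n u y i (r / 2) (T * m) ((K * T + 1) * m) su r20 (fun z hz => uT z (sub z hz)).
  move=> h; apply: le_trans (h _) _ => [z /sub hz|].
    apply: le_trans (hL z (wc _ (le_trans (ltW r0) (wr _ hz)))) _.
    have := ler_wpM2l K0 (uT z hz); move: (K * `|u z|) => p; move: Fm; clear; nra.
  rewrite ler_pdivlMr//.
  have -> : (n%:R / (r / 2) * (T * m) + r / 2 / 2 * ((K * T + 1) * m)) * r =
     2 * n%:R * T * m + (r * r / 4) * ((K * T + 1) * m) by field; rewrite gt_eqF.
  have KT : 0 <= (K * T + 1) * m by apply: mulr_ge0 => //; apply: addr_ge0 => //; exact: mulr_ge0.
  have rr : r * r / 4 <= 1 by move: r0 r1; clear; nra.
  rewrite /L; have := ler_wpM2r KT rr; move: (_ * ((K * T + 1) * m)) => p; clear; lra.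
pose rho := r / P.
have Pp : 0 < P by apply: lt_le_trans P0.
have rho0 : 0 < rho by rewrite divr_gt0.
have rhoP : rho * P = r by rewrite /rho divfK// gt_eqF.
have rho2 : rho <= r / 2 by move: rhoP rho0 P0; clear; nra.
have um y : cube y1 rho y -> m / 2 <= `|u y|.
  move=> hy; pose v := y - y1.
  have hv i : `|v 0 i| <= rho by apply: le_trans (coord_le_norm v i) hy.
  have dd (t : R) : is_derive t (1 : R) (fun t => u (y1 + t *: v)) (\sum_i v 0 i * partial i u (y1 + t *: v)).
    have [d1 d2] := is_derive_directional (y1 + t *: v) v (fun i => smooth_deriv (i := i) su) (fun i => smooth_cont (smooth_partial i su)).
    by apply: (is_derive_eq (is_derive_line d1)).
  have E1 : y1 + (1 : R) *: v = y by rewrite scale1r /v addrC subrK.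
  have E0 : y1 + (0 : R) *: v = y1 by rewrite scale0r addr0.
  suff H : forall th : R, 0 <= th <= 1 ->
      `|\sum_i v 0 i * partial i u (y1 + (0 + th * (1 - 0)) *: v)| <= m / 2.
    have /= := @mvt_le R _ _ 0 1 (m / 2) dd H; rewrite E1 E0 subr0 normr1 mulr1.
    have := ler_distD (u y) (u y1) 0; rewrite !subr0 -/m (distrC (u y1)).
    by move: (`|u y - u y1|) (`|u y|) => a b; clear; lra.
  move=> th /andP[th0 th1]; rewrite add0r subr0 mulr1.
  apply: le_trans (ler_norm_sum _ _ _) _.
  apply: (@le_trans _ _ (\sum_(i < n) rho * (L * m / r))).
    apply: ler_sum => i _; rewrite normrM; apply: ler_pM => //.
    apply: Dm; rewrite /cube/= addrAC subrr add0r mx_normZ ger0_norm//.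
    by apply: le_trans rho2; apply: le_trans hy; rewrite -/v; rewrite ler_piMl.
  rewrite sumr_const card_ord -[leLHS]mulr_natr.
  have -> : rho * (L * m / r) * n%:R = (n%:R * L) * m / P.
    by rewrite /rho; field; rewrite !gt_eqF.
  rewrite ler_pdivrMr// /P -[2 * _ * L]mulrA; move: mp (mulr_ge0 n0 L0).
  by move: (n%:R * L) (m) => q c; clear; nra.
have big : (m / 2) ^+ 2 * (2 * rho) ^+ n <= integralR (fun y => u y ^+ 2).
  have fd : dom (fun y => u y ^+ 2).
    by apply: fast_dom; under eq_fun do rewrite expr2; exact: fast_MM.
  apply: (@integralR_cube_ge n (fun y => u y ^+ 2) y1 rho) => //.
  - by move=> z; exact: sqr_ge0.
  - exact: ltW.
  - exact: sqr_ge0.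
  - move=> z /um h; rewrite -[leRHS]real_normK ?num_real//.
    by rewrite ler_pXn2r// nnegrE divr_ge0.
apply: le_trans u2 _.
have -> : w y1 ^+ n * m ^+ 2 = 4 * P ^+ n * ((m / 2) ^+ 2 * (2 * rho) ^+ n).
  have -> : w y1 = P * (2 * rho) by rewrite w2r -rhoP; ring.
  by rewrite exprMn; field.
apply: ler_pM; [by apply: mulr_ge0|by apply: mulr_ge0; [exact: sqr_ge0|apply: exprn_ge0; apply: mulr_ge0 => //; exact: ltW]|by rewrite /C lerDl|].
by apply: le_trans big _; rewrite lerDl; exact: sqr_ge0.
Qed.

End gradient_estimate.

Section real_continuity.
Context {R : realType} (T : topologicalType).
Implicit Types f g : T -> R.

Lemma rcontD f g : continuous f -> continuous g -> continuous (fun x => f x + g x).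
Proof. by move=> cf cg x; apply: cvgD; [exact: cf|exact: cg]. Qed.

Lemma rcontM f g : continuous f -> continuous g -> continuous (fun x => f x * g x).
Proof. by move=> cf cg x; apply: cvgM; [exact: cf|exact: cg]. Qed.

Lemma rcont_cst (c : R) : continuous (fun _ : T => c).
Proof. exact: cst_continuous. Qed.

End real_continuity.

(** * Poincare inequality on a cube *)

Section cube_poincare.
Context {R : realType}.
Notation mu1 := (@lebesgue_measure R).
Variable r : R.
Hypothesis r0 : 0 < r.

Let I : set R := `[- r, r]%classic.
Let Q n : set 'rV[R]_n := cube 0 r.
Local Arguments Q : clear implicits.
Let J n (g : 'rV[R]_n -> R) : R := \int[lebesgue_rV n]_(y in Q n) g y.

Lemma measureI : fine (mu1 I) = 2 * r.
Proof.
rewrite /I lebesgue_measure_itv/= lte_fin; case: ltP => h.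
  by rewrite -EFinB /=; ring.
by move: h r0; lra.
Qed.

Lemma integrable_I (h : R -> R) : continuous h -> mu1.-integrable I (EFin \o h).
Proof.
move=> ch; apply: continuous_compact_integrable; first exact: segment_compact.
exact: continuous_subspaceT.
Qed.

Lemma integrable_Q n (g : 'rV[R]_n -> R) : continuous g -> (lebesgue_rV n).-integrable (Q n) (EFin \o g).
Proof.
move=> cg; have [M M0 hM] := cont_bounded 0 r cg.
apply: measurable_bounded_integrable; first exact: cube_measurable.
- by rewrite /Q (lebesgue_rV_cube 0 (ltW r0)) ltry.
- by apply: (@measurable_funS _ _ _ _ setT) => //; exact: continuous_rV_measurable.
- exists M; split; first exact: num_real.
  by move=> x Mx y hy /=; apply: le_trans (hM y hy) (ltW Mx).
Qed.

Lemma J_le n (g h : 'rV[R]_n -> R) : continuous g -> continuous h ->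
  (forall y, Q n y -> g y <= h y) -> J g <= J h.
Proof. by move=> cg ch gh; apply: le_Rintegral => //; [exact: cube_measurable|exact: integrable_Q|exact: integrable_Q]. Qed.

Lemma J_D n (g h : 'rV[R]_n -> R) : continuous g -> continuous h ->
  J (fun y => g y + h y) = J g + J h.
Proof. by move=> cg ch; apply: RintegralD => //; [exact: cube_measurable|exact: integrable_Q|exact: integrable_Q]. Qed.

Lemma J_Z n c (g : 'rV[R]_n -> R) : continuous g -> J (fun y => c * g y) = c * J g.
Proof. by move=> cg; apply: RintegralZl => //; [exact: cube_measurable|exact: integrable_Q]. Qed.

Lemma J_cst n c : J (fun _ : 'rV[R]_n => c) = c * (2 * r) ^+ n.
Proof. by rewrite /J Rintegral_cst; [rewrite /Q (lebesgue_rV_cube 0 (ltW r0))|exact: cube_measurable]. Qed.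

Lemma J_ge0 n (g : 'rV[R]_n -> R) : (forall y, Q n y -> 0 <= g y) -> 0 <= J g.
Proof. exact: Rintegral_ge0. Qed.

Lemma JE n (g : 'rV[R]_n -> R) : continuous g ->
  (J g)%:E = (\int[lebesgue_rV n]_(y in Q n) (g y)%:E)%E.
Proof.
move=> cg; rewrite /J /Rintegral fineK//; apply: integrable_fin_num; first exact: cube_measurable.
exact: integrable_Q.
Qed.

Lemma patch_Q n (g : 'rV[R]_n.+1 -> R) t y :
  (EFin \o g \_ (Q n.+1)) (cns t y) = ((fun t => (EFin \o (fun y => g (cns t y)) \_ (Q n)) y) \_ I) t.
Proof.
rewrite /= !patchE /=.
have hI : (t \in I) = (`|t| <= r) by apply/idP/idP; rewrite inE /I /= in_itv/= ler_norml.
have hQ m (z : 'rV[R]_m) : (z \in Q m) = (`|z| <= r) by apply/idP/idP; rewrite inE /Q /cube/= subr0.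
have E : (cns t y \in Q n.+1) = (t \in I) && (y \in Q n).
  by rewrite hI !hQ norm_cnsP// ltW.
by rewrite E; case: (t \in I) => //=; rewrite patchE; case: (y \in Q n).
Qed.

(** The cube is a product, so extending [g] by zero reduces Fubini on it to [integral_cns] on the
    whole space. *)
Lemma J_cns n (g : 'rV[R]_n.+1 -> R) : continuous g -> (forall y, 0 <= g y) ->
  [/\ mu1.-integrable I (EFin \o (fun t => J (fun y => g (cns t y)))),
   J g = \int[mu1]_(t in I) J (fun y => g (cns t y)),
   (lebesgue_rV n).-integrable (Q n) (EFin \o (fun y => \int[mu1]_(t in I) g (cns t y))) &
   J g = \int[lebesgue_rV n]_(y in Q n) \int[mu1]_(t in I) g (cns t y)].
Proof.
move=> cg g0.
pose h := EFin \o g \_ (Q n.+1).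
have mg : measurable_fun [set: 'rV[R]_n.+1] g by exact: continuous_rV_measurable.
have mh : measurable_fun [set: 'rV[R]_n.+1] h.
  apply/measurable_EFinP; apply: (proj1 (@measurable_restrictT _ _ _ _ (Q n.+1) g (@cube_measurable R n.+1 0 r))).
  exact: measurable_funTS.
have h0 y : (0 <= h y)%E by rewrite /h/= patchE; case: ifP => _; rewrite lee_fin.
have cgt t : continuous (fun y => g (cns t y)) by exact: (continuous_compose (@continuous_cns _ _ t) cg).
have cgy y : continuous (fun t => g (cns t y)) by exact: (continuous_compose (@continuous_cnsl _ _ y) cg).
have E0 : (J g)%:E = (\int[lebesgue_rV n.+1]_y h y)%E.
  by rewrite JE// integral_mkcond; apply: eq_integral => y _; rewrite restrict_EFin.
have Et t : (\int[lebesgue_rV n]_y h (cns t y) = ((fun t => (J (fun y => g (cns t y)))%:E) \_ I) t)%E.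
  under eq_integral do rewrite [h _]patch_Q.
  rewrite patchE; case: ifPn => tI; last first.
    by apply: integral0_eq => y _; rewrite patchE (negbTE tI).
  rewrite JE// [RHS]integral_mkcond; apply: eq_integral => y _.
  by rewrite patchE tI -restrict_EFin.
have Ey y : (\int[mu1]_t h (cns t y) = ((fun y => (\int[mu1]_(t in I) g (cns t y))%:E) \_ (Q n)) y)%E.
  under eq_integral do rewrite [h _]patch_Q.
  rewrite -integral_mkcond patchE; case: ifPn => yQ; last first.
    by apply: integral0_eq => t _; rewrite /= patchE (negbTE yQ).
  rewrite /Rintegral fineK; last by apply: integrable_fin_num; [exact: measurable_itv|exact: integrable_I (cgy y)].
  by apply: eq_integral => t _; rewrite /= patchE yQ.
have F2 := integral_cns_swap mh h0.
have m1 := measurable_integral_cns mh h0.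
have m2 := measurable_integral_cnsr mh h0.
have F1 : ((J g)%:E = \int[mu1]_(t in I) (J (fun y => g (cns t y)))%:E)%E.
  rewrite E0 (integral_cns mh h0) [RHS]integral_mkcond.
  by apply: eq_integral => t _; rewrite Et.
have F3 : ((J g)%:E = \int[lebesgue_rV n]_(y in Q n) (\int[mu1]_(t in I) g (cns t y))%:E)%E.
  rewrite E0 (integral_cns mh h0) F2 [RHS]integral_mkcond.
  by apply: eq_integral => y _; rewrite Ey.
split.
- apply/integrableP; split.
    apply: (proj2 (@measurable_restrictT _ _ _ _ I (EFin \o (fun t => J (fun y => g (cns t y)))) (measurable_itv _))).
    by move: m1; apply: eq_measurable_fun => t _; rewrite Et.
  rewrite [X in (X < _)%E](_ : _ = (J g)%:E) ?ltry// F1; apply: eq_integral => t _.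
  by rewrite /= ger0_norm// J_ge0.
- by rewrite /Rintegral -F1.
- apply/integrableP; split.
    apply: (proj2 (@measurable_restrictT _ _ _ _ (Q n) (EFin \o (fun y => \int[mu1]_(t in I) g (cns t y))) (@cube_measurable R n 0 r))).
    by move: m2; apply: eq_measurable_fun => y _; rewrite Ey.
  rewrite [X in (X < _)%E](_ : _ = (J g)%:E) ?ltry// F3; apply: eq_integral => y _.
  by rewrite /= ger0_norm// Rintegral_ge0.
- by rewrite /Rintegral -F3.
Qed.

(** Cauchy-Schwarz for the integral of [f] between [t0] and [t], in the form [2 la f <= f^2 + la^2],
    with [la] optimized at the end. *)
Lemma poincare_1d (F f : R -> R) t t0 : (forall x, is_derive x (1 : R) F (f x)) -> continuous f ->
  I t -> I t0 -> (F t - F t0) ^+ 2 <= 2 * r * \int[mu1]_(s in I) f s ^+ 2.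
Proof.
move=> dF cf.
wlog tt : t t0 / t0 <= t => [H|] It It0.
  by case/orP: (le_total t t0) => h; [rewrite -sqrrN opprB|]; apply: H.
set K := \int[mu1]_(s in I) _.
have cf2 : continuous (fun s : R => f s ^+ 2).
  by move=> s; apply: (@continuous_comp _ _ _ f (fun x => x ^+ 2)); [exact: cf|exact: exprn_continuous].
have key la : 2 * la * (F t - F t0) <= K + la ^+ 2 * (2 * r).
  have sub : `[t0, t]%classic `<=` I.
    move: It It0; rewrite /I/= !in_itv/= => /andP[h1 h2] /andP[h3 h4] s /=.
    by rewrite !in_itv/= => /andP[h5 h6]; apply/andP; split; [exact: le_trans h3 h5|exact: le_trans h6 h2].
  have E : F t - F t0 = \int[mu1]_(s in `[t0, t]) f s by rewrite /Rintegral (ftc_seg tt dF cf).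
  have ch : continuous (fun s => f s ^+ 2 + la ^+ 2).
    exact: (rcontD cf2 (@rcont_cst _ _ _)).
  have cl : continuous (fun s => 2 * la * f s).
    exact: (rcontM (@rcont_cst _ _ _) cf).
  have i1 (h : R -> R) : continuous h -> mu1.-integrable `[t0, t] (EFin \o h).
    move=> chh; apply: continuous_compact_integrable; first exact: segment_compact.
    exact: continuous_subspaceT.
  have cc (c : R) : continuous (fun _ : R => c) by exact: cst_continuous.
  rewrite E -RintegralZl//; last exact: i1.
  apply: (@le_trans _ _ (\int[mu1]_(s in `[t0, t]) (f s ^+ 2 + la ^+ 2))).
    apply: le_Rintegral => //; [exact: i1|exact: i1|] => s _.
    have := sqr_ge0 (f s - la); move: (f s) => p; nra.
  apply: (@le_trans _ _ (\int[mu1]_(s in I) (f s ^+ 2 + la ^+ 2))).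
    rewrite /Rintegral; apply: fine_le.
    - by apply: integrable_fin_num => //; exact: i1.
    - by apply: integrable_fin_num; [exact: measurable_itv|exact: integrable_I].
    - apply: ge0_subset_integral; [exact: measurable_itv|exact: measurable_itv| | |exact: sub].
        by apply/measurable_EFinP; apply: measurable_funTS; exact: continuous_measurable_fun.
      by move=> s _; rewrite lee_fin addr_ge0// sqr_ge0.
  rewrite RintegralD; [|exact: measurable_itv|exact: integrable_I|exact: integrable_I].
  by rewrite Rintegral_cst; [rewrite measureI|exact: measurable_itv].
have := key ((F t - F t0) / (2 * r)); set D := F t - F t0.
have -> : 2 * (D / (2 * r)) * D = 2 * D ^+ 2 / (2 * r) by field; rewrite gt_eqF.
have -> : (D / (2 * r)) ^+ 2 * (2 * r) = D ^+ 2 / (2 * r) by field; rewrite gt_eqF.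
rewrite -lerBlDr -mulrBl mulr_natl mulr2n addrK ler_pdivrMr ?mulr_gt0//.
by rewrite mulrC.
Qed.

(* Some value is at most the average, up to e since no minimum need be attained. *)
Lemma good_slice (s : R -> R) e : 0 < e -> mu1.-integrable I (EFin \o s) ->
  exists2 t0, I t0 & 2 * r * s t0 <= \int[mu1]_(t in I) s t + e.
Proof.
move=> e0 is_; apply: contrapT => h.
set K := \int[mu1]_(t in I) s t in h.
have hh t : I t -> (K + e) / (2 * r) <= s t.
  move=> It; rewrite ler_pdivrMr ?mulr_gt0// mulrC leNgt; apply/negP => hl.
  by apply: h; exists t => //; exact: ltW.
have : \int[mu1]_(t in I) ((K + e) / (2 * r)) <= K.
  apply: le_Rintegral => //; first exact: measurable_itv.
  exact: (@integrable_I (fun=> (K + e) / (2 * r)) (@cst_continuous _ _ _)).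
rewrite Rintegral_cst; last exact: measurable_itv.
rewrite measureI divfK ?gt_eqF ?mulr_gt0//.
by move: e0; lra.
Qed.

(** Induction on the dimension: [good_slice] selects a slice whose gradient energy is about average,
    its constant [c] serves for all slices, and [poincare_1d] carries the estimate from that slice
    to the others. The slack [e] is the one of [good_slice]. *)
Lemma poincare n : exists2 C, 0 <= C & forall (f : 'rV[R]_n -> R) e, smooth f -> 0 < e ->
  exists c, J (fun y => (f y - c) ^+ 2) <= C * (J (fun y => \sum_i partial i f y ^+ 2) + e).
Proof.
elim: n => [|n [C C0 IH]].
  exists 0 => // f e sf e0; exists (f 0); rewrite mul0r.
  rewrite (_ : (fun y => (f y - f 0) ^+ 2) = (fun=> 0)) ?J_cst ?mul0r//.
  by apply/funext => y; rewrite (thinmx0 y) subrr expr0n.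
exists (8 * r ^+ 2 + 2 * C + 4 * r * C).
  by have := sqr_ge0 r; have := mulr_ge0 (ltW r0) C0; move: C0; nra.
move=> f e sf e0.
have csq m (g : 'rV[R]_m -> R) : continuous g -> continuous (fun y => g y ^+ 2).
  by move=> cg; under eq_fun do rewrite expr2; exact: contM.
pose g0 y := partial ord0 f y ^+ 2.
pose g1 y := \sum_i partial (lift ord0 i) f y ^+ 2.
have cp i : continuous (partial i f) by apply: smooth_cont; exact: smooth_partial.
have cg0 : continuous g0 by exact: csq.
have cg1 : continuous g1 by apply: continuous_sum_fun => i; exact: csq.
have Eg : (fun y => \sum_i partial i f y ^+ 2) = (fun y => g0 y + g1 y).
  by apply/funext => y; rewrite big_ord_recl.
rewrite Eg J_D//.
have [is1 J1 _ _] := J_cns cg1 (fun y => sumr_ge0 _ (fun i _ => sqr_ge0 (partial (lift ord0 i) f y))).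
have [_ _ is0 J0] := J_cns cg0 (fun y => sqr_ge0 _).
have [t0 It0 ht0] := good_slice e0 is1.
have [sft Eft] := smooth_cnsS t0 sf.
have [c hc] := IH _ e sft e0; exists c.
rewrite (_ : (fun y => \sum_i _) = (fun y => g1 (cns t0 y))) in hc; last first.
  by apply/funext => y; apply: eq_bigr => i _; rewrite partial_cnsS.
rewrite -J1 in ht0.
have cf := smooth_cont sf.
have cfc : continuous (fun y => (f y - c) ^+ 2).
  by apply: csq; apply: contB => //; exact: cst_continuous.
have [isf Jf _ _] := J_cns cfc (fun y => sqr_ge0 _).
set T0 := J g0; set S0 := J (fun y => g1 (cns t0 y)) in ht0 hc.
set T1 := J g1 in ht0 *.
have step t : I t -> J (fun y => (f (cns t y) - c) ^+ 2) <= 4 * r * T0 + 2 * (C * (S0 + e)).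
  move=> It.
  have cft s : continuous (fun y => f (cns s y)) by exact: (continuous_compose (@continuous_cns _ _ s) cf).
  have c1 : continuous (fun y => (f (cns t y) - f (cns t0 y)) ^+ 2) by apply: csq; exact: contB.
  have c2 : continuous (fun y => (f (cns t0 y) - c) ^+ 2) by apply: csq; apply: contB => //; exact: cst_continuous.
  have c3 : continuous (fun y => (f (cns t y) - c) ^+ 2) by apply: csq; apply: contB => //; exact: cst_continuous.
  have cc k : continuous (fun _ : 'rV[R]_n => k : R) by exact: cst_continuous.
  apply: (@le_trans _ _ (J (fun y => 2 * (f (cns t y) - f (cns t0 y)) ^+ 2 + 2 * (f (cns t0 y) - c) ^+ 2))).
    apply: J_le => //; first by apply: contD; apply: contM.
    move=> y _; move: (f (cns t y)) (f (cns t0 y)) => p q.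
    by have := sqr_ge0 ((p - q) - (q - c)); nra.
  rewrite J_D; [|by apply: contM|by apply: contM].
  rewrite !J_Z//; apply: lerD; last by rewrite ler_pM2l.
  rewrite (_ : 4 * r * T0 = 2 * (2 * r * T0)); last by ring.
  rewrite ler_pM2l// /T0 J0 -RintegralZl//; last exact: cube_measurable.
  apply: le_Rintegral; [exact: cube_measurable|exact: integrable_Q| |].
    under [X in _.-integrable _ X]eq_fun do rewrite /= EFinM.
    by apply: integrableZl => //; exact: cube_measurable.
  move=> y _; apply: (@poincare_1d (fun t => f (cns t y)) (fun t => partial ord0 f (cns t y))) => //.
    by move=> s; apply: is_derive_cns0; exact: smooth_deriv.
  exact: (continuous_compose (@continuous_cnsl _ _ y) (cp ord0)).
have : J (fun y => (f y - c) ^+ 2) <= (4 * r * T0 + 2 * (C * (S0 + e))) * (2 * r).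
  rewrite Jf -measureI -Rintegral_cst; last exact: measurable_itv.
  apply: le_Rintegral => //; first exact: measurable_itv.
  exact: (@integrable_I (fun=> _) (@cst_continuous _ _ _)).
move=> h; apply: le_trans h _.
have T00 : 0 <= T0 by apply: J_ge0 => y _; exact: sqr_ge0.
have T10 : 0 <= T1 by apply: J_ge0 => y _; apply: sumr_ge0 => i _; exact: sqr_ge0.
have X := ler_wpM2l C0 ht0.
have CT0 := mulr_ge0 C0 T00; have CT1 := mulr_ge0 C0 T10; have Ce := mulr_ge0 C0 (ltW e0).
have rT1 := mulr_ge0 (sqr_ge0 r) T10; have re := mulr_ge0 (sqr_ge0 r) (ltW e0).
have rCT0 := mulr_ge0 (ltW r0) CT0; have rCT1 := mulr_ge0 (ltW r0) CT1.
apply: (@le_trans _ _ (8 * r ^+ 2 * T0 + 2 * (C * (T1 + e)) + 4 * r * C * e)).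
  rewrite [leLHS](_ : _ = 8 * r ^+ 2 * T0 + 2 * (C * (2 * r * S0)) + 4 * r * C * e); last by ring.
  by rewrite lerD2r lerD2l ler_pM2l.
move: CT0 CT1 Ce rT1 re rCT0 rCT1; nra.
Qed.

End cube_poincare.

Section norms.
Context {R : realType}.

Lemma enormE n (y : 'rV[R]_n) : enorm y = Num.sqrt (\sum_j y 0 j ^+ 2).
Proof. by rewrite /enorm big_ord1. Qed.

Lemma enorm_sqr a b (A : 'M[R]_(a, b)) : enorm A ^+ 2 = \sum_i \sum_j A i j ^+ 2.
Proof.
rewrite /enorm sqr_sqrtr//; apply: sumr_ge0 => i _; apply: sumr_ge0 => j _.
exact: sqr_ge0.
Qed.

Lemma enorm_ge0 a b (A : 'M[R]_(a, b)) : 0 <= enorm A. Proof. exact: sqrtr_ge0. Qed.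

Lemma entry_le_enorm a b (A : 'M[R]_(a, b)) i j : `|A i j| <= enorm A.
Proof.
rewrite -ler_sqr ?nnegrE ?enorm_ge0// real_normK ?num_real// enorm_sqr.
rewrite (bigD1 i)//= (bigD1 j)//= -addrA lerDl addr_ge0//.
  by apply: sumr_ge0 => k _; exact: sqr_ge0.
by apply: sumr_ge0 => k _; apply: sumr_ge0 => l _; exact: sqr_ge0.
Qed.

Lemma norm_le_enorm n (y : 'rV[R]_n) : `|y| <= enorm y.
Proof. by apply: rV_norm_le; [exact: enorm_ge0|move=> i; exact: entry_le_enorm]. Qed.

Lemma enorm_le n (y : 'rV[R]_n) : enorm y <= n%:R * `|y|.
Proof.
rewrite -ler_sqr ?nnegrE ?enorm_ge0 ?mulr_ge0// enorm_sqr big_ord1.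
apply: (@le_trans _ _ (\sum_j `|y 0 j| ^+ 2)).
  by apply: ler_sum => j _; rewrite real_normK ?num_real.
apply: le_trans (sum_sqr_le (a := fun j => `|y 0 j|) (fun j => normr_ge0 _)) _.
rewrite ler_sqr ?nnegrE ?mulr_ge0 ?sumr_ge0//.
apply: le_trans (ler_sum _ (fun j _ => coord_le_norm y j)) _.
by rewrite sumr_const card_ord mulr_natl.
Qed.

End norms.

(** * From decay of a solution to decay of all its derivatives *)

Section CB_more.
Context {R : realType} {n : nat}.
Implicit Types (P : ('rV[R]_n -> R) -> Prop) (g : 'rV[R]_n -> R).

Lemma CB_partials P k g s : CB P (size s + k) g -> CB P k (partials s g).
Proof.
elim/last_ind: s g => [//|s i IH] g.
rewrite size_rcons partials_rcons => -[_ _ /(_ i)[_]]; exact: IH.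
Qed.

Lemma CB_holds P k g : CB P k g -> P g.
Proof. by case: k => [|k] []. Qed.

Lemma CB_of_partials P k g : smooth g ->
  (forall s, (size s <= k)%N -> P (partials s g)) -> CB P k g.
Proof.
elim: k g => [|k IH] g sg h; (split; [exact: smooth_cont|exact: (h [::])|]) => // i.
split; first exact: smooth_deriv.
apply: IH => [|s sk]; first exact: smooth_partial.
by rewrite -partials_rcons; apply: h; rewrite size_rcons.
Qed.

Lemma partialsD s (f g : 'rV[R]_n -> R) : smooth f -> smooth g ->
  partials s (fun y => f y + g y) = (fun y => partials s f y + partials s g y).
Proof.
elim/last_ind: s f g => [//|s i IH] f g sf sg.
rewrite !partials_rcons partialD; [|exact: smooth_deriv|exact: smooth_deriv].
by apply: IH; exact: smooth_partial.
Qed.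

Lemma partialsZ s c (f : 'rV[R]_n -> R) : smooth f ->
  partials s (fun y => c * f y) = (fun y => c * partials s f y).
Proof.
move=> sf; elim: s => [//|i s IH] /=; rewrite IH.
have d := smooth_deriv (i := i) (smooth_partials s sf).
rewrite (partialM (@deriv_cst R n i c) d) partial_cst.
by apply/funext => y; rewrite mul0r add0r.
Qed.

Lemma smooth_sum (I : Type) (r : seq I) (F : I -> 'rV[R]_n -> R) :
  (forall i, smooth (F i)) -> smooth (fun y => \sum_(i <- r) F i y).
Proof.
move=> h; elim: r => [|i r IH].
  by under eq_fun do rewrite big_nil; exact: smooth_cst.
by under eq_fun do rewrite big_cons; apply: smoothD; [exact: h|exact: IH].
Qed.

Lemma partials_sum s (I : Type) (r : seq I) (F : I -> 'rV[R]_n -> R) :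
  (forall i, smooth (F i)) ->
  partials s (fun y => \sum_(i <- r) F i y) = (fun y => \sum_(i <- r) partials s (F i) y).
Proof.
move=> h; elim: r => [|i r IH].
  under eq_fun do rewrite big_nil; under [RHS]eq_fun do rewrite big_nil.
  by elim/last_ind: s => [//|s i IH]; rewrite partials_rcons partial_cst.
under eq_fun do rewrite big_cons; under [RHS]eq_fun do rewrite big_cons.
by rewrite partialsD; [rewrite IH|exact: h|exact: smooth_sum].
Qed.

Lemma laplacian_partials s g : smooth g ->
  laplacian (partials s g) = partials s (laplacian g).
Proof.
move=> sg; rewrite /laplacian partials_sum => [|i]; last first.
  by do 2 apply: smooth_partial.
apply/funext => y; apply: eq_bigr => i _.
have E1 : partial i (partial i (partials s g)) = partials ([:: i; i] ++ s) g by [].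
have E2 : partials s (partial i (partial i g)) = partials (s ++ [:: i; i]) g by rewrite partials_cat.
by rewrite E1 E2; congr (_ y); apply: partials_perm => //; rewrite perm_catC.
Qed.

(** The gradient estimate on the unit cube around [y], over which the exponential weight changes by
    a factor of at most [exp |nu|]. *)
Lemma edec_gradient g i : smooth g -> edec g -> edec (laplacian g) -> edec (partial i g).
Proof.
move=> sg eg el nu; have [C hC] := eg nu; have [D hD] := el nu.
have C0 : 0 <= C by have := le_trans (normr_ge0 _) (hC 0); rewrite pmulr_lge0// expR_gt0.
have D0 : 0 <= D by have := le_trans (normr_ge0 _) (hD 0); rewrite pmulr_lge0// expR_gt0.
exists ((n%:R * C + D) * expR `|nu|) => y.
have shift z : cube y 1 z -> expR (- (nu * `|z|)) <= expR `|nu| * expR (- (nu * `|y|)).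
  rewrite /cube/= -expRD ler_expR => h.
  have h2 : `| `|y| - `|z| | <= 1 by apply: le_trans (ler_dist_dist _ _) _; rewrite distrC.
  have : nu * (`|y| - `|z|) <= `|nu|.
    apply: le_trans (ler_norm _) _; rewrite normrM; exact: ler_piMr.
  by rewrite mulrBr; move: (nu * `|y|) (nu * `|z|) (`|nu|) => a b c; clear; lra.
have := @gradient_bound R n g y i 1 (C * (expR `|nu| * expR (- (nu * `|y|)))) (D * (expR `|nu| * expR (- (nu * `|y|)))) sg ltr01.
move=> h; apply: le_trans (h _ _) _.
- by move=> z hz; apply: le_trans (hC z) _; apply: ler_wpM2l => //; exact: shift.
- by move=> z hz; apply: le_trans (hD z) _; apply: ler_wpM2l => //; exact: shift.
rewrite divr1 -[leRHS]mulrA; set E : R := expR _ * expR _.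
have E0 : 0 <= E by rewrite mulr_ge0// expR_ge0.
have := mulr_ge0 D0 E0; clearbody E; clear; lra.
Qed.

(** Bootstrap: if the derivatives up to order [k] decay, so does the Laplacian of one of order [k],
    being a derivative of [W u - G]; then [edec_gradient] reaches order [k + 1]. *)
Lemma fast_of_equation (u W G : 'rV[R]_n -> R) : smooth u -> edec u ->
  pclass W -> fast G -> (forall y, laplacian u y = W y * u y - G y) -> fast u.
Proof.
move=> su eu pW fG eq; apply/tameP; elim => [|k IH].
  by split => //; exact: smooth_cont.
apply: CB_of_partials => // s; rewrite leq_eqVlt => /predU1P[sk|sk]; last first.
  by have := @CB_partials (@edec R n) (k - size s) u s; rewrite subnKC// => /(_ IH)/CB_holds.
case: s sk => // i s [sk]; rewrite -[partials (i :: s) u]/(partial i (partials s u)).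
apply: edec_gradient; first exact: smooth_partials.
  by have := @CB_partials (@edec R n) 0%N u s; rewrite addn0 sk => /(_ IH)[].
rewrite laplacian_partials//.
have -> : laplacian u = (fun y => W y * u y + - G y) by apply/funext.
have : CB (@edec R n) k (fun y => W y * u y + - G y).
  apply: CB_D; first exact: edec_D.
    apply: (CB_M (@edec_D R n) (@edec_M R n)) => //.
    by move/tameP : pW; apply.
  by have /tameP := fast_N fG; apply.
by move=> h; have := @CB_partials (@edec R n) 0%N _ s; rewrite addn0 sk => /(_ _ h)[].
Qed.

(** The radius and the constant depend on [W] and [nu] alone, so that the bound can be applied to a
    whole family of difference quotients. The radius is where coercivity gives [nu^2 + 1 <= W]. *)
Lemma decay_uniform (W : 'rV[R]_n -> R) (nu : R) : (0 < n)%N -> coercive W -> 0 <= nu ->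
  exists r, exists2 C, 0 <= C & forall (u G : 'rV[R]_n -> R) M M', smooth u ->
    (forall y, laplacian u y = W y * u y - G y) -> 0 <= M -> 0 <= M' ->
    (forall y, `|G y| <= M * expR (- (nu * `|y|))) ->
    (forall y, `|y| <= r -> `|u y| <= M') ->
    (forall e, 0 < e -> exists rho, forall y, rho < `|y| -> `|u y| < e) ->
    forall y, `|u y| <= C * (M + M' + 1) * expR (- (nu * `|y|)).
Proof.
move=> n0 cW nu0; have [r hr] := cW (nu ^+ 2 + 1).
exists r; exists (2 * n%:R * (1 + expR (nu * `|r|))).
  by rewrite mulr_ge0 ?mulr_ge0// addr_ge0// expR_ge0.
move=> u G M M' su eq M0 M'0 hG hM hinf y.
set B := 2 * n%:R; have B0 : 0 <= B by rewrite mulr_ge0.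
have B1 : 1 <= B by have := ler_nat R 1 n; rewrite n0 /B; lra.
set E := expR (nu * `|r|); have E0 : 0 <= E by exact: expR_ge0.
have := @comparison R n u W G nu r (B * M) (M' * (B * E)) n0 su eq.
have BM : 0 <= B * M by exact: mulr_ge0.
have BE : 0 <= B * E by exact: mulr_ge0.
have MBE : 0 <= M' * (B * E) by exact: mulr_ge0.
move=> H; apply: le_trans (H BM MBE _ _ _ hinf y) _.
- move=> z; apply: le_trans (hG z) _; rewrite [B * M]mulrC -mulrA; apply: ler_wpM2l => //.
  exact: cinv_ge.
- move=> z zr; apply/ltW/hr; apply: lt_le_trans zr _; exact: norm_le_enorm.
- move=> z zr; apply: le_trans (hM z zr) _; rewrite -mulrA ler_peMr//.
  apply: (@le_trans _ _ (E * expR (- (nu * `|z|)))).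
    rewrite /E -expRD -expR0 ler_expR -mulrBr mulr_ge0// subr_ge0.
    by apply: le_trans zr (ler_norm _).
  by rewrite (mulrC B) -mulrA; apply: ler_wpM2l => //; exact: cinv_ge.
apply: (@le_trans _ _ ((B * M + M' * (B * E) + 1) * expR (- (nu * `|y|)))).
  apply: ler_wpM2l; last exact: cinv_le.
  by rewrite addr_ge0// addr_ge0.
apply: ler_wpM2r; first exact: expR_ge0.
rewrite mulrDr mulr1.
have h1 := mulr_ge0 BE M0.
have h2 := mulr_ge0 B0 M'0.
rewrite [leRHS](_ : _ = B * M + M' * (B * E) + B + (B * E * M + B * M' + B * E)); last by ring.
by move: h1 h2 BE B1; move: (B * E * M) (B * M') (B * E) (B * M) (M' * _) => a b c d e; clear; lra.
Qed.

Lemma edec_of_decay (u W G : 'rV[R]_n -> R) : (0 < n)%N -> coercive W -> smooth u ->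
  (forall y, laplacian u y = W y * u y - G y) -> edec G ->
  (forall e, 0 < e -> exists rho, forall y, rho < `|y| -> `|u y| < e) -> edec u.
Proof.
move=> n0 cW su eq eG hinf.
suff H nu : 0 <= nu -> exists C, forall y, `|u y| <= C * expR (- (nu * `|y|)).
  move=> nu; have [nu0|nu0] := leP 0 nu; first exact: H.
  have [C hC] := H 0 (lexx 0); exists C => y; apply: le_trans (hC y) _.
  have C0 : 0 <= C by have := le_trans (normr_ge0 _) (hC 0); rewrite pmulr_lge0// expR_gt0.
  by apply: ler_wpM2l => //; rewrite ler_expR lerN2 ler_wpM2r// ltW.
move=> nu0; have [r [C C0 H]] := decay_uniform n0 cW nu0.
have [M hM] := eG nu.
have M0 : 0 <= M by have := le_trans (normr_ge0 _) (hM 0); rewrite pmulr_lge0// expR_gt0.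
have [M' M'0 hM'] := cont_bounded 0 r (smooth_cont su).
exists (C * (M + M' + 1)); apply: (H u G) => // y yr; apply: hM'.
by rewrite subr0.
Qed.

End CB_more.

(** * Ground state and spectral gap *)

Section ground_state.
Context {R : realType} {n : nat}.
Variable V : 'rV[R]_n -> R.
Hypotheses (n0 : (0 < n)%N) (pV : pclass V) (cV : coercive V) (cW : coercive (Wpot V)).
Hypothesis norm1 : integralR (fun y => expR (- V y)) = 1.

Definition phi0 (y : 'rV[R]_n) : R := expR (- V y / 2).

Let W := Wpot V.
Let sV : smooth V := pclass_smooth pV.

Lemma WE y : W y = 4^-1 * (\sum_i partial i V y ^+ 2) - 2^-1 * \sum_i partial i (partial i V) y.
Proof.
rewrite /W /Wpot enorm_sqr big_ord1 /laplacian; congr (_ * _ - _).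
by apply: eq_bigr => i _; rewrite mxE.
Qed.

Lemma pclass_W : pclass W.
Proof.
rewrite (_ : W = (fun y => 4^-1 * (\sum_i partial i V y * partial i V y)
   + (- 2^-1) * \sum_i partial i (partial i V) y)); last first.
  by apply/funext => y; rewrite WE mulNr; under eq_bigr do rewrite expr2.
have pd i : pclass (partial i V) by exact: (pclass_partial i pV).
apply: pclass_D; apply: pclass_M; try exact: pclass_cst; apply: pclass_sum => i.
  by apply: pclass_M.
exact: (pclass_partial i (pd i)).
Qed.

Let smooth_mV2 : smooth (fun y => - V y / 2).
Proof. by apply: smoothM; [exact: smoothN|exact: smooth_cst]. Qed.

Lemma partial_mhalf (g : 'rV[R]_n -> R) i : smooth g ->
  partial i (fun y => - g y / 2) = (fun y => - partial i g y / 2).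
Proof.
move=> sg.
rewrite partialM; [|by apply: smooth_deriv; exact: smoothN|exact: deriv_cst].
apply/funext => y; rewrite partialN; last exact: smooth_deriv.
by rewrite partial_cst mulr0 addr0.
Qed.

Lemma smooth_phi0 : smooth phi0.
Proof. exact: (smooth_expR smooth_mV2). Qed.

Lemma partial_phi0 i : partial i phi0 = (fun y => - partial i V y / 2 * phi0 y).
Proof. by rewrite (partial_expR i smooth_mV2).2 (partial_mhalf i sV). Qed.

Lemma eq_phi0 y : laplacian phi0 y = W y * phi0 y.
Proof.
have E i : partial i (partial i phi0) y =
    4^-1 * (partial i V y ^+ 2 * phi0 y) - 2^-1 * (partial i (partial i V) y * phi0 y).
  have sdV : smooth (partial i V) by exact: smooth_partial.
  rewrite partial_phi0 partialM; first last.
  - by apply: smooth_deriv; exact: smooth_phi0.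
  - by apply: smooth_deriv; apply: smoothM; [exact: smoothN|exact: smooth_cst].
  rewrite partial_phi0 partialM; first last.
  - exact: deriv_cst.
  - by apply: smooth_deriv; exact: smoothN.
  rewrite partialN; last exact: smooth_deriv.
  rewrite partial_cst; move: (partial i (partial i V) y) (partial i V y) (phi0 y) => a b c.
  by field.
rewrite /laplacian (eq_bigr _ (fun i _ => E i)) sumrB -!mulr_sumr -!mulr_suml WE.
by move: (\sum_(_ | _) _) (\sum_(_ | _) _) (phi0 y) => a b c; ring.
Qed.

Lemma phi0_cvg0 e : 0 < e -> exists rho, forall y, rho < `|y| -> `|phi0 y| < e.
Proof.
move=> e0; have [r hr] := cV (- 2 * ln e); exists r => y ry.
rewrite gtr0_norm ?expR_gt0// -[ltRHS]lnK ?posrE// ltr_expR.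
have : r < enorm y by apply: lt_le_trans ry _; exact: norm_le_enorm.
by move=> /hr; move: (V y) (ln e) => a b; lra.
Qed.

(** [phi0] solves the equation without source; coercivity of [V] supplies the limit 0 at infinity
    that the maximum principle starts from. *)
Lemma fast_phi0 : fast phi0.
Proof.
apply: (@fast_of_equation R n phi0 W (fun=> 0)).
- exact: smooth_phi0.
- apply: (@edec_of_decay R n phi0 W (fun=> 0)).
  + exact: n0.
  + exact: cW.
  + exact: smooth_phi0.
  + by move=> y; rewrite eq_phi0 subr0.
  + by move=> nu; exists 0 => z; rewrite mul0r normr0.
  + exact: phi0_cvg0.
- exact: pclass_W.
- exact: fast0.
- by move=> y; rewrite eq_phi0 subr0.
Qed.

Lemma phi0_sqr y : phi0 y ^+ 2 = expR (- V y).
Proof. by rewrite /phi0 -expRM_natr; congr expR; field. Qed.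

Lemma integral_phi0_sqr : integralR (fun y => phi0 y ^+ 2) = 1.
Proof. by rewrite -norm1; congr integralR; apply/funext => y; exact: phi0_sqr. Qed.

Lemma fast_grad_dot (u v : 'rV[R]_n -> R) : fast u -> fast v ->
  fast (fun y => dot (grad u y) (grad v y)).
Proof.
move=> fu fv; apply: fast_sum => i.
under eq_fun do rewrite !mxE.
by apply: fast_MM; exact: fast_partial.
Qed.

Lemma fast_laplacian (u : 'rV[R]_n -> R) : fast u -> fast (laplacian u).
Proof. by move=> fu; apply: fast_sum => i; do 2 apply: fast_partial. Qed.

Lemma aform_ibp (u v : 'rV[R]_n -> R) : fast u -> fast v ->
  aform V u v = integralR (fun y => (W y * u y - laplacian u y) * v y).
Proof.
move=> fu fv; rewrite /aform.
have fF i : fast (fun y => partial i u y * v y) by exact: (fast_MM (fast_partial i fu) fv).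
have fpF i : fast (partial i (fun y => partial i u y * v y)) by exact: fast_partial.
have fH : fast (fun y => (W y * u y - laplacian u y) * v y).
  exact: (fast_MM (fast_B (fast_M pclass_W fu) (fast_laplacian fu)) fv).
transitivity (integralR (fun y => (W y * u y - laplacian u y) * v y +
    \sum_i partial i (fun y => partial i u y * v y) y)).
  congr integralR; apply/funext => y.
  rewrite (eq_bigr (fun i => partial i (partial i u) y * v y + partial i u y * partial i v y)); last first.
    move=> i _; rewrite partialM//; first by apply: smooth_deriv; apply: smooth_partial; exact: fast_smooth.
    by apply: smooth_deriv; case: fv.
  rewrite big_split/= -mulr_suml -/(laplacian u y).
  rewrite (_ : dot _ _ = \sum_i partial i u y * partial i v y); last first.
    by apply: eq_bigr => i _; rewrite !mxE.
  by move: (\sum_(_ | _) _) (laplacian u y) => a b; rewrite -/W; ring.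
rewrite integralR_D; [|exact: fast_dom|by apply: fast_dom; exact: fast_sum].
rewrite integralR_sum => [|i]; last exact: fast_dom.
rewrite big1 ?addr0// => i _; apply: integral_partial0; try exact: fast_dom.
by apply: smooth_deriv; apply: fast_smooth.
Qed.

(** This is [phi0] times the derivative of [u / phi0]; in particular it vanishes for multiples of
    [phi0]. *)
Definition qfield (u : 'rV[R]_n -> R) i y : R := partial i u y + u y * partial i V y / 2.

Lemma fast_qfield u i : fast u -> fast (qfield u i).
Proof.
move=> fu; apply: fast_D; first exact: fast_partial.
apply: fast_Mr; last exact: pclass_cst.
exact: (fast_Mr fu (pclass_partial _ pV)).
Qed.

Lemma fast_sum_qfield u : fast u -> fast (fun y => \sum_i qfield u i y ^+ 2).
Proof.
move=> fu; apply: fast_sum => i; under eq_fun do rewrite expr2.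
by apply: fast_MM; exact: fast_qfield.
Qed.

Lemma aform_qfield (u : 'rV[R]_n -> R) : fast u ->
  aform V u u = integralR (fun y => \sum_i qfield u i y ^+ 2).
Proof.
move=> fu; have su := fast_smooth fu; rewrite /aform.
(* The divergence of this field accounts for the cross term of the square and for the second
   derivatives of [V] in [W]. *)
pose F i y := (u y * u y) * (- partial i V y / 2).
have fF i : fast (F i).
  apply: fast_Mr; first exact: fast_MM.
  by apply: pclass_M; [apply: pclass_N; exact: (pclass_partial _ pV)|exact: pclass_cst].
transitivity (integralR (fun y => (\sum_i qfield u i y ^+ 2) + \sum_i partial i (F i) y)).
  congr integralR; apply/funext => y.
  rewrite -/W WE -big_split/=.
  rewrite (_ : dot _ _ = \sum_i partial i u y ^+ 2); last first.
    by apply: eq_bigr => i _; rewrite !mxE expr2.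
  rewrite [RHS](eq_bigr (fun i => partial i u y ^+ 2 + (4^-1 * u y ^+ 2 * partial i V y ^+ 2 -
       2^-1 * u y ^+ 2 * partial i (partial i V) y))).
    rewrite big_split/= sumrB -!mulr_sumr.
    by move: (\sum_(_ | _) _) (\sum_(_ | _) _) (\sum_(_ | _) _) (u y) => a b c d; ring.
  move=> i _; have du := smooth_deriv (i := i) su.
  have sdV : smooth (partial i V) by exact: smooth_partial.
  have -> : partial i (F i) y = (partial i u y * u y + u y * partial i u y) * (- partial i V y / 2)
      + (u y * u y) * (- partial i (partial i V) y / 2).
    have dm : deriv_along (fun y => - partial i V y / 2) i.
      by apply: smooth_deriv; apply: smoothM; [exact: smoothN|exact: smooth_cst].
    rewrite [LHS](congr1 (@^~ y) (partialM (derivM du du) dm)).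
    by rewrite (congr1 (@^~ y) (partialM du du)) (congr1 (@^~ y) (partial_mhalf i sdV)).
  rewrite /qfield; move: (partial i (partial i V) y) (partial i V y) (partial i u y) (u y) => a b c d.
  by field.
rewrite integralR_D; [|by apply: fast_dom; exact: fast_sum_qfield|].
  rewrite integralR_sum => [|i]; last by apply: fast_dom; exact: fast_partial.
  rewrite [X in _ + X]big1 ?addr0// => i _.
  apply: integral_partial0; [|exact: fast_dom|by apply: fast_dom; exact: fast_partial].
  by apply: smooth_deriv; apply: fast_smooth.
by apply: fast_dom; apply: fast_sum => i; exact: fast_partial.
Qed.

Lemma aform_ge0 u : fast u -> 0 <= aform V u u.
Proof.
move=> fu; rewrite aform_qfield//; apply: integralR_ge0 => y.
by apply: sumr_ge0 => i _; exact: sqr_ge0.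
Qed.

Lemma fast_pihat u : fast u -> fast (pihat V u).
Proof. by move=> fu; exact: (fast_B fu (fast_Z _ fast_phi0)). Qed.

Lemma fast_sqr (u : 'rV[R]_n -> R) : fast u -> fast (fun y => u y ^+ 2).
Proof. by move=> fu; under eq_fun do rewrite expr2; exact: fast_MM. Qed.

Lemma pihat_shift u c : fast u -> pihat V (fun y => u y - c * phi0 y) = pihat V u.
Proof.
move=> fu; apply/funext => y; rewrite /pihat -/(phi0 y).
have -> : integralR (fun y' => (u y' - c * phi0 y') * expR (- V y' / 2)) =
    integralR (fun y' => u y' * expR (- V y' / 2)) - c.
  rewrite (_ : (fun y' => _) = (fun y' => u y' * phi0 y' - c * (phi0 y' ^+ 2))); last first.
    by apply/funext => y'; rewrite -/(phi0 y'); ring.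
  rewrite integralR_B.
  - rewrite integralR_Z ?integral_phi0_sqr ?mulr1//.
    by apply: fast_dom; apply: fast_sqr; exact: fast_phi0.
  - exact: (fast_dom (fast_MM fu fast_phi0)).
  - by apply: fast_dom; apply: fast_Z; apply: fast_sqr; exact: fast_phi0.
by ring.
Qed.

Lemma pihat_le u : fast u -> integralR (fun y => pihat V u y ^+ 2) <= integralR (fun y => u y ^+ 2).
Proof.
move=> fu; set k := integralR (fun y' => u y' * expR (- V y' / 2)).
rewrite (_ : (fun y => _) = (fun y => u y ^+ 2 + (- (2 * k) * (u y * phi0 y) + k ^+ 2 * phi0 y ^+ 2))); last first.
  by apply/funext => y; rewrite /pihat -/k -/(phi0 y); ring.
have f1 := fast_MM fu fast_phi0; have f2 := fast_sqr fast_phi0.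
rewrite integralR_D; [|by apply: fast_dom; exact: fast_sqr|by apply: fast_dom; apply: fast_D; exact: fast_Z].
rewrite integralR_D; [|by apply: fast_dom; exact: fast_Z|by apply: fast_dom; exact: fast_Z].
rewrite !integralR_Z; [|exact: fast_dom|exact: fast_dom].
rewrite integral_phi0_sqr -[integralR (fun y => u y * phi0 y)]/k gerDl.
by have := sqr_ge0 k; rewrite expr2; lra.
Qed.

(** The Poincare inequality is applied to [u / phi0] on a cube where [exp V] and [exp (- V)] are at
    most [exp B]; outside it [W >= 1] lets the form itself control the mass. *)
Lemma spectral_gap : exists2 C, 0 <= C & forall u, fast u ->
  integralR (fun y => pihat V u y ^+ 2) <= C * aform V u u.
Proof.
have [r hr] := cW 1.
pose r' := Num.max r 1.
have r'0 : 0 < r' by rewrite lt_max ltr01 orbT.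
have cWW : continuous W by apply: smooth_cont; apply: pclass_smooth; exact: pclass_W.
have [M M0 hM] := cont_bounded 0 r' cWW.
have [B B0 hB] := cont_bounded 0 r' (smooth_cont sV).
have [CP CP0 hP] := poincare r'0 n.
have M10 : 0 <= M + 1 by rewrite addr_ge0.
have EB0 : 0 <= expR B by exact: expR_ge0.
exists (1 + (M + 1) * expR B * CP * expR B).
  by rewrite addr_ge0// mulr_ge0// mulr_ge0// mulr_ge0.
move=> u fu; have su := fast_smooth fu.
set A := aform V u u.
have A0 : 0 <= A by exact: aform_ge0.
have key e : 0 < e -> integralR (fun y => pihat V u y ^+ 2) <=
    A + (M + 1) * (expR B * (CP * (expR B * A + e))).
  move=> e0.
  pose f y := u y * expR (V y / 2).
  have sV2 : smooth (fun y => V y / 2) := smoothM sV (smooth_cst _).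
  have sf : smooth f.
    exact: (smoothM su (smooth_expR sV2)).
  have df i : partial i f = (fun y => qfield u i y * expR (V y / 2)).
    rewrite /f partialM; [|exact: smooth_deriv|exact: (partial_expR i sV2).1].
    rewrite (partial_expR i sV2).2 partialM; [|exact: smooth_deriv|exact: deriv_cst].
    apply/funext => y; rewrite partial_cst /qfield; move: (expR _) (partial i V y) (partial i u y) (u y) => a b c d.
    by field.
  have [c hc] := hP f e sf e0.
  (* Subtracting [c phi0] changes neither [pihat V u] nor the form, and replaces [f] by [f - c],
     which the Poincare inequality controls on the cube. *)
  pose uc y := u y - c * phi0 y.
  have fuc : fast uc := fast_B fu (fast_Z c fast_phi0).
  have qc i y : qfield uc i y = qfield u i y.
    rewrite /qfield /uc partialD; [|exact: smooth_deriv|]; last first.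
      by apply: smooth_deriv; apply: smoothN; apply: smoothM; [exact: smooth_cst|exact: smooth_phi0].
    rewrite partialN; last by apply: smooth_deriv; apply: smoothM; [exact: smooth_cst|exact: smooth_phi0].
    rewrite partialM; [|exact: deriv_cst|by apply: smooth_deriv; exact: smooth_phi0].
    rewrite partial_cst partial_phi0; move: (partial i u y) (partial i V y) (u y) (phi0 y) => a b p q.
    by field.
  have Ac : aform V uc uc = A.
    rewrite /A !aform_qfield//; congr integralR; apply/funext => y.
    by apply: eq_bigr => i _; rewrite qc.
  have fWuc : fast (fun y => W y * uc y ^+ 2) by apply: fast_M; [exact: pclass_W|exact: fast_sqr].
  have W1 : integralR (fun y => W y * uc y ^+ 2) <= A.
    rewrite -Ac /aform; apply: integralR_le; first exact: fast_dom.
      apply: fast_dom; apply: fast_D; first exact: fast_grad_dot.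
      exact: (fast_MM (fast_M pclass_W fuc) fuc).
    move=> y; rewrite -/W -mulrA -expr2 lerDr.
    by apply: sumr_ge0 => i _; rewrite -expr2 sqr_ge0.
  pose J g := (\int[lebesgue_rV n]_(y in cube 0 r') g y)%R.
  have cuc2 : continuous (fun y => uc y ^+ 2) by apply: smooth_cont; apply: fast_smooth; exact: fast_sqr.
  (* [W >= - M] on the cube and [W >= 1] outside, so adding [M + 1] on the cube makes the
     coefficient of [uc^2] at least 1 everywhere. *)
  have W2 : integralR (fun y => uc y ^+ 2) <= integralR (fun y => W y * uc y ^+ 2) + (M + 1) * J (fun y => uc y ^+ 2).
    have ii : (lebesgue_rV n).-integrable setT (EFin \o ((fun y => uc y ^+ 2) \_ (cube 0 r'))).
      rewrite -restrict_EFin; apply/integrable_restrict => //; first exact: cube_measurable.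
      by rewrite setTI; exact: integrable_Q.
    have iZ : (lebesgue_rV n).-integrable setT (EFin \o (fun y => (M + 1) * ((fun y => uc y ^+ 2) \_ (cube 0 r')) y)).
      exact: (integrableZl measurableT (M + 1) ii).
    have iW : (lebesgue_rV n).-integrable setT (EFin \o (fun y => W y * uc y ^+ 2)).
      exact: (dom_integrable (fast_dom fWuc)).
    rewrite /J Rintegral_mkcond.
    have <- := RintegralZl (M + 1) measurableT ii.
    have <- := RintegralD measurableT iW iZ.
    apply: le_Rintegral.
    - exact: measurableT.
    - exact: (dom_integrable (fast_dom (fast_sqr fuc))).
    - exact: (integrableD measurableT iW iZ).
    move=> y _; rewrite patchE; have := sqr_ge0 (uc y); case: ifPn => yQ.
      move: yQ; rewrite inE /cube/= => /hM; rewrite ler_norml => /andP[h _].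
      by move: h; move: (W y) (uc y ^+ 2) => a b; nra.
    rewrite mulr0 addr0 => h; rewrite ler_peMl//; apply/ltW/hr.
    apply: lt_le_trans (norm_le_enorm _); apply: (@le_lt_trans _ _ r'); first by rewrite le_max lexx.
    by rewrite ltNge; apply: contra yQ => h'; rewrite inE /cube/= subr0.
  have cfc : continuous (fun y => (f y - c) ^+ 2).
    under eq_fun do rewrite expr2.
    have h : continuous (fun y => f y - c) := contB (smooth_cont sf) (@cst_continuous _ _ c).
    exact: (contM h h).
  have EV y : `|y| <= r' -> expR (V y) <= expR B /\ expR (- V y) <= expR B.
    move=> yr; have := hB y; rewrite subr0 => /(_ yr); rewrite ler_norml => /andP[h1 h2].
    by rewrite !ler_expR; split => //; rewrite lerNl.
  have W3 : J (fun y => uc y ^+ 2) <= expR B * J (fun y => (f y - c) ^+ 2).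
    rewrite /J -(@J_Z R r' r'0)//; apply: (@J_le R r' r'0) => //.
      by apply: contM => //; exact: cst_continuous.
    move=> y; rewrite /cube/= subr0 => /EV[_ h].
    have -> : uc y ^+ 2 = expR (- V y) * (f y - c) ^+ 2.
      have -> : uc y = phi0 y * (f y - c).
        rewrite /uc /f mulrBr mulrCA -expRD (_ : - V y / 2 + V y / 2 = 0); last by field.
        by rewrite expR0 mulr1 [c * _]mulrC.
      by rewrite exprMn phi0_sqr.
    by apply: ler_wpM2r => //; exact: sqr_ge0.
  have cq : continuous (fun y => \sum_i qfield u i y ^+ 2).
    by apply: smooth_cont; apply: fast_smooth; exact: fast_sum_qfield.
  have W4 : J (fun y => \sum_i partial i f y ^+ 2) <= expR B * A.
    apply: (@le_trans _ _ (J (fun y => expR B * \sum_i qfield u i y ^+ 2))).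
      apply: (@J_le R r' r'0).
      - apply: continuous_sum_fun => i; under eq_fun do rewrite expr2.
        by apply: contM; apply: smooth_cont; exact: smooth_partial.
      - by apply: contM => //; exact: cst_continuous.
      move=> y; rewrite /cube/= subr0 => /EV[h _].
      have -> : \sum_i partial i f y ^+ 2 = expR (V y) * \sum_i qfield u i y ^+ 2.
        rewrite mulr_sumr; apply: eq_bigr => i _; rewrite df exprMn mulrC; congr (_ * _).
        by rewrite -expRM_natr; congr expR; field.
      by apply: ler_wpM2r => //; apply: sumr_ge0 => i _; exact: sqr_ge0.
    rewrite /J (@J_Z R r' r'0)//; apply: ler_wpM2l => //.
    rewrite /A aform_qfield// /integralR Rintegral_mkcond; apply: le_Rintegral => //.
    - rewrite -restrict_EFin; apply/integrable_restrict => //; first exact: cube_measurable.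
      by rewrite setTI; exact: integrable_Q.
    - by apply: dom_integrable; apply: fast_dom; exact: fast_sum_qfield.
    - move=> y _; rewrite patchE; case: ifP => // _.
      by apply: sumr_ge0 => i _; exact: sqr_ge0.
  rewrite -(pihat_shift c fu); apply: le_trans (pihat_le fuc) _.
  apply: le_trans W2 _; apply: lerD => //; apply: ler_wpM2l => //.
  apply: le_trans W3 _; apply: ler_wpM2l => //.
  by apply: le_trans hc _; apply: ler_wpM2l => //; rewrite lerD2r.
(* The slack of [poincare] is sent to 0; dividing by [k + 1] covers the case [k = 0]. *)
apply/ler_addgt0Pr => e e0.
pose k := (M + 1) * (expR B * CP).
have k0 : 0 <= k by rewrite mulr_ge0// mulr_ge0.
have e1 : 0 < e / (k + 1) by rewrite divr_gt0// ltr_wpDl.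
apply: le_trans (key _ e1) _.
rewrite [leLHS](_ : _ = (1 + (M + 1) * expR B * CP * expR B) * A + k / (k + 1) * e); last first.
  by rewrite /k; field; rewrite gt_eqF// ltr_wpDl.
rewrite lerD2l ler_piMl ?(ltW e0)// ler_pdivrMr ?ltr_wpDl// mul1r.
by rewrite lerDl.
Qed.

End ground_state.

Lemma le_1p_sqr (R : realType) (a b : R) : b ^+ 2 <= a -> b <= 1 + a.
Proof. by have := sqr_ge0 (b - 1); have := sqr_ge0 b; rewrite !expr2; lra. Qed.

Section coordinates.
Context {R : realType} {n : nat}.

Lemma coord_partial (i j : 'I_n) : deriv_along (fun y : 'rV[R]_n => y 0 i) j /\
  partial j (fun y : 'rV[R]_n => y 0 i) = fun=> (i == j)%:R.
Proof.
have H y : is_derive y (e_ j : 'rV[R]_n) (fun y : 'rV[R]_n => y 0 i) ((i == j)%:R : R).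
  apply: is_derive_of_line.
  have h1 := @is_deriveZ _ _ _ (fun t : R => t) (i == j)%:R 0 1 1 (is_derive_id _ _).
  have h2 := is_deriveD (is_derive_cst (y 0 i) (0 : R) (1 : R)) h1.
  have -> : (fun s : R => (y + s *: e_ j) 0 i) = (cst (y 0 i) + (i == j)%:R \*: (fun t : R => t)).
    by apply/funext => s; rewrite !mxE eqxx /= -[RHS]/(y 0 i + (i == j)%:R * s) mulrC.
  by apply: (is_derive_eq h2); rewrite add0r -[LHS]/(_ * 1) mulr1.
split; first by move=> y; case: (H y).
by apply/funext => y; case: (H y).
Qed.

Lemma pclass_coord (i : 'I_n) : pclass (fun y : 'rV[R]_n => y 0 i).
Proof.
have c : continuous (fun y : 'rV[R]_n => y 0 i) by exact: coord_cont.
have e : expb (fun y : 'rV[R]_n => y 0 i).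
  exists 1, 1 => y; rewrite !mul1r; apply: le_trans (coord_le_norm _ _) _.
  by have := expR_ge1Dx `|y|; move: (expR _) => t; lra.
apply/tameP; case => [|k]; split => // j.
have [d ->] := coord_partial i j; split => //.
by apply: CB_cst => c'; exact: expb_cst.
Qed.

Lemma pclass_exp_coord c (i : 'I_n) : pclass (fun y : 'rV[R]_n => expR (c * y 0 i)).
Proof.
have [pc sc] := (pclass_coord i, pclass_smooth (pclass_coord i)).
apply: (@tame_expR R n (@expb R n) (@expb R n)).
- exact: expb_D.
- exact: expb_M.
- exists 1, `|c| => y; rewrite mul1r ger0_norm ?expR_ge0// ler_expR.
  apply: le_trans (ler_norm _) _; rewrite normrM; apply: ler_wpM2l => //.
  exact: coord_le_norm.
- exact: (smoothM (smooth_cst c) sc).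
move=> j; rewrite (partialM (@deriv_cst R n j c) (coord_partial i j).1) partial_cst (coord_partial i j).2.
have H := pclass_D (pclass_M (@pclass_cst R n 0) pc) (pclass_M (@pclass_cst R n c) (@pclass_cst R n (i == j)%:R)).
exact: H.
Qed.

(** A smooth weight that dominates [exp (|nu| |y|)] and lies in [pclass], so that multiplying by it
    preserves the classes in use. *)
Definition expw (nu : R) (y : 'rV[R]_n) : R := \sum_i ch (nu * y 0 i).

Lemma pclass_expw nu : pclass (expw nu).
Proof.
apply: pclass_sum => i; apply: pclass_D; first exact: pclass_exp_coord.
under eq_fun do rewrite -mulNr; exact: pclass_exp_coord.
Qed.

Lemma expw_ge nu y : (0 < n)%N -> 0 <= nu -> expR (nu * `|y|) <= expw nu y.
Proof.
move=> n0 nu0; have := cinv_le y n0 nu0.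
by rewrite /cinv expRN lef_pV2 ?posrE ?expR_gt0// sum_ch_gt0.
Qed.

Lemma expw_norm_ge nu y : (0 < n)%N -> expR (`|nu| * `|y|) <= expw nu y.
Proof.
move=> n0; rewrite (_ : expw nu y = expw `|nu| y); first exact: expw_ge.
apply: eq_bigr => i _; case: (ger0P nu) => // _.
by rewrite /ch mulNr opprK addrC.
Qed.

End coordinates.

(** * Sobolev inequality and exponentially weighted L^2 *)

Section sobolev.
Context {R : realType}.
Notation mu1 := (@lebesgue_measure R).

(** The primitive [(t - t0 - 1) F^2] vanishes at [t0 + 1] and equals [- F^2] at [t0]; its derivative
    is integrated over the unit interval between them. *)
Lemma sobolev_1d (F f : R -> R) t0 : (forall x, is_derive x (1 : R) F (f x)) -> continuous f ->
  ((F t0 ^+ 2)%:E <= \int[mu1]_t (F t ^+ 2 + F t ^+ 2 + f t ^+ 2)%:E)%E.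
Proof.
move=> dF cf; have cF := is_derive_cont dF.
pose g t := F t ^+ 2 + (t - (t0 + 1)) * (F t * f t + F t * f t).
pose h t := F t ^+ 2 + F t ^+ 2 + f t ^+ 2.
have cFF : continuous (fun t => F t ^+ 2).
  by under eq_fun do rewrite expr2; exact: (rcontM cF cF).
have cff : continuous (fun t => f t ^+ 2).
  by under eq_fun do rewrite expr2; exact: (rcontM cf cf).
have ci : continuous (fun t : R => t - (t0 + 1)).
  by apply: rcontD; [move=> t; exact: cvg_id|exact: rcont_cst].
have cg : continuous g by exact: (rcontD cFF (rcontM ci (rcontD (rcontM cF cf) (rcontM cF cf)))).
have chh : continuous h by exact: (rcontD (rcontD cFF cFF) cff).
have dG x : is_derive x (1 : R) (fun t => (t - (t0 + 1)) * (F t * F t)) (g x).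
  have h1 := is_deriveB (is_derive_id x (1 : R)) (is_derive_cst (t0 + 1) x (1 : R)).
  have h2 := is_deriveM (dF x) (dF x).
  apply: (is_derive_eq (is_deriveM h1 h2)).
  rewrite -![_ *: _]/(_ * _) /g /cst /=.
  rewrite -[(id - _) x]/(x - (t0 + 1)) -[(F * F) x]/(F x * F x).
  by move: (F x) (f x) => a b; ring.
have le01 : t0 <= t0 + 1 by rewrite lerDl.
have := ftc_seg le01 dG cg.
rewrite subrr mul0r sub0r -mulNr opprB addrAC subrr add0r mul1r -expr2 => <-.
have ig k : continuous k -> mu1.-integrable `[t0, t0 + 1]%classic (EFin \o k).
  move=> ck; apply: continuous_compact_integrable; first exact: segment_compact.
  exact: continuous_subspaceT.
apply: (@le_trans _ _ (\int[mu1]_(x in `[t0, (t0 + 1)%R]) (h x)%:E)%E).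
  apply: le_integral; [by []|exact: (ig _ cg)|exact: (ig _ chh)|].
  move=> x; rewrite inE/= in_itv/= => /andP[x0 x1]; rewrite lee_fin /g /h.
  have k0 : 0 <= t0 + 1 - x by rewrite subr_ge0.
  have k1 : 0 <= x - t0 by rewrite subr_ge0.
  have := addr_ge0 (mulr_ge0 k0 (sqr_ge0 (F x + f x))) (mulr_ge0 k1 (addr_ge0 (sqr_ge0 (F x)) (sqr_ge0 (f x)))).
  by move: (F x) (f x) => a b; rewrite !expr2; lra.
apply: ge0_subset_integral => //=.
- by apply/measurable_EFinP; exact: continuous_measurable_fun.
- by move=> x _; rewrite lee_fin /h; rewrite !addr_ge0// sqr_ge0.
Qed.

(** One coordinate at a time by [sobolev_1d], each old word entering twice because [F^2] does there.
    The right-hand side is an extended real and may be infinite. *)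
Lemma sobolev n : exists L : seq (seq 'I_n), forall u : 'rV[R]_n -> R, smooth u ->
  forall y, ((u y ^+ 2)%:E <= \int[lebesgue_rV n]_z (\sum_(s <- L) partials s u z ^+ 2)%:E)%E.
Proof.
have csq k (u : 'rV[R]_k -> R) s : smooth u -> continuous (fun z => partials s u z ^+ 2).
  move=> su; under eq_fun do rewrite expr2.
  by have c := smooth_cont (smooth_partials s su); exact: (contM c c).
have cS k (u : 'rV[R]_k -> R) (L : seq (seq 'I_k)) : smooth u -> continuous (fun z => \sum_(s <- L) partials s u z ^+ 2).
  by move=> su; apply: continuous_sum_fun => s; exact: csq.
have mS k (u : 'rV[R]_k -> R) (L : seq (seq 'I_k)) : smooth u ->
    measurable_fun setT (fun z => (\sum_(s <- L) partials s u z ^+ 2)%:E).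
  by move=> su; apply/measurable_EFinP; apply: continuous_rV_measurable; exact: cS.
have S0 k (u : 'rV[R]_k -> R) (L : seq (seq 'I_k)) z : (0 <= (\sum_(s <- L) partials s u z ^+ 2)%:E)%E.
  by rewrite lee_fin; apply: sumr_ge0 => s _; exact: sqr_ge0.
elim: n => [|n [L HL]].
  exists [:: [::]] => u su y.
  rewrite /= integral_dirac//; last exact: mS.
  by rewrite /dirac indicE mem_set// mul1e big_seq1 /= [y]thinmx0.
pose lL := [seq map (lift ord0) s | s <- L].
exists (lL ++ lL ++ [seq ord0 :: s | s <- lL]) => u su z.
rewrite -(cnsK z); move: (hd z) (tl z) => t0 y0.
have [st pt] := smooth_cnsS t0 su.
apply: le_trans (HL _ st y0) _.
pose H z := (\sum_(s <- lL ++ lL ++ [seq ord0 :: s | s <- lL]) partials s u z ^+ 2)%:E.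
rewrite (integral_cns (h := H)); [|exact: mS|move=> y; exact: S0].
rewrite (integral_cns_swap (h := H)); [|exact: mS|move=> y; exact: S0].
apply: ge0_le_integral.
- exact: measurableT.
- by move=> y _; exact: S0.
- exact: mS.
- by apply: measurable_integral_cnsr; [exact: mS|move=> y; exact: S0].
move=> y _.
apply: (@le_trans _ _ (\sum_(s <- lL) \int[mu1]_t (partials s u (cns t y) ^+ 2 +
   partials s u (cns t y) ^+ 2 + partial ord0 (partials s u) (cns t y) ^+ 2)%:E)%E).
  rewrite -sumEFin big_map; apply: lee_sum => s _; rewrite pt.
  have sp : smooth (partials (map (lift ord0) s) u) := smooth_partials _ su.
  apply: (@sobolev_1d (fun t => partials (map (lift ord0) s) u (cns t y)) (fun t => partial ord0 (partials (map (lift ord0) s) u) (cns t y))).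
    by move=> t; apply: is_derive_cns0; exact: smooth_deriv.
  exact: (continuous_compose (@continuous_cnsl _ _ y) (smooth_cont (smooth_partial ord0 sp))).
rewrite -ge0_integral_sum//=; last 2 first.
- move=> s; apply/measurable_EFinP.
  have c1 := continuous_compose (@continuous_cnsl _ _ y) (csq _ u s su).
  have c2 := continuous_compose (@continuous_cnsl _ _ y) (csq _ u (ord0 :: s) su).
  exact: (continuous_measurable_fun (rcontD (rcontD c1 c1) c2)).
- by move=> s t _; rewrite lee_fin !addr_ge0// sqr_ge0.
rewrite le_eqVlt; apply/orP; left; apply/eqP; apply: eq_integral => t _.
by rewrite sumEFin /H !big_cat/= !big_split/= !big_map addrA.
Qed.

End sobolev.

Section weighted_L2.
Context {R : realType} {n : nat}.
Implicit Types f g u : 'rV[R]_n -> R.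

Definition wl2 g := continuous g /\
  forall nu : R, integrableR (fun y => g y ^+ 2 * expR (nu * `|y|)).

Lemma wl2_D f g : wl2 f -> wl2 g -> wl2 (fun y => f y + g y).
Proof.
move=> [cf hf] [cg hg]; have c := contD cf cg; split => // nu.
have i : integrableR (fun y => 2 * (f y ^+ 2 * expR (nu * `|y|)) + 2 * (g y ^+ 2 * expR (nu * `|y|))).
  exact: (integrableD measurableT (integrableZl measurableT 2 (hf nu)) (integrableZl measurableT 2 (hg nu))).
apply: le_integrable i => //.
  apply/measurable_EFinP; apply: continuous_rV_measurable.
  apply: contM; first by under eq_fun do rewrite expr2; exact: (contM c c).
  exact: (continuous_compose (contM (@cst_continuous _ _ nu) (@norm_continuous _ _)) (@continuous_expR R)).
move=> y _; rewrite /= lee_fin.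
have := expR_gt0 (nu * `|y|); move: (expR _) (f y) (g y) => e a b e0.
rewrite (ger0_norm (mulr_ge0 (sqr_ge0 _) (ltW e0))).
apply: (le_trans _ (ler_norm _)).
by have := mulr_ge0 (ltW e0) (sqr_ge0 (a - b)); rewrite !expr2; lra.
Qed.

Lemma wl2_M f g : continuous f -> expb f -> wl2 g -> wl2 (fun y => f y * g y).
Proof.
move=> cf [C [c hC]] [cg hg]; have cfg := contM cf cg; split => // nu.
have i : integrableR (fun y => C ^+ 2 * (g y ^+ 2 * expR ((nu + 2 * c) * `|y|))).
  exact: (integrableZl measurableT _ (hg _)).
apply: le_integrable i => //.
  apply/measurable_EFinP; apply: continuous_rV_measurable.
  apply: contM; first by under eq_fun do rewrite expr2; exact: (contM cfg cfg).
  exact: (continuous_compose (contM (@cst_continuous _ _ nu) (@norm_continuous _ _)) (@continuous_expR R)).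
move=> y _; rewrite /= lee_fin; apply: (le_trans _ (ler_norm _)).
have -> : expR ((nu + 2 * c) * `|y|) = expR (c * `|y|) ^+ 2 * expR (nu * `|y|).
  by rewrite -expRM_natr -expRD; congr expR; ring.
rewrite (ger0_norm (mulr_ge0 (sqr_ge0 _) (expR_ge0 _))).
rewrite (_ : C ^+ 2 * _ = (C * expR (c * `|y|)) ^+ 2 * (g y ^+ 2 * expR (nu * `|y|))); last by ring.
rewrite exprMn -mulrA; apply: ler_wpM2r; first by rewrite mulr_ge0 ?sqr_ge0 ?expR_ge0.
have C0 : 0 <= C * expR (c * `|y|) := le_trans (normr_ge0 _) (hC y).
by rewrite -[leLHS]real_normK ?num_real// ler_sqr ?nnegrE//; exact: hC.
Qed.

(** The Sobolev inequality for [expw nu * u], whose derivatives are square integrable because [wl2]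
    admits every exponential weight, gives pointwise decay at rate [nu]. *)
Lemma tame_wl2_fast u : (0 < n)%N -> tame wl2 u -> fast u.
Proof.
move=> n0 tu; split => [|s]; first by case: tu.
have {tu} : tame wl2 (partials s u) by exact: tame_partials.
move: (partials s u) => {}u tu nu.
have tw : tame wl2 (fun y => expw nu y * u y).
  apply: (@tame_M R n (fun f => continuous f /\ expb f) wl2 wl2).
  - exact: wl2_D.
  - by move=> f g [cf ef]; exact: wl2_M.
  - have [sw ew] := pclass_expw (R := R) (n := n) nu.
    by split => // t; split => //; exact: (smooth_cont (smooth_partials t sw)).
  - exact: tu.
have [L HL] := @sobolev R n.
set g := (fun y => expw nu y * u y) in tw.
have fin : (lebesgue_rV n).-integrable setT (fun z => (\sum_(s <- L) partials s g z ^+ 2)%:E).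
  rewrite (_ : (fun z => _) = (fun z => \sum_(s <- L) (partials s g z ^+ 2)%:E)%E); last first.
    by apply/funext => z; rewrite sumEFin.
  apply: (@integrable_sum _ _ _ _ _ measurableT) => t _.
  have [_ /(_ 0)] := tw.2 t.
  by rewrite /integrableR (_ : (fun y => _) = (fun y => partials t g y ^+ 2))//; apply/funext => y; rewrite mul0r expR0 mulr1.
have := integrable_fin_num measurableT fin.
set I := (\int[_]_(_ in _) _)%E => Ifin.
have sg : smooth g by case: tw.
exists (1 + fine I) => y; rewrite expRN ler_pdivlMr ?expR_gt0//.
have := HL _ sg y; rewrite -/I -(fineK Ifin) lee_fin => h.
apply: (@le_trans _ _ `|g y|).
  have w0 : 0 <= expw nu y by apply: sumr_ge0 => i _; exact/ltW/ch_gt0.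
  rewrite /g normrM (ger0_norm w0) mulrC; apply: ler_wpM2r => //.
  apply: (@le_trans _ _ (expR (`|nu| * `|y|))).
    by rewrite ler_expR; apply: ler_wpM2r => //; exact: ler_norm.
  exact: expw_norm_ge.
have : `|g y| ^+ 2 <= fine I by rewrite real_normK ?num_real.
exact: le_1p_sqr.
Qed.

End weighted_L2.

(** * Affine changes of variables *)

Section affine.
Context {R : realType} {n k : nat}.
Variables (c : 'rV[R]_k) (M : 'M[R]_(n, k)).

Definition aff (y : 'rV[R]_n) : 'rV[R]_k := c + y *m M.

Lemma aff_line h v y : aff (h *: v + y) = h *: (v *m M) + aff y.
Proof. by rewrite /aff mulmxDl -scalemxAl addrCA. Qed.

Lemma aff_cont : continuous aff.
Proof.
apply: cont_rV => j.
have E : (fun y : 'rV[R]_n => c 0 j + \sum_i y 0 i * M i j) = (fun y => aff y 0 j).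
  by apply/funext => y; rewrite !mxE.
suff : continuous (fun y : 'rV[R]_n => c 0 j + \sum_i y 0 i * M i j) by rewrite E.
apply: contD; first exact: cst_continuous.
apply: continuous_sum_fun => i; apply: contM; [exact: coord_cont|exact: cst_continuous].
Qed.

Lemma partial_aff (g : 'rV[R]_k -> R) i :
  (forall j, deriv_along g j) -> (forall j, continuous (partial j g)) ->
  deriv_along (fun y => g (aff y)) i /\
  partial i (fun y => g (aff y)) = (fun y => \sum_j M i j * partial j g (aff y)).
Proof.
move=> dg cg.
have H y := @derive_affine R _ _ g aff y (e_ i) (e_ i *m M) (fun h => aff_line h _ y).
have D y := is_derive_directional (aff y) (e_ i *m M) dg cg.
split=> [y|]; first by apply/(H y).1; case: (D y).
apply/funext => y; rewrite [LHS](H y).2; case: (D y) => _ ->.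
by apply: eq_bigr => j _; rewrite -rowE mxE.
Qed.

Lemma CB_Z P l a (g : 'rV[R]_n -> R) : (forall f g, P f -> P g -> P (fun y => f y + g y)) ->
  (forall a f, P f -> P (fun y => a * f y)) -> CB P l g -> CB P l (fun y => a * g y).
Proof.
move=> PD PZ hg.
apply: (@CB_M R n (fun f => exists b, f = fun=> b) P P) => //.
- by move=> f h [b ->] hh; exact: PZ.
- by apply: CB_cst => b; exists b.
Qed.

Lemma CB_sum P l (I : Type) (r : seq I) (F : I -> 'rV[R]_n -> R) :
  (forall f g, P f -> P g -> P (fun y => f y + g y)) -> P (fun=> 0) ->
  (forall i, CB P l (F i)) -> CB P l (fun y => \sum_(i <- r) F i y).
Proof.
move=> PD P0 hF; elim: r => [|i r IH].
  rewrite (_ : (fun y => _) = fun=> 0); last by apply/funext => y; rewrite big_nil.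
  elim: l {hF} => [|l IH]; (split; [exact: cst_continuous|exact: P0|]) => // i.
  by rewrite partial_cst; split => //; exact: deriv_cst.
rewrite (_ : (fun y => _) = fun y => F i y + \sum_(j <- r) F j y).
  exact: (CB_D PD (hF i) IH).
by apply/funext => y; rewrite big_cons.
Qed.

Lemma tame_aff (P : ('rV[R]_k -> R) -> Prop) (Q : ('rV[R]_n -> R) -> Prop) g :
  (forall f g, Q f -> Q g -> Q (fun y => f y + g y)) ->
  (forall a f, Q f -> Q (fun y => a * f y)) -> Q (fun=> 0) ->
  (forall f, P f -> Q (fun y => f (aff y))) ->
  tame P g -> tame Q (fun y => g (aff y)).
Proof.
move=> QD QZ Q0 PQ /tameP hg; apply/tameP => l; move: (hg l) => {hg}.
elim: l g => [|l IH] g; first by move=> [cg pg _]; split; [exact: (continuous_compose aff_cont cg)|exact: PQ|].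
move=> [cg pg hg]; split; [exact: (continuous_compose aff_cont cg)|exact: PQ|] => i.
have [d ->] := partial_aff i (fun j => (hg j).1) (fun j => let: And3 c _ _ := (match l return CB P l (partial j g) -> [/\ continuous (partial j g), P (partial j g) & True] with 0%N => fun h => let: And3 a b _ := h in And3 a b I | l'.+1 => fun h => let: And3 a b _ := h in And3 a b I end) (hg j).2 in c).
split => //; apply: CB_sum => // j; apply: CB_Z => //.
by apply: IH; exact: (hg j).2.
Qed.

Lemma smooth_aff (g : 'rV[R]_k -> R) : smooth g -> smooth (fun y => g (aff y)).
Proof.
by move=> /smooth_tame sg; apply/smooth_tame; apply: (@tame_aff (fun=> True)).
Qed.

End affine.

Section matrix_norm.
Context {R : realType}.

Lemma mulmx_norm_le n k (B : 'M[R]_(n, k)) : exists2 K, 0 <= K & forall v : 'rV[R]_n, `|v *m B| <= K * `|v|.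
Proof.
have K0 : 0 <= \sum_i \sum_j `|B i j| by apply: sumr_ge0 => i _; apply: sumr_ge0.
exists (\sum_i \sum_j `|B i j|) => // v; apply: rV_norm_le; first exact: mulr_ge0.
move=> j; rewrite mxE; apply: le_trans (ler_norm_sum _ _ _) _.
rewrite mulr_suml; apply: ler_sum => i _; rewrite normrM mulrC.
apply: ler_pM => //; last exact: coord_le_norm.
by rewrite (bigD1 j)//= lerDl; apply: sumr_ge0.
Qed.

Lemma expb_Z n a (f : 'rV[R]_n -> R) : expb f -> expb (fun y => a * f y).
Proof. by move=> ef; exact: (expb_M (@expb_cst R n a) ef). Qed.

Lemma edec_Z n a (f : 'rV[R]_n -> R) : edec f -> edec (fun y => a * f y).
Proof. by move=> ef; exact: (edec_M (@expb_cst R n a) ef). Qed.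

Lemma edec0 n : edec (fun _ : 'rV[R]_n => 0 : R).
Proof. by move=> nu; exists 0 => y; rewrite mul0r normr0. Qed.

Lemma aff_norm_le n k (c : 'rV[R]_k) (M : 'M[R]_(n, k)) :
  exists2 K, 0 <= K & forall y, `|aff c M y| <= `|c| + K * `|y|.
Proof.
have [K K0 hK] := mulmx_norm_le M; exists K => // y.
by apply: le_trans (ler_normD _ _) _; rewrite lerD2l.
Qed.

(** The right inverse [B] makes [y] recoverable from [aff c M y] up to a constant, so decay in the
    image variable gives decay in [y]. *)
Lemma fast_aff n k (c : 'rV[R]_k) (M : 'M[R]_(n, k)) (B : 'M[R]_(k, n)) g : M *m B = 1%:M ->
  fast g -> fast (fun y => g (aff c M y)).
Proof.
move=> MB; apply: tame_aff; [exact: edec_D|exact: edec_Z|exact: edec0|].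
move=> f hf nu; have [K K0 hK] := mulmx_norm_le B.
have [C hC] := hf (`|nu| * K).
have C0 : 0 <= C by have := le_trans (normr_ge0 _) (hC 0); rewrite pmulr_lge0// expR_gt0.
exists (C * expR (`|nu| * K * `|c|)) => y.
apply: le_trans (hC _) _; rewrite -[leRHS]mulrA -expRD; apply: ler_wpM2l => //; rewrite ler_expR.
have h : `|y| <= K * (`|aff c M y| + `|c|).
  rewrite (_ : `|y| = `|(aff c M y - c) *m B|); last first.
    by rewrite /aff addrAC subrr add0r -mulmxA MB mulmx1.
  by apply: le_trans (hK _) _; apply: ler_wpM2l => //; exact: ler_normB.
have : nu * `|y| <= `|nu| * (K * (`|aff c M y| + `|c|)).
  apply: le_trans (ler_wpM2r (normr_ge0 _) (ler_norm nu)) _.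
  by apply: ler_wpM2l.
by move: (nu * `|y|) `|nu| `|aff c M y| `|c| => a b d e; rewrite !mulrDr !mulrA; lra.
Qed.

End matrix_norm.

(** * Assumptions A and B in terms of the classes *)

Section assumptions.
Context {R : realType} {n : nat}.

Lemma expR_enorm_le (nu : R) (y : 'rV[R]_n) : expR (nu * enorm y) <= expR (`|nu| * n%:R * `|y|).
Proof.
rewrite ler_expR -mulrA; apply: le_trans (ler_wpM2r (enorm_ge0 _) (ler_norm nu)) _.
by apply: ler_wpM2l => //; exact: enorm_le.
Qed.

Lemma pclass_of_A (V : 'rV[R]_n -> R) : smooth V -> assumption_A V -> pclass V.
Proof.
move=> sV [_ hA]; split=> [//|s]; rewrite partials_multi_partial//.
have [c c0 [nu h]] := hA (fun i => count_mem i s).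
exists c, (`|nu| * n%:R) => y; apply: le_trans (h y) _.
by apply: ler_wpM2l; [exact: ltW|exact: expR_enorm_le].
Qed.

Lemma wl2_of_in_E (g : 'rV[R]_n -> R) : in_E g -> wl2 g.
Proof.
move=> [sg _ hg]; have cg := smooth_cont sg; split => // nu.
apply: le_integrable (hg `|nu|) => //.
  apply/measurable_EFinP; apply: continuous_rV_measurable.
  apply: contM; first by under eq_fun do rewrite expr2; exact: (contM cg cg).
  exact: (continuous_compose (contM (@cst_continuous _ _ nu) (@norm_continuous _ _)) (@continuous_expR R)).
move=> y _; rewrite /= lee_fin.
rewrite (ger0_norm (mulr_ge0 (sqr_ge0 _) (expR_ge0 _))); apply: (le_trans _ (ler_norm _)).
apply: ler_wpM2l; first exact: sqr_ge0.
rewrite ler_expR; apply: le_trans (ler_wpM2r (normr_ge0 _) (ler_norm nu)) _.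
by apply: ler_wpM2l => //; exact: norm_le_enorm.
Qed.

(** Assumption B concerns [phi0] times a derivative of [F], whereas [fast] asks for derivatives of
    the product. Differentiating [phi0] brings out derivatives of [V], which the factor in [pclass]
    collects; this is why the induction runs over all such factors. *)
Lemma fast_of_in_E (V F P : 'rV[R]_n -> R) : (0 < n)%N -> pclass V -> smooth F ->
  (forall a, in_E (fun y => expR (- V y / 2) * multi_partial a F y)) -> pclass P ->
  fast (fun y => P y * (phi0 V y * F y)).
Proof.
move=> n0 pV sF hE pP; apply: tame_wl2_fast => //; apply/tameP => k.
have sV := pclass_smooth pV; have s0 := smooth_phi0 pV.
have hw s : wl2 (fun y => phi0 V y * partials s F y).
  by rewrite partials_multi_partial//; exact: wl2_of_in_E.
suff H s Q : pclass Q -> CB (@wl2 R n) k (fun y => Q y * (phi0 V y * partials s F y)) by exact: (H [::] P pP).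
elim: k s Q => [|k IH] s Q pQ.
  have w : wl2 (fun y => Q y * (phi0 V y * partials s F y)).
    by apply: wl2_M (hw s); [exact: (smooth_cont (pclass_smooth pQ))|exact: (pQ.2 [::])].
  by split => //; case: w.
have w : wl2 (fun y => Q y * (phi0 V y * partials s F y)).
  by apply: wl2_M (hw s); [exact: (smooth_cont (pclass_smooth pQ))|exact: (pQ.2 [::])].
split=> [||i]; [by case: w|exact: w|].
have sQ := pclass_smooth pQ; have ss : smooth (partials s F) := smooth_partials s sF.
have dF := smooth_deriv (i := i) ss.
have d0 := smooth_deriv (i := i) s0.
have dQ := smooth_deriv (i := i) sQ.
split; first exact: (derivM dQ (derivM d0 dF)).
rewrite (partialM dQ (derivM d0 dF)) (partialM d0 dF) (partial_phi0 pV).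
rewrite (_ : (fun y => _) = (fun y => (partial i Q y + Q y * (- 2^-1 * partial i V y)) * (phi0 V y * partials s F y)
   + Q y * (phi0 V y * partials (i :: s) F y))); last first.
  apply/funext => y; rewrite -[partials (i :: s) F y]/(partial i (partials s F) y).
  move: (partial i (partials s F) y) (partials s F y) (phi0 V y) (partial i V y) (partial i Q y) (Q y) => a b c d e g.
  by field.
apply: CB_D; [exact: wl2_D| |exact: IH].
apply: IH; apply: (pclass_D (pclass_partial i pQ) (pclass_M pQ _)).
exact: (pclass_M (@pclass_cst R n _) (pclass_partial i pV)).
Qed.

End assumptions.

Section data.
Context {R : realType} {m n : nat}.
Variables (V : 'rV[R]_n -> R) (f : 'rV[R]_m -> 'rV[R]_n -> 'rV[R]_m).
Hypothesis n0 : (0 < n)%N.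
Hypothesis pV : pclass V.
Hypothesis sf : forall i, smooth (fun z : 'rV[R]_(m + n) => f (lsubmx z) (rsubmx z) 0 i).
Hypothesis hB : assumption_B V f.

Let J i : 'rV[R]_(m + n) -> R := fun z => f (lsubmx z) (rsubmx z) 0 i.
Let ins (x : 'rV[R]_m) (y : 'rV[R]_n) : 'rV[R]_(m + n) := row_mx x y.

Lemma insE x y : ins x y = aff (row_mx x 0) (row_mx 0 1%:M) y.
Proof. by rewrite /aff mul_mx_row mulmx0 mulmx1 add_row_mx addr0 add0r. Qed.

Lemma smooth_ins (g : 'rV[R]_(m + n) -> R) x : smooth g -> smooth (fun y => g (ins x y)).
Proof. by move=> sg; under eq_fun do rewrite insE; exact: smooth_aff. Qed.

Lemma insxE x y : ins x y = aff (row_mx 0 y) (row_mx 1%:M 0) x.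
Proof. by rewrite /aff mul_mx_row mulmx0 mulmx1 add_row_mx addr0 add0r. Qed.

Lemma smooth_insx (g : 'rV[R]_(m + n) -> R) y : smooth g -> smooth (fun x => g (ins x y)).
Proof. by move=> sg; under eq_fun do rewrite insxE; exact: smooth_aff. Qed.

Lemma partial_insx (g : 'rV[R]_(m + n) -> R) x y j : smooth g ->
  partial j (fun x => g (ins x y)) x = partial (lshift n j) g (ins x y).
Proof.
move=> sg.
have H h : ins (h *: e_ j + x) y = h *: e_ (lshift n j) + ins x y.
  apply/rowP => k; case: (split_ordP k) => l ->.
    by rewrite [LHS]row_mxEl [RHS]mxE row_mxEl !mxE eqxx /= (inj_eq (@lshift_inj _ _)).
  by rewrite [LHS]row_mxEr [RHS]mxE row_mxEr !mxE eqxx eq_rlshift /= mulr0 add0r.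
exact: (@derive_affine R _ _ g (fun x => ins x y) x (e_ j) (e_ (lshift n j)) H).2.
Qed.

Lemma fJ x y i : f x y 0 i = J i (ins x y).
Proof. by rewrite /J /ins row_mxKl row_mxKr. Qed.

Lemma smooth_fx x i : smooth (fun y => f x y 0 i).
Proof. by under eq_fun do rewrite fJ; exact: (smooth_ins x (sf i)). Qed.

Lemma grad_fJ x y i j : grad_x f x y i j = partial (lshift n j) (J i) (ins x y).
Proof.
rewrite mxE -(partial_insx x y j (sf i)); congr (partial j _ x).
by apply/funext => x'; rewrite fJ.
Qed.

Lemma smooth_grad_fx x i j : smooth (fun y => grad_x f x y i j).
Proof.
by under eq_fun do rewrite grad_fJ; exact: (smooth_ins x (smooth_partial _ (sf i))).
Qed.

Lemma fast_fx x i : fast (fun y => phi0 V y * f x y 0 i).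
Proof.
have := fast_of_in_E n0 pV (smooth_fx x i) (fun a => (hB a x).1 i) (@pclass_cst R n 1).
by congr fast; apply/funext => y; rewrite mul1r.
Qed.

Lemma fast_grad_fx x i j : fast (fun y => phi0 V y * grad_x f x y i j).
Proof.
have := fast_of_in_E n0 pV (smooth_grad_fx x i j) (fun a => (hB a x).2 i j) (@pclass_cst R n 1).
by congr fast; apply/funext => y; rewrite mul1r.
Qed.

End data.

(** * Polynomial growth *)

Section polynomial_growth.
Context {R : realType} {n : nat}.
Implicit Types f g : 'rV[R]_n -> R.

Definition polb g := exists C N, forall y, `|g y| <= C * (1 + `|y|) ^+ N.

Lemma polb_nonneg g C N : (forall y, `|g y| <= C * (1 + `|y|) ^+ N) -> 0 <= C.
Proof. by move=> /(_ 0) h; have := le_trans (normr_ge0 _) h; rewrite normr0 addr0 expr1n mulr1. Qed.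

Lemma polb_D f g : polb f -> polb g -> polb (fun y => f y + g y).
Proof.
move=> [C [N hf]] [D [K hg]]; have [C0 D0] := (polb_nonneg hf, polb_nonneg hg).
exists (C + D), (N + K)%N => y; apply: le_trans (ler_normD _ _) _.
rewrite mulrDl; apply: lerD.
  apply: le_trans (hf y) _; apply: ler_wpM2l => //.
  by apply: ler_weXn2l; [rewrite lerDl|exact: leq_addr].
apply: le_trans (hg y) _; apply: ler_wpM2l => //.
by apply: ler_weXn2l; [rewrite lerDl|exact: leq_addl].
Qed.

Lemma polb_M f g : polb f -> polb g -> polb (fun y => f y * g y).
Proof.
move=> [C [N hf]] [D [K hg]]; exists (C * D), (N + K)%N => y.
by rewrite normrM exprD mulrACA; apply: ler_pM.
Qed.

Lemma polb_cst c : polb (fun=> c).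
Proof. by exists `|c|, 0%N => y; rewrite expr0 mulr1. Qed.

Lemma polb_coord i : polb (fun y => y 0 i).
Proof.
exists 1, 1%N => y; rewrite mul1r expr1; apply: le_trans (coord_le_norm _ _) _.
by rewrite lerDr.
Qed.

Lemma polb_le f g : (forall y, `|f y| <= `|g y|) -> polb g -> polb f.
Proof. by move=> h [C [N hg]]; exists C, N => y; exact: le_trans (h y) (hg y). Qed.

Lemma polb_expb g : polb g -> expb g.
Proof.
move=> [C [N h]]; have C0 := polb_nonneg h; exists C, N%:R => y.
apply: le_trans (h y) _; apply: ler_wpM2l => //.
rewrite mulrC expRM_natr; apply: lerXn2r; rewrite ?nnegrE ?expR_ge0 ?addr_ge0//.
exact: expR_ge1Dx.
Qed.

Lemma polb_poly_eval (q : mpoly.mpoly n R) : polb (poly_eval q).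
Proof.
rewrite /poly_eval.
under eq_fun do rewrite mpoly.mevalE.
elim: (mpoly.msupp q) => [|t r IH].
  by under eq_fun do rewrite big_nil; exact: polb_cst.
under eq_fun do rewrite big_cons; apply: polb_D => //; apply: polb_M; first exact: polb_cst.
elim: (index_enum _) => [|i e IHe].
  by under eq_fun do rewrite big_nil; exact: polb_cst.
under eq_fun do rewrite big_cons; apply: polb_M => //.
elim: (mpoly.fun_of_multinom t i) => [|k IHk]; first by under eq_fun do rewrite expr0; exact: polb_cst.
by under eq_fun do rewrite exprS; apply: polb_M => //; exact: polb_coord.
Qed.

End polynomial_growth.

(** * Decay of the exact solution *)

Section schroedinger.
Context {R : realType} {n : nat}.
Variable V : 'rV[R]_n -> R.
Hypotheses (n0 : (0 < n)%N) (pV : pclass V) (cV : coercive V) (cW : coercive (Wpot V)).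

Let sV : smooth V := pclass_smooth pV.

(** Conjugation by [phi0] turns the generator [laplacian - grad V . grad] into the Schroedinger
    operator [laplacian - Wpot V]. *)
Lemma laplacian_phi0M (u : 'rV[R]_n -> R) y : smooth u ->
  laplacian (fun y => phi0 V y * u y) y =
  Wpot V y * (phi0 V y * u y) + phi0 V y * (laplacian u y - dot (grad V y) (grad u y)).
Proof.
move=> su; have s0 := smooth_phi0 pV.
have E i : partial i (partial i (fun y => phi0 V y * u y)) y =
   partial i (partial i (phi0 V)) y * u y + phi0 V y * (partial i (partial i u) y - partial i V y * partial i u y).
  have d0 := smooth_deriv (i := i) s0; have du := smooth_deriv (i := i) su.
  have dd0 := smooth_deriv (i := i) (smooth_partial i s0).
  have ddu := smooth_deriv (i := i) (smooth_partial i su).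
  rewrite (partialM d0 du) [LHS](congr1 (@^~ y) (partialD (derivM dd0 du) (derivM d0 ddu))).
  rewrite (congr1 (@^~ y) (partialM dd0 du)) (congr1 (@^~ y) (partialM d0 ddu)).
  have e0 : partial i (phi0 V) y = - partial i V y / 2 * phi0 V y by rewrite (partial_phi0 pV).
  rewrite e0; move: (partial i (partial i (phi0 V)) y) (partial i (partial i u) y) (partial i V y) (partial i u y) (phi0 V y) (u y).
  by move=> a b c d e g; field.
rewrite {1}/laplacian (eq_bigr _ (fun i _ => E i)) big_split/= -mulr_suml -mulr_sumr sumrB.
have -> : \sum_i partial i (partial i (phi0 V)) y = Wpot V y * phi0 V y by exact: (eq_phi0 pV y).
rewrite -mulrA; congr (_ + _ * (_ - _)).
by apply: eq_bigr => i _; rewrite !mxE.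
Qed.

Lemma fast_of_poisson (u g : 'rV[R]_n -> R) : smooth u -> expb u ->
  (forall y, - (laplacian u y - dot (grad V y) (grad u y)) = g y) ->
  fast (fun y => phi0 V y * g y) ->
  fast (fun y => phi0 V y * u y) /\
  (forall y, laplacian (fun y => phi0 V y * u y) y = Wpot V y * (phi0 V y * u y) - phi0 V y * g y).
Proof.
move=> su eu eq fg.
have E y : laplacian (fun y => phi0 V y * u y) y = Wpot V y * (phi0 V y * u y) - phi0 V y * g y.
  by rewrite laplacian_phi0M// -eq mulrN opprK.
split; last exact: E.
apply: (fast_of_equation _ _ (pclass_W pV) fg E).
  exact: (smoothM (smooth_phi0 pV) su).
have e0 : edec (phi0 V) := (fast_phi0 n0 pV cV cW).2 [::].
by have := edec_M eu e0; congr edec; apply/funext => y; rewrite mulrC.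
Qed.

Lemma poly_growth_expb (u : 'rV[R]_n -> R) : (exists q : mpoly.mpoly n R, forall y, `|u y| <= poly_eval q y) -> expb u.
Proof.
move=> [q hq]; apply: polb_expb; apply: polb_le (polb_poly_eval q) => y.
by apply: le_trans (hq y) _; exact: ler_norm.
Qed.

End schroedinger.

Lemma continuous_dist (R : realType) (T : topologicalType) (f : T -> R) :
  (forall y e, 0 < e -> \forall z \near y, `|f y - f z| <= e) -> continuous f.
Proof. by move=> h y; apply/cvgrPdist_le => e e0; exact: h. Qed.

Lemma continuous_near (R : realType) (T : topologicalType) (f : T -> R) y e :
  continuous f -> 0 < e -> \forall z \near y, `|f y - f z| <= e.
Proof. by move=> cf e0; have /cvgrPdist_le/(_ e e0) := cf y. Qed.

(** * Differentiability in the parameter *)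

Section limits.
Context {R : realType} {n : nat}.

(** [G s] is the candidate for the derivative along the word [s]; limits and integrals of
    derivatives produce such families for all orders at once. *)
Lemma smooth_tower (G : seq 'I_n -> 'rV[R]_n -> R) : (forall s, continuous (G s)) ->
  (forall s i y, is_derive y (e_ i) (G s) (G (i :: s) y)) ->
  smooth (G [::]) /\ forall s, partials s (G [::]) = G s.
Proof.
move=> cG dG.
have E s : partials s (G [::]) = G s.
  elim: s => [//|i s IH] /=; rewrite IH; apply/funext => y.
  by case: (dG s i y).
by split => // s; rewrite E; split => // i y; case: (dG s i y).
Qed.

Definition unit_step (h : R) := 0 < `|h| <= 1.

Lemma small_step (K e : R) : 0 < e -> exists2 h, unit_step h & K * `|h| <= e.
Proof.
move=> e0; have K1 : 0 < `|K| + 1 by rewrite ltr_wpDl.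
pose h := Num.min 1 (e / (`|K| + 1)).
have h0 : 0 < h by rewrite lt_min ltr01 divr_gt0.
exists h; first by rewrite /unit_step gtr0_norm// h0 ge_min lexx.
rewrite gtr0_norm//.
have : h <= e / (`|K| + 1) by rewrite ge_min lexx orbT.
rewrite ler_pdivlMr// => H; apply: le_trans H.
by rewrite mulrC; apply: ler_wpM2l; [exact: ltW|apply: le_trans (ler_norm _) _; rewrite lerDl].
Qed.

(* The steps h range over a punctured neighbourhood of 0, and Cauchy estimates for
   all derivatives replace a convergence theorem. *)
Lemma limit_tower (u : R -> 'rV[R]_n -> R) : (forall h, unit_step h -> smooth (u h)) ->
  (forall s r, exists2 C, 0 <= C & forall h k, unit_step h -> unit_step k -> forall y, `|y| <= r ->
     `|partials s (u h) y - partials s (u k) y| <= C * (`|h| + `|k|)) ->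
  exists2 chi, smooth chi & forall s r, exists2 C, 0 <= C & forall h, unit_step h ->
     forall y, `|y| <= r -> `|partials s (u h) y - partials s chi y| <= C * `|h|.
Proof.
move=> su hu.
pose t N : R := N.+1%:R^-1.
have tN N : unit_step (t N).
  by rewrite /unit_step /t gtr0_norm ?invr_gt0// ?ltr0n//= invf_le1 ?ltr0n// ler1n.
have t0 N : `|t N| = t N by rewrite gtr0_norm// invr_gt0 ltr0n.
have tmono N M : (N <= M)%N -> t M <= t N.
  by move=> NM; rewrite /t lef_pV2 ?posrE ?ltr0n// ler_nat.
have tsmall K e : 0 < e -> exists N, K * t N <= e.
  move=> e0; have [h /andP[h0 _] hK] := small_step `|K| e0.
  have [N hN] : exists N, t N <= `|h|.
    exists (Num.truncn (`|h|^-1)); rewrite /t -[leRHS]invrK lef_pV2 ?posrE ?ltr0n ?invr_gt0//.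
    by apply: ltW; exact: truncnS_gt.
  exists N; apply: le_trans hK; apply: le_trans (ler_wpM2r _ (ler_norm K)) _.
    by rewrite /t invr_ge0.
  by apply: ler_wpM2l.
pose c s y N := partials s (u (t N)) y.
have cc s y : cvgn (c s y).
  apply/cauchy_cvgP; apply: cauchy_exP => e e0.
  have [C C0 hC] := hu s `|y|.
  have [N hN] := tsmall (2 * C + 1) (e / 2) (divr_gt0 e0 (ltr0n _ 2)).
  exists (c s y N); exists N => // M /= NM.
  rewrite /ball/= distrC; apply: le_lt_trans (hC _ _ (tN M) (tN N) y (lexx _)) _.
  rewrite !t0; have tM := tmono _ _ NM; have tN0 : 0 < t N by rewrite invr_gt0 ltr0n.
  have : C * t M <= C * t N by apply: ler_wpM2l.
  by move: hN tN0 e0; move: (t N) (t M) => a b; rewrite mulrDr; lra.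
pose chi s y := limn (c s y).
have B s r : exists2 C, 0 <= C & forall h, unit_step h -> forall y, `|y| <= r ->
    `|partials s (u h) y - chi s y| <= C * `|h|.
  have [C C0 hC] := hu s r; exists C => // h hh y yr.
  apply/ler_addgt0Pr => e e0.
  have [N hN] := tsmall C (e / 2) (divr_gt0 e0 (ltr0n _ 2)).
  have /cvgrPdist_le/(_ (e / 2)) := cc s y.
  rewrite divr_gt0// => /(_ isT) [N' _ hN'].
  pose M := maxn N N'.
  have h1 := hN' M (leq_maxr _ _); rewrite distrC in h1.
  have h2 := hC h (t M) hh (tN M) y yr.
  rewrite t0 mulrDr in h2.
  have h3 : C * t M <= C * t N by apply: ler_wpM2l => //; apply: tmono; exact: leq_maxl.
  rewrite -[X in `|X|](subrKA (c s y M)).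
  apply: le_trans (ler_normD _ _) _; move: h1 h2 h3 hN; rewrite -/(chi s y) -/(c s y M).
  by move: `|c s y M - chi s y| `|partials s (u h) y - c s y M| (C * `|h|) (C * t M) (C * t N) => a1 a2 a3 a4 a5; lra.
have cchi s : continuous (chi s).
  apply: continuous_dist => y e e0.
  have [C C0 hC] := B s (`|y| + 1).
  have [h hh hK] := small_step C (divr_gt0 e0 (ltr0n _ 3)).
  have H := continuous_near y (smooth_cont (smooth_partials s (su h hh))) (divr_gt0 e0 (ltr0n _ 3)).
  have H1 : \forall z \near y, `|z| <= `|y| + 1.
    apply: filterS (continuous_near y (@norm_continuous _ _) ltr01) => z.
    by rewrite distrC ler_distl => /andP[].
  apply: filterS2 H H1 => z Hz zr.
  have h1 := hC h hh z zr; have yy : `|y| <= `|y| + 1 by rewrite lerDl.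
  have h2 := hC h hh y yy.
  have -> : chi s y - chi s z = - (partials s (u h) y - chi s y) + (partials s (u h) y - partials s (u h) z) + (partials s (u h) z - chi s z).
    by move: (chi s y) (chi s z) (partials s (u h) y) (partials s (u h) z) => a1 a2 a3 a4; ring.
  apply: le_trans (ler_normD _ _) _; apply: le_trans (lerD (ler_normD _ _) (lexx _)) _.
  rewrite normrN; move: h1 h2 Hz hK.
  by move: `|_ - chi s y| `|_ - chi s z| `|_ - partials s (u h) z| (C * `|h|) => a1 a2 a3 a4; lra.
have dchi s i y : is_derive y (e_ i) (chi s) (chi (i :: s) y).
  suff L : h^-1 *: (chi s (h *: e_ i + y) - chi s y) @[h --> (0 : R)^'] --> chi (i :: s) y.
    by split; [apply/cvg_ex; exists (chi (i :: s) y)|exact: cvg_lim L].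
  apply/cvgrPdist_le => e e0.
  have /nbhs_ballP[d /= d0 hd] := continuous_near y (cchi (i :: s)) (divr_gt0 e0 (ltr0n _ 2)).
  near=> a.
  have a0 : a != 0 by near: a; exact: nbhs_dnbhs_neq.
  have a0' : 0 < `|a| by rewrite normr_gt0.
  have ad : `|a| < d by near: a; exact: dnbhs0_lt.
  apply/ler_addgt0Pr => e' e'0.
  have [C C0 hC] := B (i :: s) (`|y| + `|a|).
  have [D D0 hD] := B s (`|y| + `|a|).
  have K0 : 0 < e' / 1 by rewrite divr1.
  (* The increment [a] is fixed before [h]: the error of replacing [chi] by [u h] gets divided by
     [a], and [h] is taken small enough to compensate. *)
  have [h hh hK] := small_step (C + `|a|^-1 * (D + D)) e'0.
  have sh := su h hh.
  have [th /andP[th0 th1] E] := mvt 0 a (fun x => partial_line y x (smooth_deriv (i := i) (smooth_partials s sh))).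
  rewrite subr0 add0r scale0r addr0 in E.
  set z := y + (th * a) *: e_ i in E.
  have dl : `|(e_ i : 'rV[R]_n)| <= 1.
    by apply: rV_norm_le => // k; rewrite mxE eqxx /=; case: (k == i); rewrite ?normr1 ?normr0.
  have nz : `|(th * a) *: (e_ i : 'rV[R]_n)| <= `|a|.
    rewrite mx_normZ normrM (ger0_norm th0); apply: le_trans (ler_wpM2l _ dl) _; first by rewrite mulr_ge0.
    by rewrite mulr1 ler_piMl.
  have na : `|a *: (e_ i : 'rV[R]_n)| <= `|a|.
    by rewrite mx_normZ; apply: le_trans (ler_wpM2l _ dl) _ => //; rewrite mulr1.
  have h1 := hC h hh z (le_trans (ler_normD _ _) (lerD (lexx _) nz)).
  have h2 := hD h hh (a *: e_ i + y).
  rewrite (addrC _ y) in h2; have {}h2 := h2 (le_trans (ler_normD _ _) (lerD (lexx _) na)).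
  have h3 := hD h hh y; rewrite lerDl normr_ge0 in h3; have {}h3 := h3 isT.
  have h4 : `|chi (i :: s) y - chi (i :: s) z| <= e / 2.
    apply: hd; rewrite mx_norm_ball /ball_/= /z opprD addNKr normrN.
    exact: le_lt_trans nz ad.
  rewrite (addrC _ y).
  have E2 : a^-1 * (partials s (u h) (y + a *: e_ i) - partials s (u h) y) = partials (i :: s) (u h) z.
    by rewrite E mulrC mulfK.
  have -> : chi (i :: s) y - a^-1 *: (chi s (y + a *: e_ i) - chi s y) =
     (chi (i :: s) y - chi (i :: s) z) - (partials (i :: s) (u h) z - chi (i :: s) z)
     + a^-1 * ((partials s (u h) (y + a *: e_ i) - chi s (y + a *: e_ i)) - (partials s (u h) y - chi s y)).
    rewrite -E2 -[_ *: _]/(_ * _).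
    move: (chi (i :: s) y) (chi (i :: s) z) (chi s y) (chi s _) (partials s (u h) y) (partials s (u h) _) a^-1.
    by move=> a1 a2 a3 a4 a5 a6 a7; ring.
  apply: le_trans (ler_normD _ _) _; apply: le_trans (lerD (ler_normB _ _) (lexx _)) _.
  rewrite normrM normfV.
  have h5 : `|a|^-1 * `|partials s (u h) (y + a *: e_ i) - chi s (y + a *: e_ i) - (partials s (u h) y - chi s y)| <= `|a|^-1 * ((D + D) * `|h|).
    apply: ler_wpM2l; first by rewrite invr_ge0.
    by apply: le_trans (ler_normB _ _) _; rewrite mulrDl; apply: lerD.
  rewrite mulrDl -mulrA in hK.
  have pure (a1 a2 a3 a4 a5 : R) : a1 <= a2 -> a4 <= e / 2 -> a5 <= a3 -> a3 + a2 <= e' -> a4 + a5 + a1 <= e + e'.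
    by move: e0; lra.
  exact: (pure _ _ _ _ _ h5 h4 h1 hK).
have [sc E] := smooth_tower cchi dchi.
by exists (chi [::]) => // s r; rewrite E; exact: B.
Unshelve. all: by end_near. Qed.

End limits.

(** * Local estimates for derivatives of every order *)

Section interior.
Context {R : realType} {n : nat}.

(** The point is uniformity: the constant depends on [W], [r] and [k], the function [w] enters only
    through [A]. *)
Lemma leibniz_bound r k (W : 'rV[R]_n -> R) : smooth W -> exists2 C, 0 <= C &
  forall (w : 'rV[R]_n -> R) (A : R), smooth w ->
    (forall t y, (size t <= k)%N -> `|y| <= r -> `|partials t w y| <= A) ->
    forall s y, (size s <= k)%N -> `|y| <= r -> `|partials s (fun y => W y * w y) y| <= C * A.
Proof.
elim: k W => [|k IH] W sW.
  have [M M0 hM] := cont_bounded 0 r (smooth_cont sW); exists M => // w A sw hA s y.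
  rewrite leqn0 size_eq0 => /eqP -> yr /=; rewrite normrM; apply: ler_pM => //.
    by apply: hM; rewrite subr0.
  exact: (hA [::]).
have [C0 C00 h0] := IH W sW.
have /choice[Cf hCf] : forall i, exists C, 0 <= C /\ forall (w : 'rV[R]_n -> R) (A : R), smooth w ->
    (forall t y, (size t <= k)%N -> `|y| <= r -> `|partials t w y| <= A) ->
    forall s y, (size s <= k)%N -> `|y| <= r -> `|partials s (fun y => partial i W y * w y) y| <= C * A.
  by move=> i; have [C ? ?] := IH (partial i W) (smooth_partial i sW); exists C.
have S0 : 0 <= \sum_i Cf i by apply: sumr_ge0 => i _; exact: (hCf i).1.
exists (C0 + \sum_i Cf i); first exact: addr_ge0.
move=> w A sw hA s y.
have A0 (z : 'rV[R]_n) : `|z| <= r -> 0 <= A by move=> zr; apply: le_trans (hA [::] z _ zr).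
rewrite leq_eqVlt => /orP[/eqP sk yr|sk yr]; last first.
  apply: le_trans (h0 w A sw _ s y _ yr) _ => //.
    by move=> t z tk; apply: hA; exact: leqW.
  by rewrite mulrDl lerDl mulr_ge0 ?(A0 y).
case/lastP: s sk => // s i; rewrite size_rcons => -[sk].
rewrite partials_rcons (partialM (smooth_deriv sW) (smooth_deriv sw)).
rewrite partialsD; [|exact: (smoothM (smooth_partial i sW) sw)|exact: (smoothM sW (smooth_partial i sw))].
apply: le_trans (ler_normD _ _) _; rewrite addrC mulrDl; apply: lerD.
  apply: (h0 (partial i w) A (smooth_partial i sw)); rewrite ?sk//.
  by move=> t z tk zr; rewrite -partials_rcons; apply: hA => //; rewrite size_rcons.
apply: (@le_trans _ _ (Cf i * A)).
  by apply: (hCf i).2; rewrite ?sk// => t z tk; apply: hA; exact: leqW.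
apply: ler_wpM2r; first exact: (A0 y).
by rewrite (bigD1 i)//= lerDl; apply: sumr_ge0 => j _; exact: (hCf j).1.
Qed.

(** Each derivative is gained by the gradient bound on a unit cube, so each order costs one unit of
    radius, whence [r + k]. *)
Lemma interior_estimate (W : 'rV[R]_n -> R) k r : smooth W -> exists2 C, 0 <= C &
  forall (w G : 'rV[R]_n -> R) (A : R), smooth w -> smooth G ->
    (forall y, laplacian w y = W y * w y - G y) -> 0 <= A ->
    (forall y, `|y| <= r + k%:R -> `|w y| <= A) ->
    (forall t y, (size t <= k)%N -> `|y| <= r + k%:R -> `|partials t G y| <= A) ->
    forall s y, (size s <= k)%N -> `|y| <= r -> `|partials s w y| <= C * A.
Proof.
move=> sW; elim: k r => [|k IH] r.
  exists 1 => // w G A sw sG eq A0 hw hG s y; rewrite leqn0 size_eq0 => /eqP -> yr /=.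
  by rewrite mul1r; apply: hw; rewrite addr0.
have [C C0 hC] := IH (r + 1).
have [L L0 hL] := leibniz_bound (r + 1) k sW.
pose T := n%:R / 1 * C + 1 / 2 * (L * C + 1).
have T0 : 0 <= T by rewrite /T addr_ge0// mulr_ge0// ?divr_ge0// addr_ge0// mulr_ge0.
exists (C + T); first exact: addr_ge0.
move=> w G A sw sG eq A0 hw hG s y sk yr.
have Er : r + 1 + k%:R = r + k.+1%:R by rewrite -addrA -natr1 [1 + _]addrC.
have H t z : (size t <= k)%N -> `|z| <= r + 1 -> `|partials t w z| <= C * A.
  apply: (hC w G A) => // [z'|t' z' tk]; rewrite Er; first exact: hw.
  by apply: hG; exact: leqW.
move: sk; rewrite leq_eqVlt => /orP[/eqP sk|sk]; last first.
  apply: le_trans (H s y sk (le_trans yr _)) _; first by rewrite lerDl.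
  by rewrite mulrDl lerDl mulr_ge0.
case: s sk => // i s [sk] /=.
have inc z : cube y 1 z -> `|z| <= r + 1.
  rewrite /cube/= => zy; rewrite -(subrK y z) addrC.
  by apply: le_trans (ler_normD _ _) _; apply: lerD.
have g1 z : cube y 1 z -> `|partials s w z| <= C * A by move=> /inc; apply: H; rewrite sk.
have g2 z : cube y 1 z -> `|laplacian (partials s w) z| <= L * (C * A) + A.
  move=> /inc zr; rewrite laplacian_partials//.
  have -> : laplacian w = (fun y => W y * w y + - G y) by apply/funext => z'; rewrite eq.
  rewrite partialsD; [|exact: smoothM|exact: smoothN].
  apply: le_trans (ler_normD _ _) _; apply: lerD.
    by apply: hL => //; rewrite sk.
  have -> : partials s (fun y => - G y) z = - partials s G z.
    by rewrite (_ : (fun y => - G y) = (fun y => -1 * G y)) ?partialsZ ?mulN1r//; apply/funext => z'; rewrite mulN1r.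
  rewrite normrN; apply: hG; first by rewrite sk.
  by apply: le_trans zr _; rewrite -Er lerDl.
apply: le_trans (gradient_bound i (smooth_partials s sw) ltr01 g1 g2) _.
rewrite /T mulrDl.
have -> : n%:R / 1 * (C * A) + 1 / 2 * (L * (C * A) + A) = T * A by rewrite /T; ring.
by rewrite lerDr mulr_ge0.
Qed.

End interior.

(** * Continuous dependence of solutions on the source *)

Section stability.
Context {R : realType} {n : nat}.
Variable V : 'rV[R]_n -> R.
Hypotheses (n0 : (0 < n)%N) (pV : pclass V) (cV : coercive V) (cW : coercive (Wpot V)).
Hypothesis norm1 : integralR (fun y => expR (- V y)) = 1.

(** A finite alphabet has finitely many words of length at most [k], and monotonicity in the
    constant lets one constant serve them all. *)
Lemma uniform_size (T : finType) (P : seq T -> R -> Prop) :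
  (forall t C C', C <= C' -> P t C -> P t C') -> (forall t, exists C, P t C) ->
  forall k, exists2 C, 0 <= C & forall t, (size t <= k)%N -> P t C.
Proof.
move=> Pm hP k; elim: k P Pm hP => [|k IH] P Pm hP.
  have [C hC] := hP [::]; exists `|C| => // t; rewrite leqn0 size_eq0 => /eqP ->.
  by apply: Pm hC; exact: ler_norm.
have /choice[Cf hCf] : forall i, exists C, 0 <= C /\ forall t, (size t <= k)%N -> P (i :: t) C.
  move=> i; have [|t|C C0 hC] := IH (fun t => P (i :: t)).
  - by move=> t C C'; exact: Pm.
  - exact: hP.
  - by exists C.
have [C hC] := hP [::].
exists (`|C| + \sum_i Cf i).
  by rewrite addr_ge0// sumr_ge0// => i _; exact: (hCf i).1.
move=> [_|i t tk].
  by apply: Pm hC; apply: le_trans (ler_norm _) _; rewrite lerDl sumr_ge0// => i _; exact: (hCf i).1.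
apply: Pm ((hCf i).2 t tk); rewrite (bigD1 i)//= addrCA lerDl addr_ge0//.
by apply: sumr_ge0 => j _; exact: (hCf j).1.
Qed.

Lemma laplacian_lin a (u v : 'rV[R]_n -> R) y : smooth u -> smooth v ->
  laplacian (fun y => a * (u y - v y)) y = a * (laplacian u y - laplacian v y).
Proof.
move=> su sv; have sN := smoothN sv.
have H i g : smooth g -> partial i (partial i (fun y => a * g y)) y = a * partial i (partial i g) y.
  by move=> sg; have := partialsZ [:: i; i] a sg => /(congr1 (@^~ y)).
rewrite /laplacian -sumrB mulr_sumr; apply: eq_bigr => i _.
rewrite (H i (fun y => u y - v y) (smoothD su sN)); congr (_ * _).
have := partialsD [:: i; i] su sN => /(congr1 (@^~ y)) /= ->; congr (_ + _).
by rewrite (partialN (smooth_deriv sv)) (congr1 (@^~ y) (partialN (smooth_deriv (smooth_partial i sv)))).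
Qed.

(** A centred [w] equals its own [pihat V w], so the spectral gap bounds its norm by [aform V w w],
    the integral of [G w]; Young's inequality then absorbs [w]. *)
Lemma L2_stability : exists2 C, 0 <= C & forall w G : 'rV[R]_n -> R, fast w -> fast G ->
  integralR (fun y => w y * phi0 V y) = 0 ->
  (forall y, laplacian w y = Wpot V y * w y - G y) ->
  integralR (fun y => w y ^+ 2) <= C * integralR (fun y => G y ^+ 2).
Proof.
have [C C0 hC] := spectral_gap n0 pV cV cW norm1.
exists (C ^+ 2); first exact: sqr_ge0.
move=> w G fw fG cw eq.
have pw : pihat V w = w.
  by apply/funext => y; rewrite /pihat [X in _ - X * _]cw mul0r subr0.
have := hC w fw; rewrite pw (aform_ibp pV fw fw).
rewrite (_ : (fun y => _ * w y) = fun y => G y * w y); last first.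
  by apply/funext => y; rewrite eq opprB addrCA subrr addr0.
move=> h.
have fGw := fast_MM fG fw; have fw2 := fast_sqr fw; have fG2 := fast_sqr fG.
have h2 : integralR (fun y => (2 * C) * (G y * w y)) <= integralR (fun y => w y ^+ 2 + C ^+ 2 * G y ^+ 2).
  apply: integralR_le; [exact: (fast_dom (fast_Z _ fGw))|exact: (fast_dom (fast_D fw2 (fast_Z _ fG2)))|].
  move=> y; have := sqr_ge0 (w y - C * G y); move: (w y) (G y) => a b; rewrite !expr2.
  by lra.
rewrite (integralR_Z _ (fast_dom fGw)) (integralR_D (fast_dom fw2) (fast_dom (fast_Z _ fG2))) (integralR_Z _ (fast_dom fG2)) in h2.
by move: h h2; move: (integralR _) (integralR _) (integralR _) => a b c; rewrite -mulrA; move: (C * b) (C ^+ 2 * c) => d e; lra.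
Qed.

(** The L^2 bound becomes a sup bound by [local_sup_bound], which uses one unit of radius, and then
    a bound on derivatives by [interior_estimate], which uses [k] more. *)
Lemma stability k r : exists2 C, 0 <= C & forall (w G : 'rV[R]_n -> R) (A : R), fast w -> fast G ->
  integralR (fun y => w y * phi0 V y) = 0 ->
  (forall y, laplacian w y = Wpot V y * w y - G y) -> 0 <= A ->
  integralR (fun y => G y ^+ 2) <= A ^+ 2 ->
  (forall t y, (size t <= k)%N -> `|y| <= r + k%:R + 1 -> `|partials t G y| <= A) ->
  forall s y, (size s <= k)%N -> `|y| <= r -> `|partials s w y| <= C * A.
Proof.
have [C1 C10 h1] := L2_stability.
have sW : smooth (Wpot V) := pclass_smooth (pclass_W pV).
have [M M0 hM] := cont_bounded 0 (r + k%:R + 1) (smooth_cont sW).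
have [C2 C20 h2] := @local_sup_bound R n M M0.
have [C3 C30 h3] := interior_estimate k r sW.
pose c := C2 * (C1 + 1); have c0 : 0 <= c by rewrite mulr_ge0// addr_ge0.
exists (C3 * (1 + c + 1)); first by rewrite mulr_ge0// !addr_ge0.
move=> w G A fw fG cw eq A0 iG hG.
(* [1 + c] serves as an upper bound for the square root of [c]. *)
have hw y : `|y| <= r + k%:R -> `|w y| <= (1 + c) * A.
  move=> yr.
  have inc z : cube y 1 z -> `|z| <= r + k%:R + 1.
    rewrite /cube/= => zy; rewrite -(subrK y z) addrC.
    by apply: le_trans (ler_normD _ _) _; apply: lerD.
  have le1 z : cube y 1 z -> `|laplacian w z| <= M * `|w z| + A.
    move=> /inc zr; rewrite eq; apply: le_trans (ler_normB _ _) _; apply: lerD.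
      by rewrite normrM; apply: ler_wpM2r => //; apply: hM; rewrite subr0.
    exact: (hG [::]).
  have := h2 w y A fw A0 le1.
  have hh : integralR (fun y => w y ^+ 2) <= C1 * A ^+ 2.
    by apply: le_trans (h1 w G fw fG cw eq) _; apply: ler_wpM2l.
  move=> h4.
  have h5 : w y ^+ 2 <= c * A ^+ 2.
    apply: le_trans h4 _; rewrite /c -mulrA; apply: ler_wpM2l => //.
    by rewrite mulrDl mul1r lerD2r.
  rewrite -ler_sqr ?nnegrE ?mulr_ge0 ?addr_ge0// real_normK ?num_real// exprMn.
  apply: le_trans h5 _; apply: ler_wpM2r; first exact: sqr_ge0.
  by rewrite expr2 mulrDl mul1r mulrDr mulr1; have := mulr_ge0 c0 c0; move: c0; move: (c * c) => d; lra.
move=> s y sk yr; rewrite -mulrA.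
have cA : 0 <= (1 + c) * A by rewrite mulr_ge0// addr_ge0.
apply: (h3 w G ((1 + c + 1) * A) (fast_smooth fw) (fast_smooth fG) eq) => //.
- by rewrite mulrDl mul1r addr_ge0.
- by move=> z zr; apply: le_trans (hw z zr) _; rewrite [leRHS]mulrDl mul1r lerDl.
- move=> t z tk zr; apply: le_trans (hG t z tk (le_trans zr _)) _; first by rewrite lerDl.
  by rewrite [leRHS]mulrDl mul1r lerDr.
Qed.

End stability.

Section taylor.
Context {R : realType} {m : nat}.

Lemma first_difference (g : 'rV[R]_m -> R) (x : 'rV[R]_m) j (h K : R) : smooth g ->
  (forall th, `|th| <= `|h| -> `|partial j (partial j g) (x + th *: e_ j)| <= K) ->
  `|g (x + h *: e_ j) - g x - h * partial j g x| <= K * `|h| ^+ 2.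
Proof.
move=> sg hK.
have [th /andP[th0 th1] E] := mvt 0 h (fun t => partial_line x t (smooth_deriv (i := j) sg)).
rewrite subr0 add0r scale0r addr0 in E.
rewrite E mulrC -mulrBr normrM mulrC expr2 mulrA; apply: ler_wpM2r => //.
have K0 : 0 <= K by apply: le_trans (hK 0 _); rewrite ?normr0.
have thh : `|th * h| <= `|h| by rewrite normrM (ger0_norm th0) ler_piMl.
have := @mvt_le R (fun s => partial j g (x + s *: e_ j)) _ 0 (th * h) K
  (fun t => partial_line x t (smooth_deriv (i := j) (smooth_partial j sg))).
rewrite scale0r addr0 subr0 => H; apply: le_trans (H _) _.
  move=> s /andP[s0 s1]; rewrite add0r; apply: hK; apply: le_trans thh.
  by rewrite normrM (ger0_norm s0) ler_piMl.
exact: ler_wpM2l.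
Qed.

Lemma difference_quotient (g : 'rV[R]_m -> R) (x : 'rV[R]_m) j (h K : R) : smooth g -> h != 0 ->
  (forall th, `|th| <= `|h| -> `|partial j (partial j g) (x + th *: e_ j)| <= K) ->
  `|h^-1 * (g (x + h *: e_ j) - g x) - partial j g x| <= K * `|h|.
Proof.
move=> sg h0 /(first_difference sg).
have h0' : 0 < `|h| by rewrite normr_gt0.
rewrite expr2 mulrA -ler_pdivrMr// -normfV -normrM mulrC mulrBr mulKf//.
Qed.

End taylor.

Lemma sqr_le_abs (R : realType) (a b : R) : `|a| <= b -> a ^+ 2 <= b ^+ 2.
Proof.
move=> h; rewrite -[leLHS]real_normK ?num_real// ler_sqr ?nnegrE//.
exact: le_trans (normr_ge0 _) h.
Qed.

Lemma term_le_sum (R : realType) m (F : 'I_m -> R) i : (forall a, 0 <= F a) -> F i <= \sum_a F a.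
Proof. by move=> F0; rewrite (bigD1 i)//= lerDl sumr_ge0. Qed.

Lemma term_le_sum3 (R : realType) m (F : 'I_m -> 'I_m -> 'I_m -> R) i j k :
  (forall a b c, 0 <= F a b c) -> F i j k <= \sum_a \sum_b \sum_c F a b c.
Proof.
move=> F0; have S0 a b : 0 <= \sum_c F a b c by apply: sumr_ge0.
have SS0 a : 0 <= \sum_b \sum_c F a b c by apply: sumr_ge0.
apply: le_trans (term_le_sum i SS0); apply: le_trans (term_le_sum j (S0 i)).
exact: (term_le_sum k (F0 i j)).
Qed.

(** * The derivative of the exact solution in the parameter *)

Section x_derivative.
Context {R : realType} {m n : nat}.
Variables (V : 'rV[R]_n -> R) (f phi : 'rV[R]_m -> 'rV[R]_n -> 'rV[R]_m).
Hypotheses (n0 : (0 < n)%N) (pV : pclass V) (cV : coercive V) (cW : coercive (Wpot V)).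
Hypothesis norm1 : integralR (fun y => expR (- V y)) = 1.
Hypothesis sf : forall i, smooth (fun z : 'rV[R]_(m + n) => f (lsubmx z) (rsubmx z) 0 i).
Hypothesis hB : assumption_B V f.
Hypothesis hP : poisson_solution V f phi.
Variables (m2 : nat) (K : R).
Hypothesis K0 : 0 < K.
Hypothesis hK : forall x y, enorm (grad_x f x y) + hess_x_norm f x y <= K * (1 + enorm y ^+ m2).

Let ins (x : 'rV[R]_m) (y : 'rV[R]_n) : 'rV[R]_(m + n) := row_mx x y.

Lemma ins_norm x y : `|ins x y| <= `|x| + `|y|.
Proof.
apply: rV_norm_le; first exact: addr_ge0.
move=> k; case: (split_ordP k) => l ->; rewrite /ins ?row_mxEl ?row_mxEr.
  by apply: le_trans (coord_le_norm _ _) _; rewrite lerDl.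
by apply: le_trans (coord_le_norm _ _) _; rewrite lerDr.
Qed.

Lemma partial_insy (g : 'rV[R]_(m + n) -> R) x y k :
  partial k (fun y => g (ins x y)) y = partial (rshift m k) g (ins x y).
Proof.
have H h : ins x (h *: e_ k + y) = h *: e_ (rshift m k) + ins x y.
  apply/rowP => l; case: (split_ordP l) => p ->.
    by rewrite [LHS]row_mxEl [RHS]mxE row_mxEl !mxE eqxx eq_lrshift /= mulr0 add0r.
  by rewrite [LHS]row_mxEr [RHS]mxE row_mxEr !mxE eqxx /= (inj_eq (@rshift_inj _ _)).
exact: (@derive_affine R _ _ g (fun y => ins x y) y (e_ k) (e_ (rshift m k)) H).2.
Qed.

Lemma partials_insy (g : 'rV[R]_(m + n) -> R) x s :
  partials s (fun y => g (ins x y)) = fun y => partials (map (@rshift m n) s) g (ins x y).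
Proof.
elim: s => [//|k s IH] /=; rewrite IH; apply/funext => y.
exact: (partial_insy (partials (map (@rshift m n) s) g)).
Qed.

Variables (x : 'rV[R]_m) (i j : 'I_m).

Let psi0 (x : 'rV[R]_m) (y : 'rV[R]_n) := phi0 V y * phi x y 0 i.

Lemma psi0_fast x' : fast (psi0 x') /\
  (forall y, laplacian (psi0 x') y = Wpot V y * psi0 x' y - phi0 V y * f x' y 0 i).
Proof.
apply: (fast_of_poisson n0 pV cV cW (g := fun y => f x' y 0 i)).
- exact: (phi_smooth hP x' i).
- apply: poly_growth_expb; have [q hq] := phi_poly_growth hP x'.
  by exists q => y; apply: le_trans (hq y); exact: entry_le_enorm.
- exact: (phi_eq hP x' i).
- exact: (fast_fx n0 pV sf hB x' i).
Qed.

Lemma psi0_centered x' : integralR (fun y => psi0 x' y * phi0 V y) = 0.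
Proof.
rewrite -(phi_centered hP x' i); congr integralR; apply/funext => y.
by rewrite -phi0_sqr /psi0 expr2; ring.
Qed.

Let fq h y := h^-1 * (f (x + h *: e_ j) y 0 i - f x y 0 i).
Let d h y := h^-1 * (psi0 (x + h *: e_ j) y - psi0 x y).
Let df y := grad_x f x y i j.

(** The hypothesis on second derivatives is uniform in [x], so the quotient differs from the
    derivative by [h] times a weight polynomial in [y], valid on the whole space. *)
Lemma fq_bound h y : h != 0 -> `|fq h y - df y| <= K * (1 + enorm y ^+ m2) * `|h|.
Proof.
move=> h0; rewrite /fq /df mxE.
have sg : smooth (fun x => f x y 0 i).
  by under eq_fun do rewrite fJ; exact: (smooth_insx y (sf i)).
apply: (difference_quotient sg h0) => th _.
apply: le_trans (hK (x + th *: e_ j) y).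
apply: (@le_trans _ _ (hess_x_norm f (x + th *: e_ j) y)); last by rewrite lerDr enorm_ge0.
rewrite -ler_sqr ?nnegrE ?sqrtr_ge0// real_normK ?num_real//.
rewrite /hess_x_norm sqr_sqrtr; last first.
  by apply: sumr_ge0 => a _; apply: sumr_ge0 => b _; apply: sumr_ge0 => c _; exact: sqr_ge0.
exact: (@term_le_sum3 _ _ (fun a b c => partial b (partial c (fun x' => f x' y 0 a)) (x + th *: e_ j) ^+ 2) i j j (fun a b c => sqr_ge0 _)).
Qed.

Lemma fq_smooth h : smooth (fq h).
Proof.
exact: (smoothM (smooth_cst _) (smoothD (smooth_fx sf _ i) (smoothN (smooth_fx sf x i)))).
Qed.

(** The growth hypothesis bounds derivatives in [x]. Once derivatives in [y] are added, the constant
    comes from joint continuity on a compact set, hence the restriction to [|y| <= r]. *)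
Lemma partials_fq_bound s r : exists2 C, 0 <= C & forall h, unit_step h -> forall y, `|y| <= r ->
  `|partials s (fq h) y - partials s df y| <= C * `|h|.
Proof.
pose g := partials (map (@rshift m n) s) (fun z => f (lsubmx z) (rsubmx z) 0 i).
have sg : smooth g := smooth_partials _ (sf i).
pose jj := lshift n j.
have [M M0 hM] := cont_bounded 0 (`|x| + 1 + r) (smooth_cont (smooth_partial jj (smooth_partial jj sg))).
exists M => // h hh y yr; have /andP[h0 h1] := hh.
have E1 x' : partials s (fun y => f x' y 0 i) y = g (ins x' y).
  have -> : (fun y => f x' y 0 i) = fun y => f (lsubmx (ins x' y)) (rsubmx (ins x' y)) 0 i.
    by apply/funext => z; rewrite /ins row_mxKl row_mxKr.
  by rewrite (partials_insy (fun z => f (lsubmx z) (rsubmx z) 0 i)).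
have -> : partials s (fq h) y = h^-1 * (g (ins (x + h *: e_ j) y) - g (ins x y)).
  have s1 := smooth_fx sf (x + h *: e_ j) i; have s2 := smooth_fx sf x i.
  rewrite /fq (partialsZ s _ (smoothD s1 (smoothN s2))) (partialsD s s1 (smoothN s2)) E1.
  have -> : (fun y => - f x y 0 i) = (fun y => -1 * f x y 0 i) by apply/funext => z; rewrite mulN1r.
  by rewrite (partialsZ s _ s2) E1 mulN1r.
have pg (g' : 'rV[R]_(m + n) -> R) x' : smooth g' -> partial j (fun x => g' (ins x y)) x' = partial jj g' (ins x' y).
  by move=> sg'; rewrite -(partial_insx x' y j sg').
have -> : partials s df y = partial j (fun x => g (ins x y)) x.
  rewrite pg//.
  have -> : df = fun y => partial jj (fun z => f (lsubmx z) (rsubmx z) 0 i) (ins x y).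
    by apply/funext => z; rewrite /df grad_fJ.
  rewrite partials_insy /g -partials_rcons -[partial jj _]/(partials (jj :: _) _).
  by rewrite (partials_perm (t := jj :: [seq rshift m i | i <- s]) (sf i))// perm_rcons.
have sgx : smooth (fun x => g (ins x y)) := smooth_insx y sg.
apply: (difference_quotient sgx); first by rewrite -normr_gt0.
move=> th hth.
have -> : partial j (fun x => g (ins x y)) = fun x => partial jj g (ins x y).
  by apply/funext => x'; exact: pg.
rewrite pg; last exact: smooth_partial.
apply: hM; rewrite subr0; apply: le_trans (ins_norm _ _) _; apply: lerD => //.
apply: le_trans (ler_normD _ _) _; rewrite lerD2l mx_normZ.
have dl : `|(e_ j : 'rV[R]_m)| <= 1.
  by apply: rV_norm_le => // k; rewrite mxE eqxx /=; case: (k == j); rewrite ?normr1 ?normr0.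
by apply: le_trans (ler_wpM2l _ dl) _ => //; rewrite mulr1; apply: le_trans hth _.
Qed.

Lemma d_fast h : fast (d h).
Proof. exact: (fast_Z _ (fast_B (psi0_fast _).1 (psi0_fast x).1)). Qed.

Lemma d_eq h y : laplacian (d h) y = Wpot V y * d h y - phi0 V y * fq h y.
Proof.
rewrite /d (laplacian_lin _ _ (fast_smooth (psi0_fast _).1) (fast_smooth (psi0_fast x).1)).
rewrite (psi0_fast _).2 (psi0_fast x).2 /fq.
by move: (psi0 _ y) (psi0 x y) (Wpot V y) (phi0 V y) (f _ y 0 i) (f x y 0 i) => a b c e g k; ring.
Qed.

Lemma d_centered h : integralR (fun y => d h y * phi0 V y) = 0.
Proof.
have f1 x' : fast (fun y => psi0 x' y * phi0 V y) := fast_MM (psi0_fast x').1 (fast_phi0 n0 pV cV cW).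
rewrite (_ : (fun y => _) = fun y => h^-1 * (psi0 (x + h *: e_ j) y * phi0 V y - psi0 x y * phi0 V y)); last first.
  by apply/funext => y; rewrite /d; ring.
rewrite (integralR_Z _ (fast_dom (fast_B (f1 _) (f1 x)))) (integralR_B (fast_dom (f1 _)) (fast_dom (f1 x))).
by rewrite !psi0_centered subr0 mulr0.
Qed.

Let G h k y := phi0 V y * (fq h y - fq k y).

Lemma G_fast h k : fast (G h k).
Proof.
have ff h' : fast (fun y => phi0 V y * fq h' y).
  have := fast_Z h'^-1 (fast_B (fast_fx n0 pV sf hB (x + h' *: e_ j) i) (fast_fx n0 pV sf hB x i)).
  by congr fast; apply/funext => y; rewrite /fq; ring.
by have := fast_B (ff h) (ff k); congr fast; apply/funext => y; rewrite /G; ring.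
Qed.

Let wt (y : 'rV[R]_n) : R := K * (1 + enorm y ^+ m2).

Lemma wt_expb : expb wt.
Proof.
have K0' := ltW K0.
exists (K * 2), (n%:R * m2%:R) => y.
rewrite /wt ger0_norm ?mulr_ge0 ?addr_ge0 ?exprn_ge0 ?enorm_ge0// -mulrA ler_pM2l//.
have h1 : 1 <= expR (n%:R * m2%:R * `|y|) by rewrite -expR0 ler_expR !mulr_ge0.
have h2 : enorm y ^+ m2 <= expR (n%:R * m2%:R * `|y|).
  have -> : n%:R * m2%:R * `|y| = (n%:R * `|y|) * m2%:R by ring.
  rewrite expRM_natr; apply: lerXn2r; rewrite ?nnegrE ?expR_ge0 ?enorm_ge0//.
  by apply: le_trans (enorm_le y) _; apply: le_trans (expR_ge1Dx _); rewrite lerDr.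
by move: h1 h2; move: (expR _) (_ ^+ _) => a b; lra.
Qed.

Lemma G_L2 : exists2 C, 0 <= C & forall h k, unit_step h -> unit_step k ->
  integralR (fun y => G h k y ^+ 2) <= (C * (`|h| + `|k|)) ^+ 2.
Proof.
have ed : edec (fun y => wt y ^+ 2 * phi0 V y ^+ 2).
  have e2 : edec (fun y => phi0 V y ^+ 2) := (fast_sqr (fast_phi0 n0 pV cV cW)).2 [::].
  have w2 : expb (fun y => wt y ^+ 2) by under eq_fun do rewrite expr2; exact: (expb_M wt_expb wt_expb).
  exact: (edec_M w2 e2).
have cen : continuous (fun y : 'rV[R]_n => enorm y).
  have E : (fun y : 'rV[R]_n => Num.sqrt (\sum_j y 0 j ^+ 2)) = (fun y => enorm y).
    by apply/funext => y; rewrite enormE.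
  rewrite -E; apply: (@continuous_compose _ _ _ (fun y : 'rV[R]_n => \sum_j y 0 j ^+ 2) Num.sqrt); last exact: sqrt_continuous.
  apply: continuous_sum_fun => k; under eq_fun do rewrite expr2.
  exact: (contM (@coord_cont _ _ k) (@coord_cont _ _ k)).
have cwt : continuous wt.
  apply: contM; first exact: cst_continuous.
  apply: contD; first exact: cst_continuous.
  elim: m2 => [|k IH]; first by under eq_fun do rewrite expr0; exact: cst_continuous.
  by under eq_fun do rewrite exprS; exact: (contM cen IH).
have c0 : continuous (phi0 V) := smooth_cont (smooth_phi0 pV).
have cont : continuous (fun y => wt y ^+ 2 * phi0 V y ^+ 2).
  apply: contM; under eq_fun do rewrite expr2; [exact: (contM cwt cwt)|exact: (contM c0 c0)].
have dm := edec_dom cont ed.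
set I := integralR (fun y => wt y ^+ 2 * phi0 V y ^+ 2).
have I0 : 0 <= I by apply: integralR_ge0 => y; rewrite mulr_ge0 ?sqr_ge0.
(* [1 + I] bounds the square root of [I], which gives the estimate the form of a square. *)
exists (1 + I); first exact: addr_ge0.
move=> h k hh kk; have [h0 k0'] : h != 0 /\ k != 0.
  by split; rewrite -normr_gt0; [case/andP: hh|case/andP: kk].
apply: (@le_trans _ _ ((`|h| + `|k|) ^+ 2 * I)).
  rewrite -(integralR_Z _ dm); apply: integralR_le.
  - exact: (fast_dom (fast_sqr (G_fast h k))).
  - exact: dom_Z.
  move=> y; rewrite /G exprMn [leRHS]mulrA mulrC; apply: ler_wpM2r; first exact: sqr_ge0.
  have wt0 : 0 <= wt y by apply: mulr_ge0; [exact: ltW|rewrite addr_ge0// exprn_ge0// enorm_ge0].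
  rewrite -exprMn; apply: sqr_le_abs.
  have -> : fq h y - fq k y = (fq h y - df y) - (fq k y - df y) by rewrite opprB addrA subrK.
  apply: le_trans (ler_normB _ _) _; rewrite [leRHS]mulrC mulrDr.
  by apply: lerD; exact: fq_bound.
rewrite exprMn mulrC; apply: ler_wpM2r; first exact: sqr_ge0.
by rewrite expr2 mulrDl mul1r mulrDr mulr1; have := mulr_ge0 I0 I0; move: I0; move: (I * I) => e; lra.
Qed.

Lemma G_partials k r : exists2 C, 0 <= C & forall h h', unit_step h -> unit_step h' ->
  forall t y, (size t <= k)%N -> `|y| <= r -> `|partials t (G h h') y| <= C * (`|h| + `|h'|).
Proof.
have [L L0 hL] := leibniz_bound r k (smooth_phi0 pV).
have [||C C0 hC] := @uniform_size R 'I_n (fun t C => forall h, unit_step h -> forall y, `|y| <= r ->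
  `|partials t (fq h) y - partials t df y| <= C * `|h|) _ _ k.
- by move=> t C C' CC h1 h hh y yr; apply: le_trans (h1 h hh y yr) _; apply: ler_wpM2r.
- by move=> t; have [C _ hC] := partials_fq_bound t r; exists C.
exists (L * C); first exact: mulr_ge0.
move=> h h' hh hh' t y tk yr; rewrite -mulrA.
have sN := smoothN (fq_smooth h').
apply: (hL (fun y => fq h y - fq h' y) _ (smoothD (fq_smooth h) sN)) => //.
move=> s z sk zr; rewrite (partialsD s (fq_smooth h) sN).
have -> : (fun y => - fq h' y) = (fun y => -1 * fq h' y) by apply/funext => z'; rewrite mulN1r.
rewrite (partialsZ s _ (fq_smooth h')) mulN1r.
have -> : partials s (fq h) z - partials s (fq h') z = (partials s (fq h) z - partials s df z) - (partials s (fq h') z - partials s df z).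
  by rewrite opprB addrA subrK.
by apply: le_trans (ler_normB _ _) _; rewrite mulrDr; apply: lerD; exact: hC.
Qed.

(** The difference of two quotients is centred and solves the equation with source [G h k], which is
    of order [|h| + |k|] both in L^2 and locally with its derivatives; this is exactly what
    [stability] asks for. *)
Lemma d_cauchy s r : exists2 C, 0 <= C & forall h k, unit_step h -> unit_step k -> forall y, `|y| <= r ->
  `|partials s (d h) y - partials s (d k) y| <= C * (`|h| + `|k|).
Proof.
have [S S0 hS] := stability n0 pV cV cW norm1 (size s) r.
have [C1 C10 h1] := G_L2.
have [C2 C20 h2] := G_partials (size s) (r + (size s)%:R + 1).
exists (S * (C1 + C2)); first by rewrite mulr_ge0// addr_ge0.
move=> h k hh kk y yr.
have sdk := fast_smooth (d_fast k); have sdh := fast_smooth (d_fast h).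
pose w y := d h y - d k y.
have fw : fast w := fast_B (d_fast h) (d_fast k).
have -> : partials s (d h) y - partials s (d k) y = partials s w y.
  rewrite /w (partialsD s sdh (smoothN sdk)).
  have -> : (fun y => - d k y) = (fun y => -1 * d k y) by apply/funext => z'; rewrite mulN1r.
  by rewrite (partialsZ s _ sdk) mulN1r.
rewrite -mulrA; have A0 : 0 <= (C1 + C2) * (`|h| + `|k|) by rewrite mulr_ge0// addr_ge0.
apply: (hS w (G h k) _ fw (G_fast h k)).
- have p0 := fast_phi0 n0 pV cV cW.
  rewrite (_ : (fun y => _) = fun y => d h y * phi0 V y - d k y * phi0 V y); last first.
    by apply/funext => z; rewrite /w mulrBl.
  by rewrite (integralR_B (fast_dom (fast_MM (d_fast h) p0)) (fast_dom (fast_MM (d_fast k) p0))) !d_centered subr0.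
- move=> z; rewrite (_ : w = fun y => 1 * (d h y - d k y)); last by apply/funext => z'; rewrite mul1r.
  rewrite (laplacian_lin _ _ sdh sdk) !d_eq /G.
  by move: (d h z) (d k z) (Wpot V z) (phi0 V z) (fq h z) (fq k z) => a b c e g l; ring.
- exact: A0.
- apply: le_trans (h1 h k hh kk) _; rewrite ler_sqr ?nnegrE ?mulr_ge0 ?addr_ge0//.
  by apply: ler_wpM2r; rewrite ?addr_ge0// lerDl.
- move=> t z tk zr; apply: le_trans (h2 h k hh kk t z tk zr) _.
  by apply: ler_wpM2r; rewrite ?addr_ge0// lerDr.
- by [].
- exact: yr.
Qed.

Lemma phi0_gt0 y : 0 < phi0 V y. Proof. exact: expR_gt0. Qed.

(** Uniformity in [h]: on the inner cube [d h] is compared with [d 1] by [d_cauchy], and the source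
    is [phi0 df] plus a multiple of [phi0 wt]. The mere decay of each [d h] provides the limit at
    infinity. *)
Lemma d_bound (nu : R) : 0 <= nu -> exists2 C, 0 <= C & forall h, unit_step h -> forall y,
  `|d h y| <= C * expR (- (nu * `|y|)).
Proof.
move=> nu0; have [r [C C0 hC]] := decay_uniform n0 cW nu0.
have [C1 C10 h1] := d_cauchy [::] r.
have u1 : unit_step (1 : R) by rewrite /unit_step gtr0_norm ?ltr01 ?lexx.
have [M1 M10 hM1] := cont_bounded 0 r (smooth_cont (fast_smooth (d_fast 1))).
have edf : edec (fun y => phi0 V y * df y) := (fast_grad_fx n0 pV sf hB x i j).2 [::].
have ew : edec (fun y => wt y * phi0 V y) := edec_M wt_expb ((fast_phi0 n0 pV cV cW).2 [::]).
have [D hD] := edf nu; have [E hE] := ew nu.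
have D0 : 0 <= D by have := le_trans (normr_ge0 _) (hD 0); rewrite pmulr_lge0// expR_gt0.
have E0 : 0 <= E by have := le_trans (normr_ge0 _) (hE 0); rewrite pmulr_lge0// expR_gt0.
exists (C * ((D + E) + (M1 + C1 * 2) + 1)).
  by rewrite mulr_ge0// !addr_ge0// mulr_ge0.
move=> h hh; have /andP[h0 hh1] := hh.
apply: (hC (d h) (fun y => phi0 V y * fq h y) _ _ (fast_smooth (d_fast h)) (d_eq h)).
- exact: addr_ge0.
- by rewrite addr_ge0// mulr_ge0.
- move=> y; have -> : phi0 V y * fq h y = phi0 V y * df y + phi0 V y * (fq h y - df y) by ring.
  apply: le_trans (ler_normD _ _) _; rewrite mulrDl; apply: lerD; first exact: hD.
  have p0 := phi0_gt0 y.
  apply: le_trans _ (hE y).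
  have wt0 : 0 <= wt y by apply: mulr_ge0; [exact: ltW|rewrite addr_ge0// exprn_ge0// enorm_ge0].
  rewrite normrM (gtr0_norm p0) (ger0_norm (mulr_ge0 wt0 (ltW p0))) mulrC; apply: ler_wpM2r; first exact: ltW.
  have hn : h != 0 by rewrite -normr_gt0.
  by apply: le_trans (fq_bound y hn) _; rewrite -[leLHS]/(wt y * `|h|) ler_piMr.
- move=> y yr; have -> : d h y = (d h y - d 1 y) + d 1 y by rewrite subrK.
  apply: le_trans (ler_normD _ _) _; rewrite addrC; apply: lerD; first by apply: hM1; rewrite subr0.
  apply: le_trans (h1 h 1 hh u1 y yr) _; apply: ler_wpM2l => //.
  by rewrite (gtr0_norm ltr01); move: hh1; lra.
- move=> e e0; have [E' hE'] := (d_fast h).2 [::] 1.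
  have E'0 : 0 < `|E'| + 1 by rewrite ltr_wpDl.
  exists (- ln (e / (`|E'| + 1))) => y hy.
  apply: le_lt_trans (hE' y) _; rewrite mul1r.
  have lt : expR (- `|y|) < e / (`|E'| + 1).
    by rewrite -[ltRHS]lnK ?posrE ?divr_gt0// ltr_expR ltrNl.
  apply: (@le_lt_trans _ _ ((`|E'| + 1) * expR (- `|y|))).
    by apply: ler_wpM2r; [exact: expR_ge0|apply: le_trans (ler_norm _) _; rewrite lerDl].
  by rewrite mulrC -ltr_pdivlMr.
Qed.

(** The limit [chi] of the quotients [d h] is identified with [grad_x_psi]; the equation passes to
    the limit pointwise, the decay by [d_bound], the centring by uniform decay. *)
Lemma grad_x_psi_fast :
  [/\ fast (fun y => grad_x_psi V phi x y i j),
   forall y, laplacian (fun y => grad_x_psi V phi x y i j) y =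
     Wpot V y * grad_x_psi V phi x y i j - phi0 V y * grad_x f x y i j &
   integralR (fun y => grad_x_psi V phi x y i j * phi0 V y) = 0].
Proof.
have [chi schi hchi] := limit_tower (fun h _ => fast_smooth (d_fast h)) d_cauchy.
have E : (fun y => grad_x_psi V phi x y i j) = chi.
  apply/funext => y; rewrite /grad_x_psi !mxE -/(phi0 V y).
  have [C C0 hC] := hchi [::] `|y|.
  have p0 := phi0_gt0 y; have p0' : phi0 V y != 0 by rewrite gt_eqF.
  (* [partial] is the limit of the difference quotients of [phi], and these are [d h y / phi0 V y]
     with [phi0 V y] positive. *)
  suff L : h^-1 *: (phi (h *: e_ j + x) y 0 i - phi x y 0 i) @[h --> (0 : R)^'] --> chi y / phi0 V y.
    by rewrite /partial /derive (cvg_lim _ L)// mulrC divfK.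
  apply/cvgrPdist_le => e e0.
  have ep : 0 < e * phi0 V y by rewrite mulr_gt0.
  have C1 : 0 < C + 1 by rewrite ltr_wpDl.
  near=> h.
  have h0 : h != 0 by near: h; exact: nbhs_dnbhs_neq.
  have h1 : `|h| < 1 by near: h; exact: dnbhs0_lt.
  have h2 : `|h| < e * phi0 V y / (C + 1) by near: h; apply: dnbhs0_lt; rewrite divr_gt0.
  have hh : unit_step h by rewrite /unit_step normr_gt0 h0 ltW.
  have := hC h hh y (lexx _); rewrite /= => h3.
  have -> : chi y / phi0 V y - h^-1 *: (phi (h *: e_ j + x) y 0 i - phi x y 0 i) = (chi y - d h y) / phi0 V y.
    rewrite /d /psi0 [h *: _ + _]addrC -[_ *: _]/(_ * _).
    by move: (phi0 V y) p0' (phi _ y 0 i) (phi x y 0 i) (chi y) h^-1 => p q a b c k; field.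
  rewrite normrM normfV (gtr0_norm p0) ler_pdivrMr// distrC; apply: le_trans h3 _.
  move: h2; rewrite ltr_pdivlMr// => /ltW; apply: le_trans.
  by rewrite mulrC; apply: ler_wpM2l => //; rewrite lerDl.
have E2 y : grad_x_psi V phi x y i j = chi y := congr1 (@^~ y) E.
have eq y : laplacian chi y = Wpot V y * chi y - phi0 V y * df y.
  have lap s : exists2 C, 0 <= C & forall h, unit_step h -> `|partials s (d h) y - partials s chi y| <= C * `|h|.
    by have [C C0 hC] := hchi s `|y|; exists C => // h hh; exact: hC.
  have /choice[Cf hCf] : forall k : 'I_n, exists C, 0 <= C /\ forall h, unit_step h -> `|partials [:: k; k] (d h) y - partials [:: k; k] chi y| <= C * `|h|.
    by move=> k; have [C ? ?] := lap [:: k; k]; exists C.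
  have [C0 C00 hC0] := lap [::].
  apply/eqP; rewrite -subr_eq0 -normr_le0; apply/ler_addgt0Pr => e e0; rewrite add0r.
  (* All errors at the fixed point [y] are linear in the step; [T] is the sum of their constants. *)
  pose T := (\sum_k Cf k) + (`|Wpot V y| * C0 + phi0 V y * wt y).
  have [h hh hT] := small_step T e0; apply: le_trans hT.
  have /andP[h0 _] := hh; have hn : h != 0 by rewrite -normr_gt0.
  have -> : laplacian chi y - (Wpot V y * chi y - phi0 V y * df y) =
     - (laplacian (d h) y - laplacian chi y) + (Wpot V y * (d h y - chi y) - phi0 V y * (fq h y - df y)).
    rewrite d_eq; move: (laplacian chi y) (Wpot V y) (chi y) (phi0 V y) (df y) (d h y) (fq h y) => a b c p q k l; ring.
  rewrite /T [leRHS]mulrDl; apply: le_trans (ler_normD _ _) _; apply: lerD.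
    rewrite normrN /laplacian -sumrB mulr_suml; apply: le_trans (ler_norm_sum _ _ _) _.
    by apply: ler_sum => k _; exact: (hCf k).2.
  apply: le_trans (ler_normB _ _) _; rewrite [leRHS]mulrDl !normrM; apply: lerD.
    by rewrite -mulrA; apply: ler_wpM2l => //; exact: hC0.
  by rewrite (gtr0_norm (phi0_gt0 y)) -mulrA; apply: ler_wpM2l; [exact/ltW/phi0_gt0|exact: fq_bound].
have eq' y : laplacian (fun y => grad_x_psi V phi x y i j) y = Wpot V y * chi y - phi0 V y * grad_x f x y i j.
  by rewrite E; exact: eq.
have bd nu : 0 <= nu -> exists2 C, 0 <= C & forall y, `|chi y| <= C * expR (- (nu * `|y|)).
  move=> nu0; have [C C0 hC] := d_bound nu0; exists C => // y.
  have [D D0 hD] := hchi [::] `|y|.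
  apply/ler_addgt0Pr => e e0; have [h hh hT] := small_step D e0.
  have -> : chi y = d h y - (d h y - chi y) by rewrite opprB addrCA subrr addr0.
  apply: le_trans (ler_normB _ _) _; apply: lerD; first exact: hC.
  by apply: le_trans hT; exact: hD.
have echi : edec chi.
  move=> nu; have [C C0 hC] := bd `|nu| (normr_ge0 _); exists C => y.
  apply: le_trans (hC y) _; apply: ler_wpM2l => //; rewrite ler_expR lerN2.
  by apply: ler_wpM2r => //; exact: ler_norm.
have fchi : fast chi := fast_of_equation schi echi (pclass_W pV) (fast_grad_fx n0 pV sf hB x i j) eq.
split; [by rewrite E|by move=> y; rewrite E2; exact: eq'|].
rewrite (_ : (fun y => _) = fun y => chi y * phi0 V y); last first.
  by apply/funext => y; rewrite E2.
apply/eqP; rewrite -normr_le0; apply/ler_addgt0Pr => e e0; rewrite add0r.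
have p0 := fast_phi0 n0 pV cV cW.
have [C C0 hC] := bd 1 ler01; have [C' C'0 hC'] := d_bound ler01.
have dp := fast_dom p0; set P := integralR (phi0 V).
have P0 : 0 <= P by apply: integralR_ge0 => y; exact/ltW/phi0_gt0.
pose Q := (C + C') * P + 1.
have Q0 : 0 < Q by rewrite ltr_wpDl// mulr_ge0// addr_ge0.
have e2 : 0 < e / 2 by exact: divr_gt0.
(* Within this radius [d h] converges uniformly; beyond it [chi] and [d h] are both below a multiple
   of [exp (- |y|)], which is at most [e / 2 / Q] there. *)
pose r := - ln (e / 2 / Q).
have [D D0 hD] := hchi [::] r.
have [h hh hT] := small_step (D * P) e2.
have fc := fast_MM fchi p0; have fd := fast_MM (d_fast h) p0.
have -> : integralR (fun y => chi y * phi0 V y) = integralR (fun y => chi y * phi0 V y - d h y * phi0 V y).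
  by rewrite (integralR_B (fast_dom fc) (fast_dom fd)) d_centered subr0.
have dB := fast_dom (fast_B fc fd).
apply: le_trans (integralR_abs dB) _.
pose a := D * `|h| + (C + C') * (e / 2 / Q).
have pw y : `|chi y * phi0 V y - d h y * phi0 V y| <= a * phi0 V y.
  have py := phi0_gt0 y.
  rewrite -mulrBl normrM (gtr0_norm py); apply: ler_wpM2r; first exact: ltW.
  have [yr|yr] := leP `|y| r.
    rewrite distrC; apply: le_trans (hD h hh y yr) _; rewrite lerDl.
    by rewrite mulr_ge0 ?addr_ge0// divr_ge0// ltW.
  have er : expR (- `|y|) <= e / 2 / Q.
    by rewrite -[leRHS]lnK ?posrE ?divr_gt0// ler_expR lerNl ltW.
  apply: le_trans (ler_normB _ _) _; apply: (@le_trans _ _ ((C + C') * expR (- `|y|))).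
    by rewrite mulrDl; apply: lerD; [have := hC y|have := hC' h hh y]; rewrite mul1r.
  apply: (@le_trans _ _ ((C + C') * (e / 2 / Q))); last by rewrite lerDr mulr_ge0.
  by apply: ler_wpM2l => //; exact: addr_ge0.
apply: le_trans (integralR_le (dom_abs dB) (dom_Z a dp) pw) _.
rewrite (integralR_Z a dp) -/P /a mulrDl.
have -> : D * `|h| * P = D * P * `|h| by ring.
have h2 : (C + C') * (e / 2 / Q) * P <= e / 2.
  have -> : (C + C') * (e / 2 / Q) * P = ((C + C') * P / Q) * (e / 2) by ring.
  rewrite ler_piMl ?(ltW e2)// ler_pdivrMr// mul1r /Q lerDl//.
by move: hT h2; move: (D * P * _) (_ * P) => u v; lra.
Unshelve. all: by end_near.
Qed.

End x_derivative.

(** * Hermite functions on the line *)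

Section line.
Context {R : realType}.
Notation mu1 := (@lebesgue_measure R).
Implicit Types f g u : R -> R.

Definition eb1 g := continuous g /\ exists C nu, forall t, `|g t| <= C * expR (nu * `|t|).
Definition ed1 g := continuous g /\ forall nu, exists C, forall t, `|g t| <= C * expR (- (nu * `|t|)).

Definition I1 g : R := \int[mu1]_t g t.

Lemma eb1_D f g : eb1 f -> eb1 g -> eb1 (fun t => f t + g t).
Proof.
move=> [cf [C [c hf]]] [cg [D [e hg]]]; split; first exact: rcontD.
have C0 : 0 <= C by have := le_trans (normr_ge0 _) (hf 0); rewrite pmulr_lge0// expR_gt0.
have D0 : 0 <= D by have := le_trans (normr_ge0 _) (hg 0); rewrite pmulr_lge0// expR_gt0.
exists (C + D), (Num.max c e) => t; apply: le_trans (ler_normD _ _) _.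
rewrite mulrDl; apply: lerD; [apply: le_trans (hf t) _|apply: le_trans (hg t) _];
  by apply: ler_wpM2l => //; rewrite ler_expR; apply: ler_wpM2r => //; rewrite le_max lexx ?orbT.
Qed.

Lemma eb1_M f g : eb1 f -> eb1 g -> eb1 (fun t => f t * g t).
Proof.
move=> [cf [C [c hf]]] [cg [D [e hg]]]; split; first exact: rcontM.
exists (C * D), (c + e) => t; rewrite normrM mulrDl expRD mulrACA.
exact: ler_pM.
Qed.

Lemma eb1_cst c : eb1 (fun=> c).
Proof. by split; [exact: rcont_cst|exists `|c|, 0 => t; rewrite mul0r expR0 mulr1]. Qed.

Lemma eb1_id : eb1 (fun t => t).
Proof.
split; first by move=> t; exact: cvg_id.
by exists 1, 1 => t; rewrite !mul1r; have := expR_ge1Dx `|t|; move: (expR _) => a; lra.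
Qed.

Lemma ed1_eb1 f : ed1 f -> eb1 f.
Proof. by move=> [cf /(_ 0)[C h]]; split => //; exists C, 0 => t; rewrite mul0r -[X in expR X]oppr0 -(mul0r `|t|). Qed.

Lemma ed1_D f g : ed1 f -> ed1 g -> ed1 (fun t => f t + g t).
Proof.
move=> [cf hf] [cg hg]; split; first exact: rcontD.
move=> nu; have [C hC] := hf nu; have [D hD] := hg nu; exists (C + D) => t.
by apply: le_trans (ler_normD _ _) _; rewrite mulrDl; apply: lerD.
Qed.

Lemma ed1_M f g : eb1 f -> ed1 g -> ed1 (fun t => f t * g t).
Proof.
move=> [cf [C [c hf]]] [cg hg]; split; first exact: rcontM.
move=> nu; have [D hD] := hg (nu + c); exists (C * D) => t.
rewrite normrM (_ : - (nu * `|t|) = c * `|t| + - ((nu + c) * `|t|)); last by ring.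
by rewrite expRD mulrACA; exact: ler_pM.
Qed.

Lemma ed1_Z c f : ed1 f -> ed1 (fun t => c * f t).
Proof. exact: ed1_M (eb1_cst c). Qed.

Lemma ed1_B f g : ed1 f -> ed1 g -> ed1 (fun t => f t - g t).
Proof.
move=> ef eg; have := ed1_D ef (ed1_Z (-1) eg).
by congr ed1; apply/funext => t; rewrite mulN1r.
Qed.

Lemma ed1_MM f g : ed1 f -> ed1 g -> ed1 (fun t => f t * g t).
Proof. by move=> ef; apply: ed1_M; exact: ed1_eb1. Qed.

Lemma ed1_sqr f : ed1 f -> ed1 (fun t => f t ^+ 2).
Proof. by move=> ef; under eq_fun do rewrite expr2; exact: ed1_MM. Qed.

Lemma ed1_0 : ed1 (fun=> 0).
Proof. by split; [exact: rcont_cst|move=> nu; exists 0 => t; rewrite normr0 mul0r]. Qed.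

Lemma ed1_dom1 f : ed1 f -> dom1 f.
Proof.
move=> [cf /(_ 2)[C hC]]; split => //; exists C => t; apply: le_trans (hC t) _.
have C0 : 0 <= C by have := le_trans (normr_ge0 _) (hC 0); rewrite pmulr_lge0// expR_gt0.
apply: ler_wpM2l => //; rewrite expRN lef_pV2 ?posrE ?expR_gt0 ?ltr_wpDr ?sqr_ge0//.
rewrite mulrC expRM_natr; apply: (@le_trans _ _ ((1 + `|t|) ^+ 2)).
  by rewrite -[t ^+ 2]real_normK ?num_real//; have := normr_ge0 t; rewrite !expr2; lra.
by apply: lerXn2r; rewrite ?nnegrE ?addr_ge0 ?expR_ge0// expR_ge1Dx.
Qed.

Lemma ed1_integrable f : ed1 f -> mu1.-integrable setT (EFin \o f).
Proof. by move=> /ed1_dom1/dom1_integrable. Qed.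

Lemma I1_D f g : ed1 f -> ed1 g -> I1 (fun t => f t + g t) = I1 f + I1 g.
Proof. by move=> ef eg; apply: RintegralD => //; exact: ed1_integrable. Qed.

Lemma I1_Z c f : ed1 f -> I1 (fun t => c * f t) = c * I1 f.
Proof. by move=> ef; apply: RintegralZl => //; exact: ed1_integrable. Qed.

Lemma I1_B f g : ed1 f -> ed1 g -> I1 (fun t => f t - g t) = I1 f - I1 g.
Proof. by move=> ef eg; apply: RintegralB => //; exact: ed1_integrable. Qed.

Lemma I1_sum n (F : 'I_n -> R -> R) : (forall i, ed1 (F i)) ->
  I1 (fun t => \sum_i F i t) = \sum_i I1 (F i).
Proof.
move=> h.
have H r : ed1 (fun t => \sum_(i <- r) F i t) /\ I1 (fun t => \sum_(i <- r) F i t) = \sum_(i <- r) I1 (F i).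
  elim: r => [|i r [E IH]].
    have -> : (fun t => \sum_(i <- [::]) F i t) = fun=> 0 by apply/funext => t; rewrite big_nil.
    split; first exact: ed1_0.
    have h0 := I1_D ed1_0 ed1_0; have E : (fun _ : R => 0 + 0) = (fun=> 0) :> (R -> R) by apply/funext => t; rewrite addr0.
    by rewrite E in h0; rewrite big_nil; move: h0; move: (I1 _) => a; lra.
  have -> : (fun t => \sum_(j <- i :: r) F j t) = fun t => F i t + \sum_(j <- r) F j t.
    by apply/funext => t; rewrite big_cons.
  by split; [exact: ed1_D|rewrite big_cons -IH; exact: I1_D].
exact: (H _).2.
Qed.

Lemma I1_le f g : ed1 f -> ed1 g -> (forall t, f t <= g t) -> I1 f <= I1 g.
Proof. by move=> ef eg fg; apply: le_Rintegral => //; exact: ed1_integrable. Qed.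

Lemma I1_ge0 f : (forall t, 0 <= f t) -> 0 <= I1 f.
Proof. by move=> h; apply: Rintegral_ge0. Qed.

(** The derivative is carried along as a second function, so that [lower] and [raise] are plain
    formulas in both. *)
Definition diff1 f f' := [/\ forall t, is_derive t (1 : R) f (f' t), ed1 f & ed1 f'].

Lemma I1_derive0 f f' : diff1 f f' -> I1 f' = 0.
Proof.
move=> [df ef ef']; rewrite /I1 /Rintegral (integral1_derive0 df)//; first exact: ed1_dom1.
by case: (ed1_dom1 ef).
Qed.

Lemma diff1_M f f' g g' : diff1 f f' -> diff1 g g' -> diff1 (fun t => f t * g t) (fun t => f' t * g t + f t * g' t).
Proof.
move=> [df ef ef'] [dg eg eg']; split; [|exact: ed1_MM|exact: (ed1_D (ed1_MM ef' eg) (ed1_MM ef eg'))].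
move=> t; apply: (is_derive_eq (is_deriveM (df t) (dg t))).
by rewrite -![_ *: _]/(_ * _) addrC mulrC.
Qed.

Lemma diff1_lin c f f' g g' : diff1 f f' -> diff1 g g' ->
  diff1 (fun t => f t + c * g t) (fun t => f' t + c * g' t).
Proof.
move=> [df ef ef'] [dg eg eg']; split; [|exact: (ed1_D ef (ed1_Z c eg))|exact: (ed1_D ef' (ed1_Z c eg'))].
move=> t; have h := @is_deriveZ _ _ _ g c t 1 (g' t) (dg t).
exact: (is_derive_eq (is_deriveD (df t) h)).
Qed.

(** Annihilation and creation operators of the harmonic oscillator with ground state [gs]. *)
Definition lower f f' (t : R) : R := f' t + t / 2 * f t.
Definition raise f f' (t : R) : R := - f' t + t / 2 * f t.

Lemma eb1_half : eb1 (fun t => t / 2).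
Proof. exact: (eb1_M eb1_id (eb1_cst 2^-1)). Qed.

Lemma ed1_lower f f' : diff1 f f' -> ed1 (lower f f').
Proof. by move=> [df ef ef']; exact: (ed1_D ef' (ed1_M eb1_half ef)). Qed.

Lemma ed1_raise f f' : diff1 f f' -> ed1 (raise f f').
Proof.
move=> [df ef ef']; have := ed1_B (ed1_M eb1_half ef) ef'.
by congr ed1; apply/funext => t; rewrite addrC.
Qed.

Lemma adjoint f f' u u' : diff1 f f' -> diff1 u u' ->
  I1 (fun t => lower f f' t * u t) = I1 (fun t => f t * raise u u' t).
Proof.
move=> Df Du; have D := diff1_M Df Du; have z := I1_derive0 D.
have [_ ef ef'] := Df; have [_ eu eu'] := Du; have [_ _ ep] := D.
apply/eqP; rewrite -subr_eq0 -I1_B; [|exact: (ed1_MM (ed1_lower Df) eu)|exact: (ed1_MM ef (ed1_raise Du))].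
rewrite -[X in _ == X]z; apply/eqP; congr I1; apply/funext => t.
by rewrite /lower /raise; ring.
Qed.

(** The commutator of [lower] and [raise] is the identity: the difference of the two squares minus
    [u^2] is minus the derivative of [t u^2]. *)
Lemma raise_norm u u' : diff1 u u' ->
  I1 (fun t => raise u u' t ^+ 2) = I1 (fun t => lower u u' t ^+ 2) + I1 (fun t => u t ^+ 2).
Proof.
move=> Du; have [du eu eu'] := Du.
have e1 := ed1_sqr (ed1_raise Du); have e2 := ed1_sqr (ed1_lower Du); have e3 := ed1_sqr eu.
have D := diff1_M Du Du.
have D2 : diff1 (fun t => t * (u t * u t)) (fun t => u t * u t + t * (u' t * u t + u t * u' t)).
  case: D => dD eD eD'; split; [|exact: (ed1_M eb1_id eD)|exact: (ed1_D eD (ed1_M eb1_id eD'))].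
  move=> t; apply: (is_derive_eq (is_deriveM (is_derive_id t (1 : R)) (dD t))).
  by rewrite -![_ *: _]/(_ * _) mulr1 addrC.
have [_ _ e4] := D2; have z := I1_derive0 D2.
apply/eqP; rewrite -subr_eq0 -(I1_D e2 e3) -(I1_B e1 (ed1_D e2 e3)) -oppr_eq0 -mulN1r -I1_Z; last first.
  exact: (ed1_B e1 (ed1_D e2 e3)).
rewrite -[X in _ == X]z; apply/eqP; congr I1; apply/funext => t.
by rewrite /lower /raise; field.
Qed.

Definition gs (t : R) : R := expR (- (t ^+ 2 / 4)).

Lemma is_derive_gauss c (t : R) : is_derive t (1 : R) (fun t => expR (- (t ^+ 2 / c))) (- (2 * t / c) * expR (- (t ^+ 2 / c))).
Proof.
have h1 := is_deriveM (is_derive_id t (1 : R)) (is_derive_id t (1 : R)).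
have h2 := @is_deriveZ _ _ _ _ (- c^-1) t 1 _ h1.
have h3 := @is_derive1_comp R expR _ t _ _ (is_derive_expR _) h2.
have -> : (fun t => expR (- (t ^+ 2 / c))) = (fun t => expR (- c^-1 * (t * t))).
  by apply/funext => s; congr expR; rewrite expr2; ring.
apply: (is_derive_eq h3); rewrite -![_ *: _]/(_ * _).
have -> : (- c^-1 \*: (id * id)) t = - (t ^+ 2 / c).
  by rewrite -[LHS]/(- c^-1 * (t * t)) expr2; ring.
by ring.
Qed.

Lemma ed1_gs : ed1 gs.
Proof.
split; first exact: (is_derive_cont (is_derive_gauss 4)).
move=> nu; exists (expR (nu ^+ 2)) => t.
rewrite /gs ger0_norm ?expR_ge0// -expRD ler_expR -[t ^+ 2]real_normK ?num_real//.
by have := sqr_ge0 (`|t| / 2 - nu); rewrite !expr2; move: `|t| => a; lra.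
Qed.

End line.

(** * Surjectivity of the raising operator *)

Section solve.
Context {R : realType}.
Notation mu1 := (@lebesgue_measure R).

Let ka (t : R) : R := (1 + t ^+ 2)^-1.

Lemma dom1_ka : dom1 ka.
Proof.
split; first exact: continuous_oneDsqrV.
by exists 1 => t; rewrite mul1r ger0_norm// invr_ge0 addr_ge0// sqr_ge0.
Qed.

(** On [A] both [gs] and the exponential of rate [nu] are largest at modulus [|s|]; the two
    remaining units of the rate pay for the integrable factor [ka]. *)
Lemma le_I1_part (A : set (measurableTypeR R)) (f : R -> R) C nu (s : R) : measurable A ->
  mu1.-integrable setT (EFin \o (fun t => gs t * f t)) -> 0 <= nu ->
  (forall t, A t -> `|s| <= `|t|) ->
  (forall t, `|f t| <= C * expR (- ((nu + 2) * `|t|))) ->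
  `|\int[mu1]_(t in A) (gs t * f t)| <= gs s * (C * expR (- (nu * `|s|)) * I1 ka).
Proof.
move=> mA ig nu0 hA hC.
have C0 : 0 <= C by have := le_trans (normr_ge0 _) (hC 0); rewrite pmulr_lge0// expR_gt0.
have ia : mu1.-integrable setT (EFin \o ((fun t => gs t * f t) \_ A)).
  rewrite -restrict_EFin; apply/integrable_restrict => //.
  by rewrite setTI; apply: integrableS ig.
rewrite Rintegral_mkcond; apply: le_trans (le_normr_Rintegral measurableT ia) _.
have ik := dom1_integrable dom1_ka.
rewrite mulrA /I1 -(RintegralZl _ measurableT ik); apply: le_Rintegral => //.
- have := integrable_abse ia; apply: eq_integrable => //.
- exact: (integrableZl measurableT _ ik).
move=> t _; rewrite patchE; case: ifPn => [|_]; last first.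
  by rewrite normr0 mulr_ge0 ?invr_ge0 ?addr_ge0 ?sqr_ge0// mulr_ge0 ?expR_ge0// mulr_ge0// expR_ge0.
rewrite inE => /hA st; rewrite normrM [`|gs t|]ger0_norm ?expR_ge0// -mulrA; apply: ler_pM => //; first exact: expR_ge0.
  rewrite /gs ler_expR lerN2 ler_pM2r ?invr_gt0//.
  by rewrite -[s ^+ 2]real_normK ?num_real// -[t ^+ 2]real_normK ?num_real// lerXn2r ?nnegrE.
apply: le_trans (hC t) _; rewrite -mulrA; apply: ler_wpM2l => //.
rewrite mulrDl opprD expRD; apply: ler_pM; rewrite ?expR_ge0//.
  by rewrite ler_expR lerN2; apply: ler_wpM2l.
rewrite /ka expRN lef_pV2 ?posrE ?expR_gt0 ?ltr_wpDr ?sqr_ge0//.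
rewrite mulrC expRM_natr; apply: (@le_trans _ _ ((1 + `|t|) ^+ 2)).
  by rewrite -[t ^+ 2]real_normK ?num_real//; have := normr_ge0 t; rewrite !expr2; lra.
by apply: lerXn2r; rewrite ?nnegrE ?addr_ge0 ?expR_ge0// expR_ge1Dx.
Qed.

(* The solution is - e^{t^2/4} times the primitive of e^{-s^2/4} f that vanishes at
   -oo; by hypothesis it vanishes at +oo as well. *)
Lemma raise_surjective (f f' : R -> R) : diff1 f f' -> I1 (fun t => gs t * f t) = 0 ->
  exists u, diff1 u (fun t => t / 2 * u t - f t).
Proof.
move=> [df ef ef'] f0; have [cf hf] := ef.
have egf : ed1 (fun t => gs t * f t) := ed1_MM (@ed1_gs R) ef.
have ig := ed1_integrable egf.
have [F FE dF] : exists2 F : R -> R, (forall t, F t = \int[mu1]_(x in `]-oo, t]) (gs x * f x)) &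
    forall t, is_derive t (1 : R) F (gs t * f t).
  exists (fun t => \int[mu1]_(x in [set` Interval -oo%O (BRight t)]) (gs x * f x)) => // t.
  have := @continuous_FTC1 R (fun x => gs x * f x) -oo%O t (t + 1) _ _ _ (egf.1 t).
  rewrite ltrDl ltr01 ltNyr => /(_ isT); case.
  - by apply: integrableS ig.
  - by [].
  by move=> d1; rewrite derive1E => d2; split.
have [E [EK E0 dE]] : exists E : R -> R, [/\ forall t, E t * gs t = 1, forall t, 0 < E t &
    forall t, is_derive t (1 : R) E (t / 2 * E t)].
  exists (fun t => expR (- (t ^+ 2 / - 4))); split=> t.
  - by rewrite /gs -expRD (_ : _ + _ = 0) ?expR0//; field.
  - exact: expR_gt0.
  by apply: (is_derive_eq (is_derive_gauss (- 4) t)); congr (_ * _); field.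
have pure (a b c : R) : a * b = 1 -> a * (b * c) = c by move=> h; rewrite mulrA h mul1r.
pose u t := - (E t * F t).
have du t : is_derive t (1 : R) u (t / 2 * u t - f t).
  apply: (is_derive_eq (is_deriveN (is_deriveM (dE t) (dF t)))).
  rewrite -![_ *: _]/(_ * _) (pure _ _ _ (EK t)) /u.
  by move: (E t) (F t) (f t) => a b c; ring.
have bF nu C : 0 <= nu -> (forall t, `|f t| <= C * expR (- ((nu + 2) * `|t|))) ->
    forall t, `|u t| <= (C * I1 ka) * expR (- (nu * `|t|)).
  move=> nu0 hC t.
  suff H : `|F t| <= gs t * (C * expR (- (nu * `|t|)) * I1 ka).
    rewrite /u normrN normrM (gtr0_norm (E0 t)); apply: le_trans (ler_wpM2l (ltW (E0 t)) H) _.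
    by rewrite (pure _ _ _ (EK t)) mulrAC.
  rewrite FE.
  have [t0|t0] := leP t 0.
    apply: le_I1_part => // x.
    rewrite /= in_itv/= => xt; rewrite !ler0_norm ?lerN2//.
    exact: le_trans xt t0.
  (* For positive [t] the ray to the left contains 0, where [gs] is not small; as the total integral
     vanishes, the ray to the right may be used instead. *)
  have -> : \int[mu1]_(x in `]-oo, t]) (gs x * f x) = - \int[mu1]_(x in `]t, +oo[) (gs x * f x).
    have := @Rintegral_setU _ _ _ mu1 `]-oo, t]%classic `]t, +oo[%classic (fun x => gs x * f x).
    have -> : `]-oo, t]%classic `|` `]t, +oo[%classic = [set: R].
      by apply/seteqP; split => // x _; rewrite /= !in_itv/= andbT; case: (leP x t); [left|right].
    rewrite -/(I1 (fun x => gs x * f x)) f0 => /(_ _ _ ig).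
    move=> H; apply/eqP; rewrite -subr_eq0 opprK eq_sym; apply/eqP; apply: H.
    - exact: measurable_itv.
    - exact: measurable_itv.
    - apply/disj_setPS => x [] /=; rewrite !in_itv/= andbT => xt tx.
      by have := le_lt_trans xt tx; rewrite ltxx.
  rewrite normrN; apply: le_I1_part => // x.
  rewrite /= in_itv/= andbT => tx; rewrite !gtr0_norm//; first exact: ltW.
  exact: lt_trans t0 tx.
exists u.
have eu : ed1 u.
  split; first exact: (is_derive_cont du).
  move=> nu; have [C hC] := hf (`|nu| + 2); exists (C * I1 ka) => t.
  apply: le_trans (bF `|nu| C (normr_ge0 _) hC t) _.
  have := le_trans (normr_ge0 _) (bF `|nu| C (normr_ge0 _) hC t); rewrite pmulr_lge0 ?expR_gt0// => h0.
  apply: ler_wpM2l => //; rewrite ler_expR lerN2; apply: ler_wpM2r => //; exact: ler_norm.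
by split => //; exact: (ed1_B (ed1_M (@eb1_half R) eu) ef).
Qed.

End solve.

(** * One-dimensional Hermite expansion with a rate *)

Section hermite_functions.
Context {R : realType}.

(** The probabilists' Hermite polynomials, by their three-term recurrence. *)
Fixpoint He (r : nat) (t : R) : R :=
  match r with
  | 0%N => 1
  | r1.+1 => match r1 with 0%N => t | r2.+1 => t * He r1 t - r1%:R * He r2 t end
  end.

(** At [r = 0] the predecessor is 0 by default and its term is multiplied by zero; the ladder
    relations below rely on the same convention. *)
Lemma HeS r t : He r.+1 t = t * He r t - r%:R * He r.-1 t.
Proof. by case: r => [|r] //=; rewrite mulr1 mul0r subr0. Qed.

Lemma is_derive_He r (t : R) : is_derive t (1 : R) (He r) (r%:R * He r.-1 t).
Proof.
suff H : (forall t : R, is_derive t (1 : R) (He r) (r%:R * He r.-1 t)) /\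
   (forall t : R, is_derive t (1 : R) (He r.+1) (r.+1%:R * He r t)) by exact: H.1.
elim: r {t} => [|r [IH1 IH2]].
  split=> t; first by rewrite mul0r; exact: is_derive_cst.
  by rewrite mulr1; exact: is_derive_id.
split=> [//|t].
have h1 := is_deriveM (is_derive_id t (1 : R)) (IH2 t).
have h2 := @is_deriveZ _ _ _ (He r) (r.+1%:R) t 1 _ (IH1 t).
apply: (is_derive_eq (is_deriveB h1 h2)).
rewrite -![_ *: _]/(_ * _) [He r.+1 t]HeS -[id t]/t -!natr1.
by move: (He r t) (He r.-1 t) (r%:R : R) => a b c; ring.
Qed.

Lemma eb1_He r : eb1 (He r).
Proof.
suff H : eb1 (He r) /\ eb1 (He r.+1) by exact: H.1.
elim: r => [|r [IH1 IH2]]; first by split; [exact: (eb1_cst 1)|exact: eb1_id].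
split => //.
have := eb1_D (eb1_M (@eb1_id R) IH2) (eb1_M (eb1_cst (- r.+1%:R)) IH1).
by congr eb1; apply/funext => t; rewrite mulNr.
Qed.

Lemma derive1n_gauss r : derive1n r (fun t : R => expR (- (t ^+ 2) / 2)) =
  fun t => (-1) ^+ r * He r t * expR (- (t ^+ 2) / 2).
Proof.
elim: r => [|r IH].
  by apply/funext => t; rewrite /= expr0 !mul1r.
rewrite derive1nS IH; apply/funext => t.
have dg : is_derive t (1 : R) (fun t : R => expR (- (t ^+ 2) / 2)) (- t * expR (- (t ^+ 2) / 2)).
  have E (s : R) : - (s ^+ 2) / 2 = - (s ^+ 2 / 2) by rewrite mulNr.
  under eq_fun do rewrite E; rewrite E.
  by apply: (is_derive_eq (is_derive_gauss 2 t)); congr (_ * _); field.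
have h1 := @is_deriveZ _ _ _ (He r) ((-1) ^+ r) t 1 _ (is_derive_He r t).
have h2 := is_deriveM h1 dg.
rewrite derive1E (@derive_val _ _ _ _ _ _ _ h2).
rewrite -![_ *: _]/(_ * _) HeS -[((-1) ^+ r \*: He r) t]/((-1) ^+ r * He r t) [(-1) ^+ r.+1]exprS.
by move: (He r t) (He r.-1 t) (expR _) (r%:R : R) ((-1) ^+ r) => a b c d e; ring.
Qed.

Definition hn r : R := Num.sqrt (r`!)%:R.

Lemma hnS r : hn r.+1 = Num.sqrt r.+1%:R * hn r.
Proof. by rewrite /hn factS natrM sqrtrM// ler0n. Qed.

Lemma hermiteE r (t : R) : hermite r t = (hn r)^-1 * He r t.
Proof.
rewrite /hermite derive1n_gauss -/(hn r).
have -> : (-1) ^+ r / hn r * expR (t ^+ 2 / 2) * ((-1) ^+ r * He r t * expR (- (t ^+ 2) / 2)) =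
   ((-1) ^+ r * (-1) ^+ r) * (expR (t ^+ 2 / 2) * expR (- (t ^+ 2) / 2)) * ((hn r)^-1 * He r t).
  by move: (expR _) (expR _) (He r t) ((-1) ^+ r) (hn r)^-1 => a b c d e; ring.
by rewrite -expRD -exprMn mulrNN mulr1 expr1n mulNr subrr expR0 !mul1r.
Qed.

(** [gs] is the square root of the Gaussian without its normalizing factor, so these functions are
    orthogonal with common squared norm [Zn] instead of 1. *)
Definition eta r (t : R) : R := hermite r t * gs t.

Lemma etaE r t : eta r t = (hn r)^-1 * He r t * gs t. Proof. by rewrite /eta hermiteE. Qed.

Lemma sqrtn_sqr r : Num.sqrt (r%:R : R) * Num.sqrt r%:R = r%:R.
Proof. by rewrite -expr2 sqr_sqrtr. Qed.

Lemma eta_down r (t : R) : (hn r)^-1 * (r%:R * He r.-1 t) * gs t = Num.sqrt r%:R * eta r.-1 t.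
Proof.
case: r => [|r]; first by rewrite mul0r mulr0 mul0r sqrtr0 mul0r.
rewrite etaE /= hnS invfM -[X in X * He r t](sqrtn_sqr r.+1).
have s0 : Num.sqrt (r.+1%:R : R) != 0 by rewrite gt_eqF// sqrtr_gt0.
by move: s0; move: (Num.sqrt _) (hn r)^-1 (He r t) (gs t) => a b c d a0; field.
Qed.

Lemma eta_up r (t : R) : t * eta r t = Num.sqrt r.+1%:R * eta r.+1 t + Num.sqrt r%:R * eta r.-1 t.
Proof.
rewrite -eta_down !etaE HeS hnS invfM.
have s0 : Num.sqrt (r.+1%:R : R) != 0 by rewrite gt_eqF// sqrtr_gt0.
by move: s0 (hn r)^-1 (He r t) (gs t) (He r.-1 t) (r%:R : R) => +; move: (Num.sqrt _) => a a0 b c d e g; field.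
Qed.

Definition eta' r (t : R) : R := Num.sqrt r%:R * eta r.-1 t - t / 2 * eta r t.

Lemma diff1_eta r : diff1 (eta r) (eta' r).
Proof.
have e0 k : ed1 (eta k).
  have := ed1_M (eb1_M (eb1_cst (hn k)^-1) (eb1_He k)) (@ed1_gs R).
  by congr ed1; apply/funext => t; rewrite etaE.
split; [|exact: e0|exact: (ed1_B (ed1_Z _ (e0 _)) (ed1_M (@eb1_half R) (e0 r)))].
move=> t.
have h1 := @is_deriveZ _ _ _ (He r) (hn r)^-1 t 1 _ (is_derive_He r t).
have h2 := is_deriveM h1 (is_derive_gauss 4 t).
have -> : eta r = (fun t => ((hn r)^-1 * He r t) * expR (- (t ^+ 2 / 4))).
  by apply/funext => s; rewrite etaE.
apply: (is_derive_eq h2); rewrite /eta' -eta_down etaE -![_ *: _]/(_ * _) -/(gs t).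
rewrite -[((hn r)^-1 \*: He r) t]/((hn r)^-1 * He r t).
by move: (He r t) (He r.-1 t) (gs t) (r%:R : R) (hn r)^-1 => a b c d e; field.
Qed.

Lemma ed1_eta r : ed1 (eta r). Proof. by case: (diff1_eta r). Qed.

Lemma lower_eta r t : lower (eta r) (eta' r) t = Num.sqrt r%:R * eta r.-1 t.
Proof. by rewrite /lower /eta' subrK. Qed.

Lemma raise_eta r t : raise (eta r) (eta' r) t = Num.sqrt r.+1%:R * eta r.+1 t.
Proof. by rewrite /raise /eta'; have := eta_up r t; move: (_ * eta r.+1 t) (_ * eta r.-1 t) (eta r t) => a b c; lra. Qed.

Definition co j (f : R -> R) : R := I1 (fun t => f t * eta j t).
Definition Zn : R := I1 (fun t => eta 0 t ^+ 2).

Lemma co_lower j f f' : diff1 f f' -> co j (lower f f') = Num.sqrt j.+1%:R * co j.+1 f.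
Proof.
move=> Df; rewrite /co (adjoint Df (diff1_eta j)) -I1_Z; last first.
  by case: Df => _ ef _; exact: (ed1_MM ef (ed1_eta _)).
by congr I1; apply/funext => t; rewrite raise_eta; ring.
Qed.

(** [co_lower] lowers both indices by one; the induction ends because [lower] annihilates
    [eta 0]. *)
Lemma eta_orth j k : co j (eta k) = if j == k then Zn else 0.
Proof.
elim: j k => [|j IH] k.
  case: k => [|k]; first by rewrite /co /Zn; congr I1; apply/funext => t; rewrite expr2.
  have h := co_lower k (diff1_eta 0); move: h.
  have -> : lower (eta 0) (eta' 0) = fun t => 0 by apply/funext => t; rewrite lower_eta sqrtr0 mul0r.
  have -> : co k (fun=> 0) = 0.
    transitivity (I1 (fun t => 0 * eta k t)); last by rewrite (I1_Z 0 (ed1_eta k)) mul0r.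
    by congr I1; apply/funext => t; rewrite !mul0r.
  move/esym/eqP; rewrite mulf_eq0 gt_eqF ?sqrtr_gt0//= => /eqP.
  by rewrite /co => <-; congr I1; apply/funext => t; rewrite mulrC.
have h := co_lower j (diff1_eta k); move: h.
have -> : lower (eta k) (eta' k) = fun t => Num.sqrt k%:R * eta k.-1 t by apply/funext => t; exact: lower_eta.
have -> : co j (fun t => Num.sqrt k%:R * eta k.-1 t) = Num.sqrt k%:R * co j (eta k.-1).
  by rewrite /co -(I1_Z _ (ed1_MM (ed1_eta _) (ed1_eta _))); congr I1; apply/funext => t; rewrite mulrA.
rewrite IH; have s0 : Num.sqrt (j.+1%:R : R) != 0 by rewrite gt_eqF// sqrtr_gt0.
case: k => [|k]; first by rewrite sqrtr0 mul0r => /esym/eqP; rewrite mulf_eq0 (negbTE s0) => /eqP ->.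
rewrite eqSS /=; case: eqP => [->|_].
  have s1 : Num.sqrt (k.+1%:R : R) != 0 by rewrite gt_eqF// sqrtr_gt0.
  by move=> /(mulfI s1) ->.
by rewrite mulr0 => /esym/eqP; rewrite mulf_eq0 (negbTE s0) => /eqP ->.
Qed.

Lemma eta0E t : eta 0 t = gs t.
Proof. by rewrite etaE /hn fact0 sqrtr1 invr1 !mul1r. Qed.

(** The one-dimensional Sobolev inequality at 0 bounds [gs 0 ^+ 2 = 1] by a multiple of [Zn], since
    [eta' 0] is a multiple of [eta 1]. *)
Lemma Zn_gt0 : 0 < Zn.
Proof.
have E t : eta' 0 t = - 2^-1 * eta 1 t.
  by have := eta_up 0 t; rewrite /eta' sqrtr0 sqrtr1 /=; move: (eta 0 t) (eta 1 t) => a b; lra.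
have [d0 e0 e1] := diff1_eta 0.
have := sobolev_1d 0 d0 e1.1.
have [s0 s1] := (ed1_sqr e0, ed1_sqr e1).
have es := ed1_D (ed1_D s0 s0) s1.
rewrite -[X in (_ <= X)%E]fineK ?integrable_fin_num//; last exact: (ed1_integrable es).
rewrite -[fine _]/(I1 _) lee_fin (I1_D (ed1_D s0 s0) s1) (I1_D s0 s0) -/Zn.
have -> : I1 (fun t => eta' 0 t ^+ 2) = 4^-1 * Zn.
  have := eta_orth 1 1; rewrite eqxx => <-; rewrite /co -(I1_Z _ (ed1_MM (ed1_eta 1) (ed1_eta 1))).
  by congr I1; apply/funext => t; rewrite E; field.
by rewrite eta0E /gs expr0n/= mul0r oppr0 expR0 expr1n; move: Zn => z; lra.
Qed.

Definition proj M (f : R -> R) t : R := \sum_(j < M) Zn^-1 * co j f * eta j t.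
Definition proj' M (f : R -> R) t : R := \sum_(j < M) Zn^-1 * co j f * eta' j t.
Definition defect M (f : R -> R) : R := I1 (fun t => f t ^+ 2) - Zn^-1 * \sum_(j < M) co j f ^+ 2.

Lemma diff1_proj M f : diff1 (proj M f) (proj' M f).
Proof.
elim: M => [|M IH].
  have -> : proj 0 f = fun=> 0 by apply/funext => t; rewrite /proj big_ord0.
  have -> : proj' 0 f = fun=> 0 by apply/funext => t; rewrite /proj' big_ord0.
  by split; [move=> t; exact: is_derive_cst|exact: ed1_0|exact: ed1_0].
have -> : proj M.+1 f = fun t => proj M f t + Zn^-1 * co M f * eta M t.
  by apply/funext => t; rewrite /proj big_ord_recr.
have -> : proj' M.+1 f = fun t => proj' M f t + Zn^-1 * co M f * eta' M t.
  by apply/funext => t; rewrite /proj' big_ord_recr.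
exact: (diff1_lin _ IH (diff1_eta M)).
Qed.

Lemma ed1_proj M f : ed1 (proj M f). Proof. by case: (diff1_proj M f). Qed.

Lemma I1_proj M f g : ed1 g -> I1 (fun t => g t * proj M f t) = Zn^-1 * \sum_(j < M) co j f * co j g.
Proof.
move=> eg; have e j := ed1_Z (Zn^-1 * co j f) (ed1_MM eg (ed1_eta j)).
rewrite (_ : (fun t => _) = fun t => \sum_(j < M) Zn^-1 * co j f * (g t * eta j t)); last first.
  by apply/funext => t; rewrite /proj mulr_sumr; apply: eq_bigr => j _; ring.
rewrite I1_sum => [|j]; last exact: e.
rewrite mulr_sumr; apply: eq_bigr => j _.
by rewrite (I1_Z _ (ed1_MM eg (ed1_eta j))) -mulrA.
Qed.

Lemma co_proj M f k : (k < M)%N -> co k (proj M f) = co k f.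
Proof.
move=> kM; rewrite /co.
have := I1_proj M f (ed1_eta k); rewrite (_ : (fun t => eta k t * _) = fun t => proj M f t * eta k t); last first.
  by apply/funext => t; rewrite mulrC.
move=> ->; rewrite (bigD1 (Ordinal kM))//= big1 => [|j jk].
  by rewrite addr0 eta_orth eqxx mulrC mulfK// gt_eqF// Zn_gt0.
rewrite eta_orth; case: eqP => [E|_]; last by rewrite mulr0.
by case/negP: jk; apply/eqP/val_inj.
Qed.

Lemma coB k f g : ed1 f -> ed1 g -> co k (fun t => f t - g t) = co k f - co k g.
Proof.
move=> ef eg; rewrite /co -(I1_B (ed1_MM ef (ed1_eta k)) (ed1_MM eg (ed1_eta k))).
by congr I1; apply/funext => t; rewrite mulrBl.
Qed.

Lemma defectE M f : ed1 f -> I1 (fun t => (f t - proj M f t) ^+ 2) = defect M f.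
Proof.
move=> ef; have ep := ed1_proj M f; have eh := ed1_B ef ep.
have -> : (fun t => (f t - proj M f t) ^+ 2) = fun t => (f t ^+ 2 - f t * proj M f t) - (f t - proj M f t) * proj M f t.
  by apply/funext => t; ring.
rewrite (I1_B (ed1_B (ed1_sqr ef) (ed1_MM ef ep)) (ed1_MM eh ep)) (I1_B (ed1_sqr ef) (ed1_MM ef ep)).
rewrite (I1_proj _ _ ef) (I1_proj _ _ eh).
rewrite [X in _ - _ * X]big1 ?mulr0 ?subr0 => [|j _]; last first.
  by rewrite (coB _ ef ep) co_proj// subrr mulr0.
by rewrite /defect; congr (_ - _ * _); apply: eq_bigr => j _; rewrite expr2.
Qed.

Lemma bessel M f : ed1 f -> Zn^-1 * \sum_(j < M) co j f ^+ 2 <= I1 (fun t => f t ^+ 2).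
Proof.
by move=> ef; rewrite -subr_ge0 -/(defect M f) -defectE//; apply: I1_ge0 => t; exact: sqr_ge0.
Qed.

(** Write [f = raise u]. Then [adjoint] makes the pairing of [lower f] with [u] equal to [|f|^2]; in
    the inductive step [u] is orthogonal to one Hermite function fewer, and [raise_norm] with the
    induction hypothesis gives [(N + 2) |u|^2 <= |f|^2]. Young's inequality with weight [N + 2]
    concludes. *)
Lemma lower_ge N f f' : diff1 f f' -> (forall j, (j <= N)%N -> co j f = 0) ->
  N.+1%:R * I1 (fun t => f t ^+ 2) <= I1 (fun t => lower f f' t ^+ 2).
Proof.
elim: N f f' => [|N IH] f f' Df h; have [_ ef _] := Df.
all: have f0 : I1 (fun t => gs t * f t) = 0.
all: try by rewrite -(h 0%N (leq0n _)) /co; congr I1; apply/funext => t; rewrite eta0E mulrC.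
all: have [u Du] := raise_surjective Df f0.
all: have [_ eu _] := Du.
all: have Er : (fun t => raise u (fun t => t / 2 * u t - f t) t) = f by apply/funext => t; rewrite /raise opprB subrK.
all: have nf := raise_norm Du.
all: rewrite (_ : (fun t => raise _ _ t ^+ 2) = fun t => f t ^+ 2) in nf; last by apply/funext => t; rewrite (congr1 (@^~ t) Er).
all: have key := adjoint Df Du.
all: rewrite (_ : (fun t => f t * raise _ _ t) = fun t => f t ^+ 2) in key; last by apply/funext => t; rewrite (congr1 (@^~ t) Er) expr2.
- have := I1_le (ed1_Z 2 (ed1_MM (ed1_lower Df) eu)) (ed1_D (ed1_sqr (ed1_lower Df)) (ed1_sqr eu)).
  rewrite (I1_Z _ (ed1_MM (ed1_lower Df) eu)) (I1_D (ed1_sqr (ed1_lower Df)) (ed1_sqr eu)) key.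
  move=> H; have {}H : 2 * I1 (fun t => f t ^+ 2) <= I1 (fun t => lower f f' t ^+ 2) + I1 (fun t => u t ^+ 2).
    by apply: H => t; have := sqr_ge0 (lower f f' t - u t); move: (lower f f' t) (u t) => a b; rewrite !expr2; lra.
  have : 0 <= I1 (fun t => lower u (fun t => t / 2 * u t - f t) t ^+ 2) by apply: I1_ge0 => t; exact: sqr_ge0.
  by move: nf H; move: (I1 _) (I1 _) (I1 _) (I1 _) => a b c d; lra.
- have hu j : (j <= N)%N -> co j u = 0.
    move=> jN; have := adjoint (diff1_eta j.+1) Du.
    rewrite (_ : (fun t => eta j.+1 t * _) = fun t => f t * eta j.+1 t); last first.
      by apply/funext => t; rewrite (congr1 (@^~ t) Er) mulrC.
    rewrite -/(co j.+1 f) h// (_ : (fun t => _) = fun t => Num.sqrt j.+1%:R * (u t * eta j t)); last first.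
      by apply/funext => t; rewrite lower_eta /=; ring.
    rewrite (I1_Z _ (ed1_MM eu (ed1_eta j))) => /eqP; rewrite mulf_eq0 gt_eqF ?sqrtr_gt0//= => /eqP.
    exact.
  have h2 := IH u _ Du hu.
  pose c : R := N.+2%:R; have c0 : 0 < c by rewrite ltr0n.
  have := I1_le (ed1_Z 2 (ed1_MM (ed1_lower Df) eu)) (ed1_D (ed1_Z c^-1 (ed1_sqr (ed1_lower Df))) (ed1_Z c (ed1_sqr eu))).
  rewrite (I1_Z _ (ed1_MM (ed1_lower Df) eu)) (I1_D (ed1_Z _ (ed1_sqr (ed1_lower Df))) (ed1_Z _ (ed1_sqr eu))) key.
  rewrite (I1_Z _ (ed1_sqr (ed1_lower Df))) (I1_Z _ (ed1_sqr eu)) => H.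
  have {}H : 2 * I1 (fun t => f t ^+ 2) <= c^-1 * I1 (fun t => lower f f' t ^+ 2) + c * I1 (fun t => u t ^+ 2).
    apply: H => t; have := mulr_ge0 (ltW c0) (sqr_ge0 (c^-1 * lower f f' t - u t)).
    move: c0 (lower f f' t) (u t) => c0 a b.
    have -> : c * (c^-1 * a - b) ^+ 2 = c^-1 * a ^+ 2 + c * b ^+ 2 - 2 * (a * b) by field; rewrite gt_eqF.
    by rewrite subr_ge0.
  have h3 : c * I1 (fun t => u t ^+ 2) <= I1 (fun t => f t ^+ 2).
    by rewrite nf /c -natr1 mulrDl mul1r lerD2r.
  have h4 : I1 (fun t => f t ^+ 2) <= c^-1 * I1 (fun t => lower f f' t ^+ 2).
    by move: H h3; move: (c^-1 * _) (c * _) (I1 _) => a b d; lra.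
  by rewrite -/c mulrC -ler_pdivlMr// mulrC.
Qed.

(** [lower] maps the projection of [f] on the first [M + 1] Hermite functions to the projection of
    [lower f] on the first [M]; [lower_ge] is then applied to the remainder of [f]. *)
Lemma defect_lower M f f' : diff1 f f' -> M.+1%:R * defect M.+1 f <= defect M (lower f f').
Proof.
move=> Df; have [_ ef _] := Df; have el := ed1_lower Df.
have Dp := diff1_proj M.+1 f; have ep := ed1_proj M.+1 f.
have Dh : diff1 (fun t => f t + -1 * proj M.+1 f t) (fun t => f' t + -1 * proj' M.+1 f t) := diff1_lin (-1) Df Dp.
have Eh : (fun t => f t + -1 * proj M.+1 f t) = fun t => f t - proj M.+1 f t by apply/funext => t; rewrite mulN1r.
have hz j : (j <= M)%N -> co j (fun t => f t + -1 * proj M.+1 f t) = 0.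
  by move=> jM; rewrite Eh (coB _ ef ep) co_proj// subrr.
have := lower_ge Dh hz; rewrite -(defectE _ ef) -(defectE _ el).
have -> : (fun t => (f t + -1 * proj M.+1 f t) ^+ 2) = fun t => (f t - proj M.+1 f t) ^+ 2 by apply/funext => t; rewrite mulN1r.
congr (_ <= _); congr I1; apply/funext => t; congr (_ ^+ 2).
have lp : proj' M.+1 f t + t / 2 * proj M.+1 f t = proj M (lower f f') t.
  rewrite /proj' /proj mulr_sumr -big_split/= big_ord_recl.
  have e0 := lower_eta 0 t; rewrite /lower sqrtr0 mul0r in e0.
  rewrite [X in X + _](_ : _ = 0); last first.
    rewrite (_ : _ + _ = Zn^-1 * co 0 f * (eta' 0 t + t / 2 * eta 0 t)); last by ring.
    by rewrite e0 mulr0.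
  rewrite add0r; apply: eq_bigr => j _; rewrite (co_lower j Df).
  have e1 := lower_eta j.+1 t; rewrite /lower /= in e1.
  rewrite lift0 (_ : _ + _ = Zn^-1 * co j.+1 f * (eta' j.+1 t + t / 2 * eta j.+1 t)); last by ring.
  by rewrite e1; ring.
by rewrite -lp /lower; ring.
Qed.

(** Every application of [lower] gains a factor of at least [N] and reduces the cutoff by one, hence
    the starting cutoff [N + k]. *)
Lemma defect_iter N k (g g' : nat -> R -> R) : (forall i, diff1 (g i) (g' i)) ->
  (forall i t, g i.+1 t = lower (g i) (g' i) t) ->
  N%:R ^+ k * defect (N + k) (g 0%N) <= I1 (fun t => g k t ^+ 2).
Proof.
elim: k g g' => [|k IH] g g' Dg Eg.
  rewrite expr0 mul1r addn0 lerBlDr lerDl mulr_ge0 ?invr_ge0 ?(ltW Zn_gt0)//.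
  by apply: sumr_ge0 => j _; exact: sqr_ge0.
have eg : ed1 (g 0%N) by case: (Dg 0%N).
have d0 : 0 <= defect (N + k).+1 (g 0%N) by rewrite -defectE//; apply: I1_ge0 => t; exact: sqr_ge0.
have := IH (fun i => g i.+1) (fun i => g' i.+1) (fun i => Dg _) (fun i => Eg _).
apply: le_trans; rewrite exprSr -mulrA addnS; apply: ler_wpM2l; first by rewrite exprn_ge0.
have -> : g 1%N = lower (g 0%N) (g' 0%N) by apply/funext => t; exact: Eg.
apply: le_trans (defect_lower (N + k) (Dg 0%N)).
by apply: ler_wpM2r => //; rewrite ler_nat -addnS leq_addr.
Qed.

End hermite_functions.

(** * Hermite expansion in several variables *)

Section partial_integrals.
Context {R : realType}.
Notation mu1 := (@lebesgue_measure R).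

Let ka (t : R) : R := (1 + t ^+ 2)^-1.

Lemma exp2_ka (t : R) : expR (- (2 * `|t|)) <= ka t.
Proof.
rewrite /ka expRN lef_pV2 ?posrE ?expR_gt0 ?ltr_wpDr ?sqr_ge0//.
rewrite mulrC expRM_natr; apply: (@le_trans _ _ ((1 + `|t|) ^+ 2)).
  by rewrite -[t ^+ 2]real_normK ?num_real//; have := normr_ge0 t; rewrite !expr2; lra.
by apply: lerXn2r; rewrite ?nnegrE ?addr_ge0 ?expR_ge0// expR_ge1Dx.
Qed.

Lemma ed1_abs (f : R -> R) : ed1 f -> ed1 (fun t => `|f t|).
Proof.
move=> [cf hf]; split; first exact: (continuous_compose cf (@norm_continuous _ _)).
by move=> nu; have [C hC] := hf nu; exists C => t; rewrite normr_id.
Qed.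

Definition Kap : R := I1 ka.

Lemma Kap_ge0 : 0 <= Kap.
Proof. by apply: I1_ge0 => t; rewrite invr_ge0 addr_ge0// sqr_ge0. Qed.

Lemma I1_abs_le (f : R -> R) B : ed1 f -> (forall t, `|f t| <= B * ka t) -> `|I1 f| <= B * Kap.
Proof.
move=> ef hB; have ia := ed1_integrable ef.
have ik := dom1_integrable (@dom1_ka R).
apply: le_trans (le_normr_Rintegral measurableT ia) _.
rewrite /Kap /I1 -(RintegralZl B measurableT ik); apply: le_Rintegral => //.
- exact: (ed1_integrable (ed1_abs ef)).
- exact: (integrableZl measurableT B ik).
Qed.

Section fixed_dim.
Variable n : nat.
Implicit Types F g : 'rV[R]_n.+1 -> R.

Lemma edec_slice F : edec F -> forall nu, 0 <= nu -> exists2 C, 0 <= C & forall t y,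
  `|F (cns t y)| <= C * expR (- (nu * `|y|)) * expR (- (2 * `|t|)).
Proof.
move=> eF nu nu0; have [C hC] := eF (nu + 2).
have C0 : 0 <= C by have := le_trans (normr_ge0 _) (hC 0); rewrite pmulr_lge0// expR_gt0.
exists C => // t y; apply: le_trans (hC _) _; rewrite -mulrA -expRD; apply: ler_wpM2l => //.
rewrite ler_expR -opprD lerN2 norm_cns.
have h1 : `|t| <= Num.max `|t| `|y| by rewrite le_max lexx.
have h2 : `|y| <= Num.max `|t| `|y| by rewrite le_max lexx orbT.
by rewrite [leRHS]mulrDl; apply: lerD; apply: ler_wpM2l.
Qed.

Lemma ed1_slice F y : continuous F -> edec F -> ed1 (fun t => F (cns t y)).
Proof.
move=> cF eF; split; first exact: (continuous_compose (@continuous_cnsl _ _ y) cF).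
move=> nu; have [C hC] := eF `|nu|; exists C => t; apply: le_trans (hC _) _.
have C0 : 0 <= C by have := le_trans (normr_ge0 _) (hC 0); rewrite pmulr_lge0// expR_gt0.
apply: ler_wpM2l => //; rewrite ler_expR lerN2 norm_cns.
apply: (@le_trans _ _ (`|nu| * `|t|)); first by apply: ler_wpM2r => //; exact: ler_norm.
by apply: ler_wpM2l => //; rewrite le_max lexx.
Qed.

Lemma ed1_fast_slice F y : fast F -> ed1 (fun t => F (cns t y)).
Proof. by move=> fF; apply: ed1_slice; [exact: (smooth_cont (fast_smooth fF))|exact: (fF.2 [::])]. Qed.

Definition pint F (y : 'rV[R]_n) : R := I1 (fun t => F (cns t y)).

Lemma edec_pint F : fast F -> edec (pint F).
Proof.
move=> fF nu; have [C C0 hC] := edec_slice (fF.2 [::]) (normr_ge0 nu).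
exists (C * Kap) => y; apply: le_trans (I1_abs_le (B := C * expR (- (nu * `|y|))) (ed1_fast_slice y fF) _) _.
  move=> t; apply: le_trans (hC t y) _; apply: ler_pM; rewrite ?mulr_ge0 ?expR_ge0//.
    apply: ler_wpM2l => //; rewrite ler_expR lerN2; apply: ler_wpM2r => //; exact: ler_norm.
  exact: exp2_ka.
by rewrite mulrAC.
Qed.

Lemma lipschitz_line (g : 'rV[R]_n -> R) M y v : smooth g -> 
  (forall i z, `|partial i g z| <= M) -> `|g (y + v) - g y| <= (n%:R * M) * `|v|.
Proof.
move=> sg hM.
have D z := is_derive_directional z v (fun i => smooth_deriv (i := i) sg) (fun i => smooth_cont (smooth_partial i sg)).
have H (t : R) : is_derive t (1 : R) (fun s : R => g (y + s *: v)) (\sum_i v 0 i * partial i g (y + t *: v)).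
  by have [d e] := D (y + t *: v); rewrite -e; exact: (is_derive_line d).
have := @mvt_le R _ _ 0 1 ((n%:R * M) * `|v|) H.
rewrite scale1r scale0r addr0 subr0 normr1 mulr1; apply=> th _.
apply: le_trans (ler_norm_sum _ _ _) _.
apply: (@le_trans _ _ (\sum_(i < n) `|v| * M)).
  by apply: ler_sum => i _; rewrite normrM; apply: ler_pM => //; exact: coord_le_norm.
by rewrite sumr_const card_ord -mulr_natr le_eqVlt; apply/orP; left; apply/eqP; ring.
Qed.

Lemma fast_slice_bound F s : fast F -> exists2 C, 0 <= C & forall t y, `|partials s F (cns t y)| <= C * ka t.
Proof.
move=> fF; have [C C0 hC] := edec_slice (fF.2 s) (lexx 0).
exists C => // t y; apply: le_trans (hC t y) _; rewrite mul0r oppr0 expR0 mulr1.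
by apply: ler_wpM2l => //; exact: exp2_ka.
Qed.

Lemma continuous_pint F : fast F -> continuous (pint F).
Proof.
move=> fF.
have /choice[Cf hCf] : forall i : 'I_n, exists C, 0 <= C /\ forall t y, `|partial (lift ord0 i) F (cns t y)| <= C * ka t.
  by move=> i; have [C C0 hC] := fast_slice_bound [:: lift ord0 i] fF; exists C.
pose C := \sum_i Cf i.
have C0 : 0 <= C by apply: sumr_ge0 => i _; exact: (hCf i).1.
apply: continuous_dist => y e e0.
have K0 : 0 < n%:R * C * Kap + 1 by rewrite ltr_wpDl// !mulr_ge0// Kap_ge0.
apply/nbhs_ballP; exists (e / (n%:R * C * Kap + 1)); first exact: divr_gt0.
move=> z; rewrite mx_norm_ball /ball_/= => zy.
rewrite /pint -(I1_B (ed1_fast_slice y fF) (ed1_fast_slice z fF)).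
apply: le_trans (I1_abs_le (B := n%:R * C * `|y - z|) (ed1_B (ed1_fast_slice y fF) (ed1_fast_slice z fF)) _) _.
  move=> t; have [st pt] := smooth_cnsS t (fast_smooth fF).
  have H := lipschitz_line (M := C * ka t) z (y - z) st.
  have zy' : z + (y - z) = y by rewrite addrC subrK.
  rewrite zy' in H.
  apply: le_trans (H _) _; last by rewrite le_eqVlt; apply/orP; left; apply/eqP; ring.
  move=> i z'; rewrite partial_cnsS; apply: le_trans ((hCf i).2 t z') _.
  apply: ler_wpM2r; first by rewrite invr_ge0 addr_ge0// sqr_ge0.
  exact: (term_le_sum i (fun i => (hCf i).1)).
rewrite mulrAC; apply: (@le_trans _ _ ((n%:R * C * Kap + 1) * `|y - z|)).
  by apply: ler_wpM2r => //; rewrite lerDl.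
by rewrite mulrC -ler_pdivlMr// ltW.
Qed.

Lemma is_derive_pint F i y : fast F -> is_derive y (e_ i) (pint F) (pint (partial (lift ord0 i) F) y).
Proof.
move=> fF; have fd := fast_partial (lift ord0 i) fF.
have [C C0 hC] := fast_slice_bound [:: lift ord0 i; lift ord0 i] fF.
suff L : h^-1 *: (pint F (h *: e_ i + y) - pint F y) @[h --> (0 : R)^'] --> pint (partial (lift ord0 i) F) y.
  by split; [apply/cvg_ex; eexists; exact: L|exact: cvg_lim L].
apply/cvgrPdist_le => e e0.
have K0 : 0 < C * Kap + 1 by rewrite ltr_wpDl// mulr_ge0// Kap_ge0.
near=> h.
have h0 : h != 0 by near: h; exact: nbhs_dnbhs_neq.
have hh : `|h| < e / (C * Kap + 1) by near: h; apply: dnbhs0_lt; exact: divr_gt0.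
have e1 := ed1_fast_slice (y + h *: e_ i) fF; have e2 := ed1_fast_slice y fF; have e3 := ed1_fast_slice y fd.
rewrite distrC (addrC _ y) /pint -[_ *: _]/(_ * _) -(I1_B e1 e2) -(I1_Z _ (ed1_B e1 e2)) -(I1_B (ed1_Z _ (ed1_B e1 e2)) e3).
apply: le_trans (I1_abs_le (B := C * `|h|) (ed1_B (ed1_Z _ (ed1_B e1 e2)) e3) _) _.
  move=> t; have [st pt] := smooth_cnsS t (fast_smooth fF).
  have := difference_quotient (g := fun y => F (cns t y)) (x := y) (j := i) (K := C * ka t) st h0.
  rewrite (partial_cnsS F) => H; apply: le_trans (H _) _; last by rewrite mulrAC.
  by move=> th _; have := congr1 (@^~ (y + th *: e_ i)) (pt [:: i; i]) => /= ->; exact: hC.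
rewrite mulrAC; apply: (@le_trans _ _ ((C * Kap + 1) * `|h|)).
  by apply: ler_wpM2r => //; rewrite lerDl.
by rewrite mulrC -ler_pdivlMr// ltW.
Unshelve. all: by end_near. Qed.

(** Differentiation under the integral sign to every order: the integrals of the derivatives are the
    family required by [smooth_tower]. *)
Lemma fast_pint F : fast F -> fast (pint F) /\ forall i, partial i (pint F) = pint (partial (lift ord0 i) F).
Proof.
move=> fF; pose G (s : seq 'I_n) := pint (partials (map (lift ord0) s) F).
have fs s : fast (partials (map (lift ord0) s) F) by exact: tame_partials.
have [sG E] := smooth_tower (G := G) (fun s => continuous_pint (fs s)) (fun s i y => is_derive_pint i y (fs s)).
split; last by move=> i; exact: (E [:: i]).
by split => // s; rewrite (E s); exact: edec_pint.
Qed.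

Lemma integralR_pint F : fast F -> integralR F = integralR (pint F).
Proof.
move=> fF; have [_ E] := integral_cns_dom (fast_dom fF).
rewrite /integralR /Rintegral E; congr fine; apply: eq_integral => y _.
by rewrite /pint /I1 /Rintegral fineK// integrable_fin_num//; exact: (ed1_integrable (ed1_fast_slice y fF)).
Qed.

End fixed_dim.
End partial_integrals.

Section eta_coordinates.
Context {R : realType} {n : nat}.

Definition etac j (i : 'I_n) (z : 'rV[R]_n) : R := eta j (z 0 i).

Lemma etac_partial j i k : deriv_along (etac j i) k /\
  partial k (etac j i) = fun z => (i == k)%:R * (Num.sqrt j%:R * etac j.-1 i z - z 0 i / 2 * etac j i z).
Proof.
have [de _ _] := diff1_eta (R := R) j.
have H z : is_derive z (e_ k : 'rV[R]_n) (etac j i) ((i == k)%:R * eta' j (z 0 i)).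
  apply: is_derive_of_line; rewrite /etac.
  have h1 := @is_deriveZ _ _ _ (fun t : R => t) (i == k)%:R 0 1 1 (is_derive_id _ _).
  have h2 := is_deriveD (is_derive_cst (z 0 i) (0 : R) (1 : R)) h1.
  have E : (fun s : R => (z + s *: e_ k) 0 i) = (cst (z 0 i) + (i == k)%:R \*: (fun t : R => t)).
    by apply/funext => s; rewrite !mxE eqxx /= -[RHS]/(z 0 i + (i == k)%:R * s) mulrC.
  have -> : (fun s : R => eta j ((z + s *: e_ k) 0 i)) = eta j \o (cst (z 0 i) + (i == k)%:R \*: (fun t : R => t)).
    by rewrite -E.
  have h3 := @is_derive1_comp R (eta j) _ 0 _ _ (de _) h2.
  apply: (is_derive_eq h3).
  rewrite -[(cst (z 0 i) + _) 0]/(z 0 i + (i == k)%:R * 0) mulr0 addr0 add0r -[_ *: 1]/(_ * 1) mulr1.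
  exact: mulrC.
split; first by move=> z; case: (H z).
by apply/funext => z; exact: (@derive_val _ _ _ _ _ _ _ (H z)).
Qed.

Lemma pclass_etac j i : pclass (etac j i).
Proof.
have c k : continuous (etac k i) by exact: (continuous_compose (@coord_cont R n i) (ed1_eta k).1).
have e k : expb (etac k i).
  have [_ /(_ 0)[C hC]] := ed1_eta (R := R) k; exists C, 0 => z.
  by rewrite mul0r; have := hC (z 0 i); rewrite mul0r oppr0.
apply/tameP => l; elim: l j => [|l IH] j; split => // k.
have [d ->] := etac_partial j i k; split => //.
apply: CB_Z; [exact: expb_D|by move=> a f; exact: expb_Z|].
rewrite (_ : (fun y => _) = fun y => Num.sqrt j%:R * etac j.-1 i y + (- 2^-1 * y 0 i) * etac j i y); last first.
  by apply/funext => y; field.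
apply: CB_D; first exact: expb_D.
  by apply: CB_Z; [exact: expb_D|by move=> a f; exact: expb_Z|exact: IH].
apply: (CB_M (@expb_D R n) (@expb_M R n)); last exact: IH.
have pc := pclass_M (@pclass_cst R n (- 2^-1)) (pclass_coord (R := R) i).
by move/tameP : pc; apply.
Qed.

Definition hfun (a : 'I_n -> nat) (z : 'rV[R]_n) : R := \prod_k etac (a k) k z.

Lemma norm_le_sum (z : 'rV[R]_n) : `|z| <= \sum_k `|z 0 k|.
Proof.
apply: rV_norm_le; first exact: sumr_ge0.
by move=> k; rewrite (bigD1 k)//= lerDl sumr_ge0.
Qed.

Lemma partials_prod_edec (F : 'I_n -> 'rV[R]_n -> R) :
  (forall k nu, exists C, forall z, `|F k z| <= C * expR (- (nu * `|z 0 k|))) ->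
  edec (fun z => \prod_k F k z).
Proof.
move=> h nu.
have /choice[C hC] := fun k => h k `|nu|.
exists (\prod_k C k) => z; rewrite normr_prod.
apply: (@le_trans _ _ (\prod_k (C k * expR (- (`|nu| * `|z 0 k|))))).
  by apply: ler_prod => k _; rewrite normr_ge0 hC.
have C0 k : 0 <= C k.
  by have := le_trans (normr_ge0 _) (hC k 0); rewrite pmulr_lge0// expR_gt0.
rewrite big_split/=; apply: ler_wpM2l; first exact: prodr_ge0.
rewrite -expR_sum ler_expR sumrN lerN2 -mulr_sumr.
apply: (@le_trans _ _ (`|nu| * `|z|)); first by apply: ler_wpM2r => //; exact: ler_norm.
by apply: ler_wpM2l => //; exact: norm_le_sum.
Qed.

Lemma pclass_He j (i : 'I_n) : pclass (fun z : 'rV[R]_n => He j (z 0 i)).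
Proof.
suff H : pclass (fun z : 'rV[R]_n => He j (z 0 i)) /\ pclass (fun z : 'rV[R]_n => He j.+1 (z 0 i)) by exact: H.1.
elim: j => [|j [IH1 IH2]]; first by split; [exact: pclass_cst|exact: pclass_coord].
split => //.
have := pclass_D (pclass_M (pclass_coord i) IH2) (pclass_M (@pclass_cst R n (- j.+1%:R)) IH1).
by congr pclass; apply/funext => z; rewrite mulNr.
Qed.

Let q (z : 'rV[R]_n) : R := \sum_k (- 4^-1) * (z 0 k * z 0 k).

Lemma pclass_q : pclass q.
Proof.
apply: pclass_sum => k.
exact: (pclass_M (@pclass_cst R n _) (pclass_M (pclass_coord k) (pclass_coord k))).
Qed.

Lemma gauss_prod z : expR (q z) = \prod_k gs (z 0 k).
Proof. by rewrite expR_sum; apply: eq_bigr => k _; rewrite /gs expr2; congr expR; field. Qed.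

(** A derivative of [P exp q] has again this shape with another [P] in [pclass], so the induction is
    over all such [P]. *)
Lemma fast_gauss (P : 'rV[R]_n -> R) : pclass P -> fast (fun z => P z * expR (q z)).
Proof.
move=> pP; apply/tameP => l; have sq := pclass_smooth pclass_q.
have c0 : continuous (fun z => expR (q z)) := smooth_cont (smooth_expR sq).
have e0 : edec (fun z => expR (q z)).
  have Eg : (fun z : 'rV[R]_n => \prod_k gs (z 0 k)) = (fun z => expR (q z)) by apply/funext => z; rewrite gauss_prod.
  rewrite -Eg.
  apply: partials_prod_edec => k nu; have [_ /(_ nu)[C hC]] := @ed1_gs R; exists C => z; exact: hC.
elim: l P pP => [|l IH] P pP; (split; [exact: (contM (smooth_cont (pclass_smooth pP)) c0)|exact: (edec_M (pP.2 [::]) e0)|]) => // i.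
have dP := smooth_deriv (i := i) (pclass_smooth pP); have [dE E] := partial_expR i sq.
split; first exact: (derivM dP dE).
rewrite (partialM dP dE) E.
have := IH _ (pclass_D (pclass_partial i pP) (pclass_M pP (pclass_partial i pclass_q))).
by congr (CB _ l _); apply/funext => z; ring.
Qed.

Lemma fast_hfun a : fast (hfun a).
Proof.
have pH : pclass (fun z : 'rV[R]_n => \prod_k ((hn (a k))^-1 * He (a k) (z 0 k))).
  elim: (index_enum _) => [|k r IH].
    by under eq_fun do rewrite big_nil; exact: pclass_cst.
  under eq_fun do rewrite big_cons; apply: pclass_M => //.
  exact: (pclass_M (@pclass_cst R n _) (pclass_He (a k) k)).
have := fast_gauss pH; congr fast; apply/funext => z.
by rewrite gauss_prod -big_split/=; apply: eq_bigr => k _; rewrite /etac etaE.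
Qed.

End eta_coordinates.

(** * Expansion error in several variables *)

Section oscillator.
Context {R : realType}.

Definition osc n (i : 'I_n) (g : 'rV[R]_n -> R) (z : 'rV[R]_n) : R := partial i g z + z 0 i / 2 * g z.

Lemma fast_osc n (i : 'I_n) g : fast g -> fast (osc i g).
Proof.
move=> fg; apply: (fast_D (fast_partial i fg)); apply: fast_M fg.
exact: (pclass_M (pclass_coord i) (@pclass_cst R n _)).
Qed.

Lemma fast_iter_osc n (i : 'I_n) k g : fast g -> fast (iter k (osc i) g).
Proof. by move=> fg; elim: k => //= k IH; exact: fast_osc. Qed.

Definition coefn n (a : 'I_n -> nat) (g : 'rV[R]_n -> R) : R := integralR (fun z => g z * hfun a z).

Lemma diff1_slice n (g : 'rV[R]_n.+1 -> R) y : fast g ->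
  diff1 (fun t => g (cns t y)) (fun t => partial ord0 g (cns t y)).
Proof.
move=> fg; split; [|exact: ed1_fast_slice|exact: (ed1_fast_slice y (fast_partial ord0 fg))].
by move=> t; apply: is_derive_cns0; apply: smooth_deriv; exact: fast_smooth.
Qed.

Definition pcoef n j (g : 'rV[R]_n.+1 -> R) : 'rV[R]_n -> R := pint (fun z => g z * etac j ord0 z).

Lemma pcoefE n j (g : 'rV[R]_n.+1 -> R) y : pcoef j g y = co j (fun t => g (cns t y)).
Proof. by congr I1; apply/funext => t; rewrite /etac cns0. Qed.

(** [osc] in a remaining coordinate commutes with integration against [etac j ord0], which does not
    vary in that direction. *)
Lemma fast_pcoef n j (g : 'rV[R]_n.+1 -> R) : fast g -> fast (pcoef j g) /\
  forall i, osc i (pcoef j g) = pcoef j (osc (lift ord0 i) g).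
Proof.
move=> fg; have fF := fast_Mr fg (pclass_etac (R := R) j (@ord0 n)).
have [fp E] := fast_pint fF; split => // i; apply/funext => y.
rewrite /osc [pcoef j g]/pcoef E.
have dg := smooth_deriv (i := lift ord0 i) (fast_smooth fg).
have [de Ee] := etac_partial (R := R) j (@ord0 n) (lift ord0 i).
rewrite (partialM dg de) Ee /pcoef /pint.
have f1 := ed1_fast_slice y (fast_Mr (fast_partial (lift ord0 i) fg) (pclass_etac (R := R) j (@ord0 n))).
have f2 := ed1_fast_slice y fF.
rewrite -(I1_Z _ f2); rewrite (_ : (fun t => partial _ g _ * _ + _) = fun t => partial (lift ord0 i) g (cns t y) * etac j ord0 (cns t y)); last first.
  by apply/funext => t; rewrite mul0r mulr0 addr0.
rewrite -(I1_D f1 (ed1_Z _ f2)); congr I1; apply/funext => t; rewrite cnsS.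
by move: (partial _ g _) (etac _ _ _) (g _) => a b c; ring.
Qed.

Lemma fast_iter_pcoef n j k (g : 'rV[R]_n.+1 -> R) i : fast g ->
  iter k (osc i) (pcoef j g) = pcoef j (iter k (osc (lift ord0 i)) g).
Proof.
by move=> fg; elim: k => //= k ->; rewrite (fast_pcoef j (fast_iter_osc _ _ fg)).2.
Qed.

Lemma hfun_cns n (b : 'I_n.+1 -> nat) t (y : 'rV[R]_n) :
  hfun b (cns t y) = eta (b ord0) t * hfun (fun k => b (lift ord0 k)) y.
Proof.
rewrite /hfun big_ord_recl /etac cns0; congr (_ * _).
by apply: eq_bigr => k _; rewrite cnsS.
Qed.

Lemma coefn_cns n (b : 'I_n.+1 -> nat) (g : 'rV[R]_n.+1 -> R) : fast g ->
  coefn b g = coefn (fun k => b (lift ord0 k)) (pcoef (b ord0) g).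
Proof.
move=> fg; rewrite /coefn (integralR_pint (fast_MM fg (fast_hfun b))).
congr integralR; apply/funext => y.
have f2 := ed1_fast_slice y (fast_Mr fg (pclass_etac (R := R) (b ord0) (@ord0 n))).
rewrite [RHS]mulrC -(I1_Z _ f2); congr I1; apply/funext => t.
by rewrite hfun_cns /etac cns0; ring.
Qed.

Lemma sum_ffunS n M (G : 'I_M -> {ffun 'I_n -> 'I_M} -> R) :
  \sum_(a : {ffun 'I_n.+1 -> 'I_M}) G (a ord0) [ffun k => a (lift ord0 k)] = \sum_j \sum_a G j a.
Proof.
rewrite pair_bigA/=.
pose h (p : 'I_M * {ffun 'I_n -> 'I_M}) : {ffun 'I_n.+1 -> 'I_M} :=
  [ffun i => if unlift ord0 i is Some k then p.2 k else p.1].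
have h1 p : h p ord0 = p.1 by rewrite ffunE unlift_none.
have h2 p : [ffun k => h p (lift ord0 k)] = p.2 by apply/ffunP => k; rewrite !ffunE liftK.
rewrite (reindex h); first by apply: eq_bigr => p _; rewrite h1 h2.
exists (fun a : {ffun 'I_n.+1 -> 'I_M} => (a ord0, [ffun k => a (lift ord0 k)])) => [p _|a _].
  by rewrite h1 h2; case: p.
by apply/ffunP => i; rewrite ffunE; case: (unliftP ord0 i) => [k ->|->]; rewrite ?ffunE.
Qed.

Lemma integralR0 (g : 'rV[R]_0 -> R) : continuous g -> integralR g = g 0.
Proof.
move=> cg; rewrite /integralR /Rintegral /= integral_dirac//; last first.
  by apply/measurable_EFinP; exact: continuous_rV_measurable.
by rewrite /dirac indicE mem_set// mul1e.
Qed.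

Lemma bessel_pcoef n M (G : 'rV[R]_n.+1 -> R) : fast G ->
  Zn^-1 * \sum_(j < M) integralR (fun y => pcoef j G y ^+ 2) <= integralR (fun z => G z ^+ 2).
Proof.
move=> fG; have f2 := fast_sqr fG; rewrite (integralR_pint f2).
have fr j : fast (fun y => pcoef j G y ^+ 2) := fast_sqr (fast_pcoef j fG).1.
rewrite -(integralR_sum (index_enum _) (fun j : 'I_M => fast_dom (fr j))) -(integralR_Z _ (fast_dom (fast_sum _ (fun j : 'I_M => fr j)))).
apply: integralR_le; [exact: (fast_dom (fast_Z _ (fast_sum _ (fun j : 'I_M => fr j))))|exact: (fast_dom (fast_pint f2).1)|].
move=> y; rewrite (eq_bigr (fun j : 'I_M => co j (fun t => G (cns t y)) ^+ 2)) => [|j _]; last by rewrite pcoefE.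
exact: (bessel M (ed1_fast_slice y fG)).
Qed.

(** Induction on the dimension. The error of expanding in the first variable is handled on each
    slice by [defect_iter]; the coefficients [pcoef j g] are then expanded in the other variables,
    and [bessel_pcoef] sums their errors back into norms of [iter k (osc _) g]. *)
Lemma osc_ineq n N k (g : 'rV[R]_n -> R) : fast g ->
  N%:R ^+ k * (integralR (fun z => g z ^+ 2) -
     Zn^-1 ^+ n * \sum_(a : {ffun 'I_n -> 'I_(N + k)}) coefn (fun i => a i) g ^+ 2)
  <= \sum_i integralR (fun z => iter k (osc i) g z ^+ 2).
Proof.
elim: n g => [|n IH] g fg.
  have cg := smooth_cont (fast_smooth fg); have cg2 := smooth_cont (fast_smooth (fast_sqr fg)).
  rewrite big_ord0 expr0 mul1r (integralR0 cg2) (eq_bigr (fun=> g 0 ^+ 2)) => [|a _].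
    by rewrite sumr_const card_ffun !card_ord expn0 subrr mulr0.
  rewrite /coefn (_ : (fun z => _) = g) ?integralR0//.
  by apply/funext => z; rewrite /hfun big_ord0 mulr1.
set M := (N + k)%N.
have Z0 : 0 < (Zn : R)^-1 by rewrite invr_gt0; exact: Zn_gt0.
have N0 : 0 <= (N%:R : R) ^+ k by exact: exprn_ge0.
pose S := \sum_(j < M) integralR (fun y => pcoef j g y ^+ 2).
have f2 := fast_sqr fg; have fA := fast_sqr (fast_iter_osc ord0 k fg).
have fr j : fast (fun y => pcoef j g y ^+ 2) := fast_sqr (fast_pcoef j fg).1.
have fS := fast_sum (index_enum 'I_M) (fun j : 'I_M => fr j).
have slice : N%:R ^+ k * (integralR (fun z => g z ^+ 2) - Zn^-1 * S) <= integralR (fun z => iter k (osc ord0) g z ^+ 2).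
  rewrite (integralR_pint f2) (integralR_pint fA) /S.
  rewrite -(integralR_sum (index_enum _) (fun j : 'I_M => fast_dom (fr j))) -(integralR_Z _ (fast_dom fS)).
  have fp := (fast_pint f2).1.
  rewrite -(integralR_B (fast_dom fp) (fast_dom (fast_Z _ fS))) -(integralR_Z _ (fast_dom (fast_B fp (fast_Z _ fS)))).
  apply: integralR_le; [exact: (fast_dom (fast_Z _ (fast_B fp (fast_Z _ fS))))|exact: (fast_dom (fast_pint fA).1)|].
  move=> y; rewrite (eq_bigr (fun j : 'I_M => co j (fun t => g (cns t y)) ^+ 2)) => [|j _]; last by rewrite pcoefE.
  apply: (@defect_iter R N k (fun i t => iter i (osc ord0) g (cns t y))
    (fun i t => partial ord0 (iter i (osc ord0) g) (cns t y))).
    by move=> i; apply: diff1_slice; exact: fast_iter_osc.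
  by move=> i t; rewrite /= /osc cns0.
have ih : N%:R ^+ k * (Zn^-1 * S - Zn^-1 ^+ n.+1 * \sum_(a : {ffun 'I_n.+1 -> 'I_M}) coefn (fun i => a i) g ^+ 2)
   <= \sum_(i < n) integralR (fun z => iter k (osc (lift ord0 i)) g z ^+ 2).
  have -> : \sum_(a : {ffun 'I_n.+1 -> 'I_M}) coefn (fun i => a i) g ^+ 2 =
     \sum_(j < M) \sum_(a : {ffun 'I_n -> 'I_M}) coefn (fun i => a i) (pcoef j g) ^+ 2.
    rewrite -(sum_ffunS (fun j a => coefn (fun i => a i) (pcoef j g) ^+ 2)); apply: eq_bigr => a _.
    rewrite (coefn_cns _ fg); congr (coefn _ _ ^+ 2).
    by apply/funext => i; rewrite ffunE.
  apply: (@le_trans _ _ (Zn^-1 * \sum_(j < M) \sum_(i < n) integralR (fun z => iter k (osc i) (pcoef j g) z ^+ 2))).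
    rewrite exprS -mulrA -mulrBr mulrCA ler_pM2l// /S mulr_sumr -sumrB mulr_sumr.
    by apply: ler_sum => j _; apply: IH; exact: (fast_pcoef j fg).1.
  rewrite exchange_big/= mulr_sumr; apply: ler_sum => i _.
  rewrite (eq_bigr (fun j : 'I_M => integralR (fun y => pcoef j (iter k (osc (lift ord0 i)) g) y ^+ 2))) => [|j _].
    by apply: bessel_pcoef; exact: fast_iter_osc.
  by rewrite fast_iter_pcoef.
rewrite big_ord_recl; apply: le_trans (lerD slice ih).
by rewrite -mulrDr addrA subrK.
Qed.

Lemma hfun_orth n (a b : 'I_n -> nat) :
  coefn a (hfun b) = if [forall i, a i == b i] then Zn ^+ n else 0.
Proof.
elim: n a b => [|n IH] a b.
  have ch := fast_smooth (fast_MM (fast_hfun (R := R) b) (fast_hfun a)).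
  rewrite /coefn (integralR0 (smooth_cont ch)) /hfun !big_ord0 mulr1 expr0.
  by case: forallP => // -[] [].
rewrite (coefn_cns _ (fast_hfun b)).
have -> : pcoef (a ord0) (hfun b) = fun y => co (a ord0) (eta (b ord0)) * hfun (fun k => b (lift ord0 k)) y.
  apply/funext => y; rewrite pcoefE [RHS]mulrC /co -(I1_Z _ (ed1_MM (ed1_eta _) (ed1_eta _))).
  by congr I1; apply/funext => t; rewrite hfun_cns; ring.
have -> : coefn (fun k => a (lift ord0 k)) (fun y => co (a ord0) (eta (b ord0)) * hfun (fun k => b (lift ord0 k)) y) =
   co (a ord0) (eta (b ord0)) * coefn (fun k => a (lift ord0 k)) (hfun (fun k => b (lift ord0 k))).
  rewrite /coefn -(integralR_Z _ (fast_dom (fast_MM (fast_hfun _) (fast_hfun _)))).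
  by congr integralR; apply/funext => z; rewrite mulrA.
rewrite IH eta_orth.
have -> : [forall i, a i == b i] = (a ord0 == b ord0) && [forall i : 'I_n, a (lift ord0 i) == b (lift ord0 i)].
  apply/forallP/andP => [h|[h0 /forallP h]]; first by split => //; apply/forallP.
  by move=> i; case: (unliftP ord0 i) => [k ->|->].
by case: eqP => _ /=; [case: ifP => _; rewrite ?mulr0// exprS|rewrite mul0r].
Qed.

End oscillator.

(** * Polynomial bounds for Hermite functions *)

Section words.
Context {R : realType}.

Lemma eta'E r (t : R) : eta' r t = 2^-1 * (Num.sqrt r%:R * eta r.-1 t - Num.sqrt r.+1%:R * eta r.+1 t).
Proof. by rewrite /eta'; have := eta_up r t; move: (_ * eta r.+1 t) (_ * eta r.-1 t) (eta r t) => a b c; lra. Qed.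

Lemma eta_sqr_int r : I1 (fun t : R => eta r t ^+ 2) = Zn.
Proof. by have := eta_orth (R := R) r r; rewrite eqxx => <-; congr I1; apply/funext => t; rewrite expr2. Qed.

(** The one-dimensional Sobolev inequality, with the norm of [eta'] computed from the two
    neighbouring Hermite functions in [eta'E]. *)
Lemma eta_sup : exists2 C : R, 0 <= C & forall r t, `|eta r t| <= C * r.+1%:R.
Proof.
have Z0 : 0 <= (Zn : R) := ltW Zn_gt0.
exists (1 + 3 * Zn); first by rewrite addr_ge0// mulr_ge0.
move=> r t; have [d0 e0 e1] := diff1_eta (R := R) r.
have := sobolev_1d t d0 e1.1.
have [s0 s1] := (ed1_sqr e0, ed1_sqr e1); have es := ed1_D (ed1_D s0 s0) s1.
rewrite -[X in (_ <= X)%E]fineK ?integrable_fin_num//; last exact: (ed1_integrable es).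
rewrite -[fine _]/(I1 _) lee_fin (I1_D (ed1_D s0 s0) s1) (I1_D s0 s0) eta_sqr_int => h.
have [sa sb] := (ed1_Z (2^-1 * r%:R) (ed1_sqr (ed1_eta (R := R) r.-1)), ed1_Z (2^-1 * r.+1%:R) (ed1_sqr (ed1_eta (R := R) r.+1))).
have h2 : I1 (fun t : R => eta' r t ^+ 2) <= 2^-1 * r%:R * Zn + 2^-1 * r.+1%:R * Zn.
  rewrite -[X in _ * X + _](eta_sqr_int r.-1) -[X in _ + _ * X](eta_sqr_int r.+1).
  rewrite -(I1_Z _ (ed1_sqr (ed1_eta r.-1))) -(I1_Z _ (ed1_sqr (ed1_eta r.+1))) -(I1_D sa sb).
  apply: (I1_le s1 (ed1_D sa sb)) => x; rewrite eta'E.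
  rewrite -[X in 2^-1 * X * _ + _](sqr_sqrtr (ler0n R r)) -[X in _ + 2^-1 * X * _](sqr_sqrtr (ler0n R r.+1)).
  move: (Num.sqrt _) (Num.sqrt _) (eta _ x) (eta _ x) => a b c d.
  by have := sqr_ge0 (a * c + b * d); rewrite !expr2; lra.
have r1 : 1 <= (r.+1%:R : R) by rewrite ler1n.
have Z1 : (Zn : R) <= Zn * r.+1%:R by rewrite ler_peMr.
have h3 : eta r t ^+ 2 <= 3 * Zn * r.+1%:R.
  have rE : (r.+1%:R : R) = r%:R + 1 by rewrite -natr1.
  apply: le_trans h _; move: Z0 h2 Z1; rewrite rE.
  by move: (I1 _) (Zn : R) (r%:R : R) => a z c; lra.
rewrite -ler_sqr ?nnegrE ?mulr_ge0 ?addr_ge0// ?mulr_ge0// real_normK ?num_real//.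
apply: le_trans h3 _; rewrite exprMn.
have p1 : 3 * (Zn : R) <= (1 + 3 * Zn) ^+ 2.
  have := mulr_ge0 Z0 Z0; move: (Zn : R) Z0 => z z0; rewrite expr2; lra.
apply: ler_pM => //; first by rewrite mulr_ge0.
by rewrite expr2 ler_peMr// ltW.
Qed.

Variable n : nat.
Implicit Types (g u v : 'rV[R]_n -> R) (a : 'I_n -> nat).

(** The letter [inl i] multiplies by the coordinate [i], the letter [inr i] differentiates; each
    turns [hfun a] into a combination of two neighbours. *)
Definition op (o : 'I_n + 'I_n) g : 'rV[R]_n -> R :=
  match o with inl i => fun z => z 0 i * g z | inr i => partial i g end.
Definition word (w : seq ('I_n + 'I_n)) g : 'rV[R]_n -> R := foldr op g w.

Lemma smooth_op o g : smooth g -> smooth (op o g).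
Proof.
case: o => i sg /=; last exact: smooth_partial.
exact: (smoothM (pclass_smooth (pclass_coord i)) sg).
Qed.

Lemma smooth_word w g : smooth g -> smooth (word w g).
Proof. by move=> sg; elim: w => [|o w IH]; [exact: sg|exact: (smooth_op o IH)]. Qed.

Lemma word_lin w (al be : R) u v : smooth u -> smooth v ->
  word w (fun z => al * u z + be * v z) = fun z => al * word w u z + be * word w v z.
Proof.
move=> su sv; elim: w => [//|o w IH] /=; rewrite IH.
have [swu swv] := (smooth_word w su, smooth_word w sv).
case: o => i /=; apply/funext => z; first by ring.
have [d1 d2] := (smooth_deriv (i := i) swu, smooth_deriv (i := i) swv).
have := partialsD [:: i] (smoothM (smooth_cst al) swu) (smoothM (smooth_cst be) swv) => /(congr1 (@^~ z)) /= ->.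
exact: (congr2 +%R (congr1 (@^~ z) (partialsZ [:: i] al swu)) (congr1 (@^~ z) (partialsZ [:: i] be swv))).
Qed.

Definition upd a (i : 'I_n) (v : nat) : 'I_n -> nat := fun k => if k == i then v else a k.

Lemma hfun_upd a i (v : nat) (z : 'rV[R]_n) : hfun (upd a i v) z = etac v i z * \prod_(k | k != i) etac (a k) k z.
Proof.
rewrite /hfun (bigD1 i)//= /upd eqxx; congr (_ * _).
by apply: eq_bigr => k /negbTE ->.
Qed.

Lemma hfun_split a i (z : 'rV[R]_n) : hfun a z = etac (a i) i z * \prod_(k | k != i) etac (a k) k z.
Proof. by rewrite /hfun (bigD1 i). Qed.

Lemma hfun_mul a i (z : 'rV[R]_n) : z 0 i * hfun a z =
  Num.sqrt (a i).+1%:R * hfun (upd a i (a i).+1) z + Num.sqrt (a i)%:R * hfun (upd a i (a i).-1) z.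
Proof. by rewrite (hfun_split a i) !hfun_upd mulrA {1}/etac eta_up /etac; ring. Qed.

Lemma hfun_partial a i : partial i (hfun a : 'rV[R]_n -> R) = fun z =>
  - (2^-1 * Num.sqrt (a i).+1%:R) * hfun (upd a i (a i).+1) z + 2^-1 * Num.sqrt (a i)%:R * hfun (upd a i (a i).-1) z.
Proof.
have [d E] := etac_partial (R := R) (a i) i i.
have Q z : is_derive z (e_ i : 'rV[R]_n) (fun z => \prod_(k | k != i) etac (a k) k z) (0 : R).
  apply: is_derive_of_line; rewrite (_ : (fun s : R => _) = cst (\prod_(k | k != i) etac (a k) k z)).
    exact: is_derive_cst.
  apply/funext => s; apply: eq_bigr => k ki; rewrite /etac !mxE (negbTE ki) andbF mulr0 addr0 //.
have dQ : deriv_along (fun z : 'rV[R]_n => \prod_(k | k != i) etac (a k) k z) i by move=> z; case: (Q z).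
have -> : hfun a = fun z : 'rV[R]_n => etac (a i) i z * \prod_(k | k != i) etac (a k) k z by apply/funext => z; exact: hfun_split.
rewrite (partialM d dQ) E; apply/funext => z.
have -> : partial i (fun z : 'rV[R]_n => \prod_(k | k != i) etac (a k) k z) z = 0 by exact: (@derive_val _ _ _ _ _ _ _ (Q z)).
rewrite !hfun_upd eqxx mulr0 addr0 mul1r.
have := eta'E (a i) (z 0 i); rewrite /eta' -![eta _ _]/(etac _ i z) => ->.
by ring.
Qed.

Lemma hfun_bound : exists2 C, 0 <= C & forall M a, (forall k, (a k <= M)%N) -> forall z : 'rV[R]_n, `|hfun a z| <= C * M.+1%:R ^+ n.
Proof.
have [C C0 hC] := eta_sup; exists (C ^+ n); first exact: exprn_ge0.
move=> M a aM z; rewrite -exprMn /hfun normr_prod.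
apply: (@le_trans _ _ (\prod_(k < n) (C * M.+1%:R))); last by rewrite prodr_const card_ord.
apply: ler_prod => k _; rewrite normr_ge0/=; apply: le_trans (hC _ _) _.
by apply: ler_wpM2l => //; rewrite ler_nat ltnS.
Qed.

(** The last letter acts first, so the induction peels letters from the right: each gives two
    Hermite functions of index at most [M + 1] with coefficients at most [M + 1]. The factor
    [2 ^+ p] accounts for [M + 2 <= 2 (M + 1)]. *)
Lemma word_bound w : exists2 C, 0 <= C & exists p, forall M a, (forall k, (a k <= M)%N) ->
  forall z, `|word w (hfun a) z| <= C * M.+1%:R ^+ p.
Proof.
elim/last_ind: w => [|w o [C C0 [p h]]].
  by have [C C0 hC] := hfun_bound; exists C => //; exists n.
have wr g : word (rcons w o) g = word w (op o g) by rewrite /word foldr_rcons.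
exists (2 * (C * 2 ^+ p)); first by rewrite mulr_ge0// mulr_ge0// exprn_ge0.
exists p.+1 => M a aM z; rewrite wr.
have [i [al [be [E [hal hbe]]]]] : exists i (al be : R),
    op o (hfun a) = (fun z => al * hfun (upd a i (a i).+1) z + be * hfun (upd a i (a i).-1) z) /\
    `|al| <= M.+1%:R /\ `|be| <= M.+1%:R.
  have sq k : (k <= M.+1)%N -> `|Num.sqrt (k%:R : R)| <= M.+1%:R.
    move=> kM; rewrite ger0_norm ?sqrtr_ge0//.
    rewrite -ler_sqr ?nnegrE ?sqrtr_ge0// sqr_sqrtr//; apply: (@le_trans _ _ (M.+1%:R)); first by rewrite ler_nat.
    by rewrite expr2 ler_peMr// ler1n.
  have hf (x : R) : `|x| <= M.+1%:R -> `|2^-1 * x| <= M.+1%:R.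
    by move=> h'; rewrite normrM ger0_norm ?invr_ge0//; apply: le_trans h'; rewrite ler_piMl// invf_le1// ler1n.
  case: o {wr} => i /=; exists i.
    exists (Num.sqrt (a i).+1%:R), (Num.sqrt (a i)%:R); split; first by apply/funext => z'; exact: hfun_mul.
    by split; apply: sq; rewrite ?ltnS//; apply: leq_trans (aM i) _.
  exists (- (2^-1 * Num.sqrt (a i).+1%:R)), (2^-1 * Num.sqrt (a i)%:R); split; first exact: hfun_partial.
  by split; rewrite ?normrN; apply: hf; apply: sq; rewrite ?ltnS//; apply: leq_trans (aM i) _.
rewrite E (word_lin w al be (fast_smooth (fast_hfun _)) (fast_smooth (fast_hfun _))).
have hu (v : nat) : (v <= M.+1)%N -> `|word w (hfun (upd a i v)) z| <= C * (2 ^+ p * M.+1%:R ^+ p).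
  move=> vM; apply: le_trans (h M.+1 _ _ z) _.
    by move=> k; rewrite /upd; case: ifP => // _; apply: leq_trans (aM k) _.
  apply: ler_wpM2l => //; rewrite -exprMn; apply: lerXn2r; rewrite ?nnegrE ?mulr_ge0//.
  by rewrite -natrM ler_nat mul2n -addnn addSn ltnS leq_addl.
apply: le_trans (ler_normD _ _) _; rewrite !normrM.
have b1 := ler_pM (normr_ge0 _) (normr_ge0 _) hal (hu (a i).+1 (aM i)).
have b2 := ler_pM (normr_ge0 _) (normr_ge0 _) hbe (hu (a i).-1 (leq_trans (leq_pred _) (leqW (aM i)))).
apply: le_trans (lerD b1 b2) _; rewrite exprS le_eqVlt; apply/orP; left; apply/eqP; ring.
Qed.

(** As [|z|] is at most the sum of the [|z_i|], every power of the weight is traded for one more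
    multiplication letter in the word. *)
Lemma word_weighted q w : exists2 C, 0 <= C & exists p, forall M a, (forall k, (a k <= M)%N) ->
  forall z, (1 + `|z|) ^+ q * `|word w (hfun a) z| <= C * M.+1%:R ^+ p.
Proof.
elim: q w => [|q IH] w.
  by have [C C0 [p h]] := word_bound w; exists C => //; exists p => M a aM z; rewrite expr0 mul1r; exact: h.
have [C C0 [p h]] := IH w.
have /choice[Cf hCf] : forall i : 'I_n, exists C, 0 <= C /\ exists p, forall M a, (forall k, (a k <= M)%N) ->
  forall z, (1 + `|z|) ^+ q * `|word (inl i :: w) (hfun a) z| <= C * M.+1%:R ^+ p.
  by move=> i; have [D D0 ?] := IH (inl i :: w); exists D.
have /choice[pf hpf] := fun i => (hCf i).2.
exists (C + \sum_i Cf i); first by rewrite addr_ge0// sumr_ge0// => i _; exact: (hCf i).1.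
exists (p + \sum_i pf i)%N => M a aM z.
have up r : (r <= p + \sum_i pf i)%N -> (M.+1%:R : R) ^+ r <= M.+1%:R ^+ (p + \sum_i pf i).
  by move=> rp; apply: ler_weXn2l => //; rewrite ler1n.
have q0 : 0 <= (1 + `|z|) ^+ q by rewrite exprn_ge0// addr_ge0.
rewrite exprSr -mulrA mulrDl mul1r mulrDr mulrDl; apply: lerD.
  apply: le_trans (h M a aM z) _; apply: ler_wpM2l => //; apply: up; exact: leq_addr.
apply: (@le_trans _ _ (\sum_i (1 + `|z|) ^+ q * `|word (inl i :: w) (hfun a) z|)).
  rewrite -mulr_sumr; apply: ler_wpM2l => //=; under eq_bigr do rewrite normrM.
  by rewrite -mulr_suml; apply: ler_wpM2r => //; exact: norm_le_sum.
rewrite mulr_suml; apply: ler_sum => i _; apply: le_trans (hpf i M a aM z) _.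
apply: ler_wpM2l; first exact: (hCf i).1.
by apply: up; rewrite (bigD1 i)//= addnCA leq_addr.
Qed.

End words.

(** * From mean-square to uniform approximation *)

Section hermite_approximation.
Context {R : realType} {n : nat}.
Hypothesis n0 : (0 < n)%N.
Implicit Types g u : 'rV[R]_n -> R.

Let zn : R := Zn^-1 ^+ n.
Let zn0 : 0 < zn. Proof. by rewrite exprn_gt0// invr_gt0 Zn_gt0. Qed.

Definition hcoef K g (a : {ffun 'I_n -> 'I_K}) : R := Zn^-1 ^+ n * coefn (fun i => a i) g.
Definition hproj K g z : R := \sum_a hcoef g a * hfun (fun i => (a : {ffun 'I_n -> 'I_K}) i) z.

Lemma fast_hproj K g : fast (hproj K g).
Proof. by apply: fast_sum => a; apply: fast_Z; exact: fast_hfun. Qed.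

Lemma integralR_hproj K g u : fast u ->
  integralR (fun z => u z * hproj K g z) =
  zn * \sum_(a : {ffun 'I_n -> 'I_K}) coefn (fun i => a i) g * coefn (fun i => a i) u.
Proof.
move=> fu; have f1 (a : {ffun 'I_n -> 'I_K}) := fast_MM fu (fast_hfun (R := R) (fun i => a i)).
rewrite (_ : (fun z => _) = fun z => \sum_(a : {ffun 'I_n -> 'I_K}) hcoef g a * (u z * hfun (fun i => a i) z)); last first.
  by apply/funext => z; rewrite /hproj mulr_sumr; apply: eq_bigr => a _; ring.
rewrite (integralR_sum _ (fun a => fast_dom (fast_Z (hcoef g a) (f1 a)))) mulr_sumr.
by apply: eq_bigr => a _; rewrite (integralR_Z _ (fast_dom (f1 a))) /hcoef -mulrA.
Qed.

Lemma coefn_hproj K g (b : {ffun 'I_n -> 'I_K}) : coefn (fun i => b i) (hproj K g) = coefn (fun i => b i) g.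
Proof.
rewrite {1}/coefn (_ : (fun z => _) = fun z => hfun (fun i => b i) z * hproj K g z); last first.
  by apply/funext => z; rewrite mulrC.
rewrite (integralR_hproj _ _ (fast_hfun _)) (bigD1 b)//= big1 => [|a ab].
  rewrite addr0 hfun_orth; case: forallP => [_|[]//].
  by rewrite /zn exprVn mulrCA mulVf ?mulr1// gt_eqF// exprn_gt0// Zn_gt0.
rewrite hfun_orth; case: forallP => [h|_]; last by rewrite mulr0.
by case/eqP: ab; apply/ffunP => i; apply/val_inj/eqP; exact: h.
Qed.

Lemma coefnB (b : 'I_n -> nat) g u : fast g -> fast u -> coefn b (fun z => g z - u z) = coefn b g - coefn b u.
Proof.
move=> fg fu; rewrite /coefn -(integralR_B (fast_dom (fast_MM fg (fast_hfun b))) (fast_dom (fast_MM fu (fast_hfun b)))).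
by congr integralR; apply/funext => z; rewrite mulrBl.
Qed.

Lemma hproj_error K g : fast g ->
  integralR (fun z => (g z - hproj K g z) ^+ 2) =
  integralR (fun z => g z ^+ 2) - zn * \sum_(a : {ffun 'I_n -> 'I_K}) coefn (fun i => a i) g ^+ 2.
Proof.
move=> fg; have fp := fast_hproj K g; have fh := fast_B fg fp.
have -> : (fun z => (g z - hproj K g z) ^+ 2) = fun z => (g z ^+ 2 - g z * hproj K g z) - (g z - hproj K g z) * hproj K g z.
  by apply/funext => z; ring.
rewrite (integralR_B (fast_dom (fast_B (fast_sqr fg) (fast_MM fg fp))) (fast_dom (fast_MM fh fp))).
rewrite (integralR_B (fast_dom (fast_sqr fg)) (fast_dom (fast_MM fg fp))).
rewrite (integralR_hproj _ _ fg) (integralR_hproj _ _ fh).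
rewrite [X in _ - _ * X]big1 ?mulr0 ?subr0 => [|a _]; last first.
  by rewrite (coefnB _ fg fp) coefn_hproj subrr mulr0.
by congr (_ - _ * _); apply: eq_bigr => a _; rewrite expr2.
Qed.

(** A single squared coefficient is at most the whole Bessel sum, which nonnegativity of the
    projection error bounds by the norm of [g]. *)
Lemma hcoef_bound g : fast g -> exists2 C, 0 <= C & forall K (a : {ffun 'I_n -> 'I_K}), `|hcoef g a| <= C.
Proof.
move=> fg; pose I := integralR (fun z => g z ^+ 2).
have I0 : 0 <= I by apply: integralR_ge0 => z; exact: sqr_ge0.
exists (zn * (1 + zn^-1 * I)); first by rewrite mulr_ge0 ?(ltW zn0)// addr_ge0// mulr_ge0// invr_ge0 ltW.
move=> K a; rewrite /hcoef -/zn normrM (gtr0_norm zn0); apply: ler_wpM2l; first exact: ltW.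
apply: le_1p_sqr; rewrite real_normK ?num_real// ler_pdivlMl//.
have : 0 <= integralR (fun z => (g z - hproj K g z) ^+ 2) by apply: integralR_ge0 => z; exact: sqr_ge0.
rewrite hproj_error// subr_ge0; apply: le_trans; apply: ler_wpM2l; first exact: ltW.
by rewrite (bigD1 a)//= lerDl; apply: sumr_ge0 => b _; exact: sqr_ge0.
Qed.

(** [osc_ineq] has the factor [N ^+ k] at cutoff [K = N + k]. For [N > k] one has [K <= 2 N]; in the
    remaining cases [K <= 2 k] and the trivial bound by the norm of [g] suffices. *)
Lemma hproj_L2 g k : fast g -> exists2 C, 0 <= C & forall K,
  K%:R ^+ k * integralR (fun z => (g z - hproj K g z) ^+ 2) <= C.
Proof.
move=> fg; pose I := integralR (fun z => g z ^+ 2).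
have I0 : 0 <= I by apply: integralR_ge0 => z; exact: sqr_ge0.
pose A := \sum_i integralR (fun z => iter k (osc i) g z ^+ 2).
have A0 : 0 <= A by apply: sumr_ge0 => i _; apply: integralR_ge0 => z; exact: sqr_ge0.
exists (2 ^+ k * (A + k%:R ^+ k * I)).
  by rewrite mulr_ge0 ?exprn_ge0// addr_ge0// mulr_ge0// exprn_ge0.
move=> K; set E := integralR _.
have E0 : 0 <= E by apply: integralR_ge0 => z; exact: sqr_ge0.
have EI : E <= I.
  rewrite /E hproj_error// gerBl mulr_ge0 ?(ltW zn0)//; apply: sumr_ge0 => a _; exact: sqr_ge0.
have [Kk|kK] := leqP K k.
  apply: (@le_trans _ _ (k%:R ^+ k * I)).
    by apply: ler_pM; rewrite ?exprn_ge0//; apply: lerXn2r; rewrite ?nnegrE// ler_nat.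
  apply: (@le_trans _ _ (1 * (A + k%:R ^+ k * I))); first by rewrite mul1r lerDr.
  apply: ler_wpM2r; first by rewrite addr_ge0// mulr_ge0// exprn_ge0.
  by rewrite exprn_ege1// ler1n.
pose N := (K - k)%N.
have KN : K = (N + k)%N by rewrite /N subnK// ltnW.
have h : N%:R ^+ k * E <= A by rewrite /E hproj_error// /zn; move: (osc_ineq N k fg); rewrite -KN.
have [Nk|kN] := leqP N k.
  apply: (@le_trans _ _ ((2 * k%:R) ^+ k * I)).
    apply: ler_pM; rewrite ?exprn_ge0//; apply: lerXn2r; rewrite ?nnegrE ?mulr_ge0//.
    by rewrite -natrM ler_nat KN mul2n -addnn leq_add2r.
  by rewrite exprMn -mulrA; apply: ler_wpM2l; [exact: exprn_ge0|rewrite lerDr].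
apply: (@le_trans _ _ ((2 * N%:R) ^+ k * E)).
  apply: ler_wpM2r => //; apply: lerXn2r; rewrite ?nnegrE ?mulr_ge0//.
  by rewrite -natrM ler_nat KN mul2n -addnn leq_add2l ltnW.
rewrite exprMn -mulrA; apply: ler_wpM2l; first exact: exprn_ge0.
by apply: le_trans h _; rewrite lerDl mulr_ge0// exprn_ge0.
Qed.

(** A crude count: [(M + 1)^n] terms with bounded coefficients and polynomially bounded derivatives.
    The exponent is fixed before any rate of decay is requested. *)
Lemma hproj_gradient g : fast g -> exists2 L, 0 < L & exists Q, forall M i z,
  `|partial i (fun z => g z - hproj M.+1 g z) z| <= L * M.+1%:R ^+ Q.
Proof.
move=> fg; have [C C0 hC] := hcoef_bound fg.
have /choice[B hB] : forall i : 'I_n, exists B, 0 <= B /\ exists p, forall M a, (forall k, (a k <= M)%N) ->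
    forall z : 'rV[R]_n, `|partial i (hfun a) z| <= B * M.+1%:R ^+ p.
  by move=> i; have [B B0 h] := word_bound (R := R) [:: inr i : 'I_n + 'I_n]; exists B.
have /choice[p hp] := fun i => (hB i).2.
have /choice[G hG] : forall i : 'I_n, exists G, 0 <= G /\ forall z, `|partial i g z| <= G.
  move=> i; have [G h] := (fast_partial i fg).2 [::] 0; exists G.
  have h' z : `|partial i g z| <= G by have := h z; rewrite mul0r oppr0 expR0 mulr1.
  by split => //; exact: le_trans (normr_ge0 _) (h' 0).
have SG : 0 <= \sum_i G i by apply: sumr_ge0 => i _; exact: (hG i).1.
have SB : 0 <= C * \sum_i B i by rewrite mulr_ge0// sumr_ge0// => i _; exact: (hB i).1.
exists (\sum_i G i + C * \sum_i B i + 1); first by rewrite ltr_wpDl// addr_ge0.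
exists (n + \sum_i p i)%N => M i z.
have fp := fast_hproj M.+1 g.
have -> : partial i (fun z => g z - hproj M.+1 g z) z =
   partial i g z - \sum_(a : {ffun 'I_n -> 'I_M.+1}) hcoef g a * partial i (hfun (fun i => a i)) z.
  have sh (a : {ffun 'I_n -> 'I_M.+1}) : smooth (fun z : 'rV[R]_n => hcoef g a * hfun (fun i => a i) z).
    exact: (fast_smooth (fast_Z _ (fast_hfun _))).
  have := partialsD [:: i] (fast_smooth fg) (smoothN (fast_smooth fp)) => /(congr1 (@^~ z)) /= ->.
  congr (_ + _); rewrite (congr1 (@^~ z) (partialN (smooth_deriv (fast_smooth fp)))); congr (- _).
  rewrite [LHS](congr1 (@^~ z) (partials_sum [:: i] _ sh)); apply: eq_bigr => a _.
  exact: (congr1 (@^~ z) (partialsZ [:: i] _ (fast_smooth (fast_hfun _)))).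
have M1 : 1 <= (M.+1%:R : R) by rewrite ler1n.
have T1 : 1 <= (M.+1%:R : R) ^+ (n + \sum_i p i) by exact: exprn_ege1.
apply: le_trans (ler_normB _ _) _; rewrite mulrDl; apply: ler_wpDr; first by rewrite mul1r exprn_ge0.
rewrite mulrDl; apply: lerD.
  apply: le_trans ((hG i).2 z) _; apply: le_trans (term_le_sum i (fun i => (hG i).1)) _.
  by rewrite ler_peMr.
apply: le_trans (ler_norm_sum _ _ _) _.
apply: (@le_trans _ _ (\sum_(a : {ffun 'I_n -> 'I_M.+1}) C * ((\sum_i B i) * M.+1%:R ^+ (\sum_i p i)))).
  apply: ler_sum => a _; rewrite normrM; apply: ler_pM => //.
  apply: le_trans (hp i M _ _ z) _; first by move=> k; rewrite -ltnS.
  apply: ler_pM; rewrite ?exprn_ge0 ?(hB i).1//; first exact: (term_le_sum i (fun i => (hB i).1)).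
  by apply: ler_weXn2l => //; rewrite (bigD1 i)//= leq_addr.
rewrite sumr_const card_ffun !card_ord -[leLHS]mulr_natr natrX exprD le_eqVlt; apply/orP; left; apply/eqP; ring.
Qed.

(* Where |R| is large the gradient bound keeps it large on a cube, against the
   smallness of its L^2 norm. *)
Lemma hproj_sup g s : fast g -> exists2 C, 0 <= C & forall M z,
  `|g z - hproj M.+1 g z| * M.+1%:R ^+ s <= C.
Proof.
move=> fg; have [L L0 [Q hQ]] := hproj_gradient fg.
(* The cube argument bounds [m ^+ n.+2] by [Lam ^+ n] times the squared L^2 error. The rate must
   therefore pay [Q * n] for [Lam ^+ n], and [s * n.+2] for the claim raised to the power
   [n + 2]. *)
have [C C0 hC] := hproj_L2 (Q * n + s * n.+2) fg.
have nR : 0 < (n%:R : R) by rewrite ltr0n.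
pose B := 4 * (n%:R * L) ^+ n * C.
have B0 : 0 <= B by rewrite mulr_ge0// mulr_ge0// exprn_ge0// mulr_ge0// ltW.
exists (1 + B); first exact: addr_ge0.
move=> M z0; set m := `|_|.
have m0 : 0 <= m by exact: normr_ge0.
have T0 : 0 < (M.+1%:R : R) by rewrite ltr0n.
have fh := fast_B fg (fast_hproj M.+1 g).
pose Lam := L * M.+1%:R ^+ Q; have Lam0 : 0 < Lam by rewrite mulr_gt0// exprn_gt0.
(* Over this distance the gradient bound lets the remainder lose at most half of [m]. *)
pose de := m / (2 * (n%:R * Lam)).
have nL : 0 < n%:R * Lam by exact: mulr_gt0.
have de0 : 0 <= de by rewrite divr_ge0// mulr_ge0// ltW.
have low z : cube z0 de z -> (m / 2) ^+ 2 <= (g z - hproj M.+1 g z) ^+ 2.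
  rewrite /cube/= => zz.
  have H := lipschitz_line (M := Lam) z0 (z - z0) (fast_smooth fh) (fun i z => hQ M i z).
  have zz' : z0 + (z - z0) = z by rewrite addrC subrK.
  rewrite zz' in H.
  have h1 : n%:R * Lam * `|z - z0| <= m / 2.
    apply: le_trans (ler_wpM2l (ltW nL) zz) _; rewrite /de le_eqVlt; apply/orP; left; apply/eqP.
    by move: (n%:R * Lam) (negbT (gt_eqF nL)) => x x0; field.
  have h2 := le_trans H h1.
  have h3 : m / 2 <= `|g z - hproj M.+1 g z|.
    have := ler_distD (g z - hproj M.+1 g z) (g z0 - hproj M.+1 g z0) 0.
    rewrite !subr0 -/m distrC; move: h2; move: `|_ - (g z0 - _)| `|g z - _| => a b; lra.
  rewrite -[leRHS]real_normK ?num_real//; apply: lerXn2r; rewrite ?nnegrE//; exact: divr_ge0.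
have := integralR_cube_ge (fast_dom (fast_sqr fh)) (fun z => sqr_ge0 _) de0 (sqr_ge0 _) low.
have -> : 2 * de = m / (n%:R * Lam).
  by rewrite /de; move: (n%:R * Lam) (negbT (gt_eqF nL)) => x x0; field.
move=> h.
have {}h : m ^+ n.+2 <= 4 * (n%:R * Lam) ^+ n * integralR (fun z => (g z - hproj M.+1 g z) ^+ 2).
  have -> : m ^+ n.+2 = 4 * (n%:R * Lam) ^+ n * ((m / 2) ^+ 2 * (m / (n%:R * Lam)) ^+ n).
    rewrite [(m / (n%:R * Lam)) ^+ n]exprMn exprVn [(m / 2) ^+ 2]exprMn -addn2 exprD.
    have : (n%:R * Lam) ^+ n != 0 by rewrite expf_neq0// gt_eqF.
    by move: ((n%:R * Lam) ^+ n) => x x0; field.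
  by apply: ler_wpM2l => //; rewrite mulr_ge0// exprn_ge0// ltW.
have x0 : 0 <= m * M.+1%:R ^+ s by rewrite mulr_ge0// exprn_ge0.
have hx : (m * M.+1%:R ^+ s) ^+ n.+2 <= B.
  rewrite exprMn -exprM; apply: le_trans (ler_wpM2r (exprn_ge0 _ (ltW T0)) h) _.
  have hK := hC M.+1; rewrite exprD exprM in hK.
  rewrite /Lam mulrA [(n%:R * L * _) ^+ n]exprMn /B.
  set I := integralR _ in hK *.
  apply: (@le_trans _ _ ((4 * (n%:R * L) ^+ n) * ((M.+1%:R ^+ Q) ^+ n * M.+1%:R ^+ (s * n.+2) * I))).
    move: ((n%:R * L) ^+ n) ((M.+1%:R ^+ Q) ^+ n) (M.+1%:R ^+ (s * n.+2)) => a b c.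
    by rewrite le_eqVlt; apply/orP; left; apply/eqP; ring.
  by apply: ler_wpM2l => //; rewrite mulr_ge0// exprn_ge0// mulr_ge0// ltW.
have [x1|x1] := leP (m * M.+1%:R ^+ s) 1; first by apply: le_trans x1 _; rewrite lerDl.
apply: (@le_trans _ _ B); last by rewrite lerDr.
by apply: le_trans hx; rewrite exprS ler_peMr// exprn_ege1// ltW.
Qed.

End hermite_approximation.

(** * Scaled Hermite functions *)

Section scaled_hermite.
Context {R : realType} {n : nat}.
Variables (mu : 'rV[R]_n) (Sigma Q : 'M[R]_n) (D : 'rV[R]_n).
Hypothesis hS : spd_factorization Sigma Q D.

Let S := scaling Q D.
Let T : 'M[R]_n := diag_mx (map_mx (fun d => (Num.sqrt d)^-1) D) *m Q^T.

Lemma orth_tr : Q^T *m Q = 1%:M. Proof. exact: mulmx1C (Q_orthogonal hS). Qed.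

Lemma D_gt0 k : 0 < D 0 k.
Proof.
pose v : 'rV[R]_n := e_ k *m Q^T.
have v0 : v != 0.
  apply/eqP => h; have : v *m Q = 0 by rewrite h mul0mx.
  rewrite /v -mulmxA orth_tr mulmx1 => /rowP/(_ k); rewrite !mxE !eqxx /= => /eqP.
  by rewrite oner_eq0.
have := Sigma_pos_def hS v0.
rewrite (Sigma_eq hS) /v trmx_mul trmxK !mulmxA -[_ *m Q^T *m Q]mulmxA orth_tr mulmx1.
rewrite -[_ *m Q^T *m Q]mulmxA orth_tr mulmx1.
by rewrite trmx_delta -rowE -colE !mxE eqxx mulr1n.
Qed.

Lemma scaling_mul : S *m T = 1%:M.
Proof.
rewrite /S /scaling /T !mulmxA -[_ *m diag_mx _ *m diag_mx _]mulmxA.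
have -> : diag_mx (map_mx Num.sqrt D) *m diag_mx (map_mx (fun d => (Num.sqrt d)^-1) D) = 1%:M.
  by apply/matrixP => i j; rewrite mulmx_diag !mxE divff// gt_eqF// sqrtr_gt0 D_gt0.
by rewrite mulmx1 (Q_orthogonal hS).
Qed.

Lemma scaling_unit : S \in unitmx.
Proof. by case: (mulmx1_unit scaling_mul). Qed.

Lemma Sigma_scaling : Sigma = S *m S^T.
Proof.
rewrite (Sigma_eq hS) /S /scaling trmx_mul tr_diag_mx !mulmxA -[_ *m diag_mx _ *m diag_mx _]mulmxA.
congr (_ *m _ *m _); apply/matrixP => i j; rewrite mulmx_diag !mxE.
by rewrite -expr2 sqr_sqrtr// ltW// D_gt0.
Qed.

Lemma det_Sigma : 0 < \det Sigma.
Proof.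
rewrite Sigma_scaling det_mulmx det_tr -expr2 lt0r sqr_ge0 sqrf_eq0 andbT.
by have := scaling_unit; rewrite unitmxE unitfE.
Qed.

Let B := (invmx S)^T.
Let c0 : 'rV[R]_n := - mu *m B.

Lemma unscale y k : (invmx S *m (y - mu)^T) k 0 = aff c0 B y 0 k.
Proof.
rewrite /aff /c0 -mulmxDl [- mu + y]addrC; transitivity (((y - mu) *m B)^T k 0).
  by rewrite trmx_mul /B trmxK.
by rewrite mxE.
Qed.

Lemma quad_unscale y : ((y - mu) *m invmx Sigma *m (y - mu)^T) 0 0 = \sum_k aff c0 B y 0 k ^+ 2.
Proof.
have iS : invmx Sigma = B *m invmx S.
  have h : Sigma *m (B *m invmx S) = 1%:M.
    rewrite Sigma_scaling /B mulmxA -[_ *m S^T *m _]mulmxA -trmx_mul mulVmx ?scaling_unit// trmx1 mulmx1.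
    by rewrite mulmxV// scaling_unit.
  by rewrite -[LHS]mulmx1 -h mulKmx// (mulmx1_unit h).1.
rewrite iS !mulmxA -mulmxA mxE; apply: eq_bigr => k _.
by rewrite -unscale expr2; congr (_ * _); rewrite unscale /aff /c0 -mulmxDl addrC.
Qed.

Definition kappa : R := Num.sqrt (Num.sqrt ((2 * pi) ^+ n * \det Sigma))^-1.

Lemma kappa_gt0 : 0 < kappa.
Proof.
rewrite sqrtr_gt0 invr_gt0 sqrtr_gt0 mulr_gt0 ?det_Sigma// exprn_gt0// mulr_gt0//.
exact: pi_gt0.
Qed.

(** In the variable [aff c0 B y], the transpose of [S^-1 (y - mu)], the square root of the Gaussian
    density splits into the factors [gs] up to the constant [kappa]. *)
Lemma hermite_funE a y : hermite_fun mu Sigma Q D a y = kappa * hfun a (aff c0 B y).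
Proof.
rewrite /hermite_fun /hermite_poly /gaussian_density quad_unscale.
have -> : expR (- (\sum_k aff c0 B y 0 k ^+ 2) / 2) = (\prod_k gs (aff c0 B y 0 k)) ^+ 2.
  rewrite -prodrXl mulNr mulr_suml -sumrN expR_sum; apply: eq_bigr => k _.
  by rewrite /gs -expRM_natr; congr expR; field.
rewrite sqrtrM ?sqr_ge0// sqrtr_sqr ger0_norm; last by apply: prodr_ge0 => k _; exact: expR_ge0.
rewrite -/kappa [_ * kappa]mulrC -mulrA; congr (_ * _).
rewrite -big_split/=; apply: eq_bigr => k _.
by rewrite unscale /etac /eta mulrC.
Qed.

Lemma aff_inv : S^T *m B = 1%:M.
Proof. by rewrite /B -trmx_mul mulVmx ?scaling_unit// trmx1. Qed.

Lemma aff_inv' : B *m S^T = 1%:M.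
Proof. by rewrite /B -trmx_mul mulmxV ?scaling_unit// trmx1. Qed.

Lemma aff_cancel y : aff mu S^T (aff c0 B y) = y.
Proof. by rewrite /aff /c0 mulmxDl mulNmx mulNmx -!mulmxA aff_inv' !mulmx1 addrA subrr add0r. Qed.

Lemma fast_hermite a : fast (hermite_fun mu Sigma Q D a).
Proof.
have -> : hermite_fun mu Sigma Q D a = fun y => kappa * hfun a (aff c0 B y).
  by apply/funext => y; exact: hermite_funE.
exact: (fast_Z _ (fast_aff c0 aff_inv' (fast_hfun a))).
Qed.

Lemma fast_in_span d u : in_span mu Sigma Q D d u -> fast u.
Proof.
move=> [c ->].
have := fast_sum (index_enum _) (fun a : {ffun 'I_n -> 'I_d.+1} =>
  fast_Z (if (\sum_i a i <= d)%N then c a else 0) (fast_hermite (fun i => a i))).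
congr fast; apply/funext => y; rewrite [RHS]big_mkcond; apply: eq_bigr => a _.
by case: ifP => // _; rewrite mul0r.
Qed.

Lemma in_span_D d u v : in_span mu Sigma Q D d u -> in_span mu Sigma Q D d v ->
  in_span mu Sigma Q D d (fun y => u y - v y).
Proof.
move=> [c ->] [e ->]; exists (fun a => c a - e a); apply/funext => y.
by rewrite -sumrB; apply: eq_bigr => a _; rewrite mulrBl.
Qed.

Lemma laplacian_hermite a y : laplacian (hermite_fun mu Sigma Q D a) y =
  \sum_i \sum_j \sum_l (kappa * B i j * B i l) * word [:: inr l; inr j] (hfun a) (aff c0 B y).
Proof.
have sh := fast_smooth (fast_hfun (R := R) a).
have PA (g : 'rV[R]_n -> R) i : smooth g -> partial i (fun y => g (aff c0 B y)) = fun y => \sum_j B i j * partial j g (aff c0 B y).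
  by move=> sg; exact: (partial_aff c0 B i (fun j => smooth_deriv sg) (fun j => smooth_cont (smooth_partial j sg))).2.
have -> : hermite_fun mu Sigma Q D a = fun y => kappa * hfun a (aff c0 B y).
  by apply/funext => z; exact: hermite_funE.
apply: eq_bigr => i _.
rewrite [LHS](congr1 (@^~ y) (partialsZ [:: i; i] kappa (smooth_aff c0 B sh))) /= (PA _ i sh).
have s1 j : smooth (fun y => partial j (hfun a) (aff c0 B y)) := smooth_aff c0 B (smooth_partial j sh).
have E := congr1 (@^~ y) (partials_sum [:: i] (index_enum _) (fun j => smoothM (smooth_cst (B i j)) (s1 j))).
rewrite /= in E; rewrite E.
rewrite mulr_sumr; apply: eq_bigr => j _.
have E2 := congr1 (@^~ y) (partialsZ [:: i] (B i j) (s1 j)).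
rewrite /= in E2; rewrite E2 (PA _ i (smooth_partial j sh)).
by rewrite mulr_sumr mulr_sumr; apply: eq_bigr => l _; ring.
Qed.

Lemma unscale_norm : exists2 K, 0 <= K & forall y, 1 + `|y| <= K * (1 + `|aff c0 B y|).
Proof.
have [K K0 hK] := aff_norm_le mu S^T; exists (1 + `|mu| + K); first by rewrite !addr_ge0.
move=> y; have := hK (aff c0 B y); rewrite aff_cancel.
have := mulr_ge0 (normr_ge0 mu) (normr_ge0 (aff c0 B y)); have := normr_ge0 (aff c0 B y).
by move: `|y| `|mu| `|aff c0 B y| K0 => a b c K0; lra.
Qed.

Lemma hermite_weighted q : exists2 C, 0 <= C & exists p, forall M a, (forall k, (a k <= M)%N) -> forall y,
  (1 + `|y|) ^+ q * (`|hermite_fun mu Sigma Q D a y| + `|laplacian (hermite_fun mu Sigma Q D a) y|) <= C * M.+1%:R ^+ p.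
Proof.
have [K K0 hK] := unscale_norm.
have [C0 C00 [p0 h0]] := word_weighted (R := R) q ([::] : seq ('I_n + 'I_n)).
have /choice[Cf hCf] : forall jl : 'I_n * 'I_n, exists C, 0 <= C /\ exists p, forall M a, (forall k, (a k <= M)%N) ->
  forall z : 'rV[R]_n, (1 + `|z|) ^+ q * `|word [:: inr jl.2; inr jl.1] (hfun a) z| <= C * M.+1%:R ^+ p.
  by move=> [j l]; have [C C1 h] := word_weighted (R := R) q ([:: inr l; inr j] : seq ('I_n + 'I_n)); exists C.
have /choice[pf hpf] := fun jl => (hCf jl).2.
pose P := (p0 + \sum_jl pf jl)%N.
pose TT := \sum_i \sum_j \sum_l `|kappa * B i j * B i l| * Cf (j, l).
have T0 : 0 <= TT.
  by apply: sumr_ge0 => i _; apply: sumr_ge0 => j _; apply: sumr_ge0 => l _; rewrite mulr_ge0// (hCf _).1.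
exists (K ^+ q * (kappa * C0 + TT)); first by rewrite mulr_ge0 ?exprn_ge0// addr_ge0// mulr_ge0// ltW// kappa_gt0.
exists P => M a aM y; set z := aff c0 B y.
have M1 : 1 <= (M.+1%:R : R) by rewrite ler1n.
have z0 : 0 <= (1 + `|z|) ^+ q by rewrite exprn_ge0// addr_ge0.
have mono r : (r <= P)%N -> (M.+1%:R : R) ^+ r <= M.+1%:R ^+ P by move=> h; apply: ler_weXn2l.
apply: (@le_trans _ _ (K ^+ q * ((1 + `|z|) ^+ q * (`|hermite_fun mu Sigma Q D a y| + `|laplacian (hermite_fun mu Sigma Q D a) y|)))).
  rewrite mulrA -exprMn; apply: ler_wpM2r; first exact: addr_ge0.
  by apply: lerXn2r; rewrite ?nnegrE ?mulr_ge0 ?addr_ge0//; exact: hK.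
rewrite -mulrA; apply: ler_wpM2l; first exact: exprn_ge0.
rewrite mulrDr mulrDl; apply: lerD.
  rewrite hermite_funE normrM (gtr0_norm kappa_gt0) mulrCA -mulrA; apply: ler_wpM2l; first exact/ltW/kappa_gt0.
  by apply: le_trans (h0 M a aM z) _; apply: ler_wpM2l => //; apply: mono; exact: leq_addr.
rewrite laplacian_hermite -/z; apply: le_trans (ler_wpM2l z0 (ler_norm_sum _ _ _)) _.
rewrite mulr_sumr /TT mulr_suml; apply: ler_sum => i _; apply: le_trans (ler_wpM2l z0 (ler_norm_sum _ _ _)) _.
rewrite mulr_sumr mulr_suml; apply: ler_sum => j _; apply: le_trans (ler_wpM2l z0 (ler_norm_sum _ _ _)) _.
rewrite mulr_sumr mulr_suml; apply: ler_sum => l _.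
rewrite normrM mulrCA -[leRHS]mulrA; apply: ler_wpM2l => //.
apply: le_trans (hpf (j, l) M a aM z) _; apply: ler_wpM2l; first exact: (hCf _).1.
by apply: mono; rewrite /P (bigD1 (j, l))//= addnCA leq_addr.
Qed.

(* A multi-index bounded by N has length at most n N, whence the cutoff
   d %/ n on each index. *)
Lemma approximation g s : (0 < n)%N -> fast g -> exists2 C, 0 <= C & forall d, (1 <= d)%N ->
  exists2 v, in_span mu Sigma Q D d v & 
   (forall y, `|g y - v y| * d%:R ^+ s <= C) /\
   exists2 c : {ffun 'I_n -> 'I_(d %/ n).+1} -> R, (forall a, `|c a| <= C) &
   v = fun y => \sum_a c a * hermite_fun mu Sigma Q D (fun i => a i) y.
Proof.
move=> n0 fg.
pose gz z := g (aff mu S^T z).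
have fgz : fast gz := fast_aff mu aff_inv fg.
have [C1 C10 h1] := hproj_sup n0 s fgz.
have [C2 C20 h2] := hcoef_bound fgz.
have k0 := kappa_gt0.
exists (n%:R ^+ s * C1 + C2 / kappa).
  by rewrite addr_ge0// ?mulr_ge0 ?exprn_ge0// invr_ge0 ltW.
move=> d d1; pose N := (d %/ n)%N.
pose v y := hproj N.+1 gz (aff c0 B y).
pose c (a : {ffun 'I_n -> 'I_N.+1}) := hcoef gz a / kappa.
have Ev : v = fun y => \sum_a c a * hermite_fun mu Sigma Q D (fun i => a i) y.
  apply/funext => y; rewrite /v /hproj; apply: eq_bigr => a _.
  by rewrite hermite_funE /c mulrA divfK// gt_eqF.
exists v; last split.
- have Nd (a : {ffun 'I_n -> 'I_N.+1}) i : (a i < d.+1)%N.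
    by apply: leq_trans (ltn_ord (a i)) _; rewrite ltnS leq_div.
  have Nw : (N.+1 <= d.+1)%N by rewrite ltnS leq_div.
  pose h (a : {ffun 'I_n -> 'I_N.+1}) : {ffun 'I_n -> 'I_d.+1} := [ffun i => widen_ord Nw (a i)].
  pose h' (a : {ffun 'I_n -> 'I_d.+1}) : {ffun 'I_n -> 'I_N.+1} := [ffun i => inord (a i)].
  (* [in_span] sums over indices with entries up to [d]; the coefficients, known for entries up to
     [N], are extended by zero. *)
  exists (fun a : {ffun 'I_n -> 'I_d.+1} => if [forall i, (a i < N.+1)%N] then c (h' a) else 0).
  rewrite Ev; apply/funext => y.
  rewrite [RHS](bigID (fun a : {ffun 'I_n -> 'I_d.+1} => [forall i, (a i < N.+1)%N]))/=.
  rewrite [X in _ = _ + X]big1 ?addr0 => [|a /andP[_ /negbTE ->]]; last by rewrite mul0r.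
  rewrite [RHS](reindex h)/=; last first.
    exists h' => [a _|a]; first by apply/ffunP => i; apply/val_inj; rewrite !ffunE /= inordK.
    rewrite inE => /andP[_ /forallP ha]; apply/ffunP => i; apply/val_inj; by rewrite !ffunE /= inordK.
  have hN a : [forall i, (h a i < N.+1)%N] by apply/forallP => i; rewrite ffunE /= ltn_ord.
  have hd a : (\sum_i h a i <= d)%N.
    apply: (@leq_trans (\sum_(i < n) N)); last by rewrite sum_nat_const card_ord mulnC leq_trunc_div.
    by apply: leq_sum => i _; rewrite ffunE /= -ltnS.
  apply: eq_big => [a|a _]; first by rewrite hN hd.
  rewrite hN; congr (c _ * hermite_fun _ _ _ _ _ y).
    by apply/ffunP => i; apply/val_inj; rewrite !ffunE /= inordK.
  by apply/funext => i; rewrite ffunE.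
- move=> y; have := h1 N (aff c0 B y); rewrite /gz aff_cancel -/(v y) => h.
  (* Euclidean division gives [d < n (N + 1)], so a rate in [N + 1] is a rate in [d] at the cost of
     [n ^+ s]. *)
  apply: (@le_trans _ _ (`|g y - v y| * (n%:R * N.+1%:R) ^+ s)).
    apply: ler_wpM2l => //; apply: lerXn2r; rewrite ?nnegrE ?mulr_ge0//.
    by rewrite -natrM ler_nat mulnC ltnW// ltn_ceil.
  rewrite exprMn mulrCA; apply: (@le_trans _ _ (n%:R ^+ s * C1)).
    by apply: ler_wpM2l => //; exact: exprn_ge0.
  by rewrite lerDl divr_ge0// ltW.
- exists c => // a; rewrite /c normrM normfV (gtr0_norm k0).
  apply: (@le_trans _ _ (C2 / kappa)); first by apply: ler_wpM2r => //; rewrite invr_ge0 ltW.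
  by rewrite lerDr mulr_ge0// exprn_ge0.
Qed.

End scaled_hermite.

(** * The Galerkin error *)

Section galerkin_error.
Context {R : realType} {n : nat}.
Variable V : 'rV[R]_n -> R.
Hypotheses (n0 : (0 < n)%N) (pV : pclass V) (cV : coercive V) (cW : coercive (Wpot V)).
Hypothesis norm1 : integralR (fun y => expR (- V y)) = 1.
Hypothesis bW : polb (Wpot V).
Variables (mu : 'rV[R]_n) (Sigma Q : 'M[R]_n) (D : 'rV[R]_n).
Hypothesis hS : spd_factorization Sigma Q D.

Let H (u : 'rV[R]_n -> R) y := Wpot V y * u y - laplacian u y.

Lemma fast_H u : fast u -> fast (H u).
Proof. by move=> fu; exact: (fast_B (fast_M (pclass_W pV) fu) (fast_laplacian fu)). Qed.

Lemma HB (u v : 'rV[R]_n -> R) y : fast u -> fast v -> H (fun y => u y - v y) y = H u y - H v y.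
Proof.
move=> fu fv; rewrite /H.
have E : (fun y => u y - v y) = (fun y => 1 * (u y - v y)) by apply/funext => z; rewrite mul1r.
rewrite E (laplacian_lin 1 y (fast_smooth fu) (fast_smooth fv)).
by move: (laplacian u y) (laplacian v y) (u y) (v y) (Wpot V y) => a b c d e; ring.
Qed.

Lemma aform_sym u v : aform V u v = aform V v u.
Proof.
congr integralR; apply/funext => y; rewrite mulrAC; congr (_ + _).
by apply: eq_bigr => i _; exact: mulrC.
Qed.

Lemma aformB u v w : fast u -> fast v -> fast w -> aform V (fun y => u y - v y) w = aform V u w - aform V v w.
Proof.
move=> fu fv fw; have fuv := fast_B fu fv.
rewrite (aform_ibp pV fuv fw) (aform_ibp pV fu fw) (aform_ibp pV fv fw) -(integralR_B (fast_dom (fast_MM (fast_H fu) fw)) (fast_dom (fast_MM (fast_H fv) fw))).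
congr integralR; apply/funext => y; rewrite -mulrBl -(HB y fu fv).
exact: erefl.
Qed.

(* The Galerkin solution is at least as close to the exact one as any other
   element of the span, for the seminorm of the form. *)
Lemma cea d (g u psi v : 'rV[R]_n -> R) : fast psi ->
  (forall y, laplacian psi y = Wpot V y * psi y - phi0 V y * g y) ->
  galerkin_solution V mu Sigma Q D d g u -> in_span mu Sigma Q D d v ->
  aform V (fun y => u y - psi y) (fun y => u y - psi y) <= aform V (fun y => psi y - v y) (fun y => psi y - v y).
Proof.
move=> fp eq [su hu] sv.
have [fu fv] := (fast_in_span hS su, fast_in_span hS sv).
have sw := in_span_D su sv; have fw := fast_B fu fv.
set w := (fun y => u y - v y) in sw fw.
have fe := fast_B fu fp; have fr := fast_B fp fv.
(* Galerkin orthogonality: [w] is an admissible test function, and integration by parts shows that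
   [psi] satisfies the same variational equation. *)
have ew : aform V (fun y => u y - psi y) w = 0.
  rewrite (aformB fu fp fw) (hu w sw) (aform_ibp pV fp fw); apply/eqP; rewrite subr_eq0; apply/eqP.
  by congr integralR; apply/funext => y; rewrite eq /phi0 opprB addrCA subrr addr0; ring.
have -> : (fun y => psi y - v y) = fun y => w y - (u y - psi y).
  by apply/funext => y; rewrite /w; move: (psi y) (v y) (u y) => a b c; ring.
have E1 : aform V (fun y => w y - (u y - psi y)) (fun y => w y - (u y - psi y)) =
    aform V w w + aform V (fun y => u y - psi y) (fun y => u y - psi y).
  rewrite (aformB fw fe (fast_B fw fe)) (aform_sym w) (aform_sym (fun y => u y - psi y) (fun y => w y - _)).
  rewrite (aformB fw fe fw) (aformB fw fe fe) ew (aform_sym w (fun y => u y - psi y)) ew.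
  by rewrite subr0 sub0r opprK.
by rewrite E1 lerDr; exact: (aform_ge0 pV fw).
Qed.

Lemma maj_ge (y : 'rV[R]_n) : 1 <= (1 + `|y|) ^+ (2 * n) * maj y.
Proof.
rewrite exprM (_ : _ ^+ n = \prod_(i < n) (1 + `|y|) ^+ 2); last by rewrite prodr_const card_ord.
rewrite /maj -big_split/=; apply: (big_ind (fun x => 1 <= x)) => //; first by move=> a b; exact: mulr_ege1.
move=> i _; have y0 : 0 < 1 + y 0 i ^+ 2 by rewrite ltr_wpDr// sqr_ge0.
rewrite ler_pdivlMr// mul1r -[y 0 i ^+ 2]real_normK ?num_real//.
have := coord_le_norm y i; have := normr_ge0 (y 0 i); have := normr_ge0 y.
move: `|y 0 i| `|y| => a b b0 a0 ab; have : a * a <= b * b by apply: ler_pM.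
by rewrite !expr2; lra.
Qed.

(** [Wpot V] grows like a power [q], and [2 n] further powers of [1 + |y|] pay for the majorant
    [maj] by [maj_ge]; [hermite_weighted] covers both polynomially in [M]. *)
Lemma integral_H_hermite : exists2 C, 0 <= C & exists p, forall M a, (forall k, (a k <= M)%N) ->
  integralR (fun y => `|H (hermite_fun mu Sigma Q D a) y|) <= C * M.+1%:R ^+ p.
Proof.
have [Cw [q hq]] := bW; have Cw0 := polb_nonneg hq.
have [C C0 [p h]] := hermite_weighted mu hS (q + 2 * n).
have I0 : 0 <= integralR (@maj R n) by apply: integralR_ge0 => y; exact/ltW/maj_gt0.
exists ((Cw + 1) * C * integralR (@maj R n)); first by rewrite !mulr_ge0// addr_ge0.
exists p => M a aM; have fh := fast_hermite mu hS a.
rewrite mulrAC -(integralR_Z _ (@dom_maj R n)).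
apply: integralR_le; [exact: (dom_abs (fast_dom (fast_H fh)))|exact: (dom_Z _ (@dom_maj R n))|].
move=> y; set A := `|hermite_fun mu Sigma Q D a y|; set L := `|laplacian (hermite_fun mu Sigma Q D a) y|.
have y1 : 1 <= 1 + `|y| by rewrite lerDl.
have q1 : 1 <= (1 + `|y|) ^+ q by exact: exprn_ege1.
have A0 : 0 <= A := normr_ge0 _; have L0 : 0 <= L := normr_ge0 _.
have h1 : `|H (hermite_fun mu Sigma Q D a) y| <= (Cw + 1) * ((1 + `|y|) ^+ q * (A + L)).
  apply: le_trans (ler_normB _ _) _; rewrite normrM -/A -/L mulrDr mulrDr; apply: lerD.
    rewrite mulrA; apply: ler_wpM2r => //; apply: le_trans (hq y) _.
    by apply: ler_wpM2r; rewrite ?lerDl// exprn_ge0// addr_ge0.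
  rewrite mulrA ler_peMl//; apply: (@le_trans _ _ (1 * (1 + `|y|) ^+ q)); first by rewrite mul1r.
  by apply: ler_wpM2r; rewrite ?lerDr// exprn_ge0// addr_ge0.
apply: le_trans h1 _; rewrite -!mulrA; apply: ler_wpM2l; first exact: addr_ge0.
have hy := h M a aM y; rewrite exprD -/A -/L in hy.
have X0 : 0 <= (1 + `|y|) ^+ q * (A + L) by rewrite mulr_ge0 ?addr_ge0// exprn_ge0// addr_ge0.
apply: (@le_trans _ _ ((1 + `|y|) ^+ q * (A + L) * ((1 + `|y|) ^+ (2 * n) * maj y))).
  by rewrite ler_peMr// maj_ge.
rewrite mulrA [C * _]mulrA; apply: ler_wpM2r; first exact/ltW/maj_gt0.
by apply: le_trans hy; rewrite mulrAC.
Qed.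

(** The constant precedes [d] and [u], so it serves for all the possibly non-unique Galerkin
    solutions. Squares are estimated because [cea] is quadratic. *)
Lemma galerkin_rate (psi g : 'rV[R]_n -> R) s : fast psi ->
  (forall y, laplacian psi y = Wpot V y * psi y - phi0 V y * g y) ->
  integralR (fun y => psi y * phi0 V y) = 0 ->
  exists2 C, 0 <= C & forall d u, (1 <= d)%N -> galerkin_solution V mu Sigma Q D d g u ->
    fast (fun y => pihat V u y - psi y) /\
    integralR (fun y => (pihat V u y - psi y) ^+ 2) * d%:R ^+ s <= C.
Proof.
move=> fp eq cen.
have [G G0 hG] := spectral_gap n0 pV cV cW norm1.
have [E E0 [p hE]] := integral_H_hermite.
(* The expansion has [(N + 1)^n] terms, each contributing at most a multiple of [(N + 1)^p] to the
   integral of [|H R|]; the sup norm is asked to decay faster by these [n + p] powers. *)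
have [C C0 hC] := approximation mu hS (s + (n + p)) n0 fp.
pose I := integralR (fun y => `|H psi y|).
have I0 : 0 <= I by apply: integralR_ge0.
pose B := I + C * E.
have B0 : 0 <= B by rewrite addr_ge0// mulr_ge0.
exists (G * (C * (B * 2 ^+ (n + p)))).
  by rewrite !mulr_ge0// exprn_ge0.
move=> d u d1 gu; have fu := fast_in_span hS gu.1.
have fe := fast_B fu fp.
(* [psi] is centred, so the projection acts on the whole error and the spectral gap applies to
   it. *)
have Ep : (fun y => pihat V u y - psi y) = pihat V (fun y => u y - psi y).
  have p0 := fast_phi0 n0 pV cV cW.
  have : integralR (fun y => (u y - psi y) * phi0 V y) = integralR (fun y => u y * phi0 V y).
    rewrite (_ : (fun y => (u y - psi y) * _) = fun y => u y * phi0 V y - psi y * phi0 V y); last first.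
      by apply/funext => y; rewrite mulrBl.
    by rewrite (integralR_B (fast_dom (fast_MM fu p0)) (fast_dom (fast_MM fp p0))) cen subr0.
  rewrite /phi0 => E1; apply/funext => y; rewrite /pihat E1.
  by move: (integralR _) (expR _) (u y) (psi y) => a b c e; ring.
split; first by rewrite Ep; exact: (fast_pihat n0 pV cV cW fe).
have -> : (fun y => (pihat V u y - psi y) ^+ 2) = fun y => pihat V (fun z => u z - psi z) y ^+ 2.
  by apply/funext => y; rewrite (congr1 (@^~ y) Ep).
have [v sv [hv [c hc Ev]]] := hC d d1.
have fv := fast_in_span hS sv; have fr := fast_B fp fv.
pose N := (d %/ n)%N.
have d0 : 0 < (d%:R : R) by rewrite ltr0n.
have Nd : (N.+1%:R : R) <= 2 * d%:R.
  rewrite -natrM ler_nat mul2n -addnn -addn1 leq_add//; exact: leq_div.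
have N1 : 1 <= (N.+1%:R : R) by rewrite ler1n.
have HR : integralR (fun y => `|H (fun y => psi y - v y) y|) <= B * (2 * d%:R) ^+ (n + p).
  have fh a := fast_hermite mu hS a.
  have da (a : {ffun 'I_n -> 'I_N.+1}) := dom_abs (fast_dom (fast_H (fh (fun i => a i)))).
  apply: (@le_trans _ _ (I + \sum_(a : {ffun 'I_n -> 'I_N.+1}) C * (E * N.+1%:R ^+ p))).
    apply: (@le_trans _ _ (integralR (fun y => `|H psi y| + \sum_(a : {ffun 'I_n -> 'I_N.+1}) C * `|H (hermite_fun mu Sigma Q D (fun i => a i)) y|))).
      apply: integralR_le; [exact: (dom_abs (fast_dom (fast_H fr)))|exact: (dom_D (dom_abs (fast_dom (fast_H fp))) (dom_sum _ (fun a => dom_Z C (da a))))|].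
      move=> y; rewrite (HB y fp fv); apply: le_trans (ler_normB _ _) _; rewrite lerD2l.
      have -> : H v y = \sum_a c a * H (hermite_fun mu Sigma Q D (fun i => a i)) y.
        rewrite /H Ev.
        have sa (a : {ffun 'I_n -> 'I_N.+1}) := fast_smooth (fast_Z (c a) (fh (fun i => a i))).
        have -> : laplacian (fun y => \sum_(a : {ffun 'I_n -> 'I_N.+1}) c a * hermite_fun mu Sigma Q D (fun i => a i) y) y =
            \sum_(a : {ffun 'I_n -> 'I_N.+1}) c a * laplacian (hermite_fun mu Sigma Q D (fun i => a i)) y.
          rewrite /laplacian; under [RHS]eq_bigr do rewrite mulr_sumr.
          rewrite exchange_big/=; apply: eq_bigr => i _.
          rewrite [LHS](congr1 (@^~ y) (partials_sum [:: i; i] (index_enum _) sa)); apply: eq_bigr => a _.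
          exact: (congr1 (@^~ y) (partialsZ [:: i; i] (c a) (fast_smooth (fh (fun i => a i))))).
        by rewrite mulr_sumr -sumrB; apply: eq_bigr => a _; ring.
      apply: le_trans (ler_norm_sum _ _ _) _; apply: ler_sum => a _; rewrite normrM.
      by apply: ler_wpM2r => //; exact: hc.
    rewrite (integralR_D (dom_abs (fast_dom (fast_H fp))) (dom_sum _ (fun a => dom_Z C (da a)))) lerD2l.
    rewrite (integralR_sum _ (fun a => dom_Z C (da a))); apply: ler_sum => a _.
    rewrite (integralR_Z _ (da a)); apply: ler_wpM2l => //.
    by apply: hE => k; rewrite -ltnS.
  rewrite sumr_const card_ffun !card_ord -[X in _ + X]mulr_natr natrX.
  apply: (@le_trans _ _ (B * N.+1%:R ^+ (n + p))).
    rewrite /B mulrDl; apply: lerD; first by rewrite ler_peMr// exprn_ege1.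
    by rewrite exprD le_eqVlt; apply/orP; left; apply/eqP; ring.
  by apply: ler_wpM2l => //; apply: lerXn2r; rewrite ?nnegrE ?mulr_ge0// ltW.
have rr : aform V (fun y => psi y - v y) (fun y => psi y - v y) * d%:R ^+ (s + (n + p)) <= C * (B * (2 * d%:R) ^+ (n + p)).
  have k0 : 0 <= (d%:R : R) ^+ (s + (n + p)) by exact/exprn_ge0/ltW.
  rewrite (aform_ibp pV fr fr) mulrC -(integralR_Z _ (fast_dom (fast_MM (fast_H fr) fr))).
  apply: le_trans (ler_wpM2l C0 HR); rewrite -(integralR_Z _ (dom_abs (fast_dom (fast_H fr)))).
  apply: integralR_le; [exact: (fast_dom (fast_Z _ (fast_MM (fast_H fr) fr)))|exact: (dom_Z _ (dom_abs (fast_dom (fast_H fr))))|].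
  move=> y; apply: le_trans (ler_norm _) _; rewrite -[X in _ * (X * _)]/(H (fun y => psi y - v y) y).
  rewrite !normrM (ger0_norm k0) mulrCA mulrC; apply: ler_wpM2r => //.
  by rewrite mulrC; exact: hv.
have ae : aform V (fun y => u y - psi y) (fun y => u y - psi y) * d%:R ^+ (s + (n + p)) <= C * (B * (2 * d%:R) ^+ (n + p)).
  apply: le_trans rr; apply: ler_wpM2r; first exact/exprn_ge0/ltW.
  exact: (cea fp eq gu sv).
have dk : 0 < (d%:R : R) ^+ (n + p) by exact: exprn_gt0.
apply: (@le_trans _ _ (G * aform V (fun y => u y - psi y) (fun y => u y - psi y) * d%:R ^+ s)).
  apply: ler_wpM2r; first exact/exprn_ge0/ltW.
  exact: (hG _ fe).
rewrite -mulrA; apply: ler_wpM2l => //.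
rewrite -(ler_pM2r dk) -mulrA -exprD; apply: le_trans ae _.
by rewrite exprMn -!mulrA.
Qed.

End galerkin_error.

(** Assumption A bounds [Wpot V] from above; from below, coercivity makes it positive outside a
    ball, and inside the ball continuity bounds it. *)
Lemma polb_Wpot {R : realType} {n : nat} (V : 'rV[R]_n -> R) :
  smooth V -> coercive (Wpot V) -> assumption_A V -> polb (Wpot V).
Proof.
move=> sV cW hA; have pV := pclass_of_A sV hA.
have [[k [q _ hq]] _] := hA.
have [r hr] := cW 0.
have [M M0 hM] := cont_bounded 0 r (smooth_cont (pclass_smooth (pclass_W pV))).
have pq : polb (fun y => `|poly_eval q y|).
  by apply: polb_le (polb_poly_eval q) => y; rewrite normr_id.
apply: polb_le (polb_D pq (polb_cst M)) => y.
rewrite [leRHS]ger0_norm ?addr_ge0//.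
have [yr|yr] := leP (enorm y) r.
  apply: le_trans (hM y _) _; last by rewrite lerDr.
  by rewrite subr0; exact: le_trans (norm_le_enorm y) yr.
rewrite (ger0_norm (ltW (hr y yr))); apply: le_trans (hq y) _.
by apply: le_trans (ler_norm _) _; rewrite lerDl.
Qed.

(** Rapid decay makes the squared entries dominated, so the extended-real norm is the square root of
    a genuine real integral. *)
Lemma norm0_le {R : realType} {n a b : nat} (F : 'rV[R]_n -> 'M[R]_(a, b)) (C : R) : 0 <= C ->
  (forall i j, fast (fun y => F y i j)) ->
  \sum_i \sum_j integralR (fun y => F y i j ^+ 2) <= C ^+ 2 -> (norm0 F <= C%:E)%E.
Proof.
move=> C0 fF hC.
have d2 i j := fast_dom (fast_sqr (fF i j)).
have d1 i := dom_sum (index_enum _) (fun j => d2 i j).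
have dE := dom_sum (index_enum _) d1.
rewrite /norm0 unlock /Lnorm.
have -> : (\int[lebesgue_rV n]_y `|(EFin \o (fun y => enorm (F y))) y| `^ 2)%E = (integralR (fun y => \sum_i \sum_j F y i j ^+ 2))%:E.
  rewrite (integralRE dE); apply: eq_integral => y _ /=.
  by rewrite ger0_norm ?sqrtr_ge0// powR_mulrn ?sqrtr_ge0// -enorm_sqr.
rewrite (integralR_sum _ d1).
under eq_bigr do rewrite (integralR_sum _ (d2 _)).
rewrite poweR_EFin lee_fin -(ger0_norm C0) -sqrtr_sqr powR12_sqrt; last first.
  by do 2!apply: sumr_ge0 => ? _; apply: integralR_ge0 => y; exact: sqr_ge0.
by rewrite ler_wsqrtr.
Qed.

Theorem theorem4p2 (R : realType) (m n p : nat)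
    (V : 'rV[R]_n -> R)
    (f : 'rV[R]_m -> 'rV[R]_n -> 'rV[R]_m)
    (alpha : 'rV[R]_m -> 'rV[R]_n -> 'M[R]_(m, p))
    (phi : 'rV[R]_m -> 'rV[R]_n -> 'rV[R]_m)
    (mu : 'rV[R]_n) (Sigma Q : 'M[R]_n) (D : 'rV[R]_n) :
  (0 < m)%N -> (0 < n)%N -> (0 < p)%N ->
  standing_hypotheses V f alpha ->
  assumption_A V ->
  assumption_B V f ->
  poisson_solution V f phi ->
  spd_factorization Sigma Q D ->
  forall (x : 'rV[R]_m) (s : nat), exists C : R, forall d : nat, (1 <= d)%N ->
  forall (psi_d : 'rV[R]_n -> 'rV[R]_m) (grad_x_psi_d : 'rV[R]_n -> 'M[R]_m),
  (forall i, galerkin_solution V mu Sigma Q D d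
     (fun y => f x y 0 i) (fun y => psi_d y 0 i)) ->
  (forall i j, galerkin_solution V mu Sigma Q D d
     (fun y => grad_x f x y i j) (fun y => grad_x_psi_d y i j)) ->
  (maxe (norm0 (fun y => pihat_mx V psi_d y - psi V phi x y)%R)
        (norm0 (fun y => pihat_mx V grad_x_psi_d y - grad_x_psi V phi x y)%R)
    <= (C * d%:R ^- s)%:E)%E.
Proof.
move=> _ n0 _ hst hA hB hP hS x s.
have pV := pclass_of_A (V_smooth hst) hA.
have [[[cV cW] norm1] sf] := (V_coercive hst, W_coercive hst, expV_normalized hst, f_smooth hst).
have bW := polb_Wpot (V_smooth hst) cW hA.
have [m1 [m2 [m3 [K [_ _ _ K0 hgr]]]]] := growth hst.
have hK x' y : enorm (grad_x f x' y) + hess_x_norm f x' y <= K * (1 + enorm y ^+ m2) by have [] := hgr x' y.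
have rate := galerkin_rate n0 pV cV cW norm1 bW mu hS.
(* The exponent is [2 * s] because squares are estimated; the sigma type turns the constants into a
   function of the entry, to be summed. *)
have h1 (i : 'I_m) : {C : R | 0 <= C & forall d u, (1 <= d)%N ->
    galerkin_solution V mu Sigma Q D d (fun y => f x y 0 i) u ->
    fast (fun y => pihat V u y - psi V phi x y 0 i) /\
    integralR (fun y => (pihat V u y - psi V phi x y 0 i) ^+ 2) * d%:R ^+ (2 * s) <= C}.
  apply/cid2; have [fp eq] := psi0_fast n0 pV cV cW sf hB hP i x.
  have E : (fun y => psi V phi x y 0 i) = fun y => phi0 V y * phi x y 0 i.
    by apply/funext => y; rewrite mxE.
  have cen := psi0_centered hP i x.
  have [C C0 hC] := rate _ _ (2 * s)%N fp eq cen.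
  exists C => // d u d1 gu; have := hC d u d1 gu.
  rewrite (_ : (fun y => pihat V u y - psi V phi x y 0 i) = fun y => pihat V u y - phi0 V y * phi x y 0 i); last first.
    by apply/funext => y; rewrite (congr1 (@^~ y) E).
  by under [X in _ -> _ /\ integralR X * _ <= _]eq_fun do rewrite (congr1 (@^~ _) E).
have h2 (ij : 'I_m * 'I_m) : {C : R | 0 <= C & forall d u, (1 <= d)%N ->
    galerkin_solution V mu Sigma Q D d (fun y => grad_x f x y ij.1 ij.2) u ->
    fast (fun y => pihat V u y - grad_x_psi V phi x y ij.1 ij.2) /\
    integralR (fun y => (pihat V u y - grad_x_psi V phi x y ij.1 ij.2) ^+ 2) * d%:R ^+ (2 * s) <= C}.
  apply/cid2; have [fp eq cen] := grad_x_psi_fast n0 pV cV cW norm1 sf hB hP K0 hK x ij.1 ij.2.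
  exact: (rate _ _ (2 * s)%N fp eq cen).
pose C1 i := s2val (h1 i); pose C2 ij := s2val (h2 ij).
have C10 i : 0 <= C1 i := s2valP (h1 i).
have C20 i : 0 <= C2 i := s2valP (h2 i).
pose B := \sum_i C1 i + \sum_ij C2 ij.
have s1 : 0 <= \sum_i C1 i by exact: sumr_ge0.
have s2 : 0 <= \sum_ij C2 ij by exact: sumr_ge0.
(* [B] sums the constants of all entries of both functions and [1 + B] bounds its square root; it is
   fixed before [d] and the approximate solutions. *)
exists (1 + B) => d d1 psi_d gpsi_d g1 g2.
have dk : 0 < (d%:R : R) ^+ s by rewrite exprn_gt0// ltr0n.
have B0 : 0 <= (1 + B) * d%:R ^- s by rewrite mulr_ge0 ?invr_ge0 ?addr_ge0// ltW.
have sq (X : R) : X * d%:R ^+ (2 * s) <= B -> X <= ((1 + B) * d%:R ^- s) ^+ 2.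
  rewrite mulnC exprM => h; rewrite exprMn exprVn ler_pdivlMr ?exprn_gt0 ?ltr0n//.
  apply: le_trans h _; have : 0 <= B by exact: addr_ge0.
  move: (B) => b b0; rewrite expr2 mulrDl mul1r mulrDr mulr1; have := mulr_ge0 b0 b0.
  by move: (b * b) => e; lra.
rewrite ge_max; apply/andP; split; apply: norm0_le => //.
- move=> i j; rewrite ord1 (_ : (fun y => _) = fun y => pihat V (fun y => psi_d y 0 j) y - psi V phi x y 0 j); last first.
    by apply/funext => y; rewrite !mxE.
  exact: (s2valP' (h1 j) d _ d1 (g1 j)).1.
- apply: sq; rewrite big_ord1 mulr_suml; apply: (@le_trans _ _ (\sum_i C1 i)); last by rewrite lerDl.
  apply: ler_sum => j _; rewrite (_ : (fun y => _) = fun y => (pihat V (fun y => psi_d y 0 j) y - psi V phi x y 0 j) ^+ 2); last first.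
    by apply/funext => y; rewrite !mxE.
  exact: (s2valP' (h1 j) d _ d1 (g1 j)).2.
- move=> i j; rewrite (_ : (fun y => _) = fun y => pihat V (fun y => gpsi_d y i j) y - grad_x_psi V phi x y i j); last first.
    by apply/funext => y; rewrite !mxE.
  exact: (s2valP' (h2 (i, j)) d _ d1 (g2 i j)).1.
- apply: sq; rewrite pair_big mulr_suml; apply: (@le_trans _ _ (\sum_ij C2 ij)); last by rewrite lerDr.
  apply: ler_sum => -[i j] _; rewrite (_ : (fun y => _) = fun y => (pihat V (fun y => gpsi_d y i j) y - grad_x_psi V phi x y i j) ^+ 2); last first.
    by apply/funext => y; rewrite !mxE.
  exact: (s2valP' (h2 (i, j)) d _ d1 (g2 i j)).2.
Qed.
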